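(* Let \[C_{\mathrm{wild}}=\frac{5}{48}\prod_{p\text{ odd}}\left(1-6p^{-2}+8p^{-3}-3p^{-4}\right),\qquad C_{\mathrm{tame}}=\frac{1}{6}\prod_{p\text{ odd}}\left(1-6p^{-2}+8p^{-3}-3p^{-4}\right).\] If $W\subseteq\mathcal{S}_{oC}$ is a compact $\mu_{oC}$-continuity set, then $\lim_{X\to\infty}N_{\mathrm{wild}}(X,W)/X^{1/2}=C_{\mathrm{wild}}\,\mu_{oC}(W)$; and if $W\subseteq\mathcal{S}_{oI}$ is a compact $\mu_{oI}$-continuity set, then $\lim_{X\to\infty}N_{\mathrm{tame}}(X,W)/X^{1/2}=C_{\mathrm{tame}}\,\mu_{oI}(W)$. Here $N_{\mathrm{wild}}(X,W)$ (resp.\ $N_{\mathrm{tame}}(X,W)$) is the number of $V_4$-quartic fields (up to isomorphism) with discriminant at most $X$, shape in $W$, that are wildly (resp.\ tamely) ramified.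
   Context: A $V_4$-quartic field is a Galois quartic field over $\mathbf{Q}$ with group $C_2\times C_2$; it is wildly ramified iff $2$ ramifies in it, tamely ramified otherwise. Shape of a number field $K$ of degree $n$: the class, under orthogonal transformations and scalings by nonzero reals, of the lattice $j(\mathcal{O}_K^\perp)$, where $j$ is the Minkowski embedding $\alpha\mapsto(\sigma_1(\alpha),\dots,\sigma_n(\alpha))$ with inner product $\sum x_i\overline{y_i}$, and $\mathcal{O}_K^\perp=\{n\alpha-\mathrm{tr}(\alpha):\alpha\in\mathcal{O}_K\}$. For $x,y>0$ let $\mathrm{sh}_{oC}(x,y)$ be the shape (class up to isometry and scaling) of the lattice $\mathbf{Z}(x,0,0)+\mathbf{Z}(0,y,0)+\mathbf{Z}(0,0,1)+\mathbf{Z}(x/2,y/2,0)$ (base-centered orthorhombic), and $\mathcal{S}_{oC}=\{\mathrm{sh}_{oC}(x,y):0<x\le y\}$, identified bijectively with $\{(x,y):0<x\le y\}$; for $x,y>0$ let $\mathrm{sh}_{oI}(x,y)$ be the shape of $\mathbf{Z}(x,0,0)+\mathbf{Z}(0,y,0)+\mathbf{Z}(0,0,1)+\mathbf{Z}(x/2,y/2,1/2)$ (body-centered orthorhombic), and $\mathcal{S}_{oI}=\{\mathrm{sh}_{oI}(x,y):0<x<y<1\}$, identified bijectively with $\{(x,y):0<x<y<1\}$. The measures are $d\mu_{oC}=d\mu_{oI}=\frac{dx\,dy}{xy}$ in these coordinates. The shape of every wildly ramified $V_4$-quartic field lies in $\mathcal{S}_{oC}$, and that of every tamely ramified one in $\mathcal{S}_{oI}$.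 A $\mu$-continuity set is a measurable set whose boundary has $\mu$-measure $0$. *)

(* Defs.v *)
From HB Require Import structures.
From mathcomp Require Import all_boot all_order all_algebra.
From mathcomp Require Import all_fingroup all_solvable all_field.
From mathcomp Require Import spectral complex.
From mathcomp Require Import all_classical all_reals all_analysis.

Set Implicit Arguments.
Unset Strict Implicit.
Unset Printing Implicit Defensive.

Import Order.TTheory GRing.Theory Num.Theory.
Import numFieldNormedType.Exports.

Local Open Scope classical_set_scope.
Local Open Scope ring_scope.
Local Open Scope complex_scope.

(* Only Galois number fields occur, so a number field is a splitting field
   over rat and galTrace 1 {:K} is the trace from K to Q. *)

Definition OK (K : splittingFieldType rat) : set K :=
  [set x | integralOver (intr : int -> K) x].
Arguments OK : clear implicits.

Definition is_discriminant (K : splittingFieldType rat) (d : int) : Prop :=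
  exists w : (\dim {:K}).-tuple K,
    [/\ basis_of {:K} w, OK K = [set x | inIntSpan w x] &
        \det (\matrix_(i < \dim {:K}, j < \dim {:K})
                galTrace 1 {:K} (w`_i * w`_j)) = d%:~R].

Definition is_ideal (K : splittingFieldType rat) (I : set K) : Prop :=
  [/\ I `<=` OK K, I 0, (forall a b, I a -> I b -> I (a + b)) &
      (forall r a, OK K r -> I a -> I (r * a))].

Definition is_prime_ideal (K : splittingFieldType rat) (P : set K) : Prop :=
  [/\ is_ideal P, ~ P 1 &
      (forall a b, OK K a -> OK K b -> P (a * b) -> P a \/ P b)].

Definition ideal_mul (K : splittingFieldType rat) (I J : set K) : set K :=
  [set x | exists n (a b : 'I_n -> K),
    [/\ (forall i, I (a i)), (forall i, J (b i)) & x = \sum_i a i * b i]].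

(* Some prime ideal occurs in the factorisation of p O_K with exponent at
   least 2. *)
Definition ramifies (p : nat) (K : splittingFieldType rat) : Prop :=
  exists P J : set K, [/\ is_prime_ideal P, is_ideal J &
    [set p%:R * r | r in OK K] = ideal_mul (ideal_mul P P) J].

Definition V4_quartic (K : splittingFieldType rat) : Prop :=
  [/\ \dim {:K} = 4%N, galois 1 {:K} &
      ('Gal({:K} / 1) \isog [set: 'Z_2 * 'Z_2]%SET)%g].

Definition wildly_ramified (K : splittingFieldType rat) : Prop := ramifies 2 K.
Definition tamely_ramified (K : splittingFieldType rat) : Prop :=
  ~ ramifies 2 K.

(* Shapes of rank r lattices are represented by sets of lattices in R^r. *)

Definition enum_embeddings (R : realType) (n : nat)
    (K : splittingFieldType rat) (s : 'I_n -> {rmorphism K -> R[i]}) : Prop :=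
  (forall i j, s i =1 s j -> i = j) /\
  (forall t : {rmorphism K -> R[i]}, exists i, s i =1 t).

Definition minkowski (R : realType) (n : nat) (K : splittingFieldType rat)
    (s : 'I_n -> {rmorphism K -> R[i]}) (a : K) : 'rV[R[i]]_n :=
  \row_i s i a.

Definition OKperp (n : nat) (K : splittingFieldType rat) : set K :=
  [set n%:R * a - galTrace 1 {:K} a | a in OK K].
Arguments OKperp : clear implicits.

(* T \is unitarymx says that the rows of T are orthonormal for
   sum x_i * conj y_i, so v |-> v *m T is an isometric embedding of R^(n-1)
   into C^n.  The set is empty unless n is the degree of K. *)
Definition field_shape (R : realType) (n : nat) (K : splittingFieldType rat) :
    set (set 'rV[R]_n.-1) :=
  [set L | exists (s : 'I_n -> {rmorphism K -> R[i]})
                  (T : 'M[R[i]]_(n.-1, n)) (c : R),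
    [/\ enum_embeddings s, T \is unitarymx, c != 0 &
        [set minkowski s a | a in OKperp n K] =
        [set c%:C *: (map_mx (real_complex R) v *m T) | v in L]]].
Arguments field_shape : clear implicits.

Definition lattice_shape (R : realType) (r : nat) (L0 : set 'rV[R]_r) :
    set (set 'rV[R]_r) :=
  [set L | exists (Q : 'M[R]_r) (c : R),
    [/\ Q *m Q^T = 1%:M, c != 0 & L = [set c *: (v *m Q) | v in L0]]].

Definition vec3 (R : realType) (x y z : R) : 'rV[R]_3 :=
  \row_(i < 3) [:: x; y; z]`_i.

Definition sh_oC (R : realType) (x y : R) : set (set 'rV[R]_3) :=
  lattice_shape [set v | inIntSpan [tuple vec3 x 0 0; vec3 0 y 0; vec3 0 0 1;
                                          vec3 (x / 2) (y / 2) 0] v].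

Definition sh_oI (R : realType) (x y : R) : set (set 'rV[R]_3) :=
  lattice_shape [set v | inIntSpan [tuple vec3 x 0 0; vec3 0 y 0; vec3 0 0 1;
                                          vec3 (x / 2) (y / 2) (1 / 2)] v].

(* Coordinate domains of the two spaces of shapes. *)

Definition S_oC (R : realType) : set (R * R) :=
  [set p | 0 < p.1 /\ p.1 <= p.2].
Arguments S_oC : clear implicits.

Definition S_oI (R : realType) : set (R * R) :=
  [set p | [/\ 0 < p.1, p.1 < p.2 & p.2 < 1]].
Arguments S_oI : clear implicits.

Definition mu_shape (R : realType) (W : set (R * R)) : \bar R :=
  (\int[lebesgue_measure \x lebesgue_measure]_(p in W)
     ((p.1 * p.2)^-1)%:E)%E.

(* Boundary of W in the subspace S of the plane. *)
Definition boundary_in (R : realType) (S W : set (R * R)) : set (R * R) :=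
  S `&` (closure W `&` closure (S `\` W)).

Definition mu_continuity_set (R : realType) (S W : set (R * R)) : Prop :=
  measurable W /\ mu_shape (boundary_in S W) = 0%E.

Definition field_iso (K L : splittingFieldType rat) : Prop :=
  exists f : {rmorphism K -> L}, bijective f.

Definition is_count_upto_iso (P : splittingFieldType rat -> Prop) (n : nat) :
    Prop :=
  exists F : 'I_n -> splittingFieldType rat,
    [/\ (forall i, P (F i)),
        (forall i j, field_iso (F i) (F j) -> i = j) &
        (forall K, P K -> exists i, field_iso K (F i))].

(* Number of isomorphism classes of fields satisfying P; 0 if there are
   infinitely many. *)
Definition count_upto_iso (P : splittingFieldType rat -> Prop) : nat :=
  xget 0%N [set n | is_count_upto_iso P n].

Definition N_wild (R : realType) (X : R) (W : set (R * R)) : nat :=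
  count_upto_iso (fun K =>
    [/\ V4_quartic K, wildly_ramified K,
        (exists2 d : int, is_discriminant K d & d%:~R <= X) &
        (exists2 p, W p & field_shape R 4 K = sh_oC p.1 p.2)]).

Definition N_tame (R : realType) (X : R) (W : set (R * R)) : nat :=
  count_upto_iso (fun K =>
    [/\ V4_quartic K, tamely_ramified K,
        (exists2 d : int, is_discriminant K d & d%:~R <= X) &
        (exists2 p, W p & field_shape R 4 K = sh_oI p.1 p.2)]).

Definition odd_euler_product (R : realType) : R :=
  limn (fun n : nat => \prod_(0 <= p < n | prime p && odd p)
    (1 - 6 * (p%:R : R) ^- 2 + 8 * p%:R ^- 3 - 3 * p%:R ^- 4)).

Definition C_wild (R : realType) : R := 5 / 48 * odd_euler_product R.
Definition C_tame (R : realType) : R := 1 / 6 * odd_euler_product R.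

(* Main.v *)
From HB Require Import structures.
Require Import Defs.
From mathcomp Require Import all_boot all_order all_algebra.
From mathcomp Require Import all_fingroup all_solvable all_field.
From mathcomp Require Import spectral complex.
From mathcomp Require Import all_classical all_reals all_analysis.
From mathcomp Require Import measurable_realfun.
From mathcomp Require Import ring lra zify.

(* Over [Q], a V4-quartic field is generated by [r] and [s] with [r^2 = b c], [s^2 = a c] and
   [t = r s / c], [t^2 = a b], for squarefree pairwise coprime integers [a], [b], [c], unique up to
   order and signs. Explicit integral bases, which depend only on the residues of [a], [b], [c]
   modulo [4] and the parity of their product, express the discriminant as a constant times
   [(a b c)^2], and the projected lattice as an orthorhombic lattice whose squared side ratios are
   ratios of [|a|], [|b|], [|c|]. So the fields of bounded discriminant with shape in [W] are the
   admissible integer triples in the cone over [W], truncated at [|a b c| <= T^3]. Sieving by the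
   squares of the primes and by pairwise divisibility gives the density of admissible triples in
   boxes, hence the Euler product; approximating the cone by boxes in logarithmic coordinates
   turns box counts into the measure [dx dy / (x y)]. *)

Set Implicit Arguments.
Unset Strict Implicit.
Unset Printing Implicit Defensive.

Import Order.TTheory GRing.Theory Num.Theory.
Import numFieldNormedType.Exports.

Local Open Scope classical_set_scope.
Local Open Scope ring_scope.

(** * Sieving triples in boxes *)

Section Sums.
Local Open Scope nat_scope.

(** Signs never enter the counts. Changing the signs of [a], [b], [c] together leaves [b c], [a c],
    [a b] alone, and every odd [n] has one sign that makes it 1 modulo 4. So positive triples
    [(i, j, k)] with odd squarefree product index the fields: one tame family, and five wild ones
    told apart by residues modulo 4 and a sign of [2 i]. The constants have three sources. The sieve
    has density 1/8 (all entries odd) times the Euler product. The map from [(log i, log j, log k)]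
    to [(log x, log y, log ijk)] has determinant 3/4, so volumes in the cone carry a factor 4/3;
    together 1/6. The root of the discriminant is [ijk] for tame fields and [4ijk], twice [8ijk],
    twice [16ijk] in the wild families, and 1/4 + 2/8 + 2/16 = 5/8 turns 1/6 into 5/48. Two
    obstacles shape the proof. Fields are selected by their shape, so the shape has to determine
    [(x, y)]; this is read off from reflections of the lattice. And [S_oC] contains its edge
    [x = y], that is [j = k], where an index may have no field; the wild count is therefore squeezed
    between two counts. *)

Definition cnt (B : nat) (P : nat -> nat -> nat -> bool) : nat :=
  \sum_(i < B) \sum_(j < B) \sum_(k < B) P i j k.

Lemma sum_modn_block (m r q : nat) : r < m ->
  \sum_(i < q * m) (i %% m == r) = q.
Proof.
move=> rm; elim: q => [|q IH]; first by rewrite mul0n big_ord0.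
rewrite mulSnr big_split_ord /= IH -addn1; congr (_ + _).
rewrite (bigD1 (Ordinal rm)) //= modnMDl modn_small // eqxx big1 ?addn0 //.
move=> i /negbTE ir; rewrite modnMDl modn_small //.
by apply/eqP; rewrite eqb0; apply: contraFN ir => /eqP ir; apply/eqP/val_inj.
Qed.

Lemma leq_sum_ord (n m : nat) (F : nat -> nat) : n <= m ->
  \sum_(i < n) F i <= \sum_(i < m) F i.
Proof.
by move=> nm; rewrite -(subnKC nm) big_split_ord /= leq_addr.
Qed.

Lemma sum_modn_bounds (m r n : nat) : r < m ->
  n %/ m <= \sum_(i < n) (i %% m == r) <= (n %/ m).+1.
Proof.
move=> rm; pose F i := nat_of_bool (i %% m == r); apply/andP; split.
  rewrite -[leqLHS](sum_modn_block _ rm).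
  by apply: (@leq_sum_ord _ _ F); rewrite leq_divM.
rewrite -[leqRHS](sum_modn_block _ rm); apply: (@leq_sum_ord _ _ F).
by rewrite ltnW // ltn_ceil // (leq_ltn_trans _ rm).
Qed.

(** The Chinese remainder bijection between indices below [M * q] and pairs of residues reindexes
    the sum. *)
Lemma sum_chinese (M q : nat) (H : nat -> nat -> nat) :
  0 < M -> 0 < q -> coprime M q ->
  \sum_(i < M * q) H (i %% M) (i %% q) = \sum_(a < M) \sum_(b < q) H a b.
Proof.
move=> M0 q0 cMq; rewrite pair_big /=.
have Mq0 : 0 < M * q by rewrite muln_gt0 M0.
pose f (p : 'I_M * 'I_q) : 'I_(M * q) := Ordinal (ltn_pmod (chinese M q p.1 p.2) Mq0).
have fM p : f p %% M = p.1.
  by rewrite /f /= modn_dvdm ?dvdn_mulr // chinese_modl // modn_small.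
have fq p : f p %% q = p.2.
  by rewrite /f /= modn_dvdm ?dvdn_mull // chinese_modr // modn_small.
have f_inj : injective f.
  move=> [a b] [c d] /(congr1 val) /= E.
  have := fM (a, b); have := fM (c, d); have := fq (a, b); have := fq (c, d).
  rewrite /= E => -> /val_inj -> -> /val_inj -> //.
have f_bij : bijective f.
  by apply: inj_card_bij => //; rewrite card_prod !card_ord.
rewrite (reindex f); last by apply/onW_bij.
by apply: eq_bigr => p _; rewrite fM fq.
Qed.

Definition periodic3 (M : nat) (P : nat -> nat -> nat -> bool) : Prop :=
  forall i j k, P i j k = P (i %% M) (j %% M) (k %% M).

(** Conditions to coprime moduli are independent: the Chinese remainder theorem is applied to each
    of the three entries, after which the six-fold sum of a product factors. *)
Lemma cnt_chinese (M q : nat) (P Q : nat -> nat -> nat -> bool) :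
  0 < M -> 0 < q -> coprime M q -> periodic3 M P -> periodic3 q Q ->
  cnt (M * q) (fun i j k => P i j k && Q i j k) = cnt M P * cnt q Q.
Proof.
move=> M0 q0 cMq pP pQ; rewrite /cnt.
under eq_bigr => i _ do under eq_bigr => j _ do
  under eq_bigr => k _ do rewrite pP pQ.
under eq_bigr => i _ do under eq_bigr => j _ do
  rewrite (@sum_chinese M q (fun a b => nat_of_bool
    (P (i %% M) (j %% M) a && Q (i %% q) (j %% q) b))) //.
under eq_bigr => i _ do
  rewrite (@sum_chinese M q (fun a b => \sum_(c < M) \sum_(d < q)
    nat_of_bool (P (i %% M) a c && Q (i %% q) b d))) //.
rewrite (@sum_chinese M q (fun a' b' => \sum_(a < M) \sum_(b < q) \sum_(c < M) \sum_(d < q)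
    nat_of_bool (P a' a c && Q b' b d))) //.
rewrite big_distrl /=; apply: eq_bigr => a _.
rewrite big_distrr /=; apply: eq_bigr => b _.
rewrite big_distrl /=; apply: eq_bigr => c _.
rewrite big_distrr /=; apply: eq_bigr => d _.
rewrite big_distrl /=; apply: eq_bigr => e _.
rewrite big_distrr /=; apply: eq_bigr => f _.
by rewrite mulnb.
Qed.

Lemma leq_cnt (B : nat) (P Q : nat -> nat -> nat -> bool) :
  (forall i j k, i < B -> j < B -> k < B -> P i j k -> Q i j k) ->
  cnt B P <= cnt B Q.
Proof.
move=> PQ; apply: leq_sum => i _; apply: leq_sum => j _; apply: leq_sum => k _.
by case: (boolP (P i j k)) => // /PQ ->.
Qed.

Lemma eq_cnt (B : nat) (P Q : nat -> nat -> nat -> bool) :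
  (forall i j k, i < B -> j < B -> k < B -> P i j k = Q i j k) ->
  cnt B P = cnt B Q.
Proof.
by move=> PQ; apply/eqP; rewrite eqn_leq !leq_cnt // => i j k iB jB kB; rewrite PQ.
Qed.

(** A union bound: every triple of [P] is charged to at least one of the listed conditions, which
    may overlap. *)
Lemma cnt_cover (I : Type) (s : seq I) (B : nat) (P : nat -> nat -> nat -> bool)
    (Q : I -> nat -> nat -> nat -> bool) :
  (forall i j k, i < B -> j < B -> k < B -> P i j k -> has (fun x => Q x i j k) s) ->
  cnt B P <= \sum_(x <- s) cnt B (Q x).
Proof.
move=> PQ; rewrite /cnt [leqRHS]exchange_big; apply: leq_sum => i _.
rewrite [leqRHS]exchange_big; apply: leq_sum => j _.
rewrite [leqRHS]exchange_big; apply: leq_sum => k _.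
case: (boolP (P i j k)) => //= /PQ H; have {H} := H (ltn_ord i) (ltn_ord j) (ltn_ord k).
elim: s {PQ} => //= x s IH; rewrite big_cons.
by case: (Q x i j k) => //= /IH /leq_trans; apply.
Qed.

Lemma cnt_disjoint (I : Type) (s : seq I) (B : nat) (P : nat -> nat -> nat -> bool)
    (Q : I -> nat -> nat -> nat -> bool) :
  (forall i j k, i < B -> j < B -> k < B -> \sum_(x <- s) Q x i j k <= P i j k) ->
  \sum_(x <- s) cnt B (Q x) <= cnt B P.
Proof.
move=> PQ; rewrite /cnt [leqLHS]exchange_big; apply: leq_sum => i _.
rewrite [leqLHS]exchange_big; apply: leq_sum => j _.
rewrite [leqLHS]exchange_big; apply: leq_sum => k _.
exact: PQ.
Qed.

Lemma cnt_widen (B B' : nat) (P : nat -> nat -> nat -> bool) : B <= B' ->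
  (forall i j k, P i j k -> [&& i < B, j < B & k < B]) -> cnt B' P = cnt B P.
Proof.
move=> BB' PB; rewrite /cnt.
have W (F : nat -> nat) : (forall i, B <= i -> F i = 0) ->
    \sum_(i < B') F i = \sum_(i < B) F i.
  move=> F0; rewrite -(subnKC BB') big_split_ord /= [X in _ + X]big1 ?addn0 //.
  by move=> i _; rewrite F0 // leq_addr.
rewrite (W (fun i => \sum_(j < B') \sum_(k < B') P i j k)).
  apply: eq_bigr => i _; rewrite (W (fun j => \sum_(k < B') P i j k)).
    apply: eq_bigr => j _; rewrite (W (fun k => P i j k)) // => k Bk.
    by case: (boolP (P i j k)) => // /PB /and3P[_ _]; rewrite ltnNge Bk.
  move=> j Bj; rewrite big1 // => k _.
  by case: (boolP (P i j k)) => // /PB /and3P[_]; rewrite ltnNge Bj.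
move=> i Bi; rewrite big1 // => j _; rewrite big1 // => k _.
by case: (boolP (P i j k)) => // /PB /and3P[]; rewrite ltnNge Bi.
Qed.

Definition sqfree (n : nat) : bool :=
  (0 < n) && all (fun p => ~~ (p ^ 2 %| n)) (primes n).

Lemma sqfreeP (n : nat) :
  reflect (0 < n /\ forall p, prime p -> ~~ (p ^ 2 %| n)) (sqfree n).
Proof.
apply: (iffP andP) => -[n0 H]; split=> //.
  move=> p pp; apply/negP => pn; have := allP H p.
  rewrite mem_primes pp n0 (dvdn_trans _ pn) ?dvdn_exp // pn => /(_ isT) //.
by apply/allP => p; rewrite mem_primes => /and3P[pp _ _]; exact: H.
Qed.

(** Squarefreeness of the product says at once that the entries are squarefree and pairwise
    coprime. *)
Definition sieve (i j k : nat) : bool := odd (i * j * k) && sqfree (i * j * k).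

(** The local condition at [p]. At 2 it is oddness, which is stronger than the condition on
    squares. *)
Definition good (p i j k : nat) : bool :=
  if p == 2 then odd (i * j * k) else ~~ (p ^ 2 %| i * j * k).

Definition sieve_upto (n i j k : nat) : bool :=
  all (fun p => good p i j k) [seq p <- iota 0 n | prime p].

Definition sieve_modulus (n : nat) : nat := \prod_(p <- iota 0 n | prime p) p ^ 2.

Lemma sieve_uptoS (n i j k : nat) :
  sieve_upto n.+1 i j k = sieve_upto n i j k && (prime n ==> good n i j k).
Proof.
rewrite /sieve_upto -[n.+1]addn1 iotaD filter_cat all_cat /= add0n.
by case: (prime n); rewrite /= ?andbT.
Qed.

Lemma sieve_modulusS (n : nat) :
  sieve_modulus n.+1 = sieve_modulus n * (if prime n then n ^ 2 else 1).
Proof.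
rewrite /sieve_modulus -[n.+1]addn1 iotaD big_cat /= add0n big_cons big_nil muln1.
by case: (prime n).
Qed.

Lemma sieve_modulus_gt0 (n : nat) : 0 < sieve_modulus n.
Proof. by apply: prodn_cond_gt0 => p pp; rewrite expn_gt0 prime_gt0. Qed.

Lemma coprime_sieve_modulus (n : nat) : prime n -> coprime (sieve_modulus n) (n ^ 2).
Proof.
move=> pn; rewrite coprime_pexpr // coprime_sym /sieve_modulus.
rewrite big_seq_cond; elim/big_rec: _ => [|p x /andP[]]; first exact: coprimen1.
rewrite mem_iota add0n => pn' pp nx; rewrite coprimeMr nx andbT coprime_pexpr //.
by rewrite prime_coprime // dvdn_prime2 //; apply: contraTN pn' => /eqP ->; rewrite ltnn.
Qed.

Lemma good_periodic (p : nat) : prime p -> periodic3 (p ^ 2) (good p).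
Proof.
move=> pp i j k; rewrite /good; case: eqP => [->|_].
  by rewrite !oddM !(@odd_mod _ (2 ^ 2)).
rewrite /dvdn -[in LHS]modnMm -[in RHS]modnMm !modn_mod.
by rewrite (modnMm i j).
Qed.

Lemma sieve_upto_periodic (n : nat) : periodic3 (sieve_modulus n) (sieve_upto n).
Proof.
elim: n => [|n IH] i j k //; rewrite !sieve_uptoS sieve_modulusS.
case: (boolP (prime n)) => pn /=; last by rewrite !andbT muln1 -IH.
rewrite [in LHS]IH [in RHS]IH [good n i j k]good_periodic //.
rewrite [in RHS]good_periodic //.
have E1 x : (x %% (sieve_modulus n * n ^ 2)) %% sieve_modulus n = x %% sieve_modulus n.
  by rewrite modn_dvdm ?dvdn_mulr.
have E2 x : (x %% (sieve_modulus n * n ^ 2)) %% n ^ 2 = x %% n ^ 2.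
  by rewrite modn_dvdm // dvdn_mull.
by rewrite !E1 !E2.
Qed.

Lemma cnt_product (B : nat) (f g h : nat -> bool) :
  cnt B (fun i j k => [&& f i, g j & h k]) =
  (\sum_(i < B) f i) * (\sum_(i < B) g i) * (\sum_(i < B) h i).
Proof.
rewrite /cnt -mulnA big_distrl /=; apply: eq_bigr => i _.
rewrite big_distrlr big_distrr /=; apply: eq_bigr => j _.
rewrite big_distrr /=; apply: eq_bigr => k _.
by rewrite !mulnb.
Qed.

Lemma sum_dvdn (p q : nat) : 0 < p -> \sum_(i < q * p) (p %| i) = q.
Proof. exact: sum_modn_block. Qed.

Lemma sum_add_predC (B : nat) (f : nat -> bool) :
  \sum_(i < B) f i + \sum_(i < B) ~~ f i = B.
Proof.
rewrite -big_split /= -[RHS]card_ord -sum1_card; apply: eq_bigr => i _.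
by case: (f i).
Qed.

(** For [p^2] not to divide the product, at most one entry may be a multiple of [p], and that one
    exactly once: four disjoint cases. *)
Lemma good_split (p i j k : nat) : prime p -> odd p ->
  (good p i j k : nat) =
    [&& ~~ (p %| i), ~~ (p %| j) & ~~ (p %| k)] +
    [&& (p %| i) && ~~ (p ^ 2 %| i), ~~ (p %| j) & ~~ (p %| k)] +
    [&& ~~ (p %| i), (p %| j) && ~~ (p ^ 2 %| j) & ~~ (p %| k)] +
    [&& ~~ (p %| i), ~~ (p %| j) & (p %| k) && ~~ (p ^ 2 %| k)].
Proof.
move=> pp po; rewrite /good; case: eqP => [p2|_]; first by rewrite p2 in po.
have cop x : ~~ (p %| x) -> coprime (p ^ 2) x.
  by move=> px; rewrite coprime_pexpl // prime_coprime.
have dv x y z : p %| x -> p %| y -> p ^ 2 %| x * y * z.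
  by move=> px py; rewrite dvdn_mulr // expnS expn1 dvdn_mul.
have dw x : p ^ 2 %| x -> p %| x by apply: dvdn_trans; rewrite dvdn_exp.
case: (boolP (p %| i)) => pi; case: (boolP (p %| j)) => pj;
  case: (boolP (p %| k)) => pk //=; rewrite ?andbF ?andbT ?addn0 ?add0n.
- by rewrite dv.
- by rewrite dv.
- by rewrite mulnAC dv.
- by rewrite Gauss_dvdl ?cop // Gauss_dvdl ?cop.
- by rewrite -mulnA mulnC dv.
- by rewrite Gauss_dvdl ?cop // Gauss_dvdr ?cop.
- by rewrite Gauss_dvdr // coprimeMr !cop.
- rewrite Gauss_dvdl ?cop // Gauss_dvdl ?cop //.
  by case: (boolP (p ^ 2 %| i)) => // /dw; rewrite (negbTE pi).
Qed.

Lemma cntD (B : nat) (P Q S : nat -> nat -> nat -> bool) :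
  (forall i j k, i < B -> j < B -> k < B -> (S i j k = P i j k + Q i j k :> nat)) ->
  cnt B S = cnt B P + cnt B Q.
Proof.
move=> E; rewrite /cnt -big_split; apply: eq_bigr => i _; rewrite -big_split.
apply: eq_bigr => j _; rewrite -big_split; apply: eq_bigr => k _; exact: E.
Qed.

(** Of the [p^2] residues, [p^2 - p] are prime to [p] and [p - 1] are divisible by [p] exactly once;
    the terms are the cases of [good_split]. *)
Lemma cnt_good_odd (p : nat) : prime p -> odd p ->
  cnt (p ^ 2) (good p) = (p ^ 2 - p) ^ 3 + 3 * (p.-1 * (p ^ 2 - p) ^ 2).
Proof.
move=> pp po; pose u i := ~~ (p %| i); pose w i := (p %| i) && ~~ (p ^ 2 %| i).
have p0 : 0 < p by rewrite prime_gt0.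
have dvs : \sum_(i < p ^ 2) (p %| i) = p by rewrite expnS expn1; exact: sum_dvdn.
have Su : \sum_(i < p ^ 2) u i = p ^ 2 - p.
  by rewrite -[X in X - _](sum_add_predC (p ^ 2) (dvdn p)) dvs addKn.
have Sw : \sum_(i < p ^ 2) w i = p.-1.
  apply: (@addnI 1); rewrite [RHS]add1n prednK //.
  rewrite -[RHS]dvs -[X in X + _](@sum_dvdn (p ^ 2) 1) ?expn_gt0 ?p0 //.
  rewrite mul1n -big_split /=; apply: eq_bigr => i _; rewrite /w.
  case: (boolP (p ^ 2 %| i)) => [|_]; last by rewrite andbT.
  by move=> /(dvdn_trans (dvdn_exp _ (dvdnn p))) ->.
have E (i j k : nat) : (good p i j k : nat) =
    [&& u i, u j & u k] + [&& w i, u j & u k] + [&& u i, w j & u k] +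
    [&& u i, u j & w k] by exact: good_split.
have X (f g h : nat -> bool) :
  \sum_(i < p ^ 2) \sum_(j < p ^ 2) \sum_(k < p ^ 2) [&& f i, g j & h k] =
  (\sum_(i < p ^ 2) f i) * (\sum_(i < p ^ 2) g i) * (\sum_(i < p ^ 2) h i).
  exact: cnt_product.
rewrite /cnt; under eq_bigr => i _.
  under eq_bigr => j _ do
    (under eq_bigr => k _ do rewrite E; rewrite !big_split /=).
  rewrite !big_split /=; over.
rewrite !big_split /= !X !Su !Sw; lia.
Qed.

Lemma cnt_good_two : cnt (2 ^ 2) (good 2) = 8.
Proof.
have -> : cnt (2 ^ 2) (good 2) = cnt (2 ^ 2) (fun i j k => [&& odd i, odd j & odd k]).
  by apply: eq_cnt => i j k _ _ _; rewrite /good eqxx !oddM andbA.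
by rewrite cnt_product !big_ord_recl big_ord0.
Qed.

End Sums.

(** * Densities of the finite sieves *)

Section Density.
Variable R : realType.
Implicit Types (p n : nat).

(** This is [(1 - 1/p)^3 (1 + 3/p)]: either no entry is divisible by [p], or one of the three is,
    exactly once. *)
Definition euler_factor p : R := 1 - 6 * p%:R ^- 2 + 8 * p%:R ^- 3 - 3 * p%:R ^- 4.

Definition local_density p : R := if p == 2%N then 1 / 8 else euler_factor p.

Definition sieve_density n : R := \prod_(p <- iota 0 n | prime p) local_density p.

Lemma sieve_densityS n :
  sieve_density n.+1 = sieve_density n * (if prime n then local_density n else 1).
Proof.
rewrite /sieve_density -[n.+1]addn1 iotaD big_cat /= add0n big_cons big_nil mulr1.
by case: (prime n).
Qed.

Lemma cnt_good p : prime p ->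
  (cnt (p ^ 2) (good p))%:R = local_density p * ((p ^ 2)%:R) ^+ 3.
Proof.
move=> pp; rewrite /local_density; case: eqP => [->|/eqP p2].
  by rewrite cnt_good_two natrX; field.
have po : odd p by move: p2; case/even_prime: pp => // ->; rewrite eqxx.
have p0 : (0 < p)%N by rewrite prime_gt0.
have pn0 : p%:R != 0 :> R by rewrite pnatr_eq0 -lt0n.
rewrite cnt_good_odd // natrD natrX natrM natrM natrX natrB; last first.
  by rewrite expnS expn1 leq_pmulr.
rewrite -subn1 natrB // natrX /euler_factor; field.
exact: pn0.
Qed.

Lemma cnt_sieve_upto n :
  (cnt (sieve_modulus n) (sieve_upto n))%:R =
    sieve_density n * ((sieve_modulus n)%:R) ^+ 3.
Proof.
elim: n => [|n IH].
  rewrite /sieve_density /sieve_modulus /= !big_nil /cnt !big_ord_recl !big_ord0.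
  by rewrite expr1n mulr1.
rewrite sieve_densityS sieve_modulusS; case: (boolP (prime n)) => pn; last first.
  rewrite muln1 mulr1 -IH; congr (_%:R); apply: eq_cnt => i j k _ _ _.
  by rewrite sieve_uptoS (negbTE pn) andbT.
have -> : cnt (sieve_modulus n * n ^ 2) (sieve_upto n.+1) =
    (cnt (sieve_modulus n) (sieve_upto n) * cnt (n ^ 2) (good n))%N.
  rewrite -cnt_chinese ?sieve_modulus_gt0 ?expn_gt0 ?prime_gt0 //.
  - by apply: eq_cnt => i j k _ _ _; rewrite sieve_uptoS pn.
  - exact: coprime_sieve_modulus.
  - exact: sieve_upto_periodic.
  - exact: good_periodic.
by rewrite natrM IH cnt_good // natrM; ring.
Qed.

End Density.

Section Residues.
Local Open Scope nat_scope.

Lemma sum_residues (B M : nat) (f : nat -> bool) (G : nat -> nat) : 0 < M ->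
  \sum_(i < B) f i * G (i %% M) =
  \sum_(a < M) (\sum_(i < B) (f i && (i %% M == a))) * G a.
Proof.
move=> M0; under [RHS]eq_bigr => a _ do rewrite big_distrl /=.
rewrite exchange_big /=; apply: eq_bigr => i _.
rewrite (bigD1 (Ordinal (ltn_pmod i M0))) //= eqxx andbT big1 ?addn0 // => a ai.
suff -> : (i %% M == a) = false by rewrite andbF.
by apply: contraNF ai => /eqP E; apply/eqP/val_inj.
Qed.

(** A box condition is a product over the entries. Once each entry is split by its residue, the
    periodic condition only sees the residues and comes out of the inner sums. *)
Lemma cnt_residues (B M : nat) (f g h : nat -> bool) (P : nat -> nat -> nat -> bool) :
  0 < M -> periodic3 M P ->
  cnt B (fun i j k => [&& f i, g j & h k] && P i j k) =
  \sum_(a < M) \sum_(b < M) \sum_(c < M)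
    (\sum_(i < B) (f i && (i %% M == a))) * (\sum_(i < B) (g i && (i %% M == b))) *
    (\sum_(i < B) (h i && (i %% M == c))) * P a b c.
Proof.
move=> M0 pP.
transitivity (\sum_(i < B) f i * (\sum_(j < B) g j *
    (\sum_(k < B) h k * P (i %% M) (j %% M) (k %% M)))).
  apply: eq_bigr => i _; rewrite big_distrr; apply: eq_bigr => j _.
  rewrite !big_distrr; apply: eq_bigr => k _.
  by rewrite -pP /= !mulnb !andbA.
under eq_bigr => i _ do under eq_bigr => j _ do
  rewrite (sum_residues _ _ (fun c => nat_of_bool (P (i %% M) (j %% M) c))) //.
under eq_bigr => i _ do
  rewrite (sum_residues _ _ (fun b => \sum_(c < M)
    (\sum_(l < B) (h l && (l %% M == c))) * P (i %% M) b c)) //.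
rewrite (sum_residues _ _ (fun a => \sum_(b < M) (\sum_(l < B) (g l && (l %% M == b))) *
  \sum_(c < M) (\sum_(l < B) (h l && (l %% M == c))) * P a b c)) //.
apply: eq_bigr => a _; rewrite big_distrr; apply: eq_bigr => b _.
by rewrite /= mulnA [LHS]big_distrr; apply: eq_bigr => c _; rewrite /= !mulnA.
Qed.

End Residues.

(** * Density of the sieve in expanding boxes *)

Section BoxDensity.
Variable R : realType.
Implicit Types (T l h : R) (B : R -> nat).

(** Half-open, so that adjacent intervals tile without overlap, and 0 is excluded as soon as
    [0 <= l]. *)
Definition in_itv_oc l h (i : nat) : bool := l < i%:R <= h.

Lemma sum_le_real (B : nat) (f : nat -> bool) h : 0 <= h -> h < B%:R ->
  (\sum_(i < B) (((i%:R <= h)%R : bool) && f i) = \sum_(i < (Num.truncn h).+1) f i)%N.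
Proof.
move=> h0 hB; have nB : ((Num.truncn h).+1 <= B)%N by rewrite truncn_lt_nat.
rewrite -(subnKC nB) big_split_ord /= [X in (_ + X)%N]big1 ?addn0.
  by apply: eq_bigr => i _; rewrite -truncn_ge_nat // -ltnS ltn_ord.
move=> i _; rewrite -truncn_ge_nat // -ltnS ltnNge /=.
by rewrite leq_addr.
Qed.

(** The count is a difference of two initial counts. Each of these is off by at most 2: one for the
    incomplete period, one for rounding the endpoint. *)
Lemma itv_residue_bound (B m r : nat) l h : (r < m)%N -> 0 <= l -> l <= h -> h < B%:R ->
  `|(\sum_(i < B) (in_itv_oc l h i && (i %% m == r)))%N%:R - (h - l) / m%:R| <= 4.
Proof.
move=> rm l0 lh hB; have m0 : (0 < m)%N by apply: leq_ltn_trans rm.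
have mR : 1 <= m%:R :> R by rewrite ler1n.
pose F x := (\sum_(i < B) (((i%:R <= x :> R)%R : bool) && (i %% m == r)))%N.
have Fb x : 0 <= x -> x < B%:R -> `|(F x)%:R - x / m%:R| <= 2.
  move=> x0 xB; rewrite /F (@sum_le_real _ (fun i => i %% m == r)%N) //; set n := (Num.truncn x).+1.
  have /andP[lo hi] := sum_modn_bounds n rm.
  set S := (\sum_(i < _) _)%N in lo hi *.
  have [xn1 xn2] : x < n%:R /\ n%:R <= x + 1.
    rewrite /n truncnS_gt; split=> //.
    by rewrite -natr1 lerD2r truncn_le.
  have E : (n%:R : R) = (n %/ m)%:R * m%:R + (n %% m)%:R.
    by rewrite -natrM -natrD -divn_eq.
  have r1 : (n %% m)%:R <= m%:R :> R by rewrite ler_nat ltnW // ltn_mod.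
  have r0 : 0 <= (n %% m)%:R :> R by [].
  have lo' : (n %/ m)%:R <= S%:R :> R by rewrite ler_nat.
  have hi' : S%:R <= (n %/ m)%:R + 1 :> R by rewrite natr1 ler_nat.
  have mp : 0 < m%:R :> R by rewrite ltr0n.
  have q1 : (n %/ m)%:R <= x / m%:R + 1.
    rewrite -(ler_pM2r mp) mulrDl mulfVK ?gt_eqF // mul1r.
    by rewrite (le_trans _ (lerD (lexx x) mR)) // (le_trans _ xn2) // E lerDl.
  have q2 : x / m%:R <= (n %/ m)%:R + 1.
    rewrite -(ler_pM2r mp) mulrDl mulfVK ?gt_eqF // mul1r.
    by rewrite (le_trans (ltW xn1)) // E lerD2l.
  by rewrite ler_norml; apply/andP; split; lra.
have -> : (\sum_(i < B) (in_itv_oc l h i && (i %% m == r)))%N%:R = (F h)%:R - (F l)%:R :> R.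
  apply/eqP; rewrite eq_sym subr_eq -natrD; apply/eqP; congr _%:R.
  rewrite /F -big_split /=; apply: eq_bigr => i _; rewrite /in_itv_oc.
  case: (leP i%:R l) => [il|li] /=; first by rewrite (le_trans il lh).
  by rewrite addn0.
rewrite mulrBl.
have -> : (F h)%:R - (F l)%:R - (h / m%:R - l / m%:R) =
  ((F h)%:R - h / m%:R) - ((F l)%:R - l / m%:R) :> R by ring.
rewrite (le_trans (ler_normB _ _)) // (_ : 4 = 2 + 2); last by ring.
by rewrite lerD // Fb // ?(le_trans l0) // (le_lt_trans lh).
Qed.

Lemma itv_residue_cvg (B : R -> nat) (m r : nat) l h : (r < m)%N -> 0 <= l -> l <= h ->
  (forall T, 0 < T -> h * T < (B T)%:R) ->
  ((\sum_(i < B T) (in_itv_oc (l * T) (h * T) i && (i %% m == r)))%N%:R / T)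
    @[T --> +oo] --> (h - l) / m%:R.
Proof.
move=> rm l0 lh hB; apply/cvgrPdist_le => e e0; near=> T.
have T0 : 0 < T by near: T; apply: nbhs_pinfty_gt; rewrite num_real.
have Te : 4 / e <= T by near: T; apply: nbhs_pinfty_ge; rewrite num_real.
have := @itv_residue_bound (B T) m r (l * T) (h * T) rm (mulr_ge0 l0 (ltW T0))
  (ler_wpM2r (ltW T0) lh) (hB T T0).
set S := (\sum_(i < _) _)%N => H.
have -> : (h - l) / m%:R - S%:R / T = - (S%:R - (h * T - l * T) / m%:R) / T.
  have m0 : m%:R != 0 :> R by rewrite pnatr_eq0 -lt0n (leq_ltn_trans _ rm).
  by field; rewrite m0 gt_eqF.
rewrite normrM normrN (gtr0_norm (_ : 0 < T^-1)) ?invr_gt0 // ler_pdivrMr //.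
by rewrite (le_trans H) // -ler_pdivrMl // mulrC.
Unshelve. all: by end_near. Qed.

Lemma cvgr_sum {I : Type} (F : set_system R) (s : seq I) (P : pred I)
    (f : I -> R -> R) (a : I -> R) : Filter F ->
  (forall i, P i -> f i x @[x --> F] --> a i) ->
  \sum_(i <- s | P i) f i x @[x --> F] --> \sum_(i <- s | P i) a i.
Proof. by move=> FF; apply: cvg_big => //; exact: add_continuous. Qed.

Definition in_box (l1 h1 l2 h2 l3 h3 : R) (i j k : nat) : bool :=
  [&& in_itv_oc l1 h1 i, in_itv_oc l2 h2 j & in_itv_oc l3 h3 k].

Lemma periodic_box_cvg (B : R -> nat) (M : nat) (P : nat -> nat -> nat -> bool)
    (l1 h1 l2 h2 l3 h3 : R) :
  (0 < M)%N -> periodic3 M P ->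
  0 <= l1 -> l1 <= h1 -> 0 <= l2 -> l2 <= h2 -> 0 <= l3 -> l3 <= h3 ->
  (forall T, 0 < T -> h1 * T < (B T)%:R) -> (forall T, 0 < T -> h2 * T < (B T)%:R) ->
  (forall T, 0 < T -> h3 * T < (B T)%:R) ->
  (cnt (B T) (fun i j k => in_box (l1 * T) (h1 * T) (l2 * T) (h2 * T) (l3 * T) (h3 * T) i j k
     && P i j k))%:R / T ^+ 3 @[T --> +oo] -->
  (cnt M P)%:R / M%:R ^+ 3 * ((h1 - l1) * (h2 - l2) * (h3 - l3)).
Proof.
move=> M0 pP l10 lh1 l20 lh2 l30 lh3 B1 B2 B3.
pose N l h T a := (\sum_(i < B T) (in_itv_oc (l * T) (h * T) i && (i %% M == a)))%N.
have -> : (cnt M P)%:R / M%:R ^+ 3 * ((h1 - l1) * (h2 - l2) * (h3 - l3)) =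
  \sum_(a < M) \sum_(b < M) \sum_(c < M)
    ((h1 - l1) / M%:R * ((h2 - l2) / M%:R) * ((h3 - l3) / M%:R) * (P a b c)%:R).
  rewrite /cnt natr_sum -!mulrA big_distrl /=; apply: eq_bigr => a _.
  rewrite natr_sum big_distrl /=; apply: eq_bigr => b _.
  rewrite natr_sum big_distrl /=; apply: eq_bigr => c _.
  have m0 : M%:R != 0 :> R by rewrite pnatr_eq0 -lt0n.
  by field.
have E T : (cnt (B T) (fun i j k =>
    in_box (l1 * T) (h1 * T) (l2 * T) (h2 * T) (l3 * T) (h3 * T) i j k
     && P i j k))%:R / T ^+ 3 = \sum_(a < M) \sum_(b < M) \sum_(c < M)
    ((N l1 h1 T a)%:R / T * ((N l2 h2 T b)%:R / T) * ((N l3 h3 T c)%:R / T) * (P a b c)%:R).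
  rewrite (cnt_residues _ _ _ _ M0 pP) natr_sum big_distrl /=; apply: eq_bigr => a _.
  rewrite natr_sum big_distrl /=; apply: eq_bigr => b _.
  rewrite natr_sum big_distrl /=; apply: eq_bigr => c _.
  by rewrite !natrM -exprVn /N; ring.
under eq_cvg do rewrite E.
apply: cvgr_sum => a _; apply: cvgr_sum => b _; apply: cvgr_sum => c _.
by apply: cvgM; [apply: cvgM; [apply: cvgM|]|exact: cvg_cst]; exact: itv_residue_cvg.
Qed.

(** The bound has no additive 1 outside the quotient, which a later sum over [d] could not absorb.
    The multiple 0 lies outside the interval, and leaving it out saves that 1. *)
Lemma sum_dvd_bound (B d : nat) l h : (0 < d)%N -> 0 <= l -> l <= h -> h < B%:R ->
  (\sum_(i < B) (in_itv_oc l h i && (d %| i)))%N%:R <= (h + 1) / d%:R.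
Proof.
move=> d0 l0 lh hB; have h0 : 0 <= h by apply: le_trans lh.
have dp : 0 < d%:R :> R by rewrite ltr0n.
have B0 : (0 < B)%N by rewrite -(ltr_nat R) (le_lt_trans h0).
pose g i := (\sum_(i < B) ((i == 0 :> nat) : nat))%N.
have one : (\sum_(i < B) ((i == 0 :> nat) : nat))%N = 1%N.
  by rewrite (bigD1 (Ordinal B0)) //= big1 // => i; rewrite -val_eqE /= => /negbTE ->.
have H1 : (1 + \sum_(i < B) (in_itv_oc l h i && (d %| i)) <=
    \sum_(i < B) (((i%:R <= h)%R : bool) && (d %| i)))%N.
  rewrite -[X in (X + _)%N]one -big_split /=; apply: leq_sum => i _.
  rewrite /in_itv_oc; case: (boolP (i == 0 :> nat)) => [/eqP ->|i0].
    by rewrite ltNge l0 h0 dvdn0.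
  by case: (_ < _) => //; case: (_ && _).
have := H1; rewrite (@sum_le_real _ (fun i => d %| i)%N) // => H2.
have /andP[_ H3] := sum_modn_bounds (Num.truncn h).+1 d0.
have H4 : (\sum_(i < B) (in_itv_oc l h i && (d %| i)) <= (Num.truncn h).+1 %/ d)%N.
  by rewrite -ltnS -add1n (leq_trans H2).
rewrite ler_pdivlMr //; apply: (@le_trans _ _ ((Num.truncn h).+1)%:R).
  by rewrite -natrM ler_nat (leq_trans (leq_mul H4 (leqnn d))) // leq_divM.
by rewrite -natr1 lerD2r truncn_le.
Qed.

(** Telescoping against [1/k - 1/(k + 1)], which exceeds [1/(k + 1)^2]. *)
Lemma sum_inv_sqr (n m : nat) : (1 < n)%N ->
  \sum_(d <- iota n m) (d%:R ^- 2 : R) <= (n.-1)%:R^-1.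
Proof.
move=> n1; suff : \sum_(d <- iota n m) (d%:R ^- 2 : R) <= (n.-1)%:R^-1 - (n + m).-1%:R^-1.
  by move=> /le_trans; apply; rewrite gerBl.
elim: m => [|m IH]; first by rewrite big_nil addn0 subrr.
rewrite -addn1 iotaD big_cat /= big_cons big_nil addr0.
apply: le_trans (lerD IH (lexx _)) _; rewrite -addrA lerD2l addn1 addnS /=.
have : (1 < n + m)%N by rewrite (leq_trans n1) // leq_addr.
case: (n + m)%N => // k; rewrite ltnS => k0 /=.
have kp : 0 < k%:R :> R by rewrite ltr0n.
have -> : (k.+1%:R ^- 2 : R) = k%:R^-1 - k.+1%:R^-1 - (k%:R * k.+1%:R ^+ 2)^-1.
  rewrite -natr1; field.
  by rewrite natr1 gt_eqF //= gt_eqF.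
have : 0 < (k%:R * k.+1%:R ^+ 2 : R)^-1 by rewrite invr_gt0 mulr_gt0 // exprn_gt0.
move: ((_ * _)^-1) (k%:R^-1) (k.+1%:R^-1) => x y z; lra.
Qed.

(** The six ways in which the square of a prime can divide a product of three factors; in each of
    them the moduli multiply to [d^2]. *)
Definition square_moduli (d : nat) : seq (nat * nat * nat) :=
  [:: (d ^ 2, 1, 1); (1, d ^ 2, 1); (1, 1, d ^ 2); (d, d, 1); (d, 1, d); (1, d, d)]%N.

Lemma prime_square_dvd3 (p i j k : nat) : prime p -> (p ^ 2 %| i * j * k)%N ->
  has (fun m => [&& m.1.1 %| i, m.1.2 %| j & m.2 %| k]%N) (square_moduli p).
Proof.
move=> pp; rewrite /= !dvd1n /= !andbT.
have cop x : ~~ (p %| x)%N -> coprime (p ^ 2) x.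
  by move=> px; rewrite coprime_pexpl // prime_coprime.
case: (boolP (p %| i)%N) => pi; case: (boolP (p %| j)%N) => pj;
  case: (boolP (p %| k)%N) => pk //=; rewrite ?orbT ?orbF //.
- by rewrite Gauss_dvdl ?cop // Gauss_dvdl ?cop // => ->.
- by rewrite Gauss_dvdl ?cop // Gauss_dvdr ?cop // => ->; rewrite !orbT.
- by rewrite Gauss_dvdr; [move=> ->; rewrite !orbT|rewrite coprimeMr !cop].
- by rewrite Gauss_dvdl ?cop // Gauss_dvdl ?cop // => ->.
Qed.

(** The difference consists of the triples rejected only by primes [p >= n]. Such a [p] forces one
    of six divisibility patterns, each met at most [(H + 1)^3 / p^2] times; the sum is then extended
    to all integers [d >= n]. *)
Lemma sieve_tail (B n : nat) (l1 h1 l2 h2 l3 h3 H : R) : (2 < n)%N ->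
  0 <= l1 -> l1 <= h1 -> 0 <= l2 -> l2 <= h2 -> 0 <= l3 -> l3 <= h3 ->
  h1 <= H -> h2 <= H -> h3 <= H -> H < B%:R ->
  (cnt B (fun i j k => in_box l1 h1 l2 h2 l3 h3 i j k && sieve_upto n i j k))%:R -
  (cnt B (fun i j k => in_box l1 h1 l2 h2 l3 h3 i j k && sieve i j k))%:R
   <= 6 * (H + 1) ^+ 3 / (n.-1)%:R.
Proof.
move=> n2 l10 lh1 l20 lh2 l30 lh3 hH1 hH2 hH3 HB.
pose Q (m : nat * nat * nat) i j k :=
  [&& in_itv_oc l1 h1 i && (m.1.1 %| i)%N, in_itv_oc l2 h2 j && (m.1.2 %| j)%N
    & in_itv_oc l3 h3 k && (m.2 %| k)%N].
pose s := flatten [seq square_moduli d | d <- iota n (B - n)].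
have cov : (cnt B (fun i j k => in_box l1 h1 l2 h2 l3 h3 i j k && sieve_upto n i j k) <=
   cnt B (fun i j k => in_box l1 h1 l2 h2 l3 h3 i j k && sieve i j k) +
   \sum_(m <- s) cnt B (Q m))%N.
  pose bx := in_box l1 h1 l2 h2 l3 h3.
  rewrite (@cntD B (fun i j k => bx i j k && sieve_upto n i j k && sieve i j k)
     (fun i j k => bx i j k && sieve_upto n i j k && ~~ sieve i j k)); last first.
    by move=> i j k _ _ _; case: (bx i j k && _); case: (sieve i j k).
  apply: leq_add.
    by apply: leq_cnt => i j k _ _ _; rewrite andbAC => /andP[].
  apply: cnt_cover => i j k iB jB kB /andP[/andP[bxijk su] ns].
  have /and3P[i1 i2 i3] := bxijk.
  have pos l h x : 0 <= l -> in_itv_oc l h x -> (0 < x)%N.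
    by move=> l0 /andP[lx _]; rewrite -(ltr0n R) (le_lt_trans l0).
  have i0 := pos _ _ _ l10 i1; have j0 := pos _ _ _ l20 i2.
  have k0 := pos _ _ _ l30 i3.
  have gd p : prime p -> (p < n)%N -> good p i j k.
    by move=> pp pn; apply: (allP su); rewrite mem_filter pp mem_iota.
  (* Since [2 < n], the prime 2 is already sieved out, so the offending prime is odd. *)
  have od : odd (i * j * k) by have := gd 2%N isT n2.
  have [p pp pd] : exists2 p, prime p & (p ^ 2 %| i * j * k)%N.
    move: ns; rewrite /sieve od /= => /sqfreeP nsq; apply: contrapT => H'.
    apply: nsq; rewrite !muln_gt0 i0 j0 k0; split=> // p pp.
    by apply/negP => pd; apply: H'; exists p.
  have pne : p != 2%N.
    apply: contraTneq pd => ->.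
    by apply: contraTN od => d2; rewrite -dvdn2 (dvdn_trans _ d2).
  have np : (n <= p)%N.
    rewrite leqNgt; apply: contraTN pd => /(gd _ pp); rewrite /good.
    by rewrite (negbTE pne).
  have := prime_square_dvd3 pp pd => /hasP[m ms /and3P[m1 m2 m3]].
  (* The prime divides a positive entry below [B], which keeps the list of moduli finite. *)
  have pB : (p < B)%N.
    have pm : [|| m.1.1 == p, m.1.2 == p, m.2 == p,
      m.1.1 == (p ^ 2)%N, m.1.2 == (p ^ 2)%N | m.2 == (p ^ 2)%N].
      by move: ms; rewrite !inE => /or4P[/eqP->|/eqP->|/eqP->|/or3P[/eqP->|/eqP->|/eqP->]];
        rewrite /= eqxx ?orbT.
    have pdv x : (p ^ 2 %| x)%N -> (p %| x)%N by apply: dvdn_trans; rewrite dvdn_exp.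
    have pl x : (0 < x)%N -> (x < B)%N -> (p %| x)%N -> (p < B)%N.
      by move=> x0 xB /(dvdn_leq x0) /leq_ltn_trans; apply.
    case/or4P: pm => [/eqP e|/eqP e|/eqP e|/or3P[/eqP e|/eqP e|/eqP e]].
    - by rewrite e in m1; exact: pl m1.
    - by rewrite e in m2; exact: pl m2.
    - by rewrite e in m3; exact: pl m3.
    - by rewrite e in m1; apply: (pl i) => //; exact: pdv.
    - by rewrite e in m2; apply: (pl j) => //; exact: pdv.
    - by rewrite e in m3; apply: (pl k) => //; exact: pdv.
  apply/hasP; exists m; last by rewrite /Q i1 i2 i3 m1 m2 m3.
  apply/flattenP; exists (square_moduli p) => //; apply: map_f.
  by rewrite mem_iota np subnKC // ltnW // (leq_ltn_trans np).
move: cov; rewrite -(ler_nat R) natrD -lerBlDl => /le_trans; apply.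
have H1 : 0 < H + 1 by rewrite ltr_wpDl // (le_trans _ hH1) // (le_trans l10).
have cQ m : (0 < m.1.1)%N -> (0 < m.1.2)%N -> (0 < m.2)%N ->
    (cnt B (Q m))%:R <= (H + 1) ^+ 3 / (m.1.1 * m.1.2 * m.2)%:R.
  move=> m1 m2 m3; rewrite /Q.
  rewrite (cnt_product B (fun i => in_itv_oc l1 h1 i && (m.1.1 %| i)%N)
    (fun j => in_itv_oc l2 h2 j && (m.1.2 %| j)%N) (fun k => in_itv_oc l3 h3 k && (m.2 %| k)%N)).
  have b l h d : (0 < d)%N -> 0 <= l -> l <= h -> h <= H ->
     (\sum_(i < B) (in_itv_oc l h i && (d %| i)))%N%:R <= (H + 1) / d%:R.
    move=> d0 l0 lh hH; apply: le_trans (sum_dvd_bound d0 l0 lh (le_lt_trans hH HB)) _.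
    by rewrite ler_pM2r ?invr_gt0 ?ltr0n // lerD2r.
  have -> : (H + 1) ^+ 3 / (m.1.1 * m.1.2 * m.2)%:R =
    (H + 1) / m.1.1%:R * ((H + 1) / m.1.2%:R) * ((H + 1) / m.2%:R).
    by rewrite !natrM; field; rewrite !pnatr_eq0 -!lt0n m1 m2 m3.
  rewrite !natrM; apply: ler_pM; rewrite ?mulr_ge0 //; last exact: b.
  by apply: ler_pM => //; exact: b.
rewrite natr_sum /s big_flatten big_map.
apply: le_trans (_ : _ <= 6 * (H + 1) ^+ 3 * \sum_(d <- iota n (B - n)) d%:R ^- 2) _.
  rewrite big_distrr /= big_seq_cond [leRHS]big_seq_cond; apply: ler_sum => d.
  rewrite mem_iota andbT => /andP[nd _].
  have d0 : (0 < d)%N by apply: leq_trans nd; rewrite (leq_trans _ n2).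
  have -> : 6 * (H + 1) ^+ 3 * d%:R ^- 2 = \sum_(m <- square_moduli d) ((H + 1) ^+ 3 * d%:R ^- 2).
    by rewrite !big_cons big_nil; ring.
  rewrite big_seq [leRHS]big_seq; apply: ler_sum => m ms.
  have [m1 m2 m3 e] : [/\ (0 < m.1.1)%N, (0 < m.1.2)%N, (0 < m.2)%N & (m.1.1 * m.1.2 * m.2 = d ^ 2)%N].
    move: ms; rewrite !inE => /or4P[/eqP->|/eqP->|/eqP->|/or3P[/eqP->|/eqP->|/eqP->]] /=;
    by rewrite ?expn_gt0 ?d0 ?muln1 ?mul1n.
  by rewrite (le_trans (cQ _ m1 m2 m3)) // e natrX.
rewrite ler_pM2l ?mulr_gt0 ?exprn_gt0 //; apply: sum_inv_sqr.
by rewrite (leq_trans _ n2).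
Qed.

Lemma euler_factor_itv (p : nat) : prime p -> odd p -> 0 <= euler_factor R p <= 1.
Proof.
move=> pp po; rewrite /euler_factor.
have p2 : 3 <= p%:R :> R by rewrite ler_nat odd_prime_gt2.
have pp0 : 0 < p%:R :> R by lra.
rewrite -!exprVn; set x : R := p%:R^-1.
have x0 : 0 < x by rewrite invr_gt0.
have x1 : x <= 1 / 3 by rewrite /x div1r lef_pV2 // posrE.
apply/andP; split.
  have -> : 1 - 6 * x ^+ 2 + 8 * x ^+ 3 - 3 * x ^+ 4 = (1 - x) ^+ 3 * (1 + 3 * x) by ring.
  by rewrite mulr_ge0 ?exprn_ge0 //; lra.
have -> : 1 - 6 * x ^+ 2 + 8 * x ^+ 3 - 3 * x ^+ 4 =
  1 - x ^+ 2 * (6 - 8 * x + 3 * x ^+ 2) by ring.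
by rewrite gerBl mulr_ge0 ?exprn_ge0 ?ltW //; nra.
Qed.

Definition odd_euler_partial (n : nat) : R :=
  \prod_(0 <= p < n | prime p && odd p) euler_factor R p.

Lemma odd_euler_partialS n : odd_euler_partial n.+1 =
  odd_euler_partial n * (if prime n && odd n then euler_factor R n else 1).
Proof.
by rewrite /odd_euler_partial big_mkcond big_nat_recr //= -big_mkcond.
Qed.

Lemma odd_euler_partial_ge0 n : 0 <= odd_euler_partial n.
Proof. by apply: prodr_ge0 => p /andP[pp po]; case/andP: (euler_factor_itv pp po). Qed.

(** All factors lie between 0 and 1, so the partial products decrease and the [limn] in
    [odd_euler_product] is a genuine limit. *)
Lemma odd_euler_partial_cvg : odd_euler_partial n @[n --> \oo] --> odd_euler_product R.
Proof.
apply: nonincreasing_is_cvgn.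
  apply/nonincreasing_seqP => n; rewrite odd_euler_partialS.
  case: ifP => [/andP[pp po]|_]; last by rewrite mulr1.
  by rewrite ler_piMr ?odd_euler_partial_ge0 //; case/andP: (euler_factor_itv pp po).
by exists 0 => _ [n _ <-]; exact: odd_euler_partial_ge0.
Qed.

Lemma sieve_density_odd n : (2 < n)%N -> sieve_density R n = 1 / 8 * odd_euler_partial n.
Proof.
elim: n => // n IH; rewrite ltnS leq_eqVlt => /orP[/eqP <-|n2].
  rewrite /sieve_density /odd_euler_partial /index_iota /= !big_cons !big_nil /=.
  by rewrite /local_density eqxx.
rewrite sieve_densityS IH // odd_euler_partialS.
rewrite mulrA; congr (_ * _); case: (boolP (prime n)) => //= pn.
rewrite /local_density; case: eqP => [e|_]; first by rewrite e in n2.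
by case: ifP => // /negbT; case/even_prime: pn => [e|-> //]; rewrite e in n2.
Qed.

Lemma sieve_density_cvg : sieve_density R n @[n --> \oo] --> 1 / 8 * odd_euler_product R.
Proof.
have H : 1 / 8 * odd_euler_partial n @[n --> \oo] --> 1 / 8 * odd_euler_product R.
  exact: cvgMl_tmp odd_euler_partial_cvg.
apply: cvg_trans H; apply: near_eq_cvg; near=> n; rewrite sieve_density_odd //.
by near: n; exact: nbhs_infty_gt.
Unshelve. all: by end_near. Qed.

(** [B] is any summation range that contains the box. The lower ends are positive: boxes stay away
    from the coordinate planes, so an exceptional fixed value of an entry drops out for large
    [T]. *)
Definition has_box_density (S : nat -> nat -> nat -> bool) (d : R) : Prop :=
  forall (B : R -> nat) (l1 h1 l2 h2 l3 h3 : R),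
  0 < l1 -> l1 <= h1 -> 0 < l2 -> l2 <= h2 -> 0 < l3 -> l3 <= h3 ->
  (forall T, 0 < T -> h1 * T < (B T)%:R) -> (forall T, 0 < T -> h2 * T < (B T)%:R) ->
  (forall T, 0 < T -> h3 * T < (B T)%:R) ->
  (cnt (B T) (fun i j k => in_box (l1 * T) (h1 * T) (l2 * T) (h2 * T) (l3 * T) (h3 * T) i j k
     && S i j k))%:R / T ^+ 3 @[T --> +oo] -->
  d * ((h1 - l1) * (h2 - l2) * (h3 - l3)).

(** An exchange of two limits. For fixed [n] the sieve by the primes below [n] is periodic and has a
    density; it exceeds the full sieve by at most [C / (n - 1)], uniformly in [T >= 1]. *)
Theorem sieve_box_density : has_box_density sieve (1 / 8 * odd_euler_product R).
Proof.
move=> B l1 h1 l2 h2 l3 h3 l10 lh1 l20 lh2 l30 lh3 B1 B2 B3.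
pose V := (h1 - l1) * (h2 - l2) * (h3 - l3).
have V0 : 0 <= V by rewrite /V !mulr_ge0 // subr_ge0.
pose H := Num.max h1 (Num.max h2 h3).
have hH1 : h1 <= H by rewrite /H le_max lexx.
have hH2 : h2 <= H by rewrite /H !le_max lexx orbT.
have hH3 : h3 <= H by rewrite /H !le_max lexx !orbT.
have HB T : 0 < T -> H * T < (B T)%:R.
  move=> T0; rewrite /H; case: (leP h1 (Num.max h2 h3)) => _; last exact: B1.
  by case: (leP h2 h3) => _; [exact: B3|exact: B2].
pose bx T := in_box (l1 * T) (h1 * T) (l2 * T) (h2 * T) (l3 * T) (h3 * T).
pose F n T := (cnt (B T) (fun i j k => bx T i j k && sieve_upto n i j k))%:R / T ^+ 3.
have Fcvg n : F n T @[T --> +oo] --> sieve_density R n * V.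
  have := periodic_box_cvg (sieve_modulus_gt0 n) (sieve_upto_periodic n) (ltW l10) lh1
    (ltW l20) lh2 (ltW l30) lh3 B1 B2 B3.
  rewrite cnt_sieve_upto mulfK // expf_neq0 // pnatr_eq0 -lt0n.
  exact: sieve_modulus_gt0.
pose G T := (cnt (B T) (fun i j k => bx T i j k && sieve i j k))%:R / T ^+ 3.
have H0 : 0 < H by rewrite (lt_le_trans l10) // (le_trans lh1).
pose C := 6 * (H + 1) ^+ 3.
have C0 : 0 < C by rewrite mulr_gt0 // exprn_gt0 // ltr_wpDl // ltW.
have FG n T : (2 < n)%N -> 1 <= T -> G T <= F n T <= G T + C / n.-1%:R.
  move=> n2 T1; have T0 : 0 < T by apply: lt_le_trans T1.
  have T3 : 0 < T ^+ 3 by rewrite exprn_gt0.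
  apply/andP; split.
    rewrite ler_pM2r ?invr_gt0 // ler_nat; apply: leq_cnt => i j k _ _ _ /andP[bxi].
    rewrite bxi /= => /andP[od /sqfreeP[_ sq]]; apply/allP => p.
    rewrite mem_filter => /andP[pp _]; rewrite /good; case: ifP => // _.
    exact: sq.
  rewrite -lerBlDl -mulrBl ler_pdivrMr //.
  have T0' := ltW T0.
  have up x y : x <= y -> x * T <= y * T by move=> xy; rewrite ler_wpM2r.
  apply: le_trans (sieve_tail n2 (mulr_ge0 (ltW l10) T0') (up _ _ lh1)
    (mulr_ge0 (ltW l20) T0') (up _ _ lh2) (mulr_ge0 (ltW l30) T0') (up _ _ lh3)
    (up _ _ hH1) (up _ _ hH2) (up _ _ hH3) (HB T T0)) _.
  (* From [1 <= T] comes [H T + 1 <= (H + 1) T], which absorbs the additive 1 of the tail bound. *)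
  have -> : C / n.-1%:R * T ^+ 3 = 6 * (((H + 1) * T) ^+ 3) / n.-1%:R.
    by rewrite exprMn /C mulrAC !mulrA.
  rewrite ler_pM2r ?ler_pM2l //; last by rewrite invr_gt0 ltr0n; case: n n2 => // -[].
  rewrite lerXn2r ?nnegrE ?addr_ge0 ?mulr_ge0 // ?(ltW H0) //.
    by rewrite addr_ge0 // ltW.
  by rewrite mulrDl mul1r lerD2l.
apply/cvgrPdist_le => e e0.
have e3 : 0 < e / 3 by rewrite divr_gt0.
have [n [n2 nC nd]] : exists n, [/\ (2 < n)%N, C / n.-1%:R <= e / 3 &
    `|1 / 8 * odd_euler_product R * V - sieve_density R n * V| <= e / 3].
  have dV : sieve_density R n * V @[n --> \oo] --> 1 / 8 * odd_euler_product R * V.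
    exact: cvgMr_tmp sieve_density_cvg.
  have /cvgrPdist_le/(_ _ e3) near1 := dV.
  have : \forall n \near \oo, [/\ (2 < n)%N, C / n.-1%:R <= e / 3 &
      `|1 / 8 * odd_euler_product R * V - sieve_density R n * V| <= e / 3].
    near=> n; split; first by near: n; exact: nbhs_infty_gt.
      have : ((Num.truncn (C / (e / 3))).+2 <= n)%N by near: n; exact: nbhs_infty_ge.
      move: (n) => [|m] //; rewrite ltnS => Hn /=.
      have m0 : (0 < m)%N by apply: leq_trans Hn.
      rewrite ler_pdivrMr ?ltr0n // mulrC -ler_pdivrMr //.
      by rewrite (le_trans (ltW (truncnS_gt _))) // ler_nat.
    by near: n; exact: near1.
  by case=> N _ /(_ N (leqnn N)); exists N.
near=> T.
have T1 : 1 <= T by near: T; apply: nbhs_pinfty_ge; rewrite num_real.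
have F1 : `|sieve_density R n * V - F n T| <= e / 3.
  by near: T; have /cvgrPdist_le/(_ _ e3) := Fcvg n.
have /andP[F2 F3] := FG n T n2 T1.
rewrite -/V -/(bx T) -/(G T).
move: nd F1; rewrite !ler_norml => /andP[a1 a2] /andP[b1 b2].
apply/andP; split; lra.
Unshelve. all: by end_near. Qed.

End BoxDensity.

(** * Box decomposition of cones *)

Section Cells.
Variable R : realType.
Variable lam : R.
Hypothesis lam0 : 0 < lam.
Implicit Types (h x y : R) (m n : int) (p : R * R) (W : set (R * R)).

(** The grid is regular in the logarithm, where [dx dy / (x y)] is translation invariant. *)
Definition gridpt h m : R := lam * expR (m%:~R * h).

(** Blocks have logarithmic width [2 h] and overlap; the cells defined next have width [h] and tile.
    The counting dictates the blocks: when [log i] and [log j] range over intervals of length [2 h],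
    half their difference ranges over an open interval of length [2 h]. Cells are for measuring,
    blocks for locating shapes. *)
Definition blk h m : set R := [set` `]gridpt h (m - 1), gridpt h (m + 1)[].
Definition cell h m : set R := [set` `]gridpt h (m - 1), gridpt h m]].

Definition blk2 h (mn : int * int) : set (R * R) := blk h mn.1 `*` blk h mn.2.
Definition cell2 h (mn : int * int) : set (R * R) := cell h mn.1 `*` cell h mn.2.

Definition inner h W mn : Prop := blk2 h mn `<=` W.
Definition touches h W mn : Prop := blk2 h mn `&` W !=set0.
Definition straddles h W mn : Prop := touches h W mn /\ ~ inner h W mn.

Lemma gridpt_gt0 h m : 0 < gridpt h m.
Proof. by rewrite mulr_gt0 ?expR_gt0. Qed.

Lemma gridpt_lt h m n : 0 < h -> (gridpt h m < gridpt h n) = (m < n).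
Proof. by move=> h0; rewrite ltr_pM2l // ltr_expR ltr_pM2r // ltr_int. Qed.

Lemma gridpt1 h m : gridpt h (m - 1) = expR (- h) * gridpt h m.
Proof.
rewrite /gridpt mulrCA -expRD; congr (_ * expR _).
by rewrite intrD mulrDl mulN1r addrC.
Qed.

Lemma cell_blk h m : 0 < h -> cell h m `<=` blk h m.
Proof.
move=> h0 x; rewrite /cell /blk /= !in_itv /= => /andP[-> /le_lt_trans] /=; apply.
by rewrite gridpt_lt // ltrDl.
Qed.

Lemma cell2_blk2 h mn : 0 < h -> cell2 h mn `<=` blk2 h mn.
Proof. by move=> h0 p [/(cell_blk h0) ? /(cell_blk h0) ?]. Qed.

Lemma blk_gt0 h m x : blk h m x -> 0 < x.
Proof. by rewrite /blk /= in_itv /= => /andP[/(lt_trans (gridpt_gt0 _ _))]. Qed.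

Lemma gridpt_ln h m x : 0 < x -> (gridpt h m < x) = (m%:~R * h < ln x - ln lam).
Proof.
move=> x0; rewrite /gridpt ltrBrDr -[RHS]ltr_expR addrC expRD !lnK ?posrE //.
Qed.

Lemma gridpt_ln_ge h m x : 0 < x -> (x <= gridpt h m) = (ln x - ln lam <= m%:~R * h).
Proof. by move=> x0; rewrite leNgt gridpt_ln // -leNgt. Qed.

Lemma gridpt_ln_gt h m x : 0 < x -> (x < gridpt h m) = (ln x - ln lam < m%:~R * h).
Proof.
by move=> x0; rewrite /gridpt ltrBlDl -[RHS]ltr_expR expRD !lnK ?posrE.
Qed.

Lemma blkP h m x : 0 < x -> blk h m x <->
  (m%:~R - 1) * h < ln x - ln lam < (m%:~R + 1) * h.
Proof.
move=> x0; rewrite /blk /= in_itv /= gridpt_ln // gridpt_ln_gt //.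
by rewrite !intrD.
Qed.

Lemma cell_exists h x : 0 < h -> 0 < x -> exists m, cell h m x.
Proof.
move=> h0 x0; exists (Num.ceil ((ln x - ln lam) / h)).
rewrite /cell /= in_itv /= gridpt_ln // gridpt_ln_ge //.
rewrite -ltr_pdivlMr // -ler_pdivrMr //.
by rewrite ceil_itv.
Qed.

Lemma cell_inj h m n x : 0 < h -> cell h m x -> cell h n x -> m = n.
Proof.
move=> h0; wlog mn : m n / m <= n.
  by move=> H cm cn; have [mn|/ltW mn] := leP m n; [|apply/esym]; exact: H.
rewrite /cell /= !in_itv /= => /andP[_ xm] /andP[nx _].
apply/eqP; rewrite eq_le mn /=; have := lt_le_trans nx xm.
by rewrite gridpt_lt // ltrBlDr ltzD1.
Qed.

Lemma measurable_blk h m : measurable (blk h m).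
Proof. exact: measurable_itv. Qed.

Lemma measurable_cell h m : measurable (cell h m).
Proof. exact: measurable_itv. Qed.

Lemma measurable_blk2 h mn : measurable (blk2 h mn).
Proof. by apply: measurableX; exact: measurable_blk. Qed.

Lemma measurable_cell2 h mn : measurable (cell2 h mn).
Proof. by apply: measurableX; exact: measurable_cell. Qed.

Notation leb2 := (@lebesgue_measure R \x @lebesgue_measure R)%E.

Lemma cell_measure h m : 0 < h ->
  lebesgue_measure (cell h m) = ((1 - expR (- h)) * gridpt h m)%:E.
Proof.
move=> h0; rewrite /cell lebesgue_measure_itv /= lte_fin gridpt_lt // ltrBlDr ltrDl ltr01.
by rewrite -EFinB gridpt1 mulrBl mul1r.
Qed.

Lemma cell2_measure h mn : 0 < h ->
  leb2 (cell2 h mn) = ((1 - expR (- h)) ^+ 2 * (gridpt h mn.1 * gridpt h mn.2))%:E.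
Proof.
move=> h0; rewrite product_measure1E; [|exact: measurable_cell..].
by rewrite [X in (X * _)%E]cell_measure // [X in (_ * X)%E]cell_measure // -EFinM;
  congr _%:E; ring.
Qed.

Lemma trivIset_cell2 h (D : set (int * int)) : 0 < h -> trivIset D (cell2 h).
Proof.
move=> h0 [m n] [m' n'] _ _ [[x y]] [[/= xm yn] [/= xm' yn']].
by rewrite (cell_inj h0 xm xm') (cell_inj h0 yn yn').
Qed.

(** A version of [1 / (x y)] that is nonnegative and measurable on the whole plane and agrees with
    it on the open quadrant. *)
Definition density p : R := expR (- (ln p.1 + ln p.2)).

Lemma measurable_density : measurable_fun setT (EFin \o density).
Proof.
apply/measurable_EFinP; apply: measurableT_comp; first exact: measurable_expR.
apply: measurableT_comp; first exact: oppr_measurable.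
by apply: measurable_funD; (apply: measurableT_comp; [exact: measurable_ln|]).
Qed.

Lemma density_ge0 p : 0 <= density p.
Proof. exact: expR_ge0. Qed.

Lemma densityE p : 0 < p.1 -> 0 < p.2 -> density p = (p.1 * p.2)^-1.
Proof. by move=> p1 p2; rewrite /density expRN expRD !lnK. Qed.

Definition quadrant : set (R * R) := [set p | 0 < p.1 /\ 0 < p.2].

Lemma mu_shapeE W : W `<=` quadrant -> mu_shape W = (\int[leb2]_(p in W) (density p)%:E)%E.
Proof.
move=> Wq; apply: eq_integral => p; rewrite inE => /Wq[p1 p2].
by rewrite densityE.
Qed.

Lemma cell2_quadrant h mn : cell2 h mn `<=` quadrant.
Proof.
move=> p [/=]; rewrite /cell /= !in_itv /= => /andP[+ _] /andP[+ _].
by move=> /(lt_trans (gridpt_gt0 _ _)) ? /(lt_trans (gridpt_gt0 _ _)).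
Qed.

(** The exact measure is [h^2]. Bounding the density by its value at the far corner, and at the near
    corner in the companion lemma, avoids computing the integral; both bounds are asymptotic to
    [h^2] for small [h]. *)
Lemma cell2_mu_ge h mn : 0 < h ->
  (((1 - expR (- h)) ^+ 2)%:E <= \int[leb2]_(p in cell2 h mn) (density p)%:E)%E.
Proof.
move=> h0; have mc := measurable_cell2 h mn.
have gp : 0 < gridpt h mn.1 * gridpt h mn.2 by rewrite mulr_gt0 ?gridpt_gt0.
apply: le_trans (_ : (\int[leb2]_(p in cell2 h mn)
    cst ((gridpt h mn.1 * gridpt h mn.2)^-1)%:E p <= _)%E).
  rewrite integral_cst // [X in (_ * X)%E]cell2_measure // -EFinM lee_fin.
  by rewrite mulrC mulfK // gt_eqF.
apply: ge0_le_integral => //.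
- by move=> p _; rewrite lee_fin invr_ge0 ltW.
- exact: measurable_funTS measurable_density.
- move=> p cp; have [p1 p2] := cell2_quadrant cp; rewrite lee_fin densityE //.
  rewrite lef_pV2 ?posrE ?mulr_gt0 ?expR_gt0 //; move: cp => [/=].
  rewrite /cell /= !in_itv /= => /andP[_ a1] /andP[_ a2].
  by rewrite ler_pM // ltW.
Qed.

Lemma cell2_mu_le h mn : 0 < h ->
  (\int[leb2]_(p in cell2 h mn) (density p)%:E <= ((expR h - 1) ^+ 2)%:E)%E.
Proof.
move=> h0; have mc := measurable_cell2 h mn.
have gp : 0 < gridpt h (mn.1 - 1) * gridpt h (mn.2 - 1) by rewrite mulr_gt0 ?gridpt_gt0.
apply: le_trans (_ : (_ <= \int[leb2]_(p in cell2 h mn)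
    cst ((gridpt h (mn.1 - 1) * gridpt h (mn.2 - 1))^-1)%:E p)%E) _.
  apply: ge0_le_integral => //.
  - by move=> p _; rewrite lee_fin density_ge0.
  - exact: measurable_funTS measurable_density.
  - move=> p cp; have [p1 p2] := cell2_quadrant cp; rewrite lee_fin densityE //.
    rewrite lef_pV2 ?posrE ?mulr_gt0 ?gridpt_gt0 ?expR_gt0 //; move: cp => [/=].
    rewrite /cell /= !in_itv /= => /andP[a1 _] /andP[a2 _].
    by rewrite ler_pM // ltW // gridpt_gt0.
rewrite integral_cst // [X in (_ * X)%E]cell2_measure // -EFinM lee_fin.
rewrite !gridpt1 expRN.
have e0 : expR h != 0 by rewrite gt_eqF ?expR_gt0.
have g1 : gridpt h mn.1 != 0 by rewrite gt_eqF ?gridpt_gt0.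
have g2 : gridpt h mn.2 != 0 by rewrite gt_eqF ?gridpt_gt0.
rewrite le_eqVlt; apply/orP; left; apply/eqP; field.
by rewrite g1 g2 e0.
Qed.

Lemma integral_cells h (s : seq (int * int)) : 0 < h -> uniq s ->
  (\int[leb2]_(p in \big[setU/set0]_(mn <- s) cell2 h mn) (density p)%:E =
   \sum_(mn <- s) \int[leb2]_(p in cell2 h mn) (density p)%:E)%E.
Proof.
move=> h0 us; apply: ge0_integral_bigsetU => //.
- by move=> mn; exact: measurable_cell2.
- exact: trivIset_cell2.
- exact: measurable_funTS measurable_density.
- by move=> p _; rewrite lee_fin density_ge0.
Qed.

(** Cells are disjoint, and each lies in its block, hence in [W]. *)
Lemma mu_ge_inner h W (s : seq (int * int)) : 0 < h -> measurable W -> W `<=` quadrant ->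
  uniq s -> (forall mn, mn \in s -> inner h W mn) ->
  (((size s)%:R * (1 - expR (- h)) ^+ 2)%:E <= mu_shape W)%E.
Proof.
move=> h0 mW Wq us sW; rewrite mu_shapeE //.
apply: (@le_trans _ _ (\int[leb2]_(p in \big[setU/set0]_(mn <- s) cell2 h mn) (density p)%:E)%E).
  rewrite integral_cells //; have -> : (((size s)%:R * (1 - expR (- h)) ^+ 2)%:E =
    \sum_(mn <- s) ((1 - expR (- h)) ^+ 2)%:E)%E.
    by rewrite sumEFin big_const_seq count_predT iter_addr_0 mulr_natl.
  by apply: lee_sum => mn _; exact: cell2_mu_ge.
apply: ge0_subset_integral => //.
- by apply: bigsetU_measurable => mn _; exact: measurable_cell2.
- exact: measurable_funTS measurable_density.
- by move=> p _; rewrite lee_fin density_ge0.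
- rewrite big_seq; elim/big_rec: _ => [//|mn D mns DW p [|/DW //]].
  by move/(cell2_blk2 h0); exact: sW.
Qed.

(** Each point of [W] lies in some cell, whose block then touches [W]. *)
Lemma mu_le_touches h W (s : seq (int * int)) : 0 < h -> measurable W -> W `<=` quadrant ->
  uniq s -> (forall mn, touches h W mn -> mn \in s) ->
  (mu_shape W <= ((size s)%:R * (expR h - 1) ^+ 2)%:E)%E.
Proof.
move=> h0 mW Wq us sW; rewrite mu_shapeE //.
apply: (@le_trans _ _ (\int[leb2]_(p in \big[setU/set0]_(mn <- s) cell2 h mn) (density p)%:E)%E).
  apply: ge0_subset_integral => //.
  - by apply: bigsetU_measurable => mn _; exact: measurable_cell2.
  - exact: measurable_funTS measurable_density.
  - by move=> p _; rewrite lee_fin density_ge0.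
  - move=> p Wp; have [p1 p2] := Wq _ Wp.
    have [m cm] := cell_exists h0 p1; have [n cn] := cell_exists h0 p2.
    have cp : cell2 h (m, n) p by [].
    have : (m, n) \in s by apply: sW; exists p; split=> //; exact: cell2_blk2 cp.
    by move=> mns; rewrite (big_rem _ mns) /=; left.
rewrite integral_cells //; have -> : (((size s)%:R * (expR h - 1) ^+ 2)%:E =
    \sum_(mn <- s) ((expR h - 1) ^+ 2)%:E)%E.
  by rewrite sumEFin big_const_seq count_predT iter_addr_0 mulr_natl.
by apply: lee_sum => mn _; exact: cell2_mu_le.
Qed.

End Cells.

(** * Blocks across the boundary are negligible *)

Section Straddling.
Variable R : realType.
Variables (lam : R) (W : set (R * R)).
Hypothesis lam0 : 0 < lam.
Hypothesis Wc : compact W.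
Hypothesis Wq : W `<=` @quadrant R.
Notation leb2 := (@lebesgue_measure R \x @lebesgue_measure R)%E.
Hypothesis Wb : forall D : set (R * R), measurable D -> D `<=` W `&` closure (~` W) ->
  leb2 D = 0%E.

Lemma log_bounded : exists N : R, 0 < N /\ forall p, W p ->
  `|ln p.1 - ln lam| <= N /\ `|ln p.2 - ln lam| <= N.
Proof.
have bd (f : R * R -> R) : continuous f -> (forall p, W p -> 0 < f p) ->
    exists N : R, 0 < N /\ forall p, W p -> `|ln (f p) - ln lam| <= N.
  move=> cf f0; pose g p := ln (f p) - ln lam.
  have : compact (g @` W).
    apply: continuous_compact => //; apply: continuous_in_subspaceT => p.
    rewrite inE => Wp; apply: cvgB; last exact: cvg_cst.
    apply: (@continuous_comp _ _ _ f (@ln R)); first exact: cf.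
    exact/continuous_ln/f0.
  move/compact_bounded => [M [_ HM]].
  exists (`|M| + 1); split; first by rewrite ltr_wpDl.
  move=> p Wp; apply: (HM (`|M| + 1)); last by exists p.
  by rewrite ltr_pwDr // ler_norm.
have [N1 [N10 H1]] := bd fst (fun p => cvg_fst) (fun p Wp => proj1 (Wq Wp)).
have [N2 [N20 H2]] := bd snd (fun p => cvg_snd) (fun p Wp => proj2 (Wq Wp)).
exists (N1 + N2); split; first by rewrite addr_gt0.
move=> p Wp; split.
  by rewrite (le_trans (H1 _ Wp)) // lerDl ltW.
by rewrite (le_trans (H2 _ Wp)) // lerDr ltW.
Qed.

(** Powers of 1/2, so that every block lies in a block of the previous mesh and the unions of
    straddling blocks decrease. *)
Definition mesh (n : nat) : R := 2^-1 ^+ n.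

Lemma mesh_gt0 n : 0 < mesh n.
Proof. by rewrite exprn_gt0 // invr_gt0. Qed.

Lemma mesh_le1 n : mesh n <= 1.
Proof. by rewrite exprn_ile1 // ?invr_ge0 // invf_le1 // ler1n. Qed.

Lemma mesh_cvg : mesh n @[n --> \oo] --> (0 : R).
Proof. by apply: cvg_expr; rewrite ger0_norm ?invr_ge0 // invf_lt1 // ltr1n. Qed.

Lemma blk_parent n m : exists m', blk lam (mesh n.+1) m `<=` blk lam (mesh n) m'.
Proof.
(* From [2 q <= m <= 2 q + 1], the ends [m - 1] and [m + 1] of the small block stay between
   [2 q - 2] and [2 q + 2], the ends of the large one. *)
exists (m %/ 2)%Z; have := divz_eq m 2; have := @modz_ge0 m 2 isT.
have := @ltz_pmod m 2 isT; set q := (m %/ 2)%Z; set r := (m %% 2)%Z => r2 r0 mE.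
have e : mesh n = 2 * mesh n.+1 by rewrite /mesh exprS mulVKf.
have h0 := mesh_gt0 n.+1; move=> x bx; have x0 := blk_gt0 lam0 bx.
move/(blkP lam0 _ _ x0): bx => /andP[b1 b2]; apply/(blkP lam0 _ _ x0).
have [le1 le2] : (2 * q%:~R <= m%:~R :> R) /\ (m%:~R <= 2 * q%:~R + 1 :> R).
  by rewrite -[2]/(2%:~R) -intrM -[1]/(1%:~R) -intrD !ler_int; split; lia.
rewrite e; apply/andP; split.
  apply: le_lt_trans b1; rewrite mulrA ler_pM2r //; lra.
apply: (lt_le_trans b2); rewrite mulrA ler_pM2r //; lra.
Qed.

Definition straddle_set (n : nat) : set (R * R) :=
  \bigcup_(mn in straddles lam (mesh n) W) blk2 lam (mesh n) mn.

Lemma straddle_setS n : straddle_set n.+1 `<=` straddle_set n.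
Proof.
move=> p [[a b] [[q [bq Wq']] nin] bp].
have [a' aP] := blk_parent n a; have [b' bP] := blk_parent n b.
have sub : blk2 lam (mesh n.+1) (a, b) `<=` blk2 lam (mesh n) (a', b').
  by move=> u [/aP ? /bP ?].
exists (a', b'); last exact: sub.
split; first by exists q; split=> //; exact: sub.
by move=> inn; apply: nin; apply: subset_trans inn.
Qed.

Lemma measurable_straddle_set n : measurable (straddle_set n).
Proof.
rewrite /straddle_set bigcup_mkcond; apply: countable_bigcupT_measurable.
  exact: countableP.
by move=> mn; case: ifP => _ //; exact: measurable_blk2.
Qed.

(** Logarithms of two points of a block differ by less than [2 h]. *)
Lemma blk_close h m (x y : R) : 0 < h -> blk lam h m x -> blk lam h m y ->
  `|x - y| <= x * (expR (2 * h) - 1).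
Proof.
move=> h0 bx by_; have x0 := blk_gt0 lam0 bx; have y0 := blk_gt0 lam0 by_.
move/(blkP lam0 _ _ x0): bx => /andP[x1 x2]; move/(blkP lam0 _ _ y0): by_ => /andP[y1 y2].
have c1 : ln y <= ln x + 2 * h by lra.
have c2 : ln x <= ln y + 2 * h by lra.
have d1 : y <= x * expR (2 * h).
  by rewrite -[y]lnK ?posrE // -[x in x * _]lnK ?posrE // -expRD ler_expR.
have d2 : x <= y * expR (2 * h).
  by rewrite -[x]lnK ?posrE // -[y in y * _]lnK ?posrE // -expRD ler_expR.
have E1 : 1 <= expR (2 * h) by rewrite -expR0 ler_expR mulr_ge0 // ltW.
rewrite ler_norml; apply/andP; split; last first.
  case: (leP x y) => xy; first by rewrite (@le_trans _ _ 0) ?subr_le0 // mulr_ge0 ?subr_ge0 // ltW.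
  have : y * (expR (2 * h) - 1) <= x * (expR (2 * h) - 1).
    by rewrite ler_wpM2r ?subr_ge0 // ltW.
  by move: d2; rewrite !mulrBr !mulr1; lra.
by move: d1; rewrite mulrBr mulr1; lra.
Qed.

(** A point that lies in straddling blocks at every scale is a limit of points of [W], which is
    closed, and of points outside [W]. *)
Lemma bigcap_straddle_set : \bigcap_n straddle_set n `<=` W `&` closure (~` W).
Proof.
move=> p Vp.
have p0 : 0 < p.1 /\ 0 < p.2.
  by have [mn _ [/(blk_gt0 lam0) ? /(blk_gt0 lam0) ?]] := Vp 0%N I.
(* To be applied with [A] equal to [W] and to its complement: the blocks around [p] shrink, their
   points being within [(p.1 + p.2) (exp (2 h) - 1)] of it. *)
have key (A : set (R * R)) : (forall n mn, straddles lam (mesh n) W mn ->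
    blk2 lam (mesh n) mn `&` A !=set0) -> closure A p.
  move=> HA B /nbhs_ballP[e /= e0 eB].
  have c0 : (p.1 + p.2) * (expR (2 * mesh n) - 1) @[n --> \oo] --> (p.1 + p.2) * (expR (2 * 0) - 1).
    apply: cvgMl_tmp; apply: cvgB; last exact: cvg_cst.
    apply: continuous_cvg; first exact: continuous_expR.
    by apply: cvgMl_tmp; exact: mesh_cvg.
  rewrite mulr0 expR0 subrr mulr0 in c0.
  have /cvgrPdist_lt/(_ _ e0) [n _ /(_ n (leqnn n))] := c0.
  rewrite sub0r normrN => small.
  have [mn st [b1 b2]] := Vp n I; have [q [[q1 q2] Aq]] := HA n mn st.
  exists q; split=> //; apply: eB; rewrite -ball_normE /=.
  have E1 : 0 <= expR (2 * mesh n) - 1.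
    by rewrite subr_ge0 -expR0 ler_expR mulr_ge0 // ltW // mesh_gt0.
  move: small; rewrite ger0_norm; last by rewrite mulr_ge0 // addr_ge0 ?ltW //; case: p0.
  move=> small; rewrite prod_normE gt_max; apply/andP; split => /=.
    apply: le_lt_trans (blk_close (mesh_gt0 n) b1 q1) _; apply: le_lt_trans small.
    by rewrite ler_wpM2r // lerDl ltW //; case: p0.
  apply: le_lt_trans (blk_close (mesh_gt0 n) b2 q2) _; apply: le_lt_trans small.
  by rewrite ler_wpM2r // lerDr ltW //; case: p0.
split.
  have Wcl : closed W by apply: compact_closed => //; exact: Rhausdorff.
  by apply: Wcl; apply: key => n mn [].
by apply: key => n mn [_ /existsNP[q /not_implyP[bq Wq']]]; exists q.
Qed.

Lemma straddle_set_bounded : exists A, 0 < A /\ forall n, straddle_set n `<=`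
  `]0, A[%classic `*` `]0, A[%classic.
Proof.
have [N [N0 HN]] := log_bounded.
(* A point of a straddling block shares the block with a point of [W], so their logarithms differ by
   less than [2 h <= 2]. *)
exists (lam * expR (N + 2)); split; first by rewrite mulr_gt0 ?expR_gt0.
suff H n m x y : blk lam (mesh n) m x -> blk lam (mesh n) m y -> `|ln y - ln lam| <= N ->
    0 < x < lam * expR (N + 2).
  move=> n p [[a b] [[q [[qa qb] Wq']] _] [pa pb]]; have [h1 h2] := HN _ Wq'.
  by split; rewrite /= in_itv /=; [apply: H pa qa h1|apply: H pb qb h2].
move=> bx by_; have x0 := blk_gt0 lam0 bx; have y0 := blk_gt0 lam0 by_.
rewrite x0 /=; move/(blkP lam0 _ _ x0): bx => /andP[x1 x2].
move/(blkP lam0 _ _ y0): by_ => /andP[y1 y2]; rewrite ler_norml => /andP[_ yN].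
rewrite -[x]lnK ?posrE // -[lam in lam * _]lnK ?posrE // -expRD ltr_expR.
have := mesh_le1 n; lra.
Qed.

(** Continuity of the measure from above along the decreasing sets; boundedness supplies the finite
    measure that this requires. *)
Lemma straddle_measure_cvg0 : leb2 (straddle_set n) @[n --> \oo] --> (0 : \bar R)%E.
Proof.
have mV := measurable_straddle_set.
have mcap : measurable (\bigcap_n straddle_set n) by exact: bigcap_measurable.
rewrite -(Wb mcap bigcap_straddle_set).
apply: (@nonincreasing_cvg_mu _ _ _ leb2) => //.
  have [A [A0 HA]] := straddle_set_bounded.
  have mI : measurable (`]0, A[%classic : set R) by exact: measurable_itv.
  apply: (@le_lt_trans _ _ (leb2 (`]0, A[%classic `*` `]0, A[%classic))).
    apply: le_measure; rewrite ?inE.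
    - exact: mV.
    - exact: measurableX.
    - exact: HA.
  have mA : lebesgue_measure (`]0, A[%classic : set R) = A%:E.
    by rewrite lebesgue_measure_itv /= lte_fin A0 -EFinB subr0.
  by rewrite product_measure1E // [X in (X * _)%E]mA [X in (_ * X)%E]mA -EFinM ltry.
by apply/nonincreasing_seqP => n; rewrite subsetEset; exact: straddle_setS.
Qed.

(** Each straddling block contains its own cell, the cells are disjoint, and the grid points of
    blocks that meet the compact [W] are bounded below. So the area of the union controls the number
    of blocks. *)
Lemma straddles_negligible : exists2 C : R, 0 < C &
  forall n (s : seq (int * int)), uniq s ->
   (forall mn, mn \in s -> straddles lam (mesh n) W mn) ->
  (((size s)%:R * (1 - expR (- mesh n)) ^+ 2 * C)%:E <= leb2 (straddle_set n))%E.
Proof.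
have [N [N0 HN]] := log_bounded.
(* The block meets [W], where the logarithm is at least [- N], and the grid point at its centre is
   within [h <= 1] of there. *)
pose c := lam * expR (- N - 1).
have c0 : 0 < c by rewrite mulr_gt0 ?expR_gt0.
exists (c ^+ 2); first by rewrite exprn_gt0.
move=> n s us ss.
have h0 := mesh_gt0 n.
have gN m x : blk lam (mesh n) m x -> `|ln x - ln lam| <= N -> c <= gridpt lam (mesh n) m.
  move=> bx; have x0 := blk_gt0 lam0 bx; move/(blkP lam0 _ _ x0): bx => /andP[x1 x2].
  rewrite ler_norml => /andP[xN _]; rewrite ler_pM2l // ler_expR.
  have := mesh_le1 n; lra.
apply: (@le_trans _ _ (leb2 (\big[setU/set0]_(mn <- s) cell2 lam (mesh n) mn))).
  have -> : leb2 (\big[setU/set0]_(mn <- s) cell2 lam (mesh n) mn) =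
      (\sum_(mn <- s) leb2 (cell2 lam (mesh n) mn))%E.
    have mc mn : measurable (cell2 lam (mesh n) mn) by exact: measurable_cell2.
    transitivity (\int[leb2]_(p in \big[setU/set0]_(mn <- s) cell2 lam (mesh n) mn) cst 1%E p)%E.
      by rewrite integral_cst ?mul1e //; apply: bigsetU_measurable => mn _; exact: mc.
    rewrite ge0_integral_bigsetU //; last exact: trivIset_cell2.
    by apply: eq_bigr => mn _; rewrite integral_cst ?mul1e //; exact: mc.
  have -> : (((size s)%:R * (1 - expR (- mesh n)) ^+ 2 * c ^+ 2)%:E =
    \sum_(mn <- s) ((1 - expR (- mesh n)) ^+ 2 * c ^+ 2)%:E)%E.
    by rewrite sumEFin big_const_seq count_predT iter_addr_0 -mulrA mulr_natl.
  rewrite big_seq [leRHS]big_seq; apply: lee_sum => -[m1 m2] /ss[[q [[/= q1 q2] Wq']] _].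
  have [n1 n2] := HN _ Wq'.
  rewrite [leRHS]cell2_measure // lee_fin ler_wpM2l ?sqr_ge0 // expr2.
  by rewrite ler_pM ?(ltW c0) //; [exact: gN q1 n1|exact: gN q2 n2].
apply: le_measure; rewrite ?inE.
- by apply: bigsetU_measurable => mn _; exact: measurable_cell2.
- exact: measurable_straddle_set.
- rewrite big_seq; elim/big_rec: _ => [//|mn D mns DW p [|/DW //]].
  by move/(cell2_blk2 lam0 h0) => bp; exists mn => //; exact: ss.
Qed.

Lemma straddles_cvg0 (e : R) : 0 < e -> \forall n \near \oo,
  forall s : seq (int * int), uniq s ->
   (forall mn, mn \in s -> straddles lam (mesh n) W mn) ->
  (size s)%:R * (1 - expR (- mesh n)) ^+ 2 <= e.
Proof.
move=> e0; have [C C0 HC] := straddles_negligible.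
have eC : 0 < e * C by rewrite mulr_gt0.
have : \forall n \near \oo, (leb2 (straddle_set n) < (e * C)%:E)%E.
  have nb : nbhs (0%E : \bar R) [set x | (x < (e * C)%:E)%E].
    apply: open_nbhs_nbhs; split; first exact: open_ereal_lt_ereal.
    by rewrite /= lte_fin.
  exact: straddle_measure_cvg0 nb.
apply: filterS => n Hn s us ss.
by have := le_lt_trans (HC n s us ss) Hn; rewrite lte_fin ltr_pM2r // => /ltW.
Qed.

End Straddling.

Lemma box_index_le (a m n : int) (l : nat) :
  3 * a - m - n <= -3 -> 3 * (a - l%:Z) - m - n + 3 <= 0.
Proof. by lia. Qed.

Lemma ltz_le_m1 (x : int) : x < 0 -> x <= -1.
Proof. by lia. Qed.

(** Here [a], [b], [c] are the exponents of the lower corner of a box and [i] is the top index of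
    the tower over the block [(a - b, a - c)]. The box is on one of the top [L + 1] floors, or so
    low that all three coordinates are small. *)
Lemma box_index_cases (a b c i : int) (K L : nat) : a + b + c <= -1 ->
  -3 <= 3 * i - (a - b) - (a - c) -> 3 * i - (a - b) - (a - c) <= -1 ->
  `|a - b| <= K%:Z -> `|a - c| <= K%:Z ->
  (exists2 l, (l < L.+1)%N & a = i - l%:Z) \/
  [/\ a + 1 <= 2 * K%:Z - L%:Z, b + 1 <= 2 * K%:Z - L%:Z & c + 1 <= 2 * K%:Z - L%:Z].
Proof.
move=> H1 H2 H3 H4 H5; have ai : a <= i by lia.
case: (lerP (i - L%:Z) a) => [le_a|lt_a]; [left|right; split; lia].
by exists `|i - a|%N; lia.
Qed.

Lemma cvgr_exp (R : realType) (f : nat -> R) (a : R) k :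
  f n @[n --> \oo] --> a -> f n ^+ k @[n --> \oo] --> a ^+ k.
Proof.
move=> fa; elim: k => [|k IH].
  by under eq_cvg do rewrite expr0; exact: cvg_cst.
by under eq_cvg do rewrite exprS; rewrite exprS; exact: cvgM.
Qed.

Definition ints (K : nat) : seq int := [seq i%:Z - K%:Z | i <- iota 0 (2 * K).+1].

Lemma ints_uniq K : uniq (ints K).
Proof. by rewrite map_inj_uniq ?iota_uniq // => i j /addIr[]. Qed.

Lemma mem_ints K (m : int) : `|m| <= K%:Z -> m \in ints K.
Proof.
move=> mK; apply/mapP; exists `|(m + K%:Z)%R|%N; last by lia.
by rewrite mem_iota; lia.
Qed.

(** * From box densities to the measure of the base of a cone *)

Section ConeCount.
Variable R : realType.
Variables (lam : R) (W : set (R * R)) (S : nat -> nat -> nat -> bool) (d : R).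
Hypothesis lam0 : 0 < lam.
Hypothesis Wc : compact W.
Hypothesis Wq : W `<=` @quadrant R.
Hypothesis d0 : 0 <= d.
Hypothesis HS : has_box_density S d.
Implicit Types (h T : R) (i j k : nat).

(** The shape parameters of the field with index [(i, j, k)]; [lam] collects the constants of the
    family. *)
Definition shape_pt (i j k : nat) : R * R :=
  (lam * Num.sqrt (i%:R / j%:R), lam * Num.sqrt (i%:R / k%:R)).

(** The product is compared with [T^3], so that the entries are of order [T] over a compact [W] and
    counts are normalised by volume. *)
Definition cone_region T (i j k : nat) : bool :=
  [&& S i j k, (0 < i)%N, (0 < j)%N, (0 < k)%N, `[< W (shape_pt i j k) >]
    & (i * j * k)%:R <= T ^+ 3].

Definition cone_count T : nat := cnt (Num.truncn (T ^+ 3)).+1 (cone_region T).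

Lemma cone_region_lt T i j k : cone_region T i j k ->
  [&& (i < (Num.truncn (T ^+ 3)).+1)%N, (j < (Num.truncn (T ^+ 3)).+1)%N
    & (k < (Num.truncn (T ^+ 3)).+1)%N].
Proof.
case/and5P => _ i0 j0 k0 /andP[_ H].
have T0 : 0 <= T ^+ 3 by apply: le_trans H.
move: H; rewrite -truncn_ge_nat // !ltnS; set t := Num.truncn _ => H.
have ij : (i * j <= i * j * k)%N by rewrite leq_pmulr.
apply/and3P; split; apply: leq_trans H.
- by rewrite (leq_trans _ ij) // leq_pmulr.
- by rewrite (leq_trans _ ij) // leq_pmull.
- by rewrite leq_pmull // muln_gt0 i0.
Qed.

Lemma ln_sqrt_ratio i j : (0 < i)%N -> (0 < j)%N ->
  ln (lam * Num.sqrt (i%:R / j%:R)) - ln lam = (ln i%:R - ln j%:R) / 2 :> R.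
Proof.
move=> i0 j0; have ij : 0 < i%:R / j%:R :> R by rewrite divr_gt0 ?ltr0n.
rewrite lnM ?posrE ?sqrtr_gt0 // addrC addrA addNr add0r.
rewrite -ln_div ?posrE ?ltr0n // -[in RHS](sqr_sqrtr (ltW ij)) lnXn ?sqrtr_gt0 //.
by rewrite -[X in X / 2]mulr_natr mulfK.
Qed.

(** Logarithmic width [2 h] rather than [h], because the square root in [shape_pt] halves
    logarithms. *)
Definition logbox h T (a : int) (i : nat) : bool :=
  in_itv_oc (expR (a%:~R * (2 * h)) * T) (expR ((a + 1)%:~R * (2 * h)) * T) i.

Lemma logbox_gt0 h T a i : 0 < T -> logbox h T a i -> (0 < i)%N.
Proof.
move=> T0 /andP[H _]; rewrite -(ltr0n R) (lt_trans _ H) // mulr_gt0 ?expR_gt0 //.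
Qed.

Lemma logboxP h T a i : 0 < T -> (0 < i)%N ->
  logbox h T a i = (a%:~R * (2 * h) < ln i%:R - ln T <= (a + 1)%:~R * (2 * h)).
Proof.
move=> T0 i0; have ip : 0 < i%:R :> R by rewrite ltr0n.
rewrite /logbox /in_itv_oc; congr (_ && _).
  by rewrite ltrBrDr -[RHS]ltr_expR expRD !lnK ?posrE.
by rewrite lerBlDr -[RHS]ler_expR expRD !lnK ?posrE.
Qed.

Lemma logbox_inj h T a b i : 0 < h -> 0 < T -> logbox h T a i -> logbox h T b i -> a = b.
Proof.
move=> h0 T0 ai bi; have i0 := logbox_gt0 T0 ai.
move: ai bi; rewrite !logboxP // => /andP[a1 a2] /andP[b1 b2].
have h2 : 0 < 2 * h by rewrite mulr_gt0.
have := lt_le_trans a1 b2; have := lt_le_trans b1 a2.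
rewrite !ltr_pM2r // !ltr_int !ltzD1 => ba ab.
by apply/eqP; rewrite eq_le ab ba.
Qed.

Lemma logbox_exists h T i : 0 < h -> 0 < T -> (0 < i)%N -> exists a, logbox h T a i.
Proof.
move=> h0 T0 i0; have h2 : 0 < 2 * h by rewrite mulr_gt0.
exists (Num.ceil ((ln i%:R - ln T) / (2 * h)) - 1); rewrite logboxP // subrK.
by rewrite -ltr_pdivlMr // -ler_pdivrMr // ceil_itv.
Qed.

Lemma logbox_blk h T a b i j : 0 < h -> 0 < T -> logbox h T a i -> logbox h T b j ->
  blk lam h (a - b) (lam * Num.sqrt (i%:R / j%:R)).
Proof.
move=> h0 T0 ai bj; have i0 := logbox_gt0 T0 ai; have j0 := logbox_gt0 T0 bj.
apply/(blkP lam0).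
  by rewrite mulr_gt0 // sqrtr_gt0 divr_gt0 ?ltr0n.
rewrite ln_sqrt_ratio //; move: ai bj; rewrite !logboxP // => /andP[a1 a2] /andP[b1 b2].
move: a1 a2 b1 b2; rewrite !intrD intrN; move: (a%:~R) (b%:~R) => x y.
by move=> a1 a2 b1 b2; apply/andP; split; nra.
Qed.

(** [x.1] names a block of shapes and [x.2] the height along the rays over it: the boxes over one
    block form a tower that runs down into the vertex of the cone. *)
Definition cone_box h T (x : (int * int) * int) i j k : bool :=
  [&& logbox h T x.2 i, logbox h T (x.2 - x.1.1) j & logbox h T (x.2 - x.1.2) k].

Definition cone_box_vol h (x : (int * int) * int) : R :=
  (expR (2 * h) - 1) ^+ 3 * expR ((3 * x.2 - x.1.1 - x.1.2)%:~R * (2 * h)).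

Lemma cone_box_cvg h (x : (int * int) * int) (H : R) : 0 < h ->
  expR ((x.2 + 1)%:~R * (2 * h)) <= H -> expR ((x.2 - x.1.1 + 1)%:~R * (2 * h)) <= H ->
  expR ((x.2 - x.1.2 + 1)%:~R * (2 * h)) <= H ->
  (cnt (Num.truncn (H * T)).+1 (fun i j k => cone_box h T x i j k && S i j k))%:R / T ^+ 3
    @[T --> +oo] --> d * cone_box_vol h x.
Proof.
move=> h0 H1 H2 H3; have h2 : 0 < 2 * h by rewrite mulr_gt0.
have lt_truncn (y : R) T : y <= H -> 0 < T -> y * T < (Num.truncn (H * T)).+1%:R.
  move=> yH T0; apply: le_lt_trans (truncnS_gt _).
  by rewrite ler_pM2r.
have le_exp (a : int) : expR (a%:~R * (2 * h)) <= expR ((a + 1)%:~R * (2 * h)).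
  by rewrite ler_expR ler_pM2r // ler_int lerDl.
have := HS (B := fun T => (Num.truncn (H * T)).+1) (expR_gt0 _) (le_exp x.2)
  (expR_gt0 _) (le_exp (x.2 - x.1.1)) (expR_gt0 _) (le_exp (x.2 - x.1.2))
  (fun T => lt_truncn _ T H1) (fun T => lt_truncn _ T H2) (fun T => lt_truncn _ T H3).
have E (a : int) : expR ((a + 1)%:~R * (2 * h)) = expR (a%:~R * (2 * h)) * expR (2 * h).
  by rewrite -expRD intrD mulrDl mul1r.
rewrite !E.
have -> : d * cone_box_vol h x = d * ((expR (x.2%:~R * (2 * h)) * expR (2 * h) - expR (x.2%:~R * (2 * h))) *
    (expR ((x.2 - x.1.1)%:~R * (2 * h)) * expR (2 * h) -
      expR ((x.2 - x.1.1)%:~R * (2 * h))) *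
      (expR ((x.2 - x.1.2)%:~R * (2 * h)) * expR (2 * h) -
      expR ((x.2 - x.1.2)%:~R * (2 * h)))).
  rewrite /cone_box_vol; congr (_ * _).
  have -> : (3 * x.2 - x.1.1 - x.1.2)%:~R * (2 * h) = x.2%:~R * (2 * h) +
     (x.2 - x.1.1)%:~R * (2 * h) + (x.2 - x.1.2)%:~R * (2 * h) :> R.
    by rewrite !intrD !intrN intrM; ring.
  by rewrite !expRD; ring.
apply: cvg_trans; apply: near_eq_cvg; near=> T.
congr (_%:R / _); apply: eq_cnt => i j k _ _ _; congr (_ && _).
by rewrite /in_box /cone_box /logbox !E.
Unshelve. all: by end_near. Qed.

(** Over [W] the logarithms of [i], [j], [k] differ pairwise by at most [4 N], and the smallest is
    at most [ln T] by the bound on the product. *)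
Lemma shape_log_bound : exists N : R, 0 < N /\ forall T i j k, 0 < T -> cone_region T i j k ->
  [/\ i%:R <= expR (4 * N) * T, j%:R <= expR (4 * N) * T & k%:R <= expR (4 * N) * T].
Proof.
have [N [N0 HN]] := log_bounded lam Wc Wq.
exists N; split=> // T i j k T0 /and5P[_ i0 j0 k0 /andP[/asboolP /HN[]]].
rewrite !ln_sqrt_ratio // !ler_norml => /andP[a1 a2] /andP[b1 b2] prod.
have [ip jp kp] : [/\ 0 < i%:R :> R, 0 < j%:R :> R & 0 < k%:R :> R] by rewrite !ltr0n.
have : ln i%:R + ln j%:R + ln k%:R <= 3 * ln T.
  have -> : 3 * ln T = ln (T ^+ 3) by rewrite lnXn // mulr_natl.
  rewrite -!lnM ?posrE ?mulr_gt0 // ler_ln ?posrE ?mulr_gt0 ?exprn_gt0 //.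
  by rewrite -!natrM.
have le_ln x : (0 < x)%N -> (ln x%:R <= 4 * N + ln T) -> x%:R <= expR (4 * N) * T :> R.
  move=> x0; rewrite -ler_expR expRD !lnK ?posrE ?ltr0n //.
by move=> s; split; apply: le_ln => //; lra.
Qed.

Lemma cone_countE B T : (forall i j k, cone_region T i j k -> [&& i < B, j < B & k < B]%N) ->
  cnt B (cone_region T) = cone_count T.
Proof.
move=> HB; pose C := maxn B (Num.truncn (T ^+ 3)).+1.
rewrite -(@cnt_widen B C) ?leq_maxl // /cone_count.
by apply: cnt_widen; [exact: leq_maxr|exact: cone_region_lt].
Qed.

(** A crude bound for the three upper ends together; summed over a list it gives one range [H T]
    valid for all boxes of the list. *)
Definition box_bound h (x : (int * int) * int) : R :=
  expR ((x.2 + 1)%:~R * (2 * h)) + expR ((x.2 - x.1.1 + 1)%:~R * (2 * h)) +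
  expR ((x.2 - x.1.2 + 1)%:~R * (2 * h)).

Lemma box_sum_cvg h (xs : seq ((int * int) * int)) (H : R) : 0 < h ->
  \sum_(x <- xs) box_bound h x <= H ->
  (\sum_(x <- xs) cnt (Num.truncn (H * T)).+1
     (fun i j k => cone_box h T x i j k && S i j k))%N%:R / T ^+ 3 @[T --> +oo] -->
  d * \sum_(x <- xs) cone_box_vol h x.
Proof.
move=> h0 HH.
have xsH x : x \in xs -> box_bound h x <= H.
  move=> xx; apply: le_trans HH; rewrite (big_rem x xx) /= lerDl.
  by apply: sumr_ge0 => y _; rewrite /box_bound !addr_ge0 ?expR_ge0.
have E T : (\sum_(x <- xs) cnt (Num.truncn (H * T)).+1
     (fun i j k => cone_box h T x i j k && S i j k))%N%:R / T ^+ 3 =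
  \sum_(x <- xs | x \in xs) (cnt (Num.truncn (H * T)).+1
     (fun i j k => cone_box h T x i j k && S i j k))%:R / T ^+ 3.
  by rewrite -big_seq natr_sum big_distrl.
under eq_cvg => T do rewrite E.
have -> : d * \sum_(x <- xs) cone_box_vol h x = \sum_(x <- xs | x \in xs) d * cone_box_vol h x.
  by rewrite -big_seq big_distrr.
apply: cvgr_sum => x /xsH; rewrite /box_bound => le1.
have := expR_ge0 ((x.2 + 1)%:~R * (2 * h) : R).
have := expR_ge0 ((x.2 - x.1.1 + 1)%:~R * (2 * h) : R).
have := expR_ge0 ((x.2 - x.1.2 + 1)%:~R * (2 * h) : R).
by move=> e1 e2 e3; apply: cone_box_cvg => //; lra.
Qed.

Lemma sum_disjoint_le (I : eqType) (s : seq I) (Q : pred I) (b : bool) : uniq s ->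
  (forall x y, x \in s -> y \in s -> Q x -> Q y -> x = y) ->
  (forall x, x \in s -> Q x -> b) -> (\sum_(x <- s) Q x <= b)%N.
Proof.
move=> us inj Qb; case: (boolP (has Q s)) => [/hasP[x xs Qx]|/hasPn nQ]; last first.
  by rewrite big_seq big1 // => x /nQ /negbTE ->.
rewrite (Qb x xs Qx) (big_rem x xs) /= Qx -[X in (_ <= X)%N]addn0 leq_add2l leqn0.
apply/eqP; rewrite big_seq big1 // => y; rewrite mem_rem_uniq // inE => /andP[yx ys].
by case: (boolP (Q y)) => // Qy; case/eqP: yx; exact: inj.
Qed.

(** Over an inner block, a box whose far corner obeys the bound on the product lies wholly in the
    region, and distinct boxes are disjoint. *)
Lemma cone_count_ge h (xs : seq ((int * int) * int)) (e : R) : 0 < h -> 0 < e -> uniq xs ->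
  (forall x, x \in xs -> inner lam h W x.1 /\ 3 * x.2 - x.1.1 - x.1.2 + 3 <= 0) ->
  \forall T \near +oo,
    d * (\sum_(x <- xs) cone_box_vol h x) - e <= (cone_count T)%:R / T ^+ 3.
Proof.
move=> h0 e0 us xsP; have [N [N0 HN]] := shape_log_bound.
pose H := \sum_(x <- xs) box_bound h x + expR (4 * N).
have HH : \sum_(x <- xs) box_bound h x <= H by rewrite lerDl expR_ge0.
have NH : expR (4 * N) <= H.
  by rewrite lerDr sumr_ge0 // => x _; rewrite /box_bound !addr_ge0 ?expR_ge0.
have /cvgrPdist_le/(_ _ e0) near1 := box_sum_cvg h0 HH.
apply: filter_app near1; near=> T.
have T0 : 0 < T by near: T; apply: nbhs_pinfty_gt; rewrite num_real.
rewrite ler_norml => /andP[_]; rewrite lerBlDl -lerBlDr => /le_trans; apply.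
rewrite ler_pM2r ?invr_gt0 ?exprn_gt0 // ler_nat.
rewrite -(@cone_countE (Num.truncn (H * T)).+1); last first.
  have lt i : i%:R <= expR (4 * N) * T -> (i < (Num.truncn (H * T)).+1)%N.
    move=> iN; rewrite -(ltr_nat R); apply: le_lt_trans (truncnS_gt _).
    by rewrite (le_trans iN) // ler_pM2r.
  by move=> i j k /(HN _ _ _ _ T0)[/lt -> /lt -> /lt ->].
apply: cnt_disjoint => i j k _ _ _; apply: sum_disjoint_le => //.
  move=> [[m n] a] [[m' n'] b] _ _ /andP[/and3P[/= a1 a2 a3] _] /andP[/and3P[/= b1 b2 b3] _].
  have e1 := logbox_inj h0 T0 a1 b1; have e2 := logbox_inj h0 T0 a2 b2.
  have e3 := logbox_inj h0 T0 a3 b3.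
  by move: e2 e3; rewrite e1 => /addrI/oppr_inj -> /addrI/oppr_inj ->.
move=> [[m n] a] /xsP /= [inn le0] /andP[/and3P[/= a1 a2 a3] Sijk].
have [i0 j0 k0] := And3 (logbox_gt0 T0 a1) (logbox_gt0 T0 a2) (logbox_gt0 T0 a3).
rewrite /cone_region Sijk i0 j0 k0 /=; apply/andP; split.
  apply/asboolP; apply: inn; split.
    by have := logbox_blk h0 T0 a1 a2; rewrite subKr.
  by have := logbox_blk h0 T0 a1 a3; rewrite subKr.
have [ip jp kp] : [/\ 0 < i%:R :> R, 0 < j%:R :> R & 0 < k%:R :> R] by rewrite !ltr0n.
rewrite !natrM -ler_ln ?posrE ?mulr_gt0 ?exprn_gt0 // lnXn // !lnM ?posrE ?mulr_gt0 //.
move: a1 a2 a3; rewrite !logboxP // => /andP[_ a1] /andP[_ a2] /andP[_ a3].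
have : (3 * a - m - n + 3)%:~R * (2 * h) <= 0 by rewrite mulr_le0_ge0 ?lerz0 // mulr_ge0 // ltW.
move: a1 a2 a3; rewrite !intrD !intrN !intrM -mulr_natl /=; move: (a%:~R) (m%:~R) (n%:~R) => x y z.
by move=> a1 a2 a3; lra.
Unshelve. all: by end_near. Qed.

(** The infinitely many low boxes are not listed. They lie in a cube of side [t T], and
    [t T + 1 <= 2 t T] for large [T] gives the term [8 t^3]. *)
Lemma cone_count_le h (xs : seq ((int * int) * int)) (e t : R) : 0 < h -> 0 < e -> 0 < t ->
  (forall T i j k, 0 < T -> cone_region T i j k -> has (fun x => cone_box h T x i j k) xs \/
     [/\ i%:R <= t * T, j%:R <= t * T & k%:R <= t * T]) ->
  \forall T \near +oo,
    (cone_count T)%:R / T ^+ 3 <= d * (\sum_(x <- xs) cone_box_vol h x) + e + 8 * t ^+ 3.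
Proof.
move=> h0 e0 t0 cov; have [N [N0 HN]] := shape_log_bound.
pose H := \sum_(x <- xs) box_bound h x + expR (4 * N) + t.
have sum0 : 0 <= \sum_(x <- xs) box_bound h x.
  by apply: sumr_ge0 => x _; rewrite /box_bound !addr_ge0 ?expR_ge0.
have E0 := expR_ge0 (4 * N).
have HH : \sum_(x <- xs) box_bound h x <= H by rewrite /H; lra.
have NH : expR (4 * N) <= H by rewrite /H; lra.
have tH : t <= H by rewrite /H; lra.
have /cvgrPdist_le/(_ _ e0) near1 := box_sum_cvg h0 HH.
apply: filter_app near1; near=> T.
have T0 : 0 < T by near: T; apply: nbhs_pinfty_gt; rewrite num_real.
have tT : 1 <= t * T.
  by rewrite mulrC -ler_pdivrMr //; near: T; apply: nbhs_pinfty_ge; rewrite num_real.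
have T3 : 0 < T ^+ 3 by rewrite exprn_gt0.
rewrite ler_norml => /andP[+ _]; rewrite lerBrDr addrC lerBlDr => le1.
set B := (Num.truncn (H * T)).+1 in le1.
have ltB i u : u <= H -> i%:R <= u * T -> (i < B)%N.
  move=> uH iN; rewrite -(ltr_nat R); apply: le_lt_trans (truncnS_gt _).
  by rewrite (le_trans iN) // ler_pM2r.
rewrite -(@cone_countE B); last first.
  by move=> i j k /(HN _ _ _ _ T0)[/(ltB _ _ NH) -> /(ltB _ _ NH) -> /(ltB _ _ NH) ->].
pose tail i j k := [&& in_itv_oc 0 (t * T) i, in_itv_oc 0 (t * T) j & in_itv_oc 0 (t * T) k].
have tailB : (cnt B tail)%:R <= 8 * t ^+ 3 * T ^+ 3.
  rewrite /tail (cnt_product B (in_itv_oc 0 (t * T)) (in_itv_oc 0 (t * T)) (in_itv_oc 0 (t * T))).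
  have b1 : (\sum_(i < B) in_itv_oc 0 (t * T) i)%N%:R <= 2 * (t * T).
    apply: le_trans (_ : t * T + 1 <= _); last by rewrite mulr2n mulrDl !mul1r lerD2l.
    have := @sum_dvd_bound R B 1 0 (t * T) isT (lexx 0) (le_trans ler01 tT).
    rewrite divr1; under eq_bigr => i _ do rewrite dvd1n andbT.
    by apply; apply: le_lt_trans (truncnS_gt _); rewrite ler_pM2r.
  rewrite !natrM; have -> : 8 * t ^+ 3 * T ^+ 3 = (2 * (t * T)) * (2 * (t * T)) * (2 * (t * T)) by ring.
  by apply: ler_pM => //; apply: ler_pM.
have : (cnt B (cone_region T) <= \sum_(x <- xs) cnt B (fun i j k => cone_box h T x i j k && S i j k)
    + cnt B tail)%N.
  have := @cnt_cover _ (None :: [seq Some x | x <- xs]) B (cone_region T)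
    (fun o i j k => if o is Some x then cone_box h T x i j k && S i j k else tail i j k).
  rewrite big_cons big_map addnC; apply => i j k _ _ _ rg /=.
  have /and5P[Sijk i0 j0 k0 _] := rg.
  have [/hasP[x xx bx]|[le_i le_j le_k]] := cov _ _ _ _ T0 rg.
    apply/orP; right; apply/hasP; exists (Some x); first exact: map_f.
    by rewrite bx Sijk.
  by rewrite /tail /in_itv_oc !ltr0n i0 j0 k0 le_i le_j le_k.
rewrite -(ler_nat R) natrD => le2.
rewrite ler_pdivrMr //; apply: (le_trans le2); rewrite mulrDl; apply: lerD => //.
by rewrite -ler_pdivrMr.
Unshelve. all: by end_near. Qed.

(** The top [L + 1] floors of the tower over each block. Volumes fall by [exp (- 6 h)] per floor, a
    factor [exp (- 2 h)] for each entry, so their sum is geometric. *)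
Definition box_list (f : int * int -> int) (L : nat) (s : seq (int * int)) :
    seq ((int * int) * int) := [seq (mn, f mn - l%:Z) | mn <- s, l <- iota 0 L.+1].

Lemma box_list_uniq (f : int * int -> int) L s : uniq s -> uniq (box_list f L s).
Proof.
move=> us; apply: allpairs_uniq => //; first exact: iota_uniq.
by move=> [a b] [a' b'] _ _ /= [-> /addrI/oppr_inj[->]].
Qed.

Lemma sum_geometric (y : R) L : y != 1 ->
  \sum_(l <- iota 0 L.+1) y ^+ l = (1 - y ^+ L.+1) / (1 - y).
Proof.
move=> y1; have y0 : 1 - y != 0 by rewrite subr_eq0 eq_sym.
apply: (canRL (mulfK y0)); rewrite -[in RHS](opprB _ 1) subrX1 -mulNr opprB mulrC.
by congr (_ * _); rewrite -[L.+1]subn0 -/(index_iota 0 _) big_mkord subn0.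
Qed.

Lemma box_list_vol h (f : int * int -> int) L s : 0 < h ->
  \sum_(x <- box_list f L s) cone_box_vol h x =
  (expR (2 * h) - 1) ^+ 3 * ((1 - expR (- (6 * h)) ^+ L.+1) / (1 - expR (- (6 * h)))) *
  \sum_(mn <- s) expR ((3 * f mn - mn.1 - mn.2)%:~R * (2 * h)).
Proof.
move=> h0; rewrite /box_list big_allpairs_dep big_distrr /=; apply: eq_bigr => mn _.
have y1 : expR (- (6 * h)) != 1 :> R by rewrite lt_eqF // expR_lt1 oppr_lt0 mulr_gt0.
rewrite -sum_geometric // big_distrr big_distrl /=; apply: eq_bigr => l _.
rewrite /cone_box_vol /= -mulrA; congr (_ * _); rewrite -expRM_natl -expRD; congr expR.
by rewrite !intrD !intrN !intrM intrB -mulr_natl; ring.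
Qed.

(** Volume of a complete infinite tower whose top box has a lower corner with coordinates of product
    1. *)
Definition vol_factor h : R := (expR (2 * h) - 1) ^+ 3 / (1 - expR (- (6 * h))).

Lemma vol_factor_gt0 h : 0 < h -> 0 < vol_factor h.
Proof.
move=> h0; rewrite /vol_factor divr_gt0 ?exprn_gt0 // subr_gt0 ?expR_gt1 ?expR_lt1.
  by rewrite mulr_gt0.
by rewrite oppr_lt0 mulr_gt0.
Qed.

Lemma cone_count_inner h (s : seq (int * int)) (e : R) : 0 < h -> 0 < e -> uniq s ->
  (forall mn, mn \in s -> inner lam h W mn) ->
  \forall T \near +oo,
    d * ((size s)%:R * (vol_factor h * expR (- (10 * h)))) - e <= (cone_count T)%:R / T ^+ 3.
Proof.
(* [i0] is the largest index whose far corner, of exponent [3 a - m - n + 3], still obeys the bound.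
   Rounding costs at most 2, so the lower corner has exponent at least -5; in units of [2 h] this is
   the loss [exp (- (10 * h))]. *)
move=> h0 e0 us sin; pose i0 (mn : int * int) := ((mn.1 + mn.2 - 3) %/ 3)%Z.
have i0P mn : -5 <= 3 * i0 mn - mn.1 - mn.2 <= -3.
  have := divz_eq (mn.1 + mn.2 - 3) 3; have := @modz_ge0 (mn.1 + mn.2 - 3) 3 isT.
  have := @ltz_pmod (mn.1 + mn.2 - 3) 3 isT; rewrite -/(i0 mn).
  by move: (i0 mn) (_ %% _)%Z => u v; lia.
set y := expR (- (6 * h)) : R.
have y01 : 0 <= y < 1 by rewrite expR_ge0 expR_lt1 oppr_lt0 mulr_gt0.
pose A := d * ((size s)%:R * (vol_factor h * expR (- (10 * h)))).
have V0 := ltW (vol_factor_gt0 h0).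
have A0 : 0 <= A by apply: mulr_ge0 => //; apply: mulr_ge0 => //; apply: mulr_ge0; rewrite ?expR_ge0.
have e20 : 0 < e / 2 by rewrite divr_gt0.
have [L HL] : exists L, A * y ^+ L.+1 <= e / 2.
  have : A * y ^+ L @[L --> \oo] --> A * 0.
    apply: cvgMl_tmp; apply: cvg_expr; case/andP: y01 => y0 y1.
    by rewrite ger0_norm.
  rewrite mulr0 => /cvgrPdist_le/(_ (e / 2) e20)[L _ HL].
  exists L; have := HL L.+1 (leqnSn L); rewrite sub0r normrN ger0_norm //.
  by rewrite mulr_ge0 // exprn_ge0; case/andP: y01.
have xsP x : x \in box_list i0 L s -> inner lam h W x.1 /\ 3 * x.2 - x.1.1 - x.1.2 + 3 <= 0.
  move=> /allpairsP[[mn l] [/= mns _ ->]] /=; split; first exact: sin.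
  by apply: box_index_le; have /andP[] := i0P mn.
apply: filterS (cone_count_ge h0 e20 (box_list_uniq i0 L us) xsP) => T; apply: le_trans.
rewrite box_list_vol // -/y.
have [y0 y1] := andP y01.
have yL : 0 <= y ^+ L.+1 by rewrite exprn_ge0.
have yL1 : 0 <= 1 - y ^+ L.+1 by rewrite subr_ge0 exprn_ile1 // ltW.
have le1 : (size s)%:R * expR (- (10 * h)) <=
    \sum_(mn <- s) expR ((3 * i0 mn - mn.1 - mn.2)%:~R * (2 * h)).
  have -> : (size s)%:R * expR (- (10 * h)) = \sum_(mn <- s) expR (- (10 * h)).
    by rewrite big_const_seq count_predT iter_addr_0 mulr_natl.
  apply: ler_sum => mn _; rewrite ler_expR.
  have /andP[+ _] := i0P mn; rewrite -(ler_int R) => H.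
  have -> : - (10 * h) = (-5)%:~R * (2 * h) by rewrite intrN; ring.
  by rewrite ler_pM2r // mulr_gt0.
have le2 : A * (1 - y ^+ L.+1) <= d * ((expR (2 * h) - 1) ^+ 3 * ((1 - y ^+ L.+1) / (1 - y)) *
    \sum_(mn <- s) expR ((3 * i0 mn - mn.1 - mn.2)%:~R * (2 * h))).
  have -> : A * (1 - y ^+ L.+1) = d * ((expR (2 * h) - 1) ^+ 3 * ((1 - y ^+ L.+1) / (1 - y)) *
    ((size s)%:R * expR (- (10 * h)))) by rewrite /A /vol_factor -/y; ring.
  rewrite ler_wpM2l // ler_wpM2l //; apply: mulr_ge0.
    by rewrite exprn_ge0 // subr_ge0 ltW // expR_gt1 mulr_gt0.
  by apply: divr_ge0 => //; rewrite subr_ge0 ltW.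
rewrite -/A; move: le2 HL; rewrite mulrBr mulr1.
by move: (A * _) (d * _) => u v; lra.
Qed.

Lemma cone_count_touches h (s : seq (int * int)) (e : R) : 0 < h -> 0 < e ->
  (forall mn, touches lam h W mn -> mn \in s) ->
  \forall T \near +oo,
    (cone_count T)%:R / T ^+ 3 <= d * ((size s)%:R * vol_factor h) + e.
Proof.
(* [i1] is the largest index whose lower corner has negative exponent, so no box above it meets the
   region. *)
move=> h0 e0 sm; pose i1 (mn : int * int) := ((mn.1 + mn.2 - 1) %/ 3)%Z.
have i1P mn : -3 <= 3 * i1 mn - mn.1 - mn.2 <= -1.
  have := divz_eq (mn.1 + mn.2 - 1) 3; have := @modz_ge0 (mn.1 + mn.2 - 1) 3 isT.
  have := @ltz_pmod (mn.1 + mn.2 - 1) 3 isT; rewrite -/(i1 mn).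
  by move: (i1 mn) (_ %% _)%Z => u v; lia.
have [K HK] : exists K : nat, forall mn, mn \in s -> `|mn.1| <= K%:Z /\ `|mn.2| <= K%:Z.
  exists (\sum_(mn <- s) (`|mn.1|%N + `|mn.2|%N))%N => mn mns.
  rewrite (big_rem mn mns) /= PoszD; split; first by lia.
  by lia.
have h2 : 0 < 2 * h by rewrite mulr_gt0.
set y := expR (- (6 * h)) : R.
have y01 : 0 <= y < 1 by rewrite expR_ge0 expR_lt1 oppr_lt0 mulr_gt0.
have [y0 y1] := andP y01.
pose t (L : nat) : R := expR ((2 * K%:Z - L%:Z)%:~R * (2 * h)).
have e20 : 0 < e / 2 by rewrite divr_gt0.
(* The leftover cube has side [exp ((2 K - L) 2 h)], whose third power is a constant times [y^L]. *)
have [L HL] : exists L, 8 * t L ^+ 3 <= e / 2.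
  pose A := 8 * expR ((2 * K%:Z)%:~R * (2 * h)) ^+ 3 : R.
  have : A * y ^+ L @[L --> \oo] --> A * 0.
    by apply: cvgMl_tmp; apply: cvg_expr; rewrite ger0_norm.
  rewrite mulr0 => /cvgrPdist_le/(_ (e / 2) e20)[L _ HL].
  exists L; have := HL L (leqnn L); rewrite sub0r normrN; apply: le_trans.
  apply: le_trans (ler_norm _); rewrite le_eqVlt; apply/orP; left; apply/eqP.
  rewrite /A /t -mulrA; congr (_ * _).
  rewrite -expRM_natl -expRM_natl -expRM_natl -expRD; congr expR.
  by rewrite intrB; ring.
have t0 : 0 < t L by exact: expR_gt0.
have cov T i j k : 0 < T -> cone_region T i j k ->
    has (fun x => cone_box h T x i j k) (box_list i1 L s) \/
     [/\ i%:R <= t L * T, j%:R <= t L * T & k%:R <= t L * T].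
  move=> T0 /and5P[_ i0 j0 k0 /andP[/asboolP Wijk prod]].
  have [a ai] := logbox_exists h0 T0 i0; have [b bj] := logbox_exists h0 T0 j0.
  have [c ck] := logbox_exists h0 T0 k0.
  pose mn := (a - b, a - c).
  have mns : mn \in s.
    apply: sm; exists (shape_pt i j k); split=> //.
    by split; [exact: logbox_blk bj|exact: logbox_blk ck].
  have abc : a + b + c <= -1.
    have [ip jp kp] : [/\ 0 < i%:R :> R, 0 < j%:R :> R & 0 < k%:R :> R] by rewrite !ltr0n.
    move: prod; rewrite !natrM -ler_ln ?posrE ?mulr_gt0 ?exprn_gt0 // lnXn // !lnM ?posrE ?mulr_gt0 //.
    move: (ai) (bj) (ck); rewrite !logboxP // => /andP[a1 _] /andP[b1 _] /andP[c1 _].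
    have -> : ln T *+ 3 = 3 * ln T by rewrite mulr_natl.
    move=> prod.
    have : (a + b + c)%:~R * (2 * h) < 0.
      move: a1 b1 c1; rewrite !intrD !mulrDl; move: (a%:~R * _) (b%:~R * _) (c%:~R * _) => u v w.
      by move=> a1 b1 c1; lra.
    by rewrite pmulr_llt0 // ltrz0 => /ltz_le_m1.
  have /andP[p1 p2] := i1P mn; have [k1 k2] := HK _ mns.
  have up u x : u + 1 <= 2 * K%:Z - L%:Z -> logbox h T u x -> x%:R <= t L * T.
    move=> ule /andP[_] /le_trans; apply; rewrite ler_pM2r // ler_expR ler_pM2r //.
    by rewrite ler_int.
  have [[l lL aE]|[ua ub uc]] := box_index_cases L abc p1 p2 k1 k2; last first.
    by right; split; [apply: up ai|apply: up bj|apply: up ck].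
  left; apply/hasP; exists (mn, a); last by rewrite /cone_box /= ai !subKr bj ck.
  apply/allpairsP; exists (mn, l); split; rewrite ?aE //.
  by rewrite mem_iota.
apply: filterS (cone_count_le h0 e20 t0 cov) => T /le_trans; apply.
rewrite box_list_vol // -/y.
have yL : 0 <= y ^+ L.+1 by rewrite exprn_ge0.
have yL1 : 0 <= 1 - y ^+ L.+1 by rewrite subr_ge0 exprn_ile1 // ltW.
have le1 : \sum_(mn <- s) expR ((3 * i1 mn - mn.1 - mn.2)%:~R * (2 * h)) <= (size s)%:R.
  have -> : (size s)%:R = \sum_(mn <- s) 1 :> R.
    by rewrite big_const_seq count_predT iter_addr_0.
  apply: ler_sum => mn _; rewrite expR_le1 pmulr_lle0 // lerz0.
  by have /andP[_ /le_trans] := i1P mn; apply.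
have E0 : 0 <= (expR (2 * h) - 1) ^+ 3 by rewrite exprn_ge0 // subr_ge0 ltW // expR_gt1.
have le2 : (expR (2 * h) - 1) ^+ 3 * ((1 - y ^+ L.+1) / (1 - y)) *
    \sum_(mn <- s) expR ((3 * i1 mn - mn.1 - mn.2)%:~R * (2 * h)) <= (size s)%:R * vol_factor h.
  rewrite [leRHS]mulrC; apply: ler_pM => //.
  - by rewrite mulr_ge0 ?divr_ge0 // subr_ge0 ltW.
  - by apply: sumr_ge0 => mn _; exact: expR_ge0.
  - rewrite /vol_factor -/y ler_wpM2l // ler_pdivrMr ?subr_gt0 // mulVf ?subr_eq0 ?gt_eqF //.
    by rewrite gerBl.
rewrite [X in _ <= _ + X]splitr addrA; apply: lerD => //.
by rewrite lerD2r ler_wpM2l.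
Qed.

Lemma touches_bounded h : 0 < h -> exists K : nat, forall mn, touches lam h W mn ->
  mn.1 \in ints K /\ mn.2 \in ints K.
Proof.
move=> h0; have [N [N0 HN]] := log_bounded lam Wc Wq.
exists (Num.truncn (N / h + 1)).+1.
have H m x : blk lam h m x -> `|ln x - ln lam| <= N -> m \in ints (Num.truncn (N / h + 1)).+1.
  move=> bx; have x0 := blk_gt0 lam0 bx; move/(blkP lam0 _ _ x0): bx => /andP[x1 x2].
  rewrite ler_norml => /andP[n1 n2]; apply: mem_ints.
  rewrite -(ler_int R) intr_norm; apply: le_trans (ltW (truncnS_gt _)).
  have e : N = N / h * h by rewrite mulfVK // gt_eqF.
  rewrite ler_norml; apply/andP; split; rewrite -(ler_pM2r h0).
    by move: e x1 x2 n1 n2; move: (m%:~R) (N / h) => u v; nra.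
  by move: e x1 x2 n1 n2; move: (m%:~R) (N / h) => u v; nra.
by move=> [m n] [p [[/H b1 /H b2] Wp]]; have [h1 h2] := HN _ Wp; split; auto.
Qed.

Lemma grid_partition h : 0 < h -> exists s_in s_st : seq (int * int),
  [/\ uniq (s_in ++ s_st), forall mn, mn \in s_in -> inner lam h W mn,
      forall mn, mn \in s_st -> straddles lam h W mn &
      forall mn, touches lam h W mn -> mn \in s_in ++ s_st].
Proof.
move=> h0; have [K HK] := touches_bounded h0.
pose s0 := [seq (m, n) | m <- ints K, n <- ints K].
have us0 : uniq s0 by apply: allpairs_uniq; rewrite ?ints_uniq // => -[? ?] [].
exists [seq mn <- s0 | `[< inner lam h W mn >]], [seq mn <- s0 | `[< straddles lam h W mn >]].
split.
- rewrite cat_uniq; apply/and3P; split; rewrite ?filter_uniq //; apply/hasPn => mn.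
  rewrite !mem_filter => /andP[/asboolP[_ nin] _]; rewrite negb_and; apply/orP; left.
  by apply/asboolP.
- by move=> mn; rewrite mem_filter => /andP[/asboolP].
- by move=> mn; rewrite mem_filter => /andP[/asboolP].
- move=> mn tm; have [m1 m2] := HK _ tm; rewrite mem_cat !mem_filter.
  have -> : mn \in s0 by case: (mn) m1 m2 => m n ? ?; exact: allpairs_f.
  rewrite !andbT; case: (pselect (inner lam h W mn)) => inn.
    by apply/orP; left; apply/asboolP.
  by apply/orP; right; apply/asboolP.
Qed.

Hypothesis mW : measurable W.
Hypothesis Wb : forall D : set (R * R), measurable D -> D `<=` W `&` closure (~` W) ->
  (@lebesgue_measure R \x @lebesgue_measure R)%E D = 0%E.

(** The grid with [h = 1] already covers [W] by finitely many cells of finite measure. *)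
Lemma mu_shape_fin : mu_shape W \is a fin_num.
Proof.
have [s_in [s_st [us _ _ ts]]] := grid_partition (@ltr01 R).
rewrite ge0_fin_numE; last by rewrite mu_shapeE //; apply: integral_ge0 => p _; rewrite lee_fin density_ge0.
by apply: le_lt_trans (mu_le_touches lam0 ltr01 mW Wq us ts) (ltry _).
Qed.

(** The volume of a complete tower divided by the lower estimate for the measure of a cell, in terms
    of [q = exp (- h)]. Its limit 4/3 is the Jacobian of passing from [(log x, log y, log ijk)] to
    the logarithms of the entries. *)
Definition upper_factor (q : R) : R := (1 + q) ^+ 2 / (q ^+ 6 * (1 + q ^+ 2 + q ^+ 4)).

Lemma vol_factorE h : 0 < h ->
  vol_factor h = (1 - expR (- h)) ^+ 2 * upper_factor (expR (- h)).
Proof.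
move=> h0; rewrite /vol_factor /upper_factor; set q := expR (- h).
have q0 : 0 < q by exact: expR_gt0.
have q1 : q < 1 by rewrite expR_lt1 oppr_lt0.
have -> : expR (- (6 * h)) = q ^+ 6 by rewrite -expRM_natl; congr expR; ring.
have -> : expR (2 * h) = q ^- 2.
  by rewrite -expRM_natl -expRN; congr expR; ring.
have e1 : 1 - q ^+ 6 = (1 - q ^+ 2) * (1 + q ^+ 2 + q ^+ 4) by ring.
have n1 : 1 - q ^+ 2 != 0.
  by rewrite subr_eq0 eq_sym lt_eqF // exprn_ilt1 // ltW.
have n2 : 1 + q ^+ 2 + q ^+ 4 != 0 by rewrite gt_eqF // !addr_gt0 ?exprn_gt0.
rewrite e1; field.
by rewrite n1 n2 gt_eqF.
Qed.

Lemma expR_mesh_cvg : expR (- mesh R n) @[n --> \oo] --> (1 : R).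
Proof.
rewrite -[X in _ --> X]expR0 -[X in expR X]oppr0.
apply: continuous_cvg; first exact: continuous_expR.
by apply: cvgN; exact: mesh_cvg.
Qed.

Lemma upper_factor_cvg : upper_factor (expR (- mesh R n)) @[n --> \oo] --> (4 / 3 : R).
Proof.
have -> : 4 / 3 = upper_factor 1 by rewrite /upper_factor !expr1n; field.
have c := expR_mesh_cvg.
have cX k : expR (- mesh R n) ^+ k @[n --> \oo] --> (1 ^+ k : R) by exact: cvgr_exp.
apply: cvgM.
  apply: cvgr_exp; apply: cvgD => //; exact: cvg_cst.
apply: cvgV; first by rewrite !expr1n mul1r gt_eqF // !addr_gt0.
apply: cvgM => //; apply: cvgD => //; apply: cvgD => //; exact: cvg_cst.
Qed.

(** Everything is compared with [mu]: inner cells give [a <= mu], touching blocks give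
    [mu q^2 <= b], and [b - a] is the weight of the straddling blocks alone, which is negligible. *)
Theorem cone_count_cvg :
  (cone_count T)%:R / T ^+ 3 @[T --> +oo] --> d * (4 / 3 * fine (mu_shape W)).
Proof.
set mu := fine (mu_shape W).
have muE : mu_shape W = mu%:E by rewrite fineK // mu_shape_fin.
have mu0 : 0 <= mu.
  by rewrite fine_ge0 // mu_shapeE //; apply: integral_ge0 => p _; rewrite lee_fin density_ge0.
apply/cvgrPdist_le => e e0.
have e4 : 0 < e / 4 by rewrite divr_gt0.
(* The weight allowed to straddling blocks: as the tower ratio is at most 2, they contribute at most
   [2 d eta <= e / 4]. *)
pose eta := e / (8 * (d + 1)).
have eta0 : 0 < eta by rewrite divr_gt0 // mulr_gt0 // ltr_wpDl.
have hic : d * (mu * upper_factor (expR (- mesh R n))) @[n --> \oo] --> d * (mu * (4 / 3)).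
  by apply: cvgMl_tmp; apply: cvgMl_tmp; exact: upper_factor_cvg.
have loc : d * (mu * (expR (- mesh R n) ^+ 12 * upper_factor (expR (- mesh R n)))) @[n --> \oo]
    --> d * (mu * (1 * (4 / 3))).
  apply: cvgMl_tmp; apply: cvgMl_tmp; apply: cvgM; last exact: upper_factor_cvg.
  by rewrite -[X in _ --> X](expr1n _ 12); apply: cvgr_exp; exact: expR_mesh_cvg.
rewrite mul1r in loc.
have /cvgrPdist_le/(_ _ e4) near1 := hic.
have /cvgrPdist_le/(_ _ e4) near2 := loc.
have two : (0 : R) < 2 - 4 / 3 by lra.
have /cvgrPdist_le/(_ _ two) near3 := upper_factor_cvg.
have near4 := straddles_cvg0 lam0 Wc Wq Wb eta0.
have [n [n1 n2 n3 n4]] : exists n, [/\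
  `|d * (mu * (4 / 3)) - d * (mu * upper_factor (expR (- mesh R n)))| <= e / 4,
  `|d * (mu * (4 / 3)) - d * (mu * (expR (- mesh R n) ^+ 12 * upper_factor (expR (- mesh R n))))|
     <= e / 4,
  upper_factor (expR (- mesh R n)) <= 2 &
  forall s : seq (int * int), uniq s ->
   (forall mn, mn \in s -> straddles lam (mesh R n) W mn) ->
  (size s)%:R * (1 - expR (- mesh R n)) ^+ 2 <= eta].
  have : \forall n \near \oo, [/\
    `|d * (mu * (4 / 3)) - d * (mu * upper_factor (expR (- mesh R n)))| <= e / 4,
    `|d * (mu * (4 / 3)) - d * (mu * (expR (- mesh R n) ^+ 12 * upper_factor (expR (- mesh R n))))|
     <= e / 4,
    upper_factor (expR (- mesh R n)) <= 2 &
    forall s : seq (int * int), uniq s ->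
     (forall mn, mn \in s -> straddles lam (mesh R n) W mn) ->
    (size s)%:R * (1 - expR (- mesh R n)) ^+ 2 <= eta].
    apply: filter_app near1; apply: filter_app near2; apply: filter_app near3.
    apply: filterS near4 => n a4 a3 a2 a1; split=> //.
    by move: a3; rewrite ler_norml => /andP[a3 _]; lra.
  by case=> N _ /(_ N (leqnn N)); exists N.
set h := mesh R n in n1 n2 n3 n4; have h0 : 0 < h by exact: mesh_gt0.
set q := expR (- h) in n1 n2 n3 n4; set K := upper_factor q in n1 n2 n3.
have q0 : 0 < q by exact: expR_gt0.
have q1 : q < 1 by rewrite expR_lt1 oppr_lt0.
have K0 : 0 < K.
  by rewrite /K /upper_factor divr_gt0 ?mulr_gt0 ?exprn_gt0 ?addr_gt0 ?exprn_gt0.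
have [s_in [s_st [us sin sst ts]]] := grid_partition h0.
have [us1 [_ us2]] : uniq s_in /\ ~~ has (mem s_in) s_st /\ uniq s_st.
  by move: us; rewrite cat_uniq => /and3P[].
pose a : R := (size s_in)%:R * (1 - q) ^+ 2; pose b : R := (size (s_in ++ s_st))%:R * (1 - q) ^+ 2.
have a_mu : a <= mu.
  by have := mu_ge_inner lam0 h0 mW Wq us1 sin; rewrite muE lee_fin.
have mu_b : mu * q ^+ 2 <= b.
  have := mu_le_touches lam0 h0 mW Wq us ts; rewrite muE lee_fin => le1.
  (* The factor [q^2] turns the upper estimate for the measure of a cell into the lower one. *)
  have eq : (expR h - 1) ^+ 2 * q ^+ 2 = (1 - q) ^+ 2.
    rewrite -exprMn mulrBl mul1r /q -expRD subrr expR0 -[in RHS]sqrrN opprB //.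
    by rewrite -[in LHS]sqrrN opprB.
  by rewrite /b -eq [leRHS]mulrA ler_pM2r ?exprn_gt0.
have b_a : b <= a + eta.
  by rewrite /b size_cat natrD mulrDl lerD2l; exact: n4.
have q10 : expR (- (10 * h)) = q ^+ 10 by rewrite /q -expRM_natl; congr expR; ring.
have up := cone_count_touches h0 e4 ts; have lo := cone_count_inner h0 e4 us1 sin.
apply: filter_app up; apply: filterS lo => T.
rewrite q10 vol_factorE // -/q -/K.
have -> : d * ((size s_in)%:R * ((1 - q) ^+ 2 * K * q ^+ 10)) = d * (a * (K * q ^+ 10)).
  by rewrite /a; ring.
have -> : d * ((size (s_in ++ s_st))%:R * ((1 - q) ^+ 2 * K)) = d * (b * K) by rewrite /b; ring.
set G := _ / _ => lo up.
have dK : d * (eta * K) <= e / 4.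
  apply: le_trans (_ : d * (eta * 2) <= _); first by rewrite !ler_wpM2l // ltW.
  have -> : e / 4 = (d + 1) * (eta * 2) by rewrite /eta; field; rewrite gt_eqF // ltr_wpDl.
  by rewrite ler_wpM2r // ?lerDl // mulr_ge0 // ltW.
have q10_1 : 0 < q ^+ 10 <= 1 by rewrite exprn_gt0 // exprn_ile1 // ltW.
have hi1 : d * (b * K) <= d * (mu * K) + e / 4.
  apply: le_trans (_ : d * ((mu + eta) * K) <= _); last by rewrite mulrDl mulrDr lerD2l.
  by rewrite ler_wpM2l // ler_wpM2r ?(ltW K0) // (le_trans b_a) // lerD2r.
have lo1 : d * (mu * (q ^+ 12 * K)) - e / 4 <= d * (a * (K * q ^+ 10)).
  rewrite lerBlDr; apply: le_trans (_ : d * ((a + eta) * (K * q ^+ 10)) <= _).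
    rewrite ler_wpM2l //; have -> : mu * (q ^+ 12 * K) = mu * q ^+ 2 * (K * q ^+ 10) by ring.
    have [x0 x1] := andP q10_1.
    by rewrite ler_wpM2r ?(le_trans mu_b) // mulr_ge0 // ltW.
  rewrite mulrDl mulrDr lerD2l; apply: le_trans dK.
  rewrite ler_wpM2l // ler_wpM2l ?(ltW eta0) // ler_piMr ?(ltW K0) //.
  by case/andP: q10_1.
have -> : d * (4 / 3 * mu) = d * (mu * (4 / 3)) by rewrite [mu * _]mulrC.
move: n1 n2 hi1 lo1 lo up; rewrite !ler_norml.
move: (d * (mu * (4 / 3))) (d * (mu * K)) (d * (mu * (q ^+ 12 * K))) (d * (b * K)) (d * (a * _)) => u1 u2 u3 u4 u5.
by move=> /andP[c1 c2] /andP[c3 c4] c5 c6 c7 c8; apply/andP; split; lra.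
Qed.

End ConeCount.

(** * Biquadratic fields *)

Section Biquadratic.
Implicit Types (K : splittingFieldType rat) (al be ga : int).

(** A symmetric presentation with [r], [s], [t] square roots of [be ga], [al ga], [al be]:
    permutations of the parameters are visible in it, and the last three relations tie the signs of
    the roots together. *)
Definition quad_rel (L : nzRingType) al be ga (r s t : L) : Prop :=
  [/\ r * r = (be * ga)%:~R, s * s = (al * ga)%:~R & t * t = (al * be)%:~R] /\
  [/\ s * t = al%:~R * r, r * t = be%:~R * s & r * s = ga%:~R * t].

(** The morphism [f] is left free so that one multiplication formula serves the field itself and its
    images in the complex numbers. *)
Definition lin4 (L : nzRingType) (f : rat -> L) (r s t : L) (a b c d : rat) : L :=
  f a + f b * r + f c * s + f d * t.

Lemma lin4M (L : comNzRingType) (f : {rmorphism rat -> L}) al be ga (r s t : L)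
    (a b c d a' b' c' d' : rat) : quad_rel al be ga r s t ->
  lin4 f r s t a b c d * lin4 f r s t a' b' c' d' =
  lin4 f r s t
    (a * a' + be%:~R * ga%:~R * b * b' + al%:~R * ga%:~R * c * c' + al%:~R * be%:~R * d * d')
    (a * b' + b * a' + al%:~R * (c * d' + d * c'))
    (a * c' + c * a' + be%:~R * (b * d' + d * b'))
    (a * d' + d * a' + ga%:~R * (b * c' + c * b')).
Proof.
move=> [[rr ss tt] [st rt rs]]; rewrite /lin4 !rmorphD !rmorphM !rmorphD !rmorphM /= !rmorph_int.
transitivity (f a * f a' + f b * f b' * (r * r) + f c * f c' * (s * s) + f d * f d' * (t * t) +
  (f a * f b' + f b * f a') * r + (f a * f c' + f c * f a') * s + (f a * f d' + f d * f a') * t +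
  (f c * f d' + f d * f c') * (s * t) + (f b * f d' + f d * f b') * (r * t) +
  (f b * f c' + f c * f b') * (r * s)); first by ring.
by rewrite rr ss tt st rt rs !intrM; ring.
Qed.

Lemma lin4D (L : comNzRingType) (f : {rmorphism rat -> L}) (r s t : L)
    (a b c d a' b' c' d' : rat) :
  lin4 f r s t a b c d + lin4 f r s t a' b' c' d' =
  lin4 f r s t (a + a') (b + b') (c + c') (d + d').
Proof. by rewrite /lin4 !rmorphD; ring. Qed.

Lemma lin4B (L : comNzRingType) (f : {rmorphism rat -> L}) (r s t : L)
    (a b c d a' b' c' d' : rat) :
  lin4 f r s t a b c d - lin4 f r s t a' b' c' d' =
  lin4 f r s t (a - a') (b - b') (c - c') (d - d').
Proof. by rewrite /lin4 !rmorphB; ring. Qed.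

Definition linK K := @lin4 K (GRing.in_alg K).

Record biquad K al be ga (r s t : K) : Prop := Biquad {
  biquad_rel : quad_rel al be ga r s t;
  biquad_span : forall x, exists a b c d, x = linK r s t a b c d;
  biquad_free : forall a b c d, linK r s t a b c d = 0 ->
    [/\ a = 0, b = 0, c = 0 & d = 0] }.

Lemma biquad_inj K al be ga (r s t : K) a b c d a' b' c' d' : biquad al be ga r s t ->
  linK r s t a b c d = linK r s t a' b' c' d' -> [/\ a = a', b = b', c = c' & d = d'].
Proof.
move=> [_ _ free] /eqP; rewrite -subr_eq0 /linK lin4B => /eqP /free[].
by move=> /eqP + /eqP + /eqP + /eqP; rewrite !subr_eq0 => /eqP -> /eqP -> /eqP -> /eqP ->.
Qed.

(** Coordinates in [1, r, s, t] are unique and products are governed by [quad_rel] alone, so every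
    solution of these relations receives a morphism. Sign changes yield automorphisms, a second
    field an isomorphism, complex square roots the embeddings. *)
Lemma biquad_morph K al be ga (r s t : K) (L : comNzRingType) (f : {rmorphism rat -> L})
    (r' s' t' : L) : biquad al be ga r s t -> quad_rel al be ga r' s' t' ->
  exists g : {rmorphism K -> L}, forall a b c d, g (linK r s t a b c d) = lin4 f r' s' t' a b c d.
Proof.
move=> bq rel'.
have [c Hc] : {c : K -> rat * rat * rat * rat &
    forall x, x = linK r s t (c x).1.1.1 (c x).1.1.2 (c x).1.2 (c x).2}.
  apply: (@choice _ _ (fun x (c : rat * rat * rat * rat) => x = linK r s t c.1.1.1 c.1.1.2 c.1.2 c.2)) => x; have [a [b [c [d ->]]]] := biquad_span bq x.
  by exists (a, b, c, d).
pose g x := lin4 f r' s' t' (c x).1.1.1 (c x).1.1.2 (c x).1.2 (c x).2.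
have gE a b e d : g (linK r s t a b e d) = lin4 f r' s' t' a b e d.
  rewrite /g; have := Hc (linK r s t a b e d).
  by case/(biquad_inj bq) => <- <- <- <-.
have ga' : zmod_morphism g.
  move=> x y; have [a [b [e [d ->]]]] := biquad_span bq x.
  have [a' [b' [e' [d' ->]]]] := biquad_span bq y.
  by rewrite [in LHS]/linK lin4B -/(linK r s t _ _ _ _) !gE lin4B.
have gm' : monoid_morphism g.
  split.
    have -> : 1 = linK r s t 1 0 0 0 :> K.
      by rewrite /linK /lin4 !rmorph0 !mul0r !addr0 rmorph1.
    by rewrite gE /lin4 !rmorph0 !mul0r !addr0 rmorph1.
  move=> x y; have [a [b [e [d ->]]]] := biquad_span bq x.
  have [a' [b' [e' [d' ->]]]] := biquad_span bq y.
  rewrite [in LHS]/linK (lin4M _ _ _ _ _ _ _ _ _ (biquad_rel bq)) -/(linK r s t _ _ _ _) !gE.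
  by rewrite (lin4M _ _ _ _ _ _ _ _ _ rel').
pose gaM := GRing.isZmodMorphism.Build _ _ g ga'.
pose gmM := GRing.isMonoidMorphism.Build _ _ g gm'.
pose gRM : {rmorphism K -> L} := HB.pack g gaM gmM.
by exists gRM.
Qed.

Lemma linK_gens K (r s t : K) :
  [/\ r = linK r s t 0 1 0 0, s = linK r s t 0 0 1 0 & t = linK r s t 0 0 0 1].
Proof.
by split; rewrite /linK /lin4 !rmorph0 !rmorph1 !mul0r !mul1r ?addr0 ?add0r.
Qed.

Lemma biquad_iso K (L : splittingFieldType rat) al be ga (r s t : K) (r' s' t' : L) :
  biquad al be ga r s t -> biquad al be ga r' s' t' -> field_iso K L.
Proof.
move=> bK bL.
have [g gE] := biquad_morph (GRing.in_alg L) bK (biquad_rel bL).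
have [h hE] := biquad_morph (GRing.in_alg K) bL (biquad_rel bK).
exists g; exists h => x.
  have [a [b [c [d ->]]]] := biquad_span bK x.
  by rewrite gE -/(linK r' s' t' _ _ _ _) hE.
have [a [b [c [d ->]]]] := biquad_span bL x.
by rewrite hE -/(linK r s t _ _ _ _) gE.
Qed.

(** With the two lemmas that follow: the three nontrivial sign changes compatible with the
    relations, one for each automorphism other than the identity. *)
Lemma quad_rel_negst (L : nzRingType) al be ga (r s t : L) :
  quad_rel al be ga r s t -> quad_rel al be ga r (- s) (- t).
Proof.
by move=> [[rr ss tt] [st rt rs]]; split; split; rewrite ?mulrNN ?mulrN ?rt ?rs.
Qed.

Lemma quad_rel_negrt (L : nzRingType) al be ga (r s t : L) :
  quad_rel al be ga r s t -> quad_rel al be ga (- r) s (- t).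
Proof.
by move=> [[rr ss tt] [st rt rs]]; split; split; rewrite ?mulrNN ?mulrN ?mulNr ?st ?rt ?rs ?mulrN.
Qed.

Lemma quad_rel_negrs (L : nzRingType) al be ga (r s t : L) :
  quad_rel al be ga r s t -> quad_rel al be ga (- r) (- s) t.
Proof.
by move=> [[rr ss tt] [st rt rs]]; split; split; rewrite ?mulrNN ?mulrN ?mulNr ?st ?rt ?rs ?mulrN.
Qed.

Lemma linK_scale K (r s t : K) a b c d :
  linK r s t a b c d = a *: 1 + b *: r + c *: s + d *: t.
Proof. by rewrite /linK /lin4 /= !mulr_algl. Qed.

Lemma biquad_basis K al be ga (r s t : K) : biquad al be ga r s t ->
  basis_of {:K} [tuple 1; r; s; t].
Proof.
move=> bq; apply/andP; split.
  apply/eqP/vspaceP => x; rewrite memvf.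
  have [a [b [c [d ->]]]] := biquad_span bq x; rewrite linK_scale.
  by rewrite !memvD // memvZ // memv_span // !inE eqxx ?orbT.
apply/freeP => k; rewrite !big_ord_recl big_ord0 /= addr0 !addrA.
rewrite -linK_scale => /(biquad_free bq)[k0 k1 k2 k3] i.
case: i => -[|[|[|[|//]]]] i4.
- by rewrite -[RHS]k0; congr k; apply/val_inj.
- by rewrite -[RHS]k1; congr k; apply/val_inj.
- by rewrite -[RHS]k2; congr k; apply/val_inj.
- by rewrite -[RHS]k3; congr k; apply/val_inj.
Qed.

Lemma biquad_dim K al be ga (r s t : K) : biquad al be ga r s t -> \dim {:K} = 4%N.
Proof. by move/biquad_basis/size_basis. Qed.

Lemma galois_rat K : galois 1 {:K}.
Proof.
apply/and3P; split; [exact: subvf| |exact: normalFieldf].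
apply/separableP => x _; apply: pcharf0_separable.
exact: ftrans (pchar_lalg _) (pchar_num _).
Qed.

Lemma gal_sqrt K (x : K) (q : rat) (g : gal_of {:K}) : x * x = q%:A ->
  g x = x \/ g x = - x.
Proof.
move=> xq; have gq : g x * g x = x * x.
  by rewrite -rmorphM xq /= rmorph_alg.
move/eqP: gq; rewrite -!expr2 eqf_sqr => /orP[/eqP|/eqP]; [left|right]; done.
Qed.

Lemma exists_gal_neg K (x : K) (q : rat) : x * x = q%:A -> x \notin 1%VS ->
  exists2 g : gal_of {:K}, g \in 'Gal({:K} / 1)%g & g x = - x.
Proof.
move=> xq x1; have /galois_fixedField E := galois_rat K.
have : ~~ (x \in fixedField 'Gal({:K} / 1)%g) by rewrite E.
move=> /(fixedFieldP (memvf x)) H; apply: contrapT => H'; apply: H => g gG.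
have [//|gx] := gal_sqrt g xq.
by case: H'; exists g.
Qed.

(** Some automorphism negates [x], and the trace is invariant under it. *)
Lemma galTrace_sqrt K (x : K) (q : rat) : x * x = q%:A -> x \notin 1%VS ->
  galTrace 1 {:K} x = 0.
Proof.
move=> xq x1; have [g gG gx] := exists_gal_neg xq x1.
have := @galTrace_gal _ _ 1%AS {:K}%AS x g (memvf x) gG.
rewrite gx raddfN /= => /eqP; rewrite eq_sym -addr_eq0 -mulr2n -mulr_natl mulf_eq0.
by rewrite -(rmorph_nat (GRing.in_alg K)) fmorph_eq0 pnatr_eq0 => /eqP.
Qed.

Lemma alg_linK K (r s t : K) k : k%:A = linK r s t k 0 0 0.
Proof. by rewrite linK_scale !scale0r !addr0. Qed.

Lemma biquad_notin1 K al be ga (r s t : K) : biquad al be ga r s t ->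
  [/\ r \notin 1%VS, s \notin 1%VS & t \notin 1%VS].
Proof.
move=> bq; have [rE sE tE] := linK_gens r s t.
split; apply/negP => /vlineP[k]; rewrite (alg_linK r s t).
- by rewrite {1}rE => /(biquad_inj bq)[_ /eqP]; rewrite oner_eq0.
- by rewrite {1}sE => /(biquad_inj bq)[_ _ /eqP]; rewrite oner_eq0.
- by rewrite {1}tE => /(biquad_inj bq)[_ _ _ /eqP]; rewrite oner_eq0.
Qed.

Lemma intr_alg K (n : int) : n%:~R = (n%:~R : rat)%:A :> K.
Proof. by rewrite -in_algE rmorph_int. Qed.

Lemma biquad_sq K al be ga (r s t : K) : biquad al be ga r s t ->
  [/\ r * r = ((be * ga)%:~R : rat)%:A, s * s = ((al * ga)%:~R : rat)%:A
    & t * t = ((al * be)%:~R : rat)%:A].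
Proof. by move=> [[[rr ss tt] _] _ _]; rewrite rr ss tt !intr_alg. Qed.

Lemma card_biquad_gal K al be ga (r s t : K) : biquad al be ga r s t ->
  #|'Gal({:K} / 1)%g| = 4%N.
Proof.
move=> bq; rewrite -(galois_dim (galois_rat K)) (biquad_dim bq) dimv1.
by rewrite divn1.
Qed.

Lemma galTrace_linK K al be ga (r s t : K) a b c d : biquad al be ga r s t ->
  galTrace 1 {:K} (linK r s t a b c d) = (4 * a)%:A.
Proof.
move=> bq; have [r1 s1 t1] := biquad_notin1 bq; have [rr ss tt] := biquad_sq bq.
have zero (x : K) (q e : rat) : x * x = q%:A -> x \notin 1%VS -> galTrace 1 {:K} (e%:A * x) = 0.
  move=> xq x1; have [->|e0] := eqVneq e 0; first by rewrite scale0r mul0r raddf0.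
  apply: (@galTrace_sqrt _ _ (e * e * q)).
    rewrite mulrACA xq -!in_algE -!rmorphM //.
  apply: contra x1; rewrite mulr_algl => /(memvZ e^-1).
  by rewrite scalerA mulVf // scale1r.
rewrite /linK /lin4 /= !raddfD /= (zero _ _ _ rr r1) (zero _ _ _ ss s1) (zero _ _ _ tt t1) !addr0.
rewrite /galTrace; under eq_bigr => g gG do rewrite rmorph_alg.
by rewrite sumr_const (card_biquad_gal bq) -scaler_nat scalerA.
Qed.

(** A group of order 4 in which every element squares to 1 is elementary abelian, and such groups
    are classified by their order. *)
Lemma biquad_V4 K al be ga (r s t : K) : biquad al be ga r s t -> V4_quartic K.
Proof.
move=> bq; split; [exact: biquad_dim bq|exact: galois_rat|].
have [rr ss tt] := biquad_sq bq.
have G4 := card_biquad_gal bq.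
have ab : (2.-abelem 'Gal({:K} / 1))%g.
  apply/abelemP => //; split; first by apply: (@card_p2group_abelian _ 2); rewrite ?G4.
  move=> g gG; apply/eqP/gal_eqP => x _; rewrite expgS expg1 galM ?memvf // gal_id.
  have gg (y : K) q : y * y = q%:A -> g (g y) = y.
    by move=> yq; have [e|e] := gal_sqrt g yq; rewrite !e // rmorphN /= e opprK.
  have [a [b [c [d ->]]]] := biquad_span bq x.
  rewrite /linK /lin4 !rmorphD !rmorphM /= !rmorph_alg.
  by rewrite (gg _ _ rr) (gg _ _ ss) (gg _ _ tt).
rewrite (isog_abelem_card _ ab) G4 cardsT card_prod !card_ord eqxx andbT.
apply/abelemP => //; split; first by apply: (@card_p2group_abelian _ 2); rewrite ?cardsT ?card_prod ?card_ord.
move=> [[[|[|//]] i] [[|[|//]] j]] _; apply/eqP; rewrite expgS expg1 //.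
Qed.

End Biquadratic.

(** * Squarefree parts of integers and rationals *)

Section SquarefreeParts.

(** A prime of [k] divides [m], for otherwise its square would divide [n]; induction then divides it
    out of both. *)
Lemma sqfree_dvd_sqr (n k m : nat) : sqfree n -> (0 < k)%N -> (k ^ 2 %| n * m ^ 2)%N -> (k %| m)%N.
Proof.
move=> /sqfreeP[n0 sq]; elim/ltn_ind: k m => k IH m k0 kd.
have [->|k1] := eqVneq k 1%N; first exact: dvd1n.
have kgt1 : (1 < k)%N by rewrite ltn_neqAle eq_sym k1.
pose p := pdiv k; have pp : prime p by exact: pdiv_prime.
have pk : (p %| k)%N by exact: pdiv_dvd.
have p0 : (0 < p)%N by exact: prime_gt0.
have pm : (p %| m)%N.
  have : (p ^ 2 %| n * m ^ 2)%N by apply: dvdn_trans kd; rewrite dvdn_exp2r.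
  apply: contraLR => npm; rewrite Gauss_dvdl; first exact: sq.
  by rewrite coprime_pexpl // coprime_pexpr // prime_coprime.
have [k' kE] := dvdnP pk; have [m' mE] := dvdnP pm.
have k'0 : (0 < k')%N by move: k0; rewrite kE muln_gt0 => /andP[].
rewrite kE mE dvdn_pmul2r //; apply: IH => //.
  by rewrite kE ltn_Pmulr // prime_gt1.
move: kd; rewrite kE mE !expnMn mulnA dvdn_pmul2r // expn_gt0 p0 //.
Qed.

Lemma sqfree_part (n : nat) : (0 < n)%N -> exists k a, [/\ (0 < k)%N, sqfree a & n = (k ^ 2 * a)%N].
Proof.
elim/ltn_ind: n => n IH n0; case: (boolP (sqfree n)) => [sq|/sqfreeP nsq].
  by exists 1%N, n; rewrite mul1n.
have [p pp pn] : exists2 p, prime p & (p ^ 2 %| n)%N.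
  by apply: contrapT => H; apply: nsq; split=> // p pp; apply/negP => pn; apply: H; exists p.
have [m mE] := dvdnP pn.
have m0 : (0 < m)%N by move: n0; rewrite mE muln_gt0 => /andP[].
have mn : (m < n)%N.
  by rewrite mE -{1}[m]muln1 ltn_pmul2l // -{1}(exp1n 2) ltn_exp2r // prime_gt1.
have [k [a [k0 sa mk]]] := IH m mn m0.
exists (k * p)%N, a; rewrite muln_gt0 k0 prime_gt0 //; split=> //.
by rewrite mE mk expnMn mulnAC.
Qed.

Lemma sqfree_part_rat (q : rat) : q != 0 -> exists (m : rat) (a : int),
  [/\ m != 0, sqfree `|a|%N & q = m ^+ 2 * a%:~R].
Proof.
move=> q0; have [n0 d0] : (numq q != 0) /\ (denq q != 0) by rewrite numq_eq0 denq_eq0.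
have nd0 : (0 < `|(numq q * denq q)%R|)%N by rewrite absz_gt0 mulf_neq0.
have [k [a [k0 sa E]]] := sqfree_part nd0.
(* Since [num / den = num den / den^2], the squarefree part is that of [num den], with its sign. *)
exists (k%:R / (denq q)%:~R), (sgz (numq q * denq q) * a%:Z); split.
- by rewrite mulf_neq0 ?invr_eq0 ?intr_eq0 // pnatr_eq0 -lt0n.
- by rewrite abszM absz_sg mulf_neq0 // mul1n.
have ndE : numq q * denq q = sgz (numq q * denq q) * (k ^ 2 * a)%N%:Z.
  by rewrite -E -{1}(intEsg (numq q * denq q)).
rewrite -{1}(divq_num_den q).
have -> : (numq q)%:~R / (denq q)%:~R = (numq q * denq q)%:~R / (denq q)%:~R ^+ 2 :> rat.
  by rewrite intrM; field; rewrite intr_eq0.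
rewrite {1}ndE; move: (sgz _) => e; rewrite !intrM PoszM intrM -!pmulrn natrX; field.
by rewrite intr_eq0.
Qed.

Lemma sqfree_mul_coprime (a b g : nat) : sqfree (b * g) -> sqfree (a * g) -> coprime a b ->
  sqfree (a * b * g).
Proof.
move=> /sqfreeP[bg0 sbg] /sqfreeP[ag0 sag] cab; apply/sqfreeP; split.
  by move: bg0 ag0; rewrite !muln_gt0 => /andP[-> ->] /andP[->].
move=> p pp; apply/negP => /(prime_square_dvd3 pp) /hasP[m].
have mul x y : (p %| x)%N -> (p %| y)%N -> (p ^ 2 %| x * y)%N.
  by move=> px py; rewrite expnS expn1 dvdn_mul.
rewrite !inE => /or4P[/eqP->|/eqP->|/eqP->|/or3P[/eqP->|/eqP->|/eqP->]] /and3P[/= d1 d2 d3].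
- by have := sag p pp; rewrite dvdn_mulr.
- by have := sbg p pp; rewrite dvdn_mulr.
- by have := sag p pp; rewrite dvdn_mull.
- have : (p %| gcdn a b)%N by rewrite dvdn_gcd d1 d2.
  by move: cab; rewrite /coprime => /eqP ->; rewrite dvdn1 => /eqP p1; rewrite p1 in pp.
- by have := sag p pp; rewrite mul.
- by have := sbg p pp; rewrite mul.
Qed.

Lemma sqfreeMl (a b : nat) : sqfree (a * b) -> sqfree a.
Proof.
move=> /sqfreeP[ab0 sq]; apply/sqfreeP; split; first by move: ab0; rewrite muln_gt0 => /andP[].
by move=> p /sq; apply: contra => /dvdn_trans; apply; rewrite dvdn_mulr.
Qed.

Lemma sqfree_sqr_rat (a : int) (q : rat) : sqfree `|a|%N -> a%:~R = q ^+ 2 -> a = 1.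
Proof.
move=> /sqfreeP[a0 sq] aq.
have dn0 : (denq q)%:~R != 0 :> rat by rewrite intr_eq0 denq_eq0.
have E : a * denq q ^+ 2 = numq q ^+ 2.
  apply/eqP; rewrite -(eqr_int rat) intrM !rmorphXn /= aq -{1}(divq_num_den q).
  by apply/eqP; field.
have En : (`|a| * `|denq q| ^ 2 = `|numq q| ^ 2)%N by rewrite -!abszX -abszM E.
have d1 : `|denq q|%N = 1%N.
  have : (`|denq q| ^ 2 %| `|numq q| ^ 2)%N by rewrite -En dvdn_mull.
  rewrite dvdn_pexp2r // => dn; have := coprime_num_den q.
  by rewrite /coprime => /eqP g1; apply/eqP; rewrite -dvdn1 -g1 dvdn_gcd dn dvdnn.
rewrite d1 exp1n muln1 in En.
have n1 : `|numq q|%N = 1%N.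
  apply/eqP; apply: contraT => n1.
  have n2 : (1 < `|numq q|)%N.
    rewrite ltn_neqAle eq_sym n1 /= lt0n; apply: contraTneq a0 => n0.
    by rewrite En n0.
  have := sq _ (pdiv_prime n2).
  by rewrite En dvdn_exp2r // pdiv_dvd.
have a_ge0 : 0 <= a by rewrite -(ler0z rat) aq sqr_ge0.
by rewrite -(gez0_abs a_ge0) En n1.
Qed.

(** Uniqueness of the squarefree part. With [q] in lowest terms, numerator and denominator divide
    each other by [sqfree_dvd_sqr], so [q^2 = 1]. *)
Lemma sqfree_ratio_sqr (a b : int) (q : rat) : sqfree `|a|%N -> sqfree `|b|%N ->
  a%:~R = q ^+ 2 * b%:~R -> a = b.
Proof.
move=> sa sb aq.
have [a0 b0] : a != 0 /\ b != 0.
  by move: sa sb => /sqfreeP[+ _] /sqfreeP[+ _]; rewrite !absz_gt0.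
have E : a * denq q ^+ 2 = numq q ^+ 2 * b.
  apply/eqP; rewrite -(eqr_int rat) !intrM aq -{1}(divq_num_den q).
  by apply/eqP; field; rewrite intr_eq0 denq_eq0.
have En : (`|a| * `|denq q| ^ 2 = `|b| * `|numq q| ^ 2)%N.
  by rewrite -!abszX -abszM E abszM mulnC.
have q0 : q != 0.
  by apply: contraNneq a0 => q0; move/eqP: aq; rewrite q0 expr0n mul0r intr_eq0.
have n0 : (0 < `|numq q|)%N by rewrite absz_gt0 numq_eq0.
have d0 : (0 < `|denq q|)%N by rewrite absz_gt0 denq_eq0.
have c := coprime_num_den q.
have n1 : `|numq q|%N = 1%N.
  have dv : (`|numq q| %| `|denq q|)%N.
    by apply: (sqfree_dvd_sqr sa n0); rewrite En dvdn_mull.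
  by move: c; rewrite /coprime => /eqP <-; apply/esym/gcdn_idPl.
have d1 : `|denq q|%N = 1%N.
  have dv : (`|denq q| %| `|numq q|)%N.
    by apply: (sqfree_dvd_sqr sb d0); rewrite -En dvdn_mull.
  by move: c; rewrite /coprime => /eqP <-; apply/esym/gcdn_idPr.
have sq1 (x : int) : `|x|%N = 1%N -> x ^+ 2 = 1.
  by move=> x1; rewrite -(gez0_abs (sqr_ge0 x)) abszX x1.
by move: E; rewrite (sq1 _ n1) (sq1 _ d1) mulr1 mul1r.
Qed.

End SquarefreeParts.

(** * Generators of a V4-quartic field *)

Section V4Fields.
Implicit Types (K : splittingFieldType rat) (al be ga : int).

(** A transposition and a 3-cycle, which generate all permutations of the three parameters. *)
Lemma biquad_perm K al be ga (r s t : K) : biquad al be ga r s t ->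
  biquad be al ga s r t /\ biquad be ga al s t r.
Proof.
move=> [[[rr ss tt] [st rt rs]] span free]; split; split.
- by split; split; rewrite ?rr ?ss ?tt // 1?mulrC ?rs // [be * al]mulrC.
- move=> x; have [a [b [c [d ->]]]] := span x; exists a, c, b, d.
  by rewrite /linK /lin4; ring.
- move=> a b c d; have -> : linK s r t a b c d = linK r s t a c b d by rewrite /linK /lin4; ring.
  by move=> /free[-> -> -> ->].
- by split; split; rewrite ?rr ?ss ?tt ?st // 1?mulrC ?rt ?rs // 1?mulrC.
- move=> x; have [a [b [c [d ->]]]] := span x; exists a, c, d, b.
  by rewrite /linK /lin4; ring.
- move=> a b c d; rewrite /linK /lin4.
  have -> : GRing.in_alg K a + GRing.in_alg K b * s + GRing.in_alg K c * t + GRing.in_alg K d * r =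
    linK r s t a d b c by rewrite /linK /lin4; ring.
  by move=> /free[-> -> -> ->].
Qed.

(** In [quad_rel] the parameters occur in pairs, or singly next to one generator on one side and two
    on the other, so all signs cancel. *)
Lemma biquad_opp K al be ga (r s t : K) : biquad al be ga r s t ->
  biquad (- al) (- be) (- ga) (- r) (- s) (- t).
Proof.
move=> [[[rr ss tt] [st rt rs]] span free]; split.
- by split; split; rewrite !mulrNN ?st ?rt ?rs ?intrN ?mulrNN.
- move=> x; have [a [b [c [d ->]]]] := span x; exists a, (- b), (- c), (- d).
  by rewrite /linK /lin4 !rmorphN !mulrNN.
- move=> a b c d.
  have -> : linK (- r) (- s) (- t) a b c d = linK r s t a (- b) (- c) (- d).
    by rewrite /linK /lin4 !rmorphN !mulNr !mulrN.
  by move=> /free[-> /eqP + /eqP + /eqP]; rewrite !oppr_eq0 => /eqP -> /eqP -> /eqP ->.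
Qed.

(** For commuting involutions [u] and [v], with [v] outside the group of [u], some [y] is fixed by
    [u] and moved by [v]; then [y - v y] is fixed by [u] and negated by [v]. The two orders of the
    involutions give [r] and [s]. *)
Lemma V4_eigenvectors K : V4_quartic K -> exists (r s : K) (q1 q2 : rat) (g h : gal_of {:K}),
  [/\ r != 0, s != 0, r * r = q1%:A & s * s = q2%:A] /\
  [/\ g r = r, h r = - r, g s = - s & h s = s].
Proof.
move=> [dim4 gal0 iso].
have ab : (2.-abelem 'Gal({:K} / 1))%g.
  rewrite (isog_abelem iso); apply/abelemP => //; split.
    by apply: (@card_p2group_abelian _ 2); rewrite ?cardsT ?card_prod ?card_ord.
  by move=> [[[|[|//]] i] [[|[|//]] j]] _; apply/eqP; rewrite expgS expg1.
have G4 : #|'Gal({:K} / 1)%g| = 4%N.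
  by rewrite -(galois_dim gal0) dim4 dimv1 divn1.
have /abelemP[//|abG exp2] := ab.
have [g gG g1] : exists2 g, g \in 'Gal({:K} / 1)%g & g != 1%g.
  by apply/trivgPn; rewrite -cardG_gt1 G4.
have og : #[g]%g = 2%N.
  by apply: (@nt_prime_order _ 2) => //; exact: exp2.
have sg : <[g]>%g \subset 'Gal({:K} / 1)%g by rewrite cycle_subG.
have [h hG hg] : exists2 h, h \in 'Gal({:K} / 1)%g & h \notin <[g]>%g.
  apply/subsetPn; apply/negP => /subset_leq_card; rewrite G4 -orderE og //.
have oh : #[h]%g = 2%N.
  apply: (@nt_prime_order _ 2) => //; first exact: exp2.
  by apply: contraNneq hg => ->; rewrite group1.
have gh : g \notin <[h]>%g.
  apply: contra hg => gh; have -> : (<[g]> = <[h]>)%g.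
    by apply/eqP; rewrite eqEcard cycle_subG gh -!orderE og oh.
  exact: cycle_id.
have comm : (g * h = h * g)%g by exact: (centsP abG).
have cgal (u v : gal_of {:K}) (x : K) : (u * v)%g x = v (u x) by rewrite galM ?memvf.
have gsq (u : gal_of {:K}) : u \in 'Gal({:K} / 1)%g -> forall x, u (u x) = x.
  by move=> uG x; rewrite -cgal -expg2 exp2 // gal_id.
have fixgh (x : K) : g x = x -> h x = x -> exists q : rat, x = q%:A.
  move=> gx hx; apply/vlineP; have /galois_fixedField <- := gal0.
  (* The subgroup generated by [g] and [h] has order dividing 4 and greater than 2. *)
  have -> : 'Gal({:K} / 1)%g = <<[set g; h]%SET>>%g.
    apply/eqP; rewrite eq_sym eqEcard gen_subG finset.subUset !finset.sub1set gG hG /= G4.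
    have p1 : <[g]>%g \proper <<[set g; h]%SET>>%g.
      apply/properP; split; first by rewrite cycle_subG mem_gen // !inE eqxx.
      by exists h => //; rewrite mem_gen // !inE eqxx orbT.
    have := proper_card p1; rewrite -orderE og.
    have : (#|<<[set g; h]%SET>>%g| %| 4)%N.
      by rewrite -G4 cardSg // gen_subG finset.subUset !finset.sub1set gG.
    by case: #|_| => [|[|[|[|[|n]]]]].
  rewrite -gal_generated; have := fixedField_galois [set g; h]%SET.
  move=> /galois_fixedField ->; apply/fixedFieldP; first exact: memvf.
  by move=> u; rewrite !inE => /orP[/eqP ->|/eqP ->].
have eigen (u v : gal_of {:K}) : u \in 'Gal({:K} / 1)%g -> v \in 'Gal({:K} / 1)%g ->
    v \notin <[u]>%g -> (u * v = v * u)%g -> exists x : K, [/\ x != 0, u x = x & v x = - x].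
  move=> uG vG vu uv.
  have [y uy vy] : exists2 y : K, u y = y & v y != y.
    apply: contrapT => H; move/negP: vu; apply.
    rewrite -(gal_fixedField <[u]>%G) gal_kHom ?subvf //; apply/kAHomP => y.
    move=> /mem_fixedFieldP[_ fy]; apply: contrapT => vy; apply: H; exists y; last exact/eqP.
    by apply: fy; rewrite cycle_id.
  exists (y - v y); split; first by rewrite subr_eq0 eq_sym.
    by rewrite rmorphB /= uy -cgal -uv cgal uy.
  by rewrite rmorphB /= gsq // opprB.
have [r [r0 gr hr]] := eigen g h gG hG hg comm.
have [s [s0 hs gs]] := eigen h g hG gG gh (esym comm).
have [q1 q1E] := fixgh (r * r) ltac:(by rewrite rmorphM /= gr) ltac:(by rewrite rmorphM /= hr mulrNN).
have [q2 q2E] := fixgh (s * s) ltac:(by rewrite rmorphM /= gs mulrNN) ltac:(by rewrite rmorphM /= hs).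
by exists r, s, q1, q2, g, h.
Qed.

Lemma V4_biquad K : V4_quartic K -> exists al be ga (r s t : K),
  sqfree `|(al * be * ga)%R|%N /\ biquad al be ga r s t.
Proof.
move=> V4; have [dim4 _ _] := V4.
have [r0 [s0 [q1 [q2 [g [h [[r0n s0n rr0 ss0] [gr hr gs hs]]]]]]]] := V4_eigenvectors V4.
have algn0 (q : rat) (x : K) : x != 0 -> x * x = q%:A -> q != 0.
  move=> x0 xq; apply: contraNneq x0 => q0; move/eqP: xq.
  by rewrite q0 scale0r mulf_eq0 orbb.
have [m [b [m0 sb q1E]]] := sqfree_part_rat (algn0 _ _ r0n rr0).
have [n [a [n0 sa q2E]]] := sqfree_part_rat (algn0 _ _ s0n ss0).
have [b0 a0] : b != 0 /\ a != 0.
  by move: sa sb => /sqfreeP[+ _] /sqfreeP[+ _]; rewrite !absz_gt0.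
(* [b] and [a] are the squarefree radicands for [r] and [s]. Dividing out their gcd leaves coprime
   cofactors, so the product of the three parameters is squarefree. *)
pose ga : int := gcdz a b.
have ga0 : ga != 0 by rewrite /ga gcdz_eq0 negb_and a0.
have [al alE] := dvdzP (dvdz_gcdl a b); have [be beE] := dvdzP (dvdz_gcdr a b).
rewrite -/ga in alE beE.
have sq : sqfree `|(al * be * ga)%R|%N.
  rewrite !abszM; apply: sqfree_mul_coprime; rewrite -?abszM -?beE -?alE //.
  have : (gcdn `|al| `|be| * `|ga| = `|ga|)%N by rewrite muln_gcdl -!abszM -alE -beE.
  by rewrite -[X in _ = X]mul1n => /eqP; rewrite eqn_pmul2r ?absz_gt0.
pose r := (m^-1)%:A * r0; pose s := (n^-1)%:A * s0; pose t := (ga%:~R)^-1 * (r * s).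
have gaK : ga%:~R != 0 :> K by rewrite intr_alg -in_algE fmorph_eq0 intr_eq0.
have sqE (x : K) q k c : x * x = q%:A -> q = k ^+ 2 * c%:~R -> k != 0 ->
    ((k^-1)%:A * x) * ((k^-1)%:A * x) = c%:~R.
  move=> xq qE k0; rewrite mulrACA xq -!in_algE -!rmorphM qE intr_alg /=; congr (_ %:A).
  by field.
have rr : r * r = (be * ga)%:~R by rewrite -beE; exact: sqE rr0 q1E m0.
have ss : s * s = (al * ga)%:~R by rewrite -alE; exact: sqE ss0 q2E n0.
exists al, be, ga, r, s, t; split=> //.
have rel : quad_rel al be ga r s t.
  split; split=> //.
  - have -> : t * t = ga%:~R^-1 * ga%:~R^-1 * ((r * r) * (s * s)) by rewrite /t; ring.
    by rewrite rr ss !intrM; field.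
  - have -> : s * t = ga%:~R^-1 * (s * s) * r by rewrite /t; ring.
    by rewrite ss intrM; field.
  - have -> : r * t = ga%:~R^-1 * (r * r) * s by rewrite /t; ring.
    by rewrite rr intrM; field.
  - by rewrite /t mulVKf.
have [r_n0 s_n0] : r != 0 /\ s != 0.
  by rewrite !mulf_neq0 // -in_algE fmorph_eq0 invr_eq0.
have t_n0 : t != 0 by apply: mulf_neq0; [rewrite invr_eq0|exact: mulf_neq0].
have gA (u : gal_of {:K}) q x : u (q%:A * x) = q%:A * u x by rewrite rmorphM /= rmorph_alg.
have ginv (u : gal_of {:K}) : u (ga%:~R^-1) = ga%:~R^-1 by rewrite fmorphV rmorph_int.
have [gr' hr' gs' hs'] : [/\ g r = r, h r = - r, g s = - s & h s = s].
  by rewrite /r /s !gA gr hr gs hs !mulrN.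
have gt' : g t = - t by rewrite /t rmorphM /= ginv (rmorphM g r s) /= gr' gs' !mulrN.
have ht' : h t = - t by rewrite /t rmorphM /= ginv (rmorphM h r s) /= hr' hs' mulNr mulrN.
clearbody t; clearbody r s.
(* Applying [1], [g], [h] and [g h] to a linear relation gives four sign patterns, and signed sums
   of these isolate each term. *)
have free_ (x y z w : rat) : linK r s t x y z w = 0 -> [/\ x = 0, y = 0, z = 0 & w = 0].
  move=> E; pose X : K := x%:A; pose Y : K := y%:A * r; pose Z : K := z%:A * s; pose V : K := w%:A * t.
  have E0 : X + Y + Z + V = 0 by exact: E.
  have E1 : X + Y - Z - V = 0.
    have := congr1 g E0; rewrite !rmorphD /= /X /Y /Z /V rmorph_alg !gA gr' gs' gt' rmorph0.
    by rewrite !mulrN.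
  have E2 : X - Y + Z - V = 0.
    have := congr1 h E0; rewrite !rmorphD /= /X /Y /Z /V rmorph_alg !gA hr' hs' ht' rmorph0.
    by rewrite !mulrN.
  have E3 : X - Y - Z + V = 0.
    have := congr1 h E1; rewrite !rmorphD !rmorphN /= /X /Y /Z /V rmorph_alg !gA hr' hs' ht' rmorph0.
    by rewrite !mulrN !opprK.
  have four : 4%:R != 0 :> K by rewrite -(rmorph_nat (GRing.in_alg K)) fmorph_eq0 pnatr_eq0.
  have kill (S u : K) : S = 4%:R * u -> S = 0 -> u = 0.
    by move=> -> /eqP; rewrite mulf_eq0 (negbTE four) => /eqP.
  have X0 : X = 0 by apply: (kill ((X + Y + Z + V) + (X + Y - Z - V) + (X - Y + Z - V) + (X - Y - Z + V))); [ring|rewrite E0 E1 E2 E3 !addr0].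
  have Y0 : Y = 0 by apply: (kill ((X + Y + Z + V) + (X + Y - Z - V) - (X - Y + Z - V) - (X - Y - Z + V))); [ring|rewrite E0 E1 E2 E3 !subr0 addr0].
  have Z0 : Z = 0 by apply: (kill ((X + Y + Z + V) - (X + Y - Z - V) + (X - Y + Z - V) - (X - Y - Z + V))); [ring|rewrite E0 E1 E2 E3 !subr0 addr0].
  have V0 : V = 0 by apply: (kill ((X + Y + Z + V) - (X + Y - Z - V) - (X - Y + Z - V) + (X - Y - Z + V))); [ring|rewrite E0 E1 E2 E3 !subr0 addr0].
  have alg0 (q : rat) : q%:A = 0 :> K -> q = 0.
    by move/eqP; rewrite -in_algE fmorph_eq0 => /eqP.
  have alg0' (q : rat) (v : K) : v != 0 -> q%:A * v = 0 -> q = 0.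
    by move=> v0 /eqP; rewrite mulf_eq0 (negbTE v0) orbF => /eqP/alg0.
  by split; [exact: alg0 X0|exact: alg0' r_n0 Y0|exact: alg0' s_n0 Z0|exact: alg0' t_n0 V0].
split=> // x.
have fr : free [tuple 1; r; s; t].
  apply/freeP => k; rewrite !big_ord_recl big_ord0 /= addr0 !addrA.
  rewrite -linK_scale => /free_[k0 k1 k2 k3] i.
  case: i => -[|[|[|[|//]]]] i4.
  - by rewrite -[RHS]k0; congr k; apply/val_inj.
  - by rewrite -[RHS]k1; congr k; apply/val_inj.
  - by rewrite -[RHS]k2; congr k; apply/val_inj.
  - by rewrite -[RHS]k3; congr k; apply/val_inj.
have bas : basis_of {:K} [tuple 1; r; s; t].
  by rewrite basisEfree fr subvf dim4.
rewrite (coord_basis bas (memvf x)) !big_ord_recl big_ord0 /= addr0 !addrA.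
by eexists; eexists; eexists; eexists; rewrite linK_scale.
Qed.

(** Every automorphism sends [z] to [z] or [- z], so a single coordinate of [z] survives, and the
    squarefree radicand is then determined. This is how isomorphic fields are matched: through the
    radicands of their quadratic subfields. *)
Lemma biquad_sqrt K al be ga (r s t z : K) (d : int) : sqfree `|(al * be * ga)%R|%N ->
  biquad al be ga r s t -> sqfree `|d|%N -> d != 1 -> z * z = d%:~R ->
  [\/ d = be * ga, d = al * ga | d = al * be].
Proof.
move=> sq bq sd d1 zz.
have [s1 s2 s3] : [/\ sqfree `|(be * ga)%R|%N, sqfree `|(al * ga)%R|%N & sqfree `|(al * be)%R|%N].
  split; rewrite abszM.
  - by apply: (@sqfreeMl _ `|al|%N); move: sq; rewrite !abszM -mulnA mulnC.
  - by apply: (@sqfreeMl _ `|be|%N); move: sq; rewrite !abszM mulnAC.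
  - by apply: (@sqfreeMl _ `|ga|%N); move: sq; rewrite !abszM.
have [rr ss tt] := biquad_sq bq.
have [a [b [c [e zE]]]] := biquad_span bq z.
have [g1 g1E] := biquad_morph (GRing.in_alg K) bq (quad_rel_negst (biquad_rel bq)).
have [g2 g2E] := biquad_morph (GRing.in_alg K) bq (quad_rel_negrt (biquad_rel bq)).
have neg (f : {rmorphism K -> K}) : f z = z \/ f z = - z.
  have : f z ^+ 2 == z ^+ 2 by rewrite !expr2 -rmorphM zz rmorph_int.
  by rewrite eqf_sqr => /orP[/eqP|/eqP]; [left|right].
have E1 : g1 z = linK r s t a b (- c) (- e).
  by rewrite zE g1E /linK /lin4 !rmorphN !mulrN !mulNr.
have E2 : g2 z = linK r s t a (- b) c (- e).
  by rewrite zE g2E /linK /lin4 !rmorphN !mulrN !mulNr.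
have negz : - z = linK r s t (- a) (- b) (- c) (- e).
  by rewrite zE /linK /lin4 !rmorphN !mulNr !opprD.
have self (x : rat) : x = - x -> x = 0.
  by move=> /eqP; rewrite -addr_eq0 -mulr2n mulrn_eq0 /= => /eqP.
have fin (q : rat) (x : int) (y : K) : y * y = (x%:~R : rat)%:A -> z = q%:A * y -> sqfree `|x|%N -> d = x.
  move=> yy zq sx; apply: (@sqfree_ratio_sqr _ _ q) => //.
  move/eqP: zz; rewrite zq mulrACA yy intr_alg -!in_algE -!rmorphM (inj_eq (fmorph_inj _)).
  by move=> /eqP <-; rewrite expr2.
have [h1|h1] := neg g1; have [h2|h2] := neg g2.
- move: h1 h2; rewrite E1 E2 zE => /(biquad_inj bq)[_ _ /esym/self c0 /esym/self e0].
  move=> /(biquad_inj bq)[_ /esym/self b0 _ _].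
  case/eqP: d1; apply: (@sqfree_ratio_sqr _ _ a) => //.
  rewrite mulr1; apply: (fmorph_inj (GRing.in_alg K)).
  rewrite rmorph_int -zz zE c0 e0 b0 /linK /lin4 !rmorph0 !mul0r !addr0.
  by rewrite expr2 rmorphM.
- move: h1; rewrite E1 zE => /(biquad_inj bq)[_ _ /esym/self c0 /esym/self e0].
  move: h2; rewrite E2 negz => /(biquad_inj bq)[/self a0 _ _ _].
  apply: Or31; apply: (fin b _ r) => //.
  by rewrite zE a0 c0 e0 /linK /lin4 !rmorph0 !mul0r !addr0 add0r.
- move: h2; rewrite E2 zE => /(biquad_inj bq)[_ /esym/self b0 _ /esym/self e0].
  move: h1; rewrite E1 negz => /(biquad_inj bq)[/self a0 _ _ _].
  apply: Or32; apply: (fin c _ s) => //.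
  by rewrite zE a0 b0 e0 /linK /lin4 !rmorph0 !mul0r !addr0 !add0r.
- move: h1; rewrite E1 negz => /(biquad_inj bq)[/self a0 /self b0 _ _].
  move: h2; rewrite E2 negz => /(biquad_inj bq)[_ _ /self c0 _].
  apply: Or33; apply: (fin e _ t) => //.
  by rewrite zE a0 b0 c0 /linK /lin4 !rmorph0 !mul0r !add0r.
Qed.

End V4Fields.

(** * Existence of a field with given parameters *)

Section Existence.

Lemma quad_free (F : fieldType) (f : {rmorphism rat -> F}) (r : F) (A : int) (a b : rat) :
  r * r = A%:~R -> sqfree `|A|%N -> A != 1 -> f a + f b * r = 0 -> a = 0 /\ b = 0.
Proof.
move=> rr sA A1 E; have [b0|b0] := eqVneq b 0.
  by move: E; rewrite b0 rmorph0 mul0r addr0 => /eqP; rewrite fmorph_eq0 => /eqP.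
have fb : f b != 0 by rewrite fmorph_eq0.
case/eqP: A1; apply: (@sqfree_sqr_rat _ (a / b)) => //; apply: (fmorph_inj f).
have -> : f (A%:~R) = r * r by rewrite rmorph_int rr.
have -> : r = - f (a / b).
  rewrite fmorph_div; apply: (mulfI fb); rewrite mulrN mulrC mulrCA mulfV // mulr1.
  by apply/eqP; rewrite eq_sym eqr_oppLR -addr_eq0 mulrC E.
by rewrite mulrNN -rmorphM expr2.
Qed.

(** Write the relation as [u + v s = 0] with [u], [v] in [Q(r)]. If [v] is nonzero, then
    [s = y0 + y1 r]; on squaring, the term [2 y0 y1 r] must vanish, so [al ga] or its quotient by
    [be ga] is a rational square. *)
Lemma biquad_free_gen (F : fieldType) (f : {rmorphism rat -> F}) (r s t : F) (al be ga : int)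
    (a b c d : rat) : sqfree `|(al * be * ga)%R|%N ->
  be * ga != 1 -> al * ga != 1 -> al * be != 1 -> quad_rel al be ga r s t ->
  lin4 f r s t a b c d = 0 -> [/\ a = 0, b = 0, c = 0 & d = 0].
Proof.
move=> sq A1 B1 C1 [[rr ss tt] [st rt rs]] E.
have [s1 s2 s3] : [/\ sqfree `|(be * ga)%R|%N, sqfree `|(al * ga)%R|%N & sqfree `|(al * be)%R|%N].
  split; rewrite abszM.
  - by apply: (@sqfreeMl _ `|al|%N); move: sq; rewrite !abszM -mulnA mulnC.
  - by apply: (@sqfreeMl _ `|be|%N); move: sq; rewrite !abszM mulnAC.
  - by apply: (@sqfreeMl _ `|ga|%N); move: sq; rewrite !abszM.
have ga0 : ga != 0.
  by move: s1 => /sqfreeP[+ _]; rewrite absz_gt0 mulf_eq0 negb_or => /andP[].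
have fga : f ga%:~R != 0 by rewrite fmorph_eq0 intr_eq0.
have tE : t = f ((ga%:~R)^-1) * (r * s).
  by rewrite rs fmorphV -(rmorph_int f ga) mulKf.
pose e := d / ga%:~R; pose u := f a + f b * r; pose v := f c + f e * r.
have E' : u + v * s = 0.
  rewrite -E /lin4 /u /v tE /e rmorphM; ring.
(* The norm of [v] to the rationals, by which [v] is inverted. *)
pose N := c ^+ 2 - (be * ga)%:~R * e ^+ 2.
have nv : v * (f c - f e * r) = f N.
  have -> : v * (f c - f e * r) = f c * f c - f e * f e * (r * r) by rewrite /v; ring.
  by rewrite rr -(rmorph_int f) /N !expr2 rmorphB !rmorphM; ring.
have [v0|v0] := eqVneq v 0.
  have [c0 e0] := quad_free rr s1 A1 v0.
  have u0 : u = 0 by move: E'; rewrite v0 mul0r addr0.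
  have [a0 b0] := quad_free rr s1 A1 u0; split=> //.
  by move/eqP: e0; rewrite /e mulf_eq0 invr_eq0 intr_eq0 (negbTE ga0) orbF => /eqP.
have N0 : N != 0.
  apply: contra_neq v0 => N0; have : v * (f c - f e * r) = 0 by rewrite nv N0 rmorph0.
  move/eqP; rewrite mulf_eq0 => /orP[/eqP //|/eqP]; rewrite -mulNr -rmorphN => /(quad_free rr s1 A1)[c0 /eqP].
  by rewrite oppr_eq0 => /eqP e0; rewrite /v c0 e0 !rmorph0 mul0r addr0.
pose y0 := - (a * c - (be * ga)%:~R * b * e) / N; pose y1 := - (b * c - a * e) / N.
have fN : f N != 0 by rewrite fmorph_eq0.
have sE : s = f y0 + f y1 * r.
  apply: (mulfI fN); rewrite -nv.
  have -> : v * (f c - f e * r) * s = (v * s) * (f c - f e * r) by ring.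
  have -> : v * s = - u by apply/eqP; rewrite -addr_eq0 addrC E'.
  rewrite nv /y0 /y1 [RHS]mulrDr [X in _ = _ + X]mulrA -!(rmorphM f).
  have -> : N * (- (a * c - (be * ga)%:~R * b * e) / N) = - (a * c - (be * ga)%:~R * b * e) by field.
  have -> : N * (- (b * c - a * e) / N) = - (b * c - a * e) by field.
  transitivity (- (f a * f c - f b * f e * (r * r) + (f b * f c - f a * f e) * r)).
    by rewrite /u; ring.
  by rewrite rr -(rmorph_int f) !rmorphN !rmorphB !rmorphM; ring.
clearbody y0 y1.
have : f (y0 ^+ 2 + (be * ga)%:~R * y1 ^+ 2 - (al * ga)%:~R) + f (2%:R * y0 * y1) * r = 0.
  have : s * s = (al * ga)%:~R by [].
  rewrite {1 2}sE; have -> : (f y0 + f y1 * r) * (f y0 + f y1 * r) =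
    f y0 * f y0 + f y1 * f y1 * (r * r) + (f y0 * f y1 + f y0 * f y1) * r by ring.
  rewrite rr -!(rmorph_int f) => /eqP; rewrite -subr_eq0 => /eqP <-.
  by rewrite rmorphB rmorphD !rmorphM rmorph_nat; ring.
move/(quad_free rr s1 A1) => [/eqP + /eqP]; rewrite subr_eq0 !mulf_eq0 pnatr_eq0 /=.
move=> /eqP H /orP[/eqP y00|/eqP y10].
  have BA : al * ga = be * ga.
    apply: (@sqfree_ratio_sqr _ _ y1) => //.
    by rewrite -H y00 expr0n add0r mulrC.
  have ab : al = be by apply: (mulIf ga0).
  case/eqP: C1; apply: (@sqfree_sqr_rat _ (al%:~R)) => //.
  by rewrite -ab intrM expr2.
case/eqP: B1; apply: (@sqfree_sqr_rat _ y0) => //.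
by rewrite -H y10 expr0n mulr0 addr0.
Qed.

(** By [quad_rel] the span of [1, r, s, t] is closed under products, so it is a subalgebra that
    contains the generators. *)
Lemma biquad_span_gen (K : splittingFieldType rat) (r s t : K) (al be ga : int) :
  quad_rel al be ga r s t -> <<1 & [:: r; s]>>%VS = fullv ->
  forall x, exists a b c d, x = linK r s t a b c d.
Proof.
move=> rel gen x0; pose V := span [:: 1; r; s; t].
have VP x : x \in V -> exists a b c d, x = linK r s t a b c d.
  move=> /(@coord_span _ _ _ [tuple 1; r; s; t]) ->; rewrite !big_ord_recl big_ord0 /= addr0 !addrA.
  by eexists; eexists; eexists; eexists; rewrite linK_scale.
have PV a b c d : linK r s t a b c d \in V.
  by rewrite linK_scale !memvD // memvZ // memv_span // !inE eqxx ?orbT.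
have asp : is_aspace V.
  rewrite /is_aspace has_algid1; last by rewrite memv_span // !inE eqxx.
  apply/prodvP => x y /VP[a [b [c [d ->]]]] /VP[a' [b' [c' [d' ->]]]].
  by rewrite /linK (lin4M _ _ _ _ _ _ _ _ _ rel); exact: PV.
apply: (VP x0); suff : (fullv <= ASpace asp)%VS by move/subvP; apply; exact: memvf.
have -> : fullv = <<1 & [:: r; s]>>%VS by rewrite gen.
apply/Fadjoin_seqP; split; first exact: sub1v.
by move=> y; rewrite !inE => /orP[/eqP->|/eqP->]; rewrite memv_span // !inE eqxx ?orbT.
Qed.

Lemma biquad_exists (al be ga : int) : sqfree `|(al * be * ga)%R|%N ->
  be * ga != 1 -> al * ga != 1 -> al * be != 1 ->
  exists (K : splittingFieldType rat) (r s t : K), biquad al be ga r s t.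
Proof.
move=> sq A1 B1 C1.
have [Qs [QsC [s1 s1E s1f]]] := num_field_exists [:: sqrtC (be * ga)%:~R; sqrtC (al * ga)%:~R].
case: s1 s1E s1f => [|r [|s [|]]] //= [rE sE] gen.
have sqr (x : Qs) (n : int) : QsC x = sqrtC n%:~R -> x * x = n%:~R.
  move=> xE; apply: (fmorph_inj QsC).
  by rewrite rmorphM rmorph_int /= xE -expr2 sqrtCK.
have rr := sqr _ _ rE; have ss := sqr _ _ sE.
(* Normality: the field is generated by all the roots of a product of two quadratics. *)
have ax : splitting_field_axiom Qs.
  exists (('X^2 - ((be * ga)%:~R)%:P) * ('X^2 - ((al * ga)%:~R)%:P)).
    have i1 (n : int) : (n%:~R : Qs) \in 1%VS by rewrite rpred_int.
    by rewrite rpredM // rpredB ?rpredX ?polyOverX ?polyOverC ?i1.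
  exists [:: r; - r; s; - s].
    rewrite !big_cons big_nil -rr -ss mulr1 !polyCN !polyCM.
    set R := r%:P; set S := s%:P.
    have -> : ('X - R) * (('X - - R) * (('X - S) * ('X - - S))) =
      ('X^2 - R * R) * ('X^2 - S * S) by ring.
    exact: eqpxx.
  apply/eqP; rewrite eqEsubv subvf /= -gen.
  apply/Fadjoin_seqP; split; first exact: subv_adjoin_seq.
  by move=> x; rewrite !inE => /orP[/eqP->|/eqP->]; rewrite seqv_sub_adjoin // !inE eqxx ?orbT.
pose mx := FieldExt_isSplittingField.Build rat Qs ax.
pose K : splittingFieldType rat := HB.pack Qs mx.
pose r' : K := r; pose s' : K := s.
have ga0 : ga != 0.
  by move: sq => /sqfreeP[+ _]; rewrite absz_gt0 mulf_eq0 negb_or => /andP[].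
have gaK : ga%:~R != 0 :> K by rewrite intr_alg -in_algE fmorph_eq0 intr_eq0.
pose t' : K := (ga%:~R)^-1 * (r' * s').
have rel : quad_rel al be ga r' s' t'.
  split; split=> //.
  - have -> : t' * t' = ga%:~R^-1 * ga%:~R^-1 * ((r' * r') * (s' * s')) by rewrite /t'; ring.
    by rewrite [r' * r']rr [s' * s']ss !intrM; field.
  - have -> : s' * t' = ga%:~R^-1 * (s' * s') * r' by rewrite /t'; ring.
    by rewrite [s' * s']ss intrM; field.
  - have -> : r' * t' = ga%:~R^-1 * (r' * r') * s' by rewrite /t'; ring.
    by rewrite [r' * r']rr intrM; field.
  - by rewrite /t' mulVKf.
exists K, r', s', t'; split=> //; last first.
  by move=> a b c d; exact: biquad_free_gen rel.
by apply: (biquad_span_gen rel); rewrite -gen.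
Qed.

End Existence.

(** * Integral bases *)

Section Integers.
Implicit Types (K : splittingFieldType rat) (al be ga : int).

(** Transferred to [algC], where a rational algebraic integer is known to be an integer. *)
Lemma rat_integral K (q : rat) : OK K q%:A -> exists n : int, q = n%:~R.
Proof.
move=> [p mp]; rewrite /root.
have -> : map_poly intr p = map_poly (GRing.in_alg K) (map_poly intr p).
  by rewrite -map_poly_comp; apply: eq_map_poly => z /=; rewrite intr_alg.
rewrite -in_algE horner_map fmorph_eq0 => rq.
have : (ratr q : algC) \in Num.int.
  apply: Cint_rat_Aint; first exact: rpred_rat.
  apply: (@root_monic_Aint (map_poly intr p)).
  - have -> : map_poly intr p = map_poly (ratr : rat -> algC) (map_poly intr p).
      by rewrite -map_poly_comp; apply: eq_map_poly => z /=; rewrite ratr_int.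
    by rewrite /root horner_map (eqP rq) rmorph0.
  - exact: monic_map.
  - by apply/polyOverP => i; rewrite coef_map /= rpred_int.
case/intrP => n nE; exists n; apply: (fmorph_inj (ratr : rat -> algC)).
by rewrite rmorph_int; exact: nE.
Qed.

Lemma OK_int K (n : int) : OK K n%:~R.
Proof. exact: (@integral_id _ _ intr). Qed.

Lemma OK_add K (x y : K) : OK K x -> OK K y -> OK K (x + y).
Proof. exact: integral_add. Qed.

Lemma OK_opp K (x : K) : OK K x -> OK K (- x).
Proof. exact: integral_opp. Qed.

Lemma OK_mul K (x y : K) : OK K x -> OK K y -> OK K (x * y).
Proof. exact: integral_mul. Qed.

Lemma OK_morph K (f : {rmorphism K -> K}) (x : K) : OK K x -> OK K (f x).
Proof.
move=> [p mp rp]; exists p => //.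
have -> : map_poly intr p = map_poly f (map_poly intr p).
  by rewrite -map_poly_comp; apply: eq_map_poly => z /=; rewrite rmorph_int.
by rewrite /root horner_map (eqP rp) rmorph0.
Qed.

(** Integrality is transitive: the monic quadratic has integral, not only rational integer,
    coefficients. This verifies basis elements by a relative equation. *)
Lemma OK_quad K (b c x : K) : OK K b -> OK K c -> x * x = b * x + c -> OK K x.
Proof.
move=> ob oc E.
apply: (@integral_root_monic _ _ _ x ('X^2 - (b *: 'X + c%:P))).
- rewrite monicE lead_coefDl ?lead_coefXn // size_polyXn size_polyN.
  apply: (leq_ltn_trans (size_polyD _ _)); rewrite gtn_max.
  rewrite (leq_ltn_trans (size_scale_leq _ _)) ?size_polyX //.
  by rewrite (leq_ltn_trans (size_polyC_leq1 _)).
- by rewrite /root !hornerE expr2 E subrr.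
- apply/integral_poly => i.
  rewrite coefB coefXn coefD coefZ coefX coefC.
  case: i => [|[|[|i]]] /=; rewrite ?mulr0 ?mulr1 ?addr0 ?add0r ?subr0 ?sub0r.
  + exact: OK_opp.
  + exact: OK_opp.
  + exact: integral1.
  + by rewrite oppr0; exact: (OK_int K 0).
Qed.

(** By [sqfree_dvd_sqr] the denominator of [q] divides the numerator, so it is 1. *)
Lemma sqfree_mul_sqr_int (N m : int) (q : rat) : sqfree `|N|%N ->
  N%:~R * q ^+ 2 = m%:~R -> exists n : int, q = n%:~R.
Proof.
move=> sN E.
have dn0 : (denq q)%:~R != 0 :> rat by rewrite intr_eq0 denq_eq0.
have EZ : N * numq q ^+ 2 = m * denq q ^+ 2.
  apply/eqP; rewrite -(eqr_int rat) [X in X == _]intrM [X in _ == X]intrM !rmorphXn /= -E -{2}(divq_num_den q).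
  by apply/eqP; field.
have dd : (`|denq q| ^ 2 %| `|N| * `|numq q| ^ 2)%N.
  by rewrite -!abszX -abszM EZ abszM dvdn_mull.
have d0 : (0 < `|denq q|)%N by rewrite absz_gt0 denq_eq0.
have := sqfree_dvd_sqr sN d0 dd => /gcdn_idPr; rewrite (eqP (coprime_num_den q)) => d1.
have d1' : denq q = 1 by rewrite -absz_denq -d1.
by exists (numq q); rewrite -{1}(divq_num_den q) d1' divr1.
Qed.

(** The conjugate is integral too. The trace gives [2 P]; four times the norm shows that the
    squarefree radicand times [(2 Q)^2] is an integer, which gives [2 Q]. *)
Lemma quad_integral K al be ga (r s t : K) (P Q : rat) : biquad al be ga r s t ->
  sqfree `|(be * ga)%R|%N -> OK K (linK r s t P Q 0 0) ->
  exists p q m : int, [/\ 2 * P = p%:~R, 2 * Q = q%:~R & p ^+ 2 - be * ga * q ^+ 2 = 4 * m].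
Proof.
move=> bq sq oK.
have [g gE] := biquad_morph (GRing.in_alg K) bq (quad_rel_negrs (biquad_rel bq)).
have gx : g (linK r s t P Q 0 0) = linK r s t P (- Q) 0 0.
  by rewrite gE /linK /lin4 !rmorph0 !mul0r rmorphN mulrN mulNr.
have oK' := OK_morph g oK; rewrite gx in oK'.
have [p pE] : exists n : int, 2 * P = n%:~R.
  apply: (@rat_integral K); rewrite (alg_linK r s t).
  have := OK_add oK oK'; rewrite /linK lin4D.
  by rewrite subrr !addr0 -mulr2n mulr_natl.
have [m mE] : exists n : int, P ^+ 2 - (be * ga)%:~R * Q ^+ 2 = n%:~R.
  apply: (@rat_integral K); rewrite (alg_linK r s t).
  have := OK_mul oK oK'; rewrite /linK (lin4M _ _ _ _ _ _ _ _ _ (biquad_rel bq)).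
  rewrite !mulr0 !mul0r !addr0 !mulr0 !addr0 intrM.
  congr (OK K (lin4 _ _ _ _ _ _ _ _)); by ring.
have E : (2 * P) ^+ 2 - (be * ga)%:~R * (2 * Q) ^+ 2 = (4 * m)%:~R.
  by rewrite [RHS]intrM -mE; ring.
have [q qE] : exists n : int, 2 * Q = n%:~R.
  apply: (@sqfree_mul_sqr_int (be * ga) (p ^+ 2 - 4 * m)) => //.
  by rewrite rmorphB rmorphXn /= -pE -E; ring.
exists p, q, m; split=> //; apply/eqP; rewrite -(eqr_int rat) -E pE qE.
by rewrite rmorphB [X in _ - X == _]intrM !rmorphXn.
Qed.

(* The last three conditions say that the norm of [x] to [Q(s)] is integral. *)
Lemma OK_coefs K al be ga (r s t : K) (a b c d : rat) : biquad al be ga r s t ->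
  sqfree `|(al * be * ga)%R|%N -> OK K (linK r s t a b c d) ->
  exists u0 u1 u2 u3 p q : int, [/\ 4 * a = u0%:~R, 4 * b = u1%:~R, 4 * c = u2%:~R & 4 * d = u3%:~R] /\
   [/\ exists m, u0 ^+ 2 - be * ga * u1 ^+ 2 = 4 * m,
       exists m, u0 ^+ 2 - al * ga * u2 ^+ 2 = 4 * m &
       exists m, u0 ^+ 2 - al * be * u3 ^+ 2 = 4 * m] /\
   [/\ u0 ^+ 2 + al * ga * u2 ^+ 2 - be * ga * u1 ^+ 2 - al * be * u3 ^+ 2 = 8 * p,
       u0 * u2 - be * u1 * u3 = 4 * q & exists m, p ^+ 2 - al * ga * q ^+ 2 = 4 * m].
Proof.
move=> bq sq oK.
have [bq2 bq3] := biquad_perm bq.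
have [s1 s2 s3] : [/\ sqfree `|(be * ga)%R|%N, sqfree `|(al * ga)%R|%N & sqfree `|(al * be)%R|%N].
  split; rewrite abszM.
  - by apply: (@sqfreeMl _ `|al|%N); move: sq; rewrite !abszM -mulnA mulnC.
  - by apply: (@sqfreeMl _ `|be|%N); move: sq; rewrite !abszM mulnAC.
  - by apply: (@sqfreeMl _ `|ga|%N); move: sq; rewrite !abszM.
have rel := biquad_rel bq.
have [g gE] := biquad_morph (GRing.in_alg K) bq (quad_rel_negst rel).
have [h hE] := biquad_morph (GRing.in_alg K) bq (quad_rel_negrt rel).
have [k kE] := biquad_morph (GRing.in_alg K) bq (quad_rel_negrs rel).
have gx : g (linK r s t a b c d) = linK r s t a b (- c) (- d).
  by rewrite gE /linK /lin4 !rmorphN !mulNr !mulrN.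
have hx : h (linK r s t a b c d) = linK r s t a (- b) c (- d).
  by rewrite hE /linK /lin4 !rmorphN !mulNr !mulrN.
have kx : k (linK r s t a b c d) = linK r s t a (- b) (- c) d.
  by rewrite kE /linK /lin4 !rmorphN !mulNr !mulrN.
have og := OK_morph g oK; have oh := OK_morph h oK; have ok := OK_morph k oK.
rewrite gx in og; rewrite hx in oh; rewrite kx in ok.
have sw1 P Q : linK r s t P 0 Q 0 = linK s r t P Q 0 0.
  by rewrite /linK /lin4; ring.
have sw2 P Q : linK r s t P 0 0 Q = linK t r s P Q 0 0.
  by rewrite /linK /lin4; ring.
have [_ bq5] := biquad_perm bq3.
(* The trace to [Q(r)]; the traces to [Q(s)] and [Q(t)] are taken in the same way below. *)
have := OK_add oK og; rewrite [in X in X -> _]/linK lin4D !subrr -/(linK r s t _ _ _ _).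
move=> /(quad_integral bq s1)[u0 [u1 [m1 [E0 E1 M1]]]].
have := OK_add oK oh; rewrite [in X in X -> _]/linK lin4D !subrr -/(linK r s t _ _ _ _) sw1.
move=> /(quad_integral bq2 s2)[u0' [u2 [m2 [E0' E2 M2]]]].
have := OK_add oK ok; rewrite [in X in X -> _]/linK lin4D !subrr -/(linK r s t _ _ _ _) sw2.
move=> /(quad_integral bq5 s3)[u0'' [u3 [m3 [E0'' E3 M3]]]].
have e0' : u0' = u0 by apply/eqP; rewrite -(eqr_int rat) -E0 -E0'.
have e0'' : u0'' = u0 by apply/eqP; rewrite -(eqr_int rat) -E0 -E0''.
rewrite e0' in M2; rewrite e0'' in M3.
have a4 : 4 * a = u0%:~R by rewrite -E0; ring.
have b4 : 4 * b = u1%:~R by rewrite -E1; ring.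
have c4 : 4 * c = u2%:~R by rewrite -E2; ring.
have d4 : 4 * d = u3%:~R by rewrite -E3; ring.
have := OK_mul oK oh; rewrite [in X in X -> _]/linK (lin4M _ _ _ _ _ _ _ _ _ rel) -/(linK r s t _ _ _ _).
have -> : a * - b + b * a + al%:~R * (c * - d + d * c) = 0 by ring.
have -> : a * - d + d * a + ga%:~R * (b * c + c * - b) = 0 by ring.
rewrite sw1 => /(quad_integral bq2 s2)[p [q [m [EP EQ M]]]].
exists u0, u1, u2, u3, p, q; split; first by [].
split; first by split; [exists m1|exists m2|exists m3].
split; last by exists m.
- apply/eqP; rewrite -(eqr_int rat); apply/eqP.
  transitivity ((u0%:~R : rat) ^+ 2 + al%:~R * ga%:~R * u2%:~R ^+ 2 - be%:~R * ga%:~R * u1%:~R ^+ 2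
    - al%:~R * be%:~R * u3%:~R ^+ 2); first by ring.
  by rewrite -a4 -b4 -c4 -d4 [RHS]intrM -EP; ring.
- apply/eqP; rewrite -(eqr_int rat); apply/eqP.
  transitivity ((u0%:~R : rat) * u2%:~R - be%:~R * u1%:~R * u3%:~R); first by ring.
  by rewrite -a4 -b4 -c4 -d4 [RHS]intrM -EQ; ring.
Qed.

End Integers.

(** * Congruences for the coordinates of integers *)

Section Arithmetic.
Implicit Types (al be ga : int).

Lemma int_parity (n : int) : exists k, n = 2 * k \/ n = 2 * k + 1.
Proof.
exists (n %/ 2)%Z; have := divz_eq n 2; have := modz_ge0 n (isT : 2 != 0 :> int).
by have := ltz_mod n (isT : 2 != 0 :> int); lia.
Qed.

(** Squares are 0 or 1 modulo 4. *)
Lemma norm_even (N n u0 u1 m : int) : N = 4 * n + 2 \/ N = 4 * n + 3 ->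
  u0 ^+ 2 - N * u1 ^+ 2 = 4 * m -> exists v0 v1, u0 = 2 * v0 /\ u1 = 2 * v1.
Proof.
have [v0 E0] := int_parity u0; have [v1 E1] := int_parity u1; rewrite !expr2.
move=> NE E; exists v0, v1; case: E0 E1 NE E => -> [] -> [] ->; lia.
Qed.

Lemma norm_odd_even (n u0 u1 m : int) :
  u0 ^+ 2 - (4 * n + 1) * u1 ^+ 2 = 4 * m -> exists k, u0 = u1 + 2 * k.
Proof.
have [v0 E0] := int_parity u0; have [v1 E1] := int_parity u1; rewrite !expr2.
move=> E; exists (v0 - v1); case: E0 E1 E => -> [] ->; lia.
Qed.

(** The parameters [al], [be], [ga] have residues 2, 1, 3 modulo 4. The traces make all coordinates
    even, the norm to [Q(s)] has even coordinates for the same reason, and the finer parities follow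
    by cases. *)
Lemma type2_coefs (b e f h u0 u1 u2 u3 p q m1 m2 m3 m : int) :
  u0 ^+ 2 - (4 * f + 3) * u1 ^+ 2 = 4 * m1 -> u0 ^+ 2 - (4 * e + 2) * u2 ^+ 2 = 4 * m2 ->
  u0 ^+ 2 - (4 * h + 2) * u3 ^+ 2 = 4 * m3 ->
  u0 ^+ 2 + (4 * e + 2) * u2 ^+ 2 - (4 * f + 3) * u1 ^+ 2 - (4 * h + 2) * u3 ^+ 2 = 8 * p ->
  u0 * u2 - (4 * b + 1) * u1 * u3 = 4 * q -> p ^+ 2 - (4 * e + 2) * q ^+ 2 = 4 * m ->
  exists x0 x1 x2 x3, [/\ u0 = 4 * x0, u1 = 4 * x1, u2 = 4 * x2 + 2 * x3 & u3 = 2 * x3].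
Proof.
move=> /(norm_even (or_intror (erefl _)))[v0 [v1 [-> ->]]].
move=> /(norm_even (or_introl (erefl _)))[_ [v2 [_ ->]]].
move=> /(norm_even (or_introl (erefl _)))[_ [v3 [_ ->]]] E1 E2 /(norm_even (or_introl (erefl _)))[p' [q' [pE qE]]].
move: E1 E2; rewrite pE qE => E1 E2.
have {}E1 : v0 * v0 + (4 * e + 2) * (v2 * v2) - (4 * f + 3) * (v1 * v1) - (4 * h + 2) * (v3 * v3) = 4 * p'.
  by move: E1; rewrite !expr2; lia.
have {}E2 : v0 * v2 - (4 * b + 1) * (v1 * v3) = 2 * q' by lia.
have [w0 W0] := int_parity v0; have [w1 W1] := int_parity v1.
have [w2 W2] := int_parity v2; have [w3 W3] := int_parity v3.
exists w0, w1, (w2 - w3), v3.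
by case: W0 W1 W2 W3 E1 E2 => -> [] -> [] -> [] -> E1 E2; split; lia.
Qed.

(** Residues [N], 1, 1 modulo 4: the cases [N = 2] and [N = 3] lead to the same lattice. *)
Lemma type1_coefs (N b e f h u0 u1 u2 u3 p q m1 m2 m3 m : int) : N = 2 \/ N = 3 ->
  u0 ^+ 2 - (4 * f + 1) * u1 ^+ 2 = 4 * m1 -> u0 ^+ 2 - (4 * e + N) * u2 ^+ 2 = 4 * m2 ->
  u0 ^+ 2 - (4 * h + N) * u3 ^+ 2 = 4 * m3 ->
  u0 ^+ 2 + (4 * e + N) * u2 ^+ 2 - (4 * f + 1) * u1 ^+ 2 - (4 * h + N) * u3 ^+ 2 = 8 * p ->
  u0 * u2 - (4 * b + 1) * u1 * u3 = 4 * q -> p ^+ 2 - (4 * e + N) * q ^+ 2 = 4 * m ->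
  exists x0 x1 x2 x3, [/\ u0 = 4 * x0 + 2 * x1, u1 = 2 * x1, u2 = 4 * x2 + 2 * x3 & u3 = 2 * x3].
Proof.
move=> N23.
have Nc k : 4 * k + N = 4 * k + 2 \/ 4 * k + N = 4 * k + 3 by case: N23 => ->; [left|right].
move=> /norm_odd_even[v1 U1].
move=> /(norm_even (Nc _))[v0 [v2 [U0 ->]]].
move=> /(norm_even (Nc _))[_ [v3 [_ ->]]] E1 E2 /(norm_even (Nc _))[p' [q' [pE qE]]].
have {}U1 : u1 = 2 * (v0 - v1) by lia.
move: E1 E2; rewrite pE qE U0 U1; move: (v0 - v1) => {U1 v1} v1 E1 E2.
have {}E1 : v0 * v0 + (4 * e + N) * (v2 * v2) - (4 * f + 1) * (v1 * v1) - (4 * h + N) * (v3 * v3) = 4 * p'.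
  by move: E1; rewrite !expr2; lia.
have {}E2 : v0 * v2 - (4 * b + 1) * (v1 * v3) = 2 * q' by lia.
have [w0 W0] := int_parity v0; have [w1 W1] := int_parity v1.
have [w2 W2] := int_parity v2; have [w3 W3] := int_parity v3.
exists (w0 - w1), v1, (w2 - w3), v3.
by case: N23 W0 W1 W2 W3 E1 E2 => -> [] -> [] -> [] -> [] -> E1 E2; split; lia.
Qed.

(** Residues 1, 1, 1 modulo 4. The norms only make parities agree. One parity condition, on
    [v1 + v2 + v3], is left; it comes from the equation with [q] if [u3] is odd and from that with
    [p] if [u3] is even. *)
Lemma tame_coefs (a b c u0 u1 u2 u3 p q m1 m2 m3 : int) :
  u0 ^+ 2 - (4 * b + 1) * (4 * c + 1) * u1 ^+ 2 = 4 * m1 ->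
  u0 ^+ 2 - (4 * a + 1) * (4 * c + 1) * u2 ^+ 2 = 4 * m2 ->
  u0 ^+ 2 - (4 * a + 1) * (4 * b + 1) * u3 ^+ 2 = 4 * m3 ->
  u0 ^+ 2 + (4 * a + 1) * (4 * c + 1) * u2 ^+ 2 - (4 * b + 1) * (4 * c + 1) * u1 ^+ 2
    - (4 * a + 1) * (4 * b + 1) * u3 ^+ 2 = 8 * p ->
  u0 * u2 - (4 * b + 1) * u1 * u3 = 4 * q ->
  exists x0 x1 x2, [/\ u0 = 4 * x0 + 2 * x1 + 2 * x2 + u3, u1 = 2 * x1 + u3 & u2 = 2 * x2 + u3].
Proof.
have pr (x y : int) : exists z, (4 * x + 1) * (4 * y + 1) = 4 * z + 1.
  by exists (4 * x * y + x + y); ring.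
have [e ->] := pr b c; have [f ->] := pr a c; have [h ->] := pr a b.
move=> /norm_odd_even[v1 U1] /norm_odd_even[v2 U2] /norm_odd_even[v3 U3].
have {U1}-> : u1 = 2 * (v3 - v1) + u3 by lia.
have {U2}-> : u2 = 2 * (v3 - v2) + u3 by lia.
rewrite {u0}U3; move: (v3 - v1) (v3 - v2) => {}v1 {}v2 E1 E2.
have [k K] := int_parity (v1 + v2 + v3).
suff E : v1 + v2 + v3 = 2 * k by exists (k - v1 - v2), v1, v2; split=> //; lia.
have [w3 W3] := int_parity u3; have [w0 W0] := int_parity v3.
have [w1 W1] := int_parity v1; have [w2 W2] := int_parity v2.
case: W3 => W3; last first.
  by clear E1; case: W0 W1 W2 W3 E2 K => -> [] -> [] -> -> E2 K; lia.
move: E1; rewrite !expr2 W3 => E1 {E2}.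
have {}E1 : (v3 + w3) * (v3 + w3) + (4 * f + 1) * ((v2 + w3) * (v2 + w3)) - (4 * e + 1) * ((v1 + w3) * (v1 + w3)) - (4 * h + 1) * (w3 * w3) = 2 * p.
  by lia.
have [w W] := int_parity w3.
by case: W0 W1 W2 W E1 K => -> [] -> [] -> [] -> E1 K; lia.
Qed.

End Arithmetic.

Local Notation o0 := (@Ordinal 4 0 isT).
Local Notation o1 := (@Ordinal 4 1 isT).
Local Notation o2 := (@Ordinal 4 2 isT).
Local Notation o3 := (@Ordinal 4 3 isT).

(** * Trace form and discriminant *)

Section Discriminant.
Implicit Types (K : splittingFieldType rat) (al be ga : int).

Definition gram K n (w : n.-tuple K) : 'M[K]_n :=
  \matrix_(i < n, j < n) galTrace 1 {:K} (w`_i * w`_j).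

Lemma galTrace_int K (n : int) (x : K) : galTrace 1 {:K} (x *~ n) = galTrace 1 {:K} x *~ n.
Proof. exact: raddfMz. Qed.

Lemma gram_change K n (w w' : n.-tuple K) (A : 'M[int]_n) :
  (forall i : 'I_n, w'`_i = \sum_(j < n) w`_j *~ A i j) ->
  gram w' = map_mx intr A *m gram w *m (map_mx intr A)^T.
Proof.
move=> wA; apply/matrixP => i j; rewrite !mxE !wA.
rewrite mulr_suml raddf_sum; under [RHS]eq_bigr => k _ do rewrite !mxE mulr_suml.
rewrite [RHS]exchange_big; apply: eq_bigr => k _ /=.
rewrite mulr_sumr raddf_sum; apply: eq_bigr => l _ /=.
rewrite !mxE mulrzAl mulrzAr !galTrace_int -mulrzl -[in X in _ * X]mulrzl; ring.
Qed.

Lemma free_int_matrix K n (w : n.-tuple K) (C : 'M[int]_n) : free w ->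
  (forall i : 'I_n, w`_i = \sum_(j < n) w`_j *~ C i j) -> C = 1%:M.
Proof.
move=> fw wC; apply/matrixP => i j; rewrite mxE.
move/freeP/(_ (fun k => (C i k)%:~R - (i == k)%:R)): fw.
have E0 : \sum_(k < n) ((C i k)%:~R - (i == k)%:R) *: w`_k = 0.
  under eq_bigr => k _ do rewrite scalerBl scaler_int.
  rewrite sumrB -wC (bigD1 i) //= eqxx scale1r big1 ?addr0 ?subrr // => k ki.
  by rewrite eq_sym (negbTE ki) scale0r.
move=> /(_ E0 j) /eqP; rewrite subr_eq0 (_ : (i == j)%:R = ((i == j)%:R : int)%:~R) ?eqr_int => [/eqP //|]; exact: (esym (mulrz_nat _ _)).
Qed.

(** Two bases of one lattice differ by an integral matrix of determinant 1 or -1, which enters the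
    Gram determinant squared. *)
Lemma gram_det_unique K n (w w' : n.-tuple K) : free w ->
  [set x | inIntSpan w x] = [set x | inIntSpan w' x] -> \det (gram w) = \det (gram w').
Proof.
move=> fw E.
have mem (v : n.-tuple K) (i : 'I_n) : inIntSpan v v`_i.
  exists [ffun j => (i == j)%:R]; rewrite (bigD1 i) //= ffunE eqxx big1 ?addr0 // => j ji.
  by rewrite ffunE eq_sym (negbTE ji).
have ex (v v' : n.-tuple K) : [set x | inIntSpan v x] = [set x | inIntSpan v' x] ->
    exists A : 'M[int]_n, forall i : 'I_n, v'`_i = \sum_(j < n) v`_j *~ A i j.
  move=> vv; have H (i : 'I_n) : exists a : int ^ n, v'`_i = \sum_(j < n) v`_j *~ a j.
    by have : [set x | inIntSpan v' x] v'`_i by [exact: mem]; rewrite -vv.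
  have [a Ha] := choice H; exists (\matrix_(i, j) a i j) => i.
  by rewrite Ha; apply: eq_bigr => j _; rewrite mxE.
have [A HA] := ex w w' E; have [B HB] := ex w' w (esym E).
have BA : B *m A = 1%:M.
  apply: (free_int_matrix fw) => i; rewrite {1}HB.
  under eq_bigr => k _ do rewrite HA mulrz_suml.
  rewrite exchange_big; apply: eq_bigr => j _ /=.
  by rewrite mxE mulrz_sumr; apply: eq_bigr => k _; rewrite mulrzA_C.
have detA : \det A * \det A = 1.
  have : \det B * \det A = 1 by rewrite -det_mulmx BA det1.
  move: (\det A) (\det B) => a b /(congr1 absz); rewrite abszM => /eqP.
  rewrite muln_eq1 => /andP[_ /eqP a1].
  by have [->|->] : a = 1 \/ a = -1 by lia.
rewrite (gram_change HA) !det_mulmx det_tr det_map_mx mulrAC -intrM detA mul1r //.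
Qed.

(* [O_K] has basis [1, p1 + q1 r, p2 + q2 s, p3 + h1 r + h2 s + q3 t]. *)
Definition ring_lattice K (r s t : K) (p1 q1 p2 q2 p3 h1 h2 q3 : rat) : Prop :=
  forall a b c d, OK K (linK r s t a b c d) <-> exists x0 x1 x2 x3 : int,
    [/\ a = x0%:~R + x1%:~R * p1 + x2%:~R * p2 + x3%:~R * p3,
        b = x1%:~R * q1 + x3%:~R * h1, c = x2%:~R * q2 + x3%:~R * h2 & d = x3%:~R * q3].

Lemma sum_ord4 (V : nmodType) (F : 'I_4 -> V) : \sum_i F i = F o0 + F o1 + F o2 + F o3.
Proof.
rewrite !big_ord_recl big_ord0 addr0 !addrA.
by congr (F _ + F _ + F _ + F _); apply: val_inj.
Qed.

Lemma one_linK K (r s t : K) : 1 = linK r s t 1 0 0 0.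
Proof. by rewrite -alg_linK scale1r. Qed.

Lemma scale_linK K (r s t : K) a b c d (k : rat) :
  k *: linK r s t a b c d = linK r s t (k * a) (k * b) (k * c) (k * d).
Proof. by rewrite !linK_scale !scalerDr !scalerA. Qed.

Lemma mulrz_linK K (r s t : K) a b c d (n : int) :
  linK r s t a b c d *~ n = linK r s t (n%:~R * a) (n%:~R * b) (n%:~R * c) (n%:~R * d).
Proof. by rewrite -scaler_int scale_linK. Qed.

(** The traces of [r], [s], [t] vanish, so the trace form is diagonal in the basis [1, r, s, t]. *)
Lemma gram_linK K al be ga (r s t : K) (w : 4.-tuple K) (M : 'M[rat]_4) (e : 'rV[rat]_4) :
  biquad al be ga r s t ->
  (forall i : 'I_4, w`_i = linK r s t (M i o0) (M i o1) (M i o2) (M i o3)) ->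
  [/\ e 0 o0 = 4, e 0 o1 = 4 * (be * ga)%:~R, e 0 o2 = 4 * (al * ga)%:~R
    & e 0 o3 = 4 * (al * be)%:~R] ->
  gram w = map_mx (GRing.in_alg K) (M *m diag_mx e *m M^T).
Proof.
move=> bq wM [e0 e1 e2 e3]; apply/matrixP => i j; rewrite !mxE !wM.
rewrite [X in galTrace _ _ X](lin4M _ _ _ _ _ _ _ _ _ (biquad_rel bq)) -/(linK r s t _ _ _ _).
rewrite (galTrace_linK _ _ _ _ bq) -in_algE; congr (GRing.in_alg K _).
rewrite sum_ord4 mul_mx_diag !mxE e0 e1 e2 e3 !intrM; ring.
Qed.

Definition lower4 (p1 q1 p2 q2 p3 h1 h2 q3 : rat) : 'M[rat]_4 :=
  \matrix_(i < 4, j < 4)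
  (nth [::] [:: [:: 1; 0; 0; 0]; [:: p1; q1; 0; 0]; [:: p2; 0; q2; 0]; [:: p3; h1; h2; q3]] i)`_j.

Lemma det_lower4 p1 q1 p2 q2 p3 h1 h2 q3 : \det (lower4 p1 q1 p2 q2 p3 h1 h2 q3) = q1 * q2 * q3.
Proof.
rewrite det_trig.
  rewrite !big_ord_recl big_ord0 !mxE /= !mulr1 mul1r mulrA; reflexivity.
apply/is_trig_mxP => -[[|[|[|[|i]]]] ilt] [[|[|[|[|j]]]] jlt]; rewrite ?mxE //=.
Qed.

(** The basis matrix is triangular with diagonal [1, q1, q2, q3], and the diagonal trace form has
    determinant [4^4 (al be ga)^2]. *)
Lemma ring_lattice_disc K al be ga (r s t : K) (p1 q1 p2 q2 p3 h1 h2 q3 : rat) (D d : int) :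
  biquad al be ga r s t -> ring_lattice r s t p1 q1 p2 q2 p3 h1 h2 q3 ->
  q1 != 0 -> q2 != 0 -> q3 != 0 ->
  D%:~R = 256 * (al * be * ga)%:~R ^+ 2 * (q1 * q2 * q3) ^+ 2 ->
  (is_discriminant K d <-> d = D).
Proof.
move=> bq rl q10 q20 q30 DE.
pose w : 4.-tuple K := [tuple 1; linK r s t p1 q1 0 0; linK r s t p2 0 q2 0; linK r s t p3 h1 h2 q3].
pose M := lower4 p1 q1 p2 q2 p3 h1 h2 q3.
pose e : 'rV[rat]_4 := \row_(j < 4) [:: 4; 4 * (be * ga)%:~R; 4 * (al * ga)%:~R; 4 * (al * be)%:~R]`_j.
have wM (i : 'I_4) : w`_i = linK r s t (M i o0) (M i o1) (M i o2) (M i o3).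
  move: i => [[|[|[|[|i]]]] ilt]; rewrite ?mxE /=.
  - exact: one_linK.
  - reflexivity.
  - reflexivity.
  - reflexivity.
  - by [].
have spanE : OK K = [set x | inIntSpan w x].
  apply/seteqP; split=> x /=.
    have [a [b [c [d' ->]]]] := biquad_span bq x => /rl[x0 [x1 [x2 [x3 [-> -> -> ->]]]]].
    exists [ffun i : 'I_4 => [:: x0; x1; x2; x3]`_i].
    rewrite sum_ord4 !ffunE /= (one_linK r s t) !mulrz_linK /linK !lin4D.
    by congr (lin4 _ _ _ _ _ _ _ _); ring.
  case=> a ->; rewrite sum_ord4 /= (one_linK r s t) !mulrz_linK /linK !lin4D.
  apply/rl; exists (a o0), (a o1), (a o2), (a o3); split; ring.
have fw : free w.
  apply/freeP => k; rewrite sum_ord4 /= (one_linK r s t) !scale_linK /linK !lin4D => E.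
  have {}E : linK r s t (k o0 + k o1 * p1 + k o2 * p2 + k o3 * p3) (k o1 * q1 + k o3 * h1)
      (k o2 * q2 + k o3 * h2) (k o3 * q3) = 0.
    by rewrite -E /linK; congr (lin4 _ _ _ _ _ _ _ _); ring.
  have [k0 k1 k2 /eqP] := biquad_free bq E; rewrite mulf_eq0 (negbTE q30) orbF => /eqP k3.
  rewrite k3 !mul0r !addr0 in k0 k1 k2.
  move/eqP: k1; rewrite mulf_eq0 (negbTE q10) orbF => /eqP k1.
  move/eqP: k2; rewrite mulf_eq0 (negbTE q20) orbF => /eqP k2.
  rewrite k1 k2 !mul0r !addr0 in k0.
  by move=> [[|[|[|[|//]]]] i]; [rewrite -[RHS]k0|rewrite -[RHS]k1|rewrite -[RHS]k2|rewrite -[RHS]k3]; congr k; apply: val_inj.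
have bw : basis_of {:K} w.
  by rewrite basisEfree fw subvf size_tuple (biquad_dim bq).
have dw : \det (gram w) = D%:~R.
  rewrite (gram_linK bq wM (e := e)); last by split; rewrite mxE.
  rewrite det_map_mx !det_mulmx det_tr det_lower4 det_diag !big_ord_recl big_ord0 !mxE /=.
  rewrite -[RHS](rmorph_int (GRing.in_alg K)) DE !intrM; congr (GRing.in_alg K _); ring.
rewrite /is_discriminant (biquad_dim bq); split.
  move=> [w' [bw' E' dE]].
  have : d%:~R = D%:~R :> K.
    rewrite -dE -dw; apply: (gram_det_unique (w := w')); first exact: basis_free bw'.
    by rewrite -E' -spanE.
  by rewrite !intr_alg -!in_algE => /fmorph_inj /eqP; rewrite eqr_int => /eqP.
by move=> ->; exists w; split.
Qed.

End Discriminant.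

(** * Integral bases for each pattern of residues *)

Section IntegralBases.
Implicit Types (K : splittingFieldType rat) (al be ga : int).

Lemma int_linK K (r s t : K) (n : int) : n%:~R = linK r s t n%:~R 0 0 0.
Proof. by rewrite intr_alg (alg_linK r s t). Qed.

Lemma linKM K al be ga (r s t : K) (a b c d a' b' c' d' : rat) : quad_rel al be ga r s t ->
  linK r s t a b c d * linK r s t a' b' c' d' = linK r s t
    (a * a' + be%:~R * ga%:~R * b * b' + al%:~R * ga%:~R * c * c' + al%:~R * be%:~R * d * d')
    (a * b' + b * a' + al%:~R * (c * d' + d * c'))
    (a * c' + c * a' + be%:~R * (b * d' + d * b'))
    (a * d' + d * a' + ga%:~R * (b * c' + c * b')).
Proof. exact: (lin4M (GRing.in_alg K)). Qed.

Lemma linKD K (r s t : K) (a b c d a' b' c' d' : rat) :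
  linK r s t a b c d + linK r s t a' b' c' d' = linK r s t (a + a') (b + b') (c + c') (d + d').
Proof. exact: lin4D. Qed.

Lemma eq_linK K (r s t : K) (a b c d a' b' c' d' : rat) : a = a' -> b = b' -> c = c' -> d = d' ->
  linK r s t a b c d = linK r s t a' b' c' d'.
Proof. by move=> -> -> -> ->. Qed.

Lemma ring_lattice_of K (r s t : K) (p1 q1 p2 q2 p3 h1 h2 q3 : rat) :
  OK K (linK r s t p1 q1 0 0) -> OK K (linK r s t p2 0 q2 0) -> OK K (linK r s t p3 h1 h2 q3) ->
  (forall a b c d, OK K (linK r s t a b c d) -> exists x0 x1 x2 x3 : int,
    [/\ a = x0%:~R + x1%:~R * p1 + x2%:~R * p2 + x3%:~R * p3,
        b = x1%:~R * q1 + x3%:~R * h1, c = x2%:~R * q2 + x3%:~R * h2 & d = x3%:~R * q3]) ->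
  ring_lattice r s t p1 q1 p2 q2 p3 h1 h2 q3.
Proof.
move=> o1 o2 o3 H a b c d; split; first exact: H.
move=> [x0 [x1 [x2 [x3 [-> -> -> ->]]]]].
have -> : linK r s t (x0%:~R + x1%:~R * p1 + x2%:~R * p2 + x3%:~R * p3)
    (x1%:~R * q1 + x3%:~R * h1) (x2%:~R * q2 + x3%:~R * h2) (x3%:~R * q3) =
  x0%:~R + x1%:~R * linK r s t p1 q1 0 0 + x2%:~R * linK r s t p2 0 q2 0
    + x3%:~R * linK r s t p3 h1 h2 q3.
  rewrite !mulrzl !mulrz_linK (int_linK r s t) !linKD.
  by apply: eq_linK; ring.
by apply: OK_add; [apply: OK_add; [apply: OK_add|]|];
  try apply: OK_mul => //; exact: OK_int.
Qed.

(** The element [x = (1 + r) / 2] satisfies [x^2 = x + (be ga - 1) / 4]. *)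
Lemma OK_half K al be ga (r s t : K) (b c : int) : biquad al be ga r s t ->
  be = 4 * b + 1 -> ga = 4 * c + 1 -> OK K (linK r s t (1 / 2) (1 / 2) 0 0).
Proof.
move=> bq bE cE; apply: (@OK_quad _ 1 (b + c + 4 * b * c)%:~R).
- exact: (OK_int K 1).
- exact: OK_int.
rewrite [X in _ = X + _]mul1r [X in _ = _ + X](int_linK r s t) (linKM _ _ _ _ _ _ _ _ (biquad_rel bq)) linKD.
apply: eq_linK; rewrite ?bE ?cE; by field.
Qed.

Lemma ring_lattice_tame K al be ga (r s t : K) (a b c : int) : biquad al be ga r s t ->
  sqfree `|(al * be * ga)%R|%N -> al = 4 * a + 1 -> be = 4 * b + 1 -> ga = 4 * c + 1 ->
  ring_lattice r s t (1 / 2) (1 / 2) (1 / 2) (1 / 2) (1 / 4) (1 / 4) (1 / 4) (1 / 4).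
Proof.
move=> bq sq aE bE cE; have oh := OK_half bq bE cE.
have [bq2 _] := biquad_perm bq.
apply: ring_lattice_of => //.
- have -> : linK r s t (1 / 2) 0 (1 / 2) 0 = linK s r t (1 / 2) (1 / 2) 0 0.
    by rewrite /linK /lin4; ring.
  exact: OK_half bq2 aE cE.
(* The element [(1 + r + s + t) / 4] is quadratic over the ring generated by [(1 + r) / 2]. *)
- apply: (@OK_quad _ (linK r s t (1 / 2) (1 / 2) 0 0)
    (a%:~R * linK r s t (1 / 2) (1 / 2) 0 0 + (a * c + a * b - b * c)%:~R)) => //.
    by apply: OK_add; [apply: OK_mul|]; rewrite //; exact: OK_int.
  rewrite [X in _ = _ + (X + _)]mulrzl mulrz_linK [X in _ = _ + (_ + X)](int_linK r s t) !(linKM _ _ _ _ _ _ _ _ (biquad_rel bq)) !linKD.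
  apply: eq_linK; rewrite ?aE ?bE ?cE; by field.
- move=> a' b' c' d' /(OK_coefs bq sq)[u0 [u1 [u2 [u3 [p [q [[U0 U1 U2 U3] [[[m1 M1] [m2 M2] [m3 M3]] [P Q _]]]]]]]]].
  move: M1 M2 M3 P Q; rewrite aE bE cE => M1 M2 M3 P Q.
  have [x0 [x1 [x2 [E0 E1 E2]]]] := tame_coefs M1 M2 M3 P Q.
  exists x0, x1, x2, u3.
  split; apply: (@mulfI _ 4) => //; rewrite ?U0 ?U1 ?U2 ?U3 ?E0 ?E1 ?E2; by field.
Qed.

Lemma ring_lattice_type1 K al be ga (r s t : K) (a b c N : int) : biquad al be ga r s t ->
  sqfree `|(al * be * ga)%R|%N -> N = 2 \/ N = 3 -> al = 4 * a + N -> be = 4 * b + 1 -> ga = 4 * c + 1 ->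
  ring_lattice r s t (1 / 2) (1 / 2) 0 1 0 0 (1 / 2) (1 / 2).
Proof.
move=> bq sq N23 aE bE cE; have oh := OK_half bq bE cE.
apply: ring_lattice_of => //.
- apply: (@OK_quad _ 0 (al * ga)%:~R); [exact: (OK_int K 0)|exact: OK_int|].
  rewrite [X in _ = X + _]mul0r add0r (int_linK r s t) (linKM _ _ _ _ _ _ _ _ (biquad_rel bq)).
  apply: eq_linK; rewrite ?intrM; ring.
(* The equation is [((s + t) / 2)^2 = al ((1 + r) / 2 + b + c)]. *)
- apply: (@OK_quad _ 0 (al%:~R * (linK r s t (1 / 2) (1 / 2) 0 0 + (b + c)%:~R))); first exact: (OK_int K 0).
    by apply: OK_mul; [|apply: OK_add]; rewrite //; exact: OK_int.
  rewrite [X in _ = X + _]mul0r add0r [RHS]mulrzl (int_linK r s t) linKD mulrz_linK.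
  rewrite (linKM _ _ _ _ _ _ _ _ (biquad_rel bq)).
  apply: eq_linK; rewrite ?bE ?cE; by field.
- move=> a' b' c' d' /(OK_coefs bq sq)[u0 [u1 [u2 [u3 [p [q [[U0 U1 U2 U3] [[[m1 M1] [m2 M2] [m3 M3]] [P Q [m M]]]]]]]]]].
  have gE : be * ga = 4 * (b + c + 4 * b * c) + 1 by rewrite bE cE; ring.
  have gE2 : al * ga = 4 * (a * ga + c * N) + N by rewrite aE cE; ring.
  have gE3 : al * be = 4 * (a * be + b * N) + N by rewrite aE bE; ring.
  move: M1 M2 M3 P Q M; rewrite gE gE2 gE3 [be in X in _ -> _ -> _ -> _ -> X]bE => M1 M2 M3 P Q M.
  have [x0 [x1 [x2 [x3 [E0 E1 E2 E3]]]]] := type1_coefs N23 M1 M2 M3 P Q M.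
  exists x0, x1, x2, x3.
  split; apply: (@mulfI _ 4) => //; rewrite ?U0 ?U1 ?U2 ?U3 ?E0 ?E1 ?E2 ?E3; by field.
Qed.

Lemma ring_lattice_type2 K al be ga (r s t : K) (a b c : int) : biquad al be ga r s t ->
  sqfree `|(al * be * ga)%R|%N -> al = 4 * a + 2 -> be = 4 * b + 1 -> ga = 4 * c + 3 ->
  ring_lattice r s t 0 1 0 1 0 0 (1 / 2) (1 / 2).
Proof.
move=> bq sq aE bE cE.
have or1 : OK K (linK r s t 0 1 0 0).
  apply: (@OK_quad _ 0 (be * ga)%:~R); [exact: (OK_int K 0)|exact: OK_int|].
  rewrite [X in _ = X + _]mul0r add0r (int_linK r s t) (linKM _ _ _ _ _ _ _ _ (biquad_rel bq)).
  apply: eq_linK; rewrite ?intrM; ring.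
apply: ring_lattice_of => //.
- apply: (@OK_quad _ 0 (al * ga)%:~R); [exact: (OK_int K 0)|exact: OK_int|].
  rewrite [X in _ = X + _]mul0r add0r (int_linK r s t) (linKM _ _ _ _ _ _ _ _ (biquad_rel bq)).
  apply: eq_linK; rewrite ?intrM; ring.
(* The equation is [((s + t) / 2)^2 = (2 a + 1) r + al (b + c + 1)]. *)
- apply: (@OK_quad _ 0 ((2 * a + 1)%:~R * linK r s t 0 1 0 0 + (al * (b + c + 1))%:~R)); first exact: (OK_int K 0).
    by apply: OK_add; [apply: OK_mul|]; rewrite //; exact: OK_int.
  rewrite [X in _ = X + _]mul0r add0r [X in _ = X + _]mulrzl mulrz_linK (int_linK r s t) linKD.
  rewrite (linKM _ _ _ _ _ _ _ _ (biquad_rel bq)).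
  apply: eq_linK; rewrite ?aE ?bE ?cE; by field.
- move=> a' b' c' d' /(OK_coefs bq sq)[u0 [u1 [u2 [u3 [p [q [[U0 U1 U2 U3] [[[m1 M1] [m2 M2] [m3 M3]] [P Q [m M]]]]]]]]]].
  have gE : be * ga = 4 * (c + 3 * b + 4 * b * c) + 3 by rewrite bE cE; ring.
  have gE2 : al * ga = 4 * (a * ga + 2 * c + 1) + 2 by rewrite aE cE; ring.
  have gE3 : al * be = 4 * (a * be + 2 * b) + 2 by rewrite aE bE; ring.
  move: M1 M2 M3 P Q M; rewrite gE gE2 gE3 [be in X in _ -> _ -> _ -> _ -> X]bE => M1 M2 M3 P Q M.
  have [x0 [x1 [x2 [x3 [E0 E1 E2 E3]]]]] := type2_coefs M1 M2 M3 P Q M.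
  exists x0, x1, x2, x3.
  split; apply: (@mulfI _ 4) => //; rewrite ?U0 ?U1 ?U2 ?U3 ?E0 ?E1 ?E2 ?E3; by field.
Qed.

End IntegralBases.

(** * Ramification at two *)

Section RamificationTwo.
Implicit Types (K : splittingFieldType rat).

Lemma ideal_mul_in K (I J : set K) a b : I a -> J b -> ideal_mul I J (a * b).
Proof.
by move=> Ia Jb; exists 1%N, (fun=> a), (fun=> b); split=> //; rewrite big_ord1.
Qed.

Lemma ideal_mul_add K (I J : set K) x y :
  ideal_mul I J x -> ideal_mul I J y -> ideal_mul I J (x + y).
Proof.
move=> [n [a [b [Ia Jb ->]]]] [m [a' [b' [Ia' Jb' ->]]]].
exists (n + m)%N, (fun i => match fintype.split i with inl j => a j | inr j => a' j end),
  (fun i => match fintype.split i with inl j => b j | inr j => b' j end); split.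
- by move=> i; case: (fintype.split i).
- by move=> i; case: (fintype.split i).
rewrite big_split_ord /=; congr (_ + _); apply: eq_bigr => i _.
  by have := unsplitK (inl i : 'I_n + 'I_m); rewrite /= => ->.
by have := unsplitK (inr i : 'I_n + 'I_m); rewrite /= => ->.
Qed.

Lemma ideal_mul_ind K (I J : set K) (Q : K -> Prop) : Q 0 ->
  (forall x y, Q x -> Q y -> Q (x + y)) -> (forall a b, I a -> J b -> Q (a * b)) ->
  forall x, ideal_mul I J x -> Q x.
Proof.
move=> Q0 QD QM x [n [a [b [Ia Jb ->]]]].
by apply: big_ind => // i _; exact: QM.
Qed.

Lemma ideal_mul_ideal K (I J : set K) : is_ideal I -> is_ideal J -> is_ideal (ideal_mul I J).
Proof.
move=> [IO I0 ID IM] [JO J0 JD JM]; split.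
- apply: ideal_mul_ind; [exact: (OK_int K 0)|by move=> x y; exact: OK_add|].
  by move=> a b /IO oa /JO ob; exact: OK_mul.
- by exists 0%N, (fun=> 0), (fun=> 0); split=> //; rewrite big_ord0.
- by move=> a b; exact: ideal_mul_add.
- move=> r a or; move: a; apply: ideal_mul_ind.
  + by rewrite mulr0; exists 0%N, (fun=> 0), (fun=> 0); split=> //; rewrite big_ord0.
  + by move=> x y hx hy; rewrite mulrDr; exact: ideal_mul_add.
  + by move=> a b Ia Jb; rewrite mulrA; apply: ideal_mul_in => //; exact: IM.
Qed.

Lemma OK_ideal K : is_ideal (OK K).
Proof.
split=> //; [exact: (OK_int K 0)|by move=> a b; exact: OK_add|by move=> r a; exact: OK_mul].
Qed.

(* If [P] and [Q] multiply into a set whose products lie in [2 O], then [P^2 Q^2 = (2)] as soon as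
   [2] is a combination of products of elements of [PQ]. *)
Lemma ramifies_two_of K (P Q I : set K) (u y z : K) :
  is_prime_ideal P -> is_ideal Q ->
  (forall p q, P p -> Q q -> I (p * q)) ->
  (forall i j, I i -> I j -> exists2 w, OK K w & i * j = 2%:R * w) ->
  ideal_mul P Q u -> ideal_mul P Q 2%:R -> OK K y -> OK K z ->
  2%:R = u * u + u * (2%:R * y) + 2%:R * (2%:R * z) -> ramifies 2 K.
Proof.
move=> Pp Qi PQI II2 PQu PQ2 oy oz E2; have [Pi _ _] := Pp.
exists P, (ideal_mul Q Q); split=> //; first exact: ideal_mul_ideal.
have [_ _ PQD PQM] := ideal_mul_ideal Pi Qi.
have PPi := ideal_mul_ideal Pi Pi; have QQi := ideal_mul_ideal Qi Qi.
have [PQO PQ0 PPQQD PPQQM] := ideal_mul_ideal PPi QQi.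
have mem a b : ideal_mul P Q a -> ideal_mul P Q b -> ideal_mul (ideal_mul P P) (ideal_mul Q Q) (a * b).
  move=> + hb; move: a; apply: ideal_mul_ind.
  - by rewrite mul0r.
  - by move=> x x' hx hx'; rewrite mulrDl; exact: PPQQD.
  - move=> p q Pp' Qq; move: b hb; apply: ideal_mul_ind.
    + by rewrite mulr0.
    + by move=> x x' hx hx'; rewrite mulrDr; exact: PPQQD.
    + by move=> p' q' Pp'' Qq'; rewrite mulrACA; apply: ideal_mul_in; exact: ideal_mul_in.
apply/seteqP; split=> x /=.
  move=> [r or <-]; rewrite mulrC; apply: PPQQM => //.
  rewrite E2; apply: (PPQQD _ _ (PPQQD _ _ _ _) _); apply: mem => //.
    by rewrite mulrC; exact: PQM.
  by rewrite mulrC; exact: PQM.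
suff {x} H x : ideal_mul (ideal_mul P P) (ideal_mul Q Q) x -> exists2 w, OK K w & x = 2%:R * w.
  by move/H => [w ow ->]; exists w.
have zero : exists2 w, OK K w & (0 : K) = 2%:R * w by exists 0; [exact: (OK_int K 0)|rewrite mulr0].
have add a b : (exists2 w, OK K w & a = 2%:R * w) -> (exists2 w, OK K w & b = 2%:R * w) ->
    exists2 w, OK K w & a + b = 2%:R * w.
  move=> [w ow ->] [w' ow' ->]; exists (w + w'); first exact: OK_add.
  by rewrite mulrDr.
move: x; apply: ideal_mul_ind => // a b ha hb; move: a ha; apply: ideal_mul_ind.
- by rewrite mul0r.
- by move=> a a' ha ha'; rewrite mulrDl; exact: add.
- move=> p p' Pp1 Pp2; move: b hb; apply: ideal_mul_ind.
  + by rewrite mulr0.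
  + by move=> a a' ha ha'; rewrite mulrDr; exact: add.
  + by move=> q q' Qq Qq'; rewrite mulrACA; apply: II2; exact: PQI.
Qed.

(** The hypothesis says that the ring of integers modulo 2 is reduced. If [(2) = P^2 J], squares of
    products from [P] and [J] lie in [(2)], so [P J] lies in [(2)] and [(2) = P (P J)] in [2 P],
    which puts 1 in [P]. *)
Lemma not_ramifies_two K : (forall x w, OK K x -> OK K w -> x * x = 2%:R * w ->
    exists2 v, OK K v & x = 2%:R * v) -> ~ ramifies 2 K.
Proof.
move=> red [P [J [[[PO P0 PD PM] P1 Pp] [JO J0 JD JM] E]]].
have PJ p j : P p -> J j -> exists2 v, OK K v & p * j = 2%:R * v.
  move=> hp hj.
  have : ideal_mul (ideal_mul P P) J (p * j * (p * j)).
    rewrite mulrACA; apply: ideal_mul_in; first exact: ideal_mul_in.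
    by apply: JM => //; exact: JO.
  rewrite -E => -[w ow wE]; apply: (red _ w) => //.
  by apply: OK_mul; [exact: PO|exact: JO].
have H x : ideal_mul (ideal_mul P P) J x -> exists2 v, P v & x = 2%:R * v.
  have zero : exists2 v, P v & (0 : K) = 2%:R * v by exists 0 => //; rewrite mulr0.
  have add a b : (exists2 w, P w & a = 2%:R * w) -> (exists2 w, P w & b = 2%:R * w) ->
    exists2 w, P w & a + b = 2%:R * w.
    move=> [w ow ->] [w' ow' ->]; exists (w + w'); first exact: PD.
    by rewrite mulrDr.
  move: x; apply: ideal_mul_ind => // a j ha hj; move: a ha; apply: ideal_mul_ind.
  - by rewrite mul0r.
  - by move=> a a' ha ha'; rewrite mulrDl; exact: add.
  - move=> p p' hp hp'; have [v ov E'] := PJ _ _ hp' hj.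
    by exists (v * p); [exact: PM|rewrite -mulrA E'; ring].
have [v hv vE] : exists2 v, P v & 2%:R * 1 = 2%:R * v.
  by apply: H; rewrite -E; exists 1 => //; exact: (OK_int K 1).
apply: P1; suff -> : (1 : K) = v by [].
apply: (@mulfI _ 2%:R) => //.
have -> : (2%:R : K) = GRing.in_alg K 2%:R by rewrite rmorph_nat.
by rewrite fmorph_eq0.
Qed.

End RamificationTwo.

(** * Computations with coordinates modulo 2 *)

Section RamificationArithmetic.

Lemma even_of (x : int) : (forall k, x = 2 * k + 1 -> False) -> exists k, x = 2 * k.
Proof. by move=> H; have [k [->|/H//]] := int_parity x; exists k. Qed.

(** The four coordinates of [x^2 = 2 w] in the tame basis, cleared of denominators. An odd [x3] is
    impossible, then an odd [x2], [x1] and [x0] in turn. *)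
Lemma tame_reduced (a b c x0 x1 x2 x3 y0 y1 y2 y3 u0 u1 u2 : int) :
  u0 = 4 * x0 + 2 * x1 + 2 * x2 + x3 -> u1 = 2 * x1 + x3 -> u2 = 2 * x2 + x3 ->
  u0 * x3 + (4 * c + 1) * (u1 * u2) = 4 * y3 ->
  u0 * u2 + (4 * b + 1) * (u1 * x3) = 4 * (2 * y2 + y3) ->
  u0 * u1 + (4 * a + 1) * (u2 * x3) = 4 * (2 * y1 + y3) ->
  u0 * u0 + (4 * b + 1) * (4 * c + 1) * (u1 * u1) + (4 * a + 1) * (4 * c + 1) * (u2 * u2)
    + (4 * a + 1) * (4 * b + 1) * (x3 * x3) = 8 * (4 * y0 + 2 * y1 + 2 * y2 + y3) ->
  exists z0 z1 z2 z3, [/\ x0 = 2 * z0, x1 = 2 * z1, x2 = 2 * z2 & x3 = 2 * z3].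
Proof.
move=> -> -> -> E3 E2 E1 E0.
have [z3 [Z3|Z3]] := int_parity x3; last by rewrite Z3 in E3; clear -E3; exfalso; lia.
have {}E3 : (2 * x0 + x1 + x2 + z3) * z3 + (4 * c + 1) * ((x1 + z3) * (x2 + z3)) = y3.
  by rewrite Z3 in E3; clear -E3; lia.
have {}E2 : (2 * x0 + x1 + x2 + z3) * (x2 + z3) + (4 * b + 1) * ((x1 + z3) * z3) = 2 * y2 + y3.
  by rewrite Z3 in E2; clear -E2; lia.
have {}E1 : (2 * x0 + x1 + x2 + z3) * (x1 + z3) + (4 * a + 1) * ((x2 + z3) * z3) = 2 * y1 + y3.
  by rewrite Z3 in E1; clear -E1; lia.
have {}E0 : (2 * x0 + x1 + x2 + z3) * (2 * x0 + x1 + x2 + z3) + (4 * b + 1) * (4 * c + 1) * ((x1 + z3) * (x1 + z3))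
   + (4 * a + 1) * (4 * c + 1) * ((x2 + z3) * (x2 + z3)) + (4 * a + 1) * (4 * b + 1) * (z3 * z3) = 2 * (4 * y0 + 2 * y1 + 2 * y2 + y3).
  by rewrite Z3 in E0; clear -E0; lia.
have [z2 [Z2|Z2]] := int_parity x2; last first.
  have [z1 Z1] := int_parity x1; have [w W] := int_parity z3; clear E0 E1.
  by exfalso; case: Z1 W => Z1 [] W; rewrite Z1 Z2 W in E2 E3; clear -E2 E3; lia.
have [z1 [Z1|Z1]] := int_parity x1; last first.
  have [w W] := int_parity z3; clear E0 E2.
  by exfalso; case: W => W; rewrite Z1 Z2 W in E1 E3; clear -E1 E3; lia.
have [z0 [Z0|Z0]] := int_parity x0; first by exists z0, z1, z2, z3.
exfalso; have [w W] := int_parity z3.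
have [v1 V1] := int_parity z1; have [v2 V2] := int_parity z2.
rewrite Z0 Z1 Z2 in E0 E1 E2 E3; clear Z0 Z1 Z2 Z3 x0 x1 x2 x3.
case: W V1 V2 => -> [] -> [] -> in E0 E1 E2 E3 *; clear -E0 E1 E2 E3; lia.
Qed.

(** Modulo 2, [x0 + al x2] and [x1 + al x3] multiply like the coordinates of [p + q w] with
    [w^2 = w + e]; this lemma and [type1_mul1] give the two coordinates of the product. [kap]
    records that [al^2] and [al] have equal parity. *)
Lemma type1_mul0 (al c b e x0 x1 x2 x3 y0 y1 y2 y3 : int) (kap : int) : al * al = al + 2 * kap ->
  e = b + c + 4 * b * c -> exists k,
  (x0 * y0 + e * x1 * y1 + al * (4 * c + 1) * x2 * y2 + 2 * c * al * (x2 * y3 + x3 * y2) + al * (b + c) * x3 * y3)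
  + al * (x0 * y2 + x2 * y0 - 2 * c * (x1 * y2 + x2 * y1) + (b - c) * (x1 * y3 + x3 * y1))
  = (x0 + al * x2) * (y0 + al * y2) + e * (x1 + al * x3) * (y1 + al * y3) + 2 * k.
Proof.
move=> kE ->; exists ((2 * c * al - kap) * x2 * y2 + (- kap * (b + c) - 2 * b * c * (al + 2 * kap)) * x3 * y3
  + al * (- c - 2 * b * c) * (x1 * y3 + x3 * y1)
  + c * al * (x2 * y3 + x3 * y2 - x1 * y2 - x2 * y1)).
have E x : al * (al * x) = (al + 2 * kap) * x by rewrite mulrA kE.
apply/eqP; rewrite -subr_eq0; apply/eqP.
transitivity ((al + 2 * kap - al * al) * (x2 * y2 + (b + c + 4 * b * c) * x3 * y3)); first by ring.
by rewrite kE; ring.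
Qed.

Lemma type1_mul1 (al c x0 x1 x2 x3 y0 y1 y2 y3 : int) (kap : int) : al * al = al + 2 * kap ->
  exists k, (x0 * y1 + x1 * y0 + x1 * y1 + al * (x2 * y3 + x3 * y2) + al * x3 * y3)
  + al * (x0 * y3 + x3 * y0 + (4 * c + 1) * (x1 * y2 + x2 * y1) + (1 + 2 * c) * (x1 * y3 + x3 * y1))
  = (x0 + al * x2) * (y1 + al * y3) + (x1 + al * x3) * (y0 + al * y2) + (x1 + al * x3) * (y1 + al * y3) + 2 * k.
Proof.
move=> kE; exists (- kap * (x2 * y3 + x3 * y2 + x3 * y3) + 2 * c * al * (x1 * y2 + x2 * y1)
  + c * al * (x1 * y3 + x3 * y1)).
apply/eqP; rewrite -subr_eq0; apply/eqP.
transitivity ((al + 2 * kap - al * al) * (x2 * y3 + x3 * y2 + x3 * y3)); first by ring.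
by rewrite kE; ring.
Qed.

(** The form [x0 + x1 + x3] modulo 2 is the residue map onto the field with two elements. *)
Lemma type2_mul (a b c x0 x1 x2 x3 y0 y1 y2 y3 : int) : exists k,
  (x0 * y0 + (4 * b + 1) * (4 * c + 3) * x1 * y1 + (4 * a + 2) * (4 * c + 3) * x2 * y2
    + (2 * a + 1) * (4 * c + 3) * (x2 * y3 + x3 * y2) + (4 * a + 2) * (b + c + 1) * x3 * y3)
  + (x0 * y1 + x1 * y0 + (2 * a + 1) * (x2 * y3 + x3 * y2) + (2 * a + 1) * x3 * y3)
  + (x0 * y3 + x3 * y0 + 2 * (4 * c + 3) * (x1 * y2 + x2 * y1) + (4 * c + 3) * (x1 * y3 + x3 * y1))
  = (x0 + x1 + x3) * (y0 + y1 + y3) + 2 * k.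
Proof.
exists ((8 * b * c + 6 * b + 2 * c + 1) * x1 * y1 + (2 * a + 1) * (4 * c + 3) * x2 * y2
  + (2 * a + 1) * (2 * c + 2) * (x2 * y3 + x3 * y2) + ((2 * a + 1) * (b + c + 1) + a) * x3 * y3
  + (4 * c + 3) * (x1 * y2 + x2 * y1) + (2 * c + 1) * (x1 * y3 + x3 * y1)).
ring.
Qed.

(** For two elements in the kernel of the homomorphism of [type1_mul0] and [type1_mul1], all four
    coordinates of the product are even: the kernel squares into [(2)]. *)
Lemma type1_square (N a b c x0 x1 x2 x3 y0 y1 y2 y3 m n m' n' : int) : N = 2 \/ N = 3 ->
  x0 + (4 * a + N) * x2 = 2 * m -> x1 + (4 * a + N) * x3 = 2 * n ->
  y0 + (4 * a + N) * y2 = 2 * m' -> y1 + (4 * a + N) * y3 = 2 * n' ->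
  [/\ exists k, x0 * y0 + (b + c + 4 * b * c) * x1 * y1 + (4 * a + N) * (4 * c + 1) * x2 * y2
      + 2 * c * (4 * a + N) * (x2 * y3 + x3 * y2) + (4 * a + N) * (b + c) * x3 * y3 = 2 * k,
    exists k, x0 * y1 + x1 * y0 + x1 * y1 + (4 * a + N) * (x2 * y3 + x3 * y2) + (4 * a + N) * x3 * y3 = 2 * k,
    exists k, x0 * y2 + x2 * y0 - 2 * c * (x1 * y2 + x2 * y1) + (b - c) * (x1 * y3 + x3 * y1) = 2 * k
  & exists k, x0 * y3 + x3 * y0 + (4 * c + 1) * (x1 * y2 + x2 * y1) + (1 + 2 * c) * (x1 * y3 + x3 * y1) = 2 * k].
Proof.
move=> N23 X0 X1 Y0 Y1.
have -> : x0 = 2 * m - (4 * a + N) * x2 by rewrite -X0; ring.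
have -> : x1 = 2 * n - (4 * a + N) * x3 by rewrite -X1; ring.
have -> : y0 = 2 * m' - (4 * a + N) * y2 by rewrite -Y0; ring.
have -> : y1 = 2 * n' - (4 * a + N) * y3 by rewrite -Y1; ring.
clear X0 X1 Y0 Y1 x0 x1 y0 y1.
by split; apply: even_of => k; case: N23 => ->; lia.
Qed.

Lemma type2_square (a b c x0 x1 x2 x3 y0 y1 y2 y3 m n m' n' : int) :
  x0 + x1 = 2 * m -> x3 = 2 * n -> y0 + y1 = 2 * m' -> y3 = 2 * n' ->
  [/\ exists k, x0 * y0 + (4 * b + 1) * (4 * c + 3) * x1 * y1 + (4 * a + 2) * (4 * c + 3) * x2 * y2
    + (2 * a + 1) * (4 * c + 3) * (x2 * y3 + x3 * y2) + (4 * a + 2) * (b + c + 1) * x3 * y3 = 2 * k,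
   exists k, x0 * y1 + x1 * y0 + (2 * a + 1) * (x2 * y3 + x3 * y2) + (2 * a + 1) * x3 * y3 = 2 * k,
   exists k, x0 * y2 + x2 * y0 - (4 * c + 3) * (x1 * y2 + x2 * y1) + (2 * b - 2 * c - 1) * (x1 * y3 + x3 * y1) = 2 * k
 & exists k, x0 * y3 + x3 * y0 + 2 * (4 * c + 3) * (x1 * y2 + x2 * y1) + (4 * c + 3) * (x1 * y3 + x3 * y1) = 2 * k].
Proof.
move=> X0 -> Y0 ->.
have -> : x0 = 2 * m - x1 by rewrite -X0; ring.
have -> : y0 = 2 * m' - y1 by rewrite -Y0; ring.
by clear X0 Y0; split; apply: even_of => k; lia.
Qed.

(** The last coordinate of a product of two elements of the prime above 2; its parity places the
    square of the prime in an intermediate ideal whose own square lies in [(2)]. *)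
Lemma type2_prime_square (c x0 x1 x2 x3 y0 y1 y2 y3 m m' : int) :
  x0 + x1 + x3 = 2 * m -> y0 + y1 + y3 = 2 * m' ->
  exists k, x0 * y3 + x3 * y0 + 2 * (4 * c + 3) * (x1 * y2 + x2 * y1) + (4 * c + 3) * (x1 * y3 + x3 * y1) = 2 * k.
Proof.
move=> X0 Y0.
have -> : x0 = 2 * m - x1 - x3 by rewrite -X0; ring.
have -> : y0 = 2 * m' - y1 - y3 by rewrite -Y0; ring.
by clear X0 Y0; apply: even_of => k; lia.
Qed.

(** The polynomial [w^2 + w + 1] is irreducible modulo 2, so the quotient is a field with four
    elements and a vanishing product has a vanishing factor. *)
Lemma inert_prime (e p q p' q' k k' : int) : (exists f, e = 2 * f + 1) ->
  p * p' + e * q * q' = 2 * k -> p * q' + q * p' + q * q' = 2 * k' ->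
  ((exists m, p = 2 * m) /\ exists n, q = 2 * n) \/ ((exists m, p' = 2 * m) /\ exists n, q' = 2 * n).
Proof.
move=> [f ->] E1 E2; have [a A] := int_parity p; have [b B] := int_parity q.
have [a' A'] := int_parity p'; have [b' B'] := int_parity q'.
case: A B => A [] B; first (by left; split; [exists a|exists b]);
  (case: A' B' => A' [] B'; first (by right; split; [exists a'|exists b']));
  by exfalso; rewrite A B A' B' in E1 E2; clear -E1 E2; lia.
Qed.

End RamificationArithmetic.

(** * Ramification at 2 for each pattern of residues *)

Section RamificationOfTypes.
Implicit Types (K : splittingFieldType rat) (al be ga : int).

Definition coord_set K (F : int -> int -> int -> int -> K) (ev : int -> int -> int -> int -> Prop) :
  set K := [set x | exists x0 x1 x2 x3, x = F x0 x1 x2 x3 /\ ev x0 x1 x2 x3].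

Lemma coord_ideal K (F : int -> int -> int -> int -> K) (ev : int -> int -> int -> int -> Prop) :
  (forall x, OK K x <-> exists x0 x1 x2 x3, x = F x0 x1 x2 x3) ->
  (forall x0 x1 x2 x3 y0 y1 y2 y3,
    F x0 x1 x2 x3 + F y0 y1 y2 y3 = F (x0 + y0) (x1 + y1) (x2 + y2) (x3 + y3)) ->
  ev 0 0 0 0 ->
  (forall x0 x1 x2 x3 y0 y1 y2 y3, ev x0 x1 x2 x3 -> ev y0 y1 y2 y3 ->
    ev (x0 + y0) (x1 + y1) (x2 + y2) (x3 + y3)) ->
  (forall x0 x1 x2 x3 y0 y1 y2 y3, ev y0 y1 y2 y3 ->
     coord_set F ev (F x0 x1 x2 x3 * F y0 y1 y2 y3)) ->
  is_ideal (coord_set F ev).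
Proof.
move=> FO FD ev0 evD evM; split.
- by move=> x [x0 [x1 [x2 [x3 [-> _]]]]]; apply/FO; exists x0, x1, x2, x3.
- exists 0, 0, 0, 0; split=> //.
  by apply: (@addrI _ (F 0 0 0 0)); rewrite addr0 FD !addr0.
- move=> _ _ [x0 [x1 [x2 [x3 [-> ex]]]]] [y0 [y1 [y2 [y3 [-> ey]]]]].
  by rewrite FD; do 4 eexists; split; [reflexivity|exact: evD].
- move=> _ _ /FO[x0 [x1 [x2 [x3 ->]]]] [y0 [y1 [y2 [y3 [-> ey]]]]]; exact: evM.
Qed.

Lemma dbl_linK K (r s t : K) a b c d :
  2%:R * linK r s t a b c d = linK r s t (2 * a) (2 * b) (2 * c) (2 * d).
Proof. by rewrite mulr_natl pmulrn mulrz_linK. Qed.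

Lemma tame_not_ramifies K al be ga (r s t : K) (a b c : int) : biquad al be ga r s t ->
  sqfree `|(al * be * ga)%R|%N -> al = 4 * a + 1 -> be = 4 * b + 1 -> ga = 4 * c + 1 ->
  ~ ramifies 2 K.
Proof.
move=> bq sq aE bE cE; have rl := ring_lattice_tame bq sq aE bE cE.
apply: not_ramifies_two => x w.
have [a1 [b1 [c1 [d1 ->]]]] := biquad_span bq x.
have [a2 [b2 [c2 [d2 ->]]]] := biquad_span bq w.
move=> /rl[x0 [x1 [x2 [x3 [-> -> -> ->]]]]] /rl[y0 [y1 [y2 [y3 [-> -> -> ->]]]]].
rewrite (linKM _ _ _ _ _ _ _ _ (biquad_rel bq)) dbl_linK.
move=> /(biquad_inj bq)[E0 E1 E2 E3].
have toint (p q : rat) (m n : int) : p = q -> m%:~R = 16 * p -> n%:~R = 16 * q -> m = n.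
  by move=> pq mE nE; apply/eqP; rewrite -(eqr_int rat) mE nE pq.
have [z0 [z1 [z2 [z3 [Z0 Z1 Z2 Z3]]]]] : exists z0 z1 z2 z3, [/\ x0 = 2 * z0, x1 = 2 * z1, x2 = 2 * z2 & x3 = 2 * z3].
  apply: (@tame_reduced a b c x0 x1 x2 x3 y0 y1 y2 y3 _ _ _ (erefl _) (erefl _) (erefl _)).
  - apply: (@mulfI _ 2) => //; apply: toint E3 _ _; rewrite ?cE; by field.
  - apply: (@mulfI _ 2) => //; apply: toint E2 _ _; rewrite ?bE; by field.
  - apply: (@mulfI _ 2) => //; apply: toint E1 _ _; rewrite ?aE; by field.
  - apply: toint E0 _ _; rewrite ?aE ?bE ?cE; by field.
exists (linK r s t (z0%:~R + z1%:~R * (1 / 2) + z2%:~R * (1 / 2) + z3%:~R * (1 / 4))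
  (z1%:~R * (1 / 2) + z3%:~R * (1 / 4)) (z2%:~R * (1 / 2) + z3%:~R * (1 / 4)) (z3%:~R * (1 / 4))).
  by apply/rl; exists z0, z1, z2, z3.
by rewrite dbl_linK Z0 Z1 Z2 Z3; apply: eq_linK; ring.
Qed.

Definition even (x : int) : Prop := exists k, x = 2 * k.

Lemma evenD x y : even x -> even y -> even (x + y).
Proof. by move=> [k ->] [l ->]; exists (k + l); ring. Qed.

Lemma type1_ramifies K al be ga (r s t : K) (a b c N : int) : biquad al be ga r s t ->
  sqfree `|(al * be * ga)%R|%N -> N = 2 \/ N = 3 -> al = 4 * a + N -> be = 4 * b + 1 -> ga = 4 * c + 1 ->
  ramifies 2 K.
Proof.
move=> bq sq N23 aE bE cE; have rl := ring_lattice_type1 bq sq N23 aE bE cE.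
pose F (x0 x1 x2 x3 : int) := linK r s t (x0%:~R + x1%:~R * (1 / 2) + x2%:~R * 0 + x3%:~R * 0)
  (x1%:~R * (1 / 2) + x3%:~R * 0) (x2%:~R * 1 + x3%:~R * (1 / 2)) (x3%:~R * (1 / 2)).
have FO x : OK K x <-> exists x0 x1 x2 x3, x = F x0 x1 x2 x3.
  have [a' [b' [c' [d' ->]]]] := biquad_span bq x; split.
    by move=> /rl[x0 [x1 [x2 [x3 [-> -> -> ->]]]]]; exists x0, x1, x2, x3.
  by move=> [x0 [x1 [x2 [x3 ->]]]]; apply/rl; exists x0, x1, x2, x3.
have Finj x0 x1 x2 x3 y0 y1 y2 y3 : F x0 x1 x2 x3 = F y0 y1 y2 y3 ->
    [/\ x0 = y0, x1 = y1, x2 = y2 & x3 = y3].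
  move=> /(biquad_inj bq)[E0 E1 E2 E3].
  have e3 : x3 = y3 by apply/eqP; rewrite -(eqr_int rat); apply/eqP; lra.
  have e1 : x1 = y1 by apply/eqP; rewrite -(eqr_int rat); apply/eqP; lra.
  by split=> //; apply/eqP; rewrite -(eqr_int rat); apply/eqP; rewrite e1 e3 in E0 E1 E2; lra.
have FD x0 x1 x2 x3 y0 y1 y2 y3 : F x0 x1 x2 x3 + F y0 y1 y2 y3 =
    F (x0 + y0) (x1 + y1) (x2 + y2) (x3 + y3).
  by rewrite /F linKD; apply: eq_linK; ring.
pose e := b + c + 4 * b * c.
have FM x0 x1 x2 x3 y0 y1 y2 y3 : F x0 x1 x2 x3 * F y0 y1 y2 y3 =
    F (x0 * y0 + e * x1 * y1 + al * (4 * c + 1) * x2 * y2 + 2 * c * al * (x2 * y3 + x3 * y2) + al * (b + c) * x3 * y3)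
      (x0 * y1 + x1 * y0 + x1 * y1 + al * (x2 * y3 + x3 * y2) + al * x3 * y3)
      (x0 * y2 + x2 * y0 - 2 * c * (x1 * y2 + x2 * y1) + (b - c) * (x1 * y3 + x3 * y1))
      (x0 * y3 + x3 * y0 + (4 * c + 1) * (x1 * y2 + x2 * y1) + (1 + 2 * c) * (x1 * y3 + x3 * y1)).
  rewrite /F (linKM _ _ _ _ _ _ _ _ (biquad_rel bq)) /e bE cE; clear.
  by apply: eq_linK; field.
have [kap kE] : exists kap, al * al = al + 2 * kap.
  case: N23 => NE; [exists ((2 * a + 1) * (4 * a + 1))|exists ((4 * a + 3) * (2 * a + 1))];
    by rewrite aE NE; ring.
have M0 x0 x1 x2 x3 y0 y1 y2 y3 := @type1_mul0 al c b e x0 x1 x2 x3 y0 y1 y2 y3 kap kE (erefl e).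
have M1 x0 x1 x2 x3 y0 y1 y2 y3 := @type1_mul1 al c x0 x1 x2 x3 y0 y1 y2 y3 kap kE.
have eE : e = b + c + 4 * b * c by [].
clearbody e.
(* The kernel of reduction to [p + q w] modulo 2 with [w^2 = w + e]. Its square will be [(2)];
   whether it is prime or a product of two primes depends on the parity of [e]. *)
pose evI x0 x1 x2 x3 := even (x0 + al * x2) /\ even (x1 + al * x3).
have F2 x0 x1 x2 x3 : F (2 * x0) (2 * x1) (2 * x2) (2 * x3) = 2%:R * F x0 x1 x2 x3.
  by rewrite /F dbl_linK; apply: eq_linK; ring.
have FOK x0 x1 x2 x3 : OK K (F x0 x1 x2 x3) by apply/FO; exists x0, x1, x2, x3.
have Fint (n : int) : F n 0 0 0 = n%:~R.
  by rewrite (int_linK r s t) /F; apply: eq_linK; ring.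
clearbody F.
have II2 i j : coord_set F evI i -> coord_set F evI j -> exists2 w, OK K w & i * j = 2%:R * w.
  move=> [x0 [x1 [x2 [x3 [-> [[m X0] [n X1]]]]]]] [y0 [y1 [y2 [y3 [-> [[m' Y0] [n' Y1]]]]]]].
  rewrite aE in X0 X1 Y0 Y1.
  have [[k0 K0] [k1 K1] [k2 K2] [k3 K3]] := type1_square b c N23 X0 X1 Y0 Y1.
  rewrite FM eE aE K0 K1 K2 K3 F2; by exists (F k0 k1 k2 k3).
have [k kA] : exists k, al * (4 * c + 1 - al) = 4 * k + 2.
  rewrite aE; case: N23 => ->.
    by exists (a * (4 * c - 4 * a - 1) + 2 * (c - a) - 1); ring.
  by exists (a * (4 * c - 4 * a - 2) + 3 * (c - a) - 2); ring.
(* This is [u = s - al], and [u^2 + 2 al u = al (ga - al)] is 2 modulo 4. As [u] and 2 lie in the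
   kernel, this puts 2 into its square. *)
pose u := F (- al) 0 1 0.
have E2 : 2%:R = u * u + u * (2%:R * F al 0 0 0) + 2%:R * (2%:R * F (- k) 0 0 0).
  rewrite -[LHS](Fint 2) [u * (_ * _)]mulrCA !FM -!F2 !FD.
  have K2 : 2 = al * (4 * c + 1 - al) - 4 * k by rewrite kA; ring.
  rewrite [in LHS]K2; congr (F _ _ _ _); ring.
have Iu : evI (- al) 0 1 0 by split; exists 0; ring.
have I2 : evI 2 0 0 0 by split; [exists 1|exists 0]; ring.
have [f fE] := int_parity e; case: fE => fE.
(* For [e] even, [w (w - 1) = 0] splits the quotient: [P] and [Q] are the kernels of sending [w] to
   0 and to 1. *)
- pose evP x0 (x1 : int) x2 (x3 : int) := even (x0 + al * x2).
  pose evQ x0 x1 x2 x3 := even (x0 + al * x2 + (x1 + al * x3)).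
  have Pid : is_ideal (coord_set F evP).
    apply: coord_ideal => //; first by exists 0; ring.
      move=> x0 x1 x2 x3 y0 y1 y2 y3 /evenD H /H [l lE]; exists l; rewrite -lE; ring.
    move=> x0 x1 x2 x3 y0 y1 y2 y3 [l lE]; rewrite FM; do 4 eexists; split; first reflexivity.
    have [l' M] := M0 x0 x1 x2 x3 y0 y1 y2 y3; rewrite /evP M lE fE.
    by exists ((x0 + al * x2) * l + f * (x1 + al * x3) * (y1 + al * y3) + l'); ring.
  have Qid : is_ideal (coord_set F evQ).
    apply: coord_ideal => //; first by exists 0; ring.
      move=> x0 x1 x2 x3 y0 y1 y2 y3 /evenD H /H [l lE]; exists l; rewrite -lE; ring.
    move=> x0 x1 x2 x3 y0 y1 y2 y3 [l lE]; rewrite FM; do 4 eexists; split; first reflexivity.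
    have [l' M] := M0 x0 x1 x2 x3 y0 y1 y2 y3; have [l'' M'] := M1 x0 x1 x2 x3 y0 y1 y2 y3.
    rewrite /evQ M M' fE.
    exists (l * (x0 + al * x2 + (x1 + al * x3)) + f * (x1 + al * x3) * (y1 + al * y3) + l' + l'').
    transitivity ((x0 + al * x2 + (x1 + al * x3)) * (y0 + al * y2 + (y1 + al * y3)) +
      2 * (f * (x1 + al * x3) * (y1 + al * y3) + l' + l'')); first by ring.
    by rewrite lE; ring.
  have PQ x0 x1 x2 x3 : evI x0 x1 x2 x3 -> ideal_mul (coord_set F evP) (coord_set F evQ) (F x0 x1 x2 x3).
    move=> [h0 h1].
    (* [P] contains [w] and [Q] contains [1 - w]: the two primes are comaximal, so their product
       contains their intersection. *)
    have -> : F x0 x1 x2 x3 = F x0 x1 x2 x3 * F 1 (-1) 0 0 + F 0 1 0 0 * F x0 x1 x2 x3.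
      have one : F 1 (-1) 0 0 + F 0 1 0 0 = 1 by rewrite FD -[RHS](Fint 1).
      by rewrite [F 0 1 0 0 * _]mulrC -mulrDr one mulr1.
    apply: ideal_mul_add; apply: ideal_mul_in.
    + by exists x0, x1, x2, x3.
    + by exists 1, (-1), 0, 0; split=> //; exists 0; ring.
    + by exists 0, 1, 0, 0; split=> //; exists 0; ring.
    + by exists x0, x1, x2, x3; split=> //; exact: evenD.
  apply: (@ramifies_two_of _ (coord_set F evP) (coord_set F evQ) (coord_set F evI) u (F al 0 0 0) (F (- k) 0 0 0)) => //.
  + split=> //.
      move=> [x0 [x1 [x2 [x3 [E ev]]]]]; have {}E : F 1 0 0 0 = F x0 x1 x2 x3 by rewrite Fint -E.
      by case: (Finj _ _ _ _ _ _ _ _ E) => e0 _ e2 _; case: ev => l; rewrite -e0 -e2; clear; lia.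
    move=> _ _ /FO[x0 [x1 [x2 [x3 ->]]]] /FO[y0 [y1 [y2 [y3 ->]]]] [z0 [z1 [z2 [z3 [E ev]]]]].
    rewrite FM in E; case: (Finj _ _ _ _ _ _ _ _ E) => e0 _ e2 _.
    have [l' M] := M0 x0 x1 x2 x3 y0 y1 y2 y3; case: ev => l; rewrite -e0 -e2 M fE => L.
    have [m [m0|m1]] := int_parity (x0 + al * x2).
      by left; exists x0, x1, x2, x3; split=> //; exists m.
    right; exists y0, y1, y2, y3; split=> //; apply: even_of => m' m1'.
    by rewrite m1 m1' in L; clear -L; lia.
  + move=> _ _ [x0 [x1 [x2 [x3 [-> [m X0]]]]]] [y0 [y1 [y2 [y3 [-> [m' Y0]]]]]].
    rewrite FM; do 4 eexists; split; first reflexivity.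
    have [l' M] := M0 x0 x1 x2 x3 y0 y1 y2 y3; have [l'' M'] := M1 x0 x1 x2 x3 y0 y1 y2 y3.
    split.
      rewrite M X0 fE.
      by exists (m * (y0 + al * y2) + f * (x1 + al * x3) * (y1 + al * y3) + l'); ring.
    rewrite M' X0; exists (m * (y1 + al * y3) + (x1 + al * x3) * m' + l'').
    transitivity (2 * m * (y1 + al * y3) + (x1 + al * x3) * (y0 + al * y2 + (y1 + al * y3)) + 2 * l''); first by ring.
    by rewrite Y0; ring.
  + exact: PQ.
  + by rewrite -[2%:R](Fint 2); exact: PQ.
(* For [e] odd the kernel itself is prime, and the second factor is the whole ring. *)
- have Pid : is_ideal (coord_set F evI).
    apply: coord_ideal => //; first by split; exists 0; ring.
      move=> x0 x1 x2 x3 y0 y1 y2 y3 [/evenD H /evenD H'] [/H [l lE] /H' [l' lE']].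
      by split; [exists l; rewrite -lE; ring|exists l'; rewrite -lE'; ring].
    move=> x0 x1 x2 x3 y0 y1 y2 y3 [[l lE] [m mE]]; rewrite FM; do 4 eexists; split; first reflexivity.
    have [l' M] := M0 x0 x1 x2 x3 y0 y1 y2 y3; have [l'' M'] := M1 x0 x1 x2 x3 y0 y1 y2 y3.
    split.
      rewrite M lE mE; exists ((x0 + al * x2) * l + e * (x1 + al * x3) * m + l'); ring.
    rewrite M' lE mE; exists ((x0 + al * x2) * m + (x1 + al * x3) * (l + m) + l''); ring.
  apply: (@ramifies_two_of _ (coord_set F evI) (OK K) (coord_set F evI) u (F al 0 0 0) (F (- k) 0 0 0)) => //.
  + split=> //.
      move=> [x0 [x1 [x2 [x3 [E [ev _]]]]]]; have {}E : F 1 0 0 0 = F x0 x1 x2 x3 by rewrite Fint -E.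
      by case: (Finj _ _ _ _ _ _ _ _ E) => e0 _ e2 _; case: ev => l; rewrite -e0 -e2; clear; lia.
    move=> _ _ /FO[x0 [x1 [x2 [x3 ->]]]] /FO[y0 [y1 [y2 [y3 ->]]]] [z0 [z1 [z2 [z3 [E [ev ev']]]]]].
    rewrite FM in E; case: (Finj _ _ _ _ _ _ _ _ E) => e0 e1 e2 e3.
    have [l M] := M0 x0 x1 x2 x3 y0 y1 y2 y3; have [l' M'] := M1 x0 x1 x2 x3 y0 y1 y2 y3.
    rewrite -e0 -e2 M in ev; rewrite -e1 -e3 M' in ev'; case: ev => n N0; case: ev' => n' N1.
    have G0 : (x0 + al * x2) * (y0 + al * y2) + e * (x1 + al * x3) * (y1 + al * y3) = 2 * (n - l).
      by rewrite mulrBr -N0; ring.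
    have G1 : (x0 + al * x2) * (y1 + al * y3) + (x1 + al * x3) * (y0 + al * y2) +
        (x1 + al * x3) * (y1 + al * y3) = 2 * (n' - l') by rewrite mulrBr -N1; ring.
    have [[h h']|[h h']] := inert_prime (ex_intro _ f fE) G0 G1.
    * by left; exists x0, x1, x2, x3.
    * by right; exists y0, y1, y2, y3.
  + exact: OK_ideal.
  + by case: Pid => _ _ _ PM p q hp oq; rewrite mulrC; exact: PM.
  + rewrite -[u]mulr1; apply: ideal_mul_in; last exact: (OK_int K 1).
    by exists (- al), 0, 1, 0.
  + rewrite -[2%:R]mulr1; apply: ideal_mul_in; last exact: (OK_int K 1).
    by exists 2, 0, 0, 0; rewrite Fint.
Qed.

Lemma type2_ramifies K al be ga (r s t : K) (a b c : int) : biquad al be ga r s t ->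
  sqfree `|(al * be * ga)%R|%N -> al = 4 * a + 2 -> be = 4 * b + 1 -> ga = 4 * c + 3 ->
  ramifies 2 K.
Proof.
move=> bq sq aE bE cE; have rl := ring_lattice_type2 bq sq aE bE cE.
pose F (x0 x1 x2 x3 : int) := linK r s t (x0%:~R + x1%:~R * 0 + x2%:~R * 0 + x3%:~R * 0)
  (x1%:~R * 1 + x3%:~R * 0) (x2%:~R * 1 + x3%:~R * (1 / 2)) (x3%:~R * (1 / 2)).
have FO x : OK K x <-> exists x0 x1 x2 x3, x = F x0 x1 x2 x3.
  have [a' [b' [c' [d' ->]]]] := biquad_span bq x; split.
    by move=> /rl[x0 [x1 [x2 [x3 [-> -> -> ->]]]]]; exists x0, x1, x2, x3.
  by move=> [x0 [x1 [x2 [x3 ->]]]]; apply/rl; exists x0, x1, x2, x3.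
have Finj x0 x1 x2 x3 y0 y1 y2 y3 : F x0 x1 x2 x3 = F y0 y1 y2 y3 ->
    [/\ x0 = y0, x1 = y1, x2 = y2 & x3 = y3].
  move=> /(biquad_inj bq)[E0 E1 E2 E3].
  have e3 : x3 = y3 by apply/eqP; rewrite -(eqr_int rat); apply/eqP; lra.
  have e1 : x1 = y1 by apply/eqP; rewrite -(eqr_int rat); apply/eqP; lra.
  by split=> //; apply/eqP; rewrite -(eqr_int rat); apply/eqP; rewrite e1 e3 in E0 E1 E2; lra.
have FD x0 x1 x2 x3 y0 y1 y2 y3 : F x0 x1 x2 x3 + F y0 y1 y2 y3 =
    F (x0 + y0) (x1 + y1) (x2 + y2) (x3 + y3).
  by rewrite /F linKD; apply: eq_linK; ring.
have FM x0 x1 x2 x3 y0 y1 y2 y3 : F x0 x1 x2 x3 * F y0 y1 y2 y3 =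
    F (x0 * y0 + (4 * b + 1) * (4 * c + 3) * x1 * y1 + (4 * a + 2) * (4 * c + 3) * x2 * y2
        + (2 * a + 1) * (4 * c + 3) * (x2 * y3 + x3 * y2) + (4 * a + 2) * (b + c + 1) * x3 * y3)
      (x0 * y1 + x1 * y0 + (2 * a + 1) * (x2 * y3 + x3 * y2) + (2 * a + 1) * x3 * y3)
      (x0 * y2 + x2 * y0 - (4 * c + 3) * (x1 * y2 + x2 * y1) + (2 * b - 2 * c - 1) * (x1 * y3 + x3 * y1))
      (x0 * y3 + x3 * y0 + 2 * (4 * c + 3) * (x1 * y2 + x2 * y1) + (4 * c + 3) * (x1 * y3 + x3 * y1)).
  rewrite /F (linKM _ _ _ _ _ _ _ _ (biquad_rel bq)) aE bE cE; clear.
  by apply: eq_linK; field.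
have F2 x0 x1 x2 x3 : F (2 * x0) (2 * x1) (2 * x2) (2 * x3) = 2%:R * F x0 x1 x2 x3.
  by rewrite /F dbl_linK; apply: eq_linK; ring.
have FOK x0 x1 x2 x3 : OK K (F x0 x1 x2 x3) by apply/FO; exists x0, x1, x2, x3.
have Fint (n : int) : F n 0 0 0 = n%:~R.
  by rewrite (int_linK r s t) /F; apply: eq_linK; ring.
clearbody F.
(* The totally ramified case: [P^2] lies in the ideal of [evI], whose square lies in [(2)], and
   conversely 2 lies in [P^4]. *)
pose evP (x0 x1 x2 x3 : int) := even (x0 + x1 + x3).
pose evI (x0 x1 x2 x3 : int) := even (x0 + x1) /\ even x3.
have M x0 x1 x2 x3 y0 y1 y2 y3 := type2_mul a b c x0 x1 x2 x3 y0 y1 y2 y3.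
have Pid : is_ideal (coord_set F evP).
  apply: coord_ideal => //; first by exists 0; ring.
    move=> x0 x1 x2 x3 y0 y1 y2 y3 /evenD H /H [l lE]; exists l; rewrite -lE; ring.
  move=> x0 x1 x2 x3 y0 y1 y2 y3 [l lE]; rewrite FM; do 4 eexists; split; first reflexivity.
  have [l' M'] := M x0 x1 x2 x3 y0 y1 y2 y3; rewrite /evP M' lE.
  by exists ((x0 + x1 + x3) * l + l'); ring.
have [_ _ PPD PPM] := ideal_mul_ideal Pid Pid.
have P2 (n : int) : coord_set F evP (F (2 * n) 0 0 0).
  by exists (2 * n), 0, 0, 0; split=> //; exists n; ring.
have PP2 : ideal_mul (coord_set F evP) (coord_set F evP) 2%:R.
  (* Since [s^2 = al ga] is 2 modulo 4, the number 2 is [s^2] plus a multiple of 4, and both [s] and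
     2 lie in [P]. *)
  have -> : 2%:R = F 0 0 1 0 * F 0 0 1 0 + F (2 * 1) 0 0 0 * F (2 * - (a * (4 * c + 3) + 2 * c + 1)) 0 0 0.
    by rewrite -[LHS](Fint 2) !FM FD; congr (F _ _ _ _); ring.
  by apply: ideal_mul_add; apply: ideal_mul_in; rewrite ?P2 //; exists 0, 0, 1, 0; split=> //; exists 0.
apply: (@ramifies_two_of _ (coord_set F evP) (coord_set F evP) (coord_set F evI) (F 1 1 0 0)
  (F (-1) 0 0 0) (F (- (4 * b * c + 3 * b + c)) 0 0 0)) => //.
- split=> //.
    move=> [x0 [x1 [x2 [x3 [E ev]]]]]; have {}E : F 1 0 0 0 = F x0 x1 x2 x3 by rewrite Fint -E.
    by case: (Finj _ _ _ _ _ _ _ _ E) => e0 e1 _ e3; case: ev => l; rewrite -e0 -e1 -e3; clear; lia.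
  move=> _ _ /FO[x0 [x1 [x2 [x3 ->]]]] /FO[y0 [y1 [y2 [y3 ->]]]] [z0 [z1 [z2 [z3 [E ev]]]]].
  rewrite FM in E; case: (Finj _ _ _ _ _ _ _ _ E) => e0 e1 _ e3.
  have [l' M'] := M x0 x1 x2 x3 y0 y1 y2 y3; case: ev => l; rewrite -e0 -e1 -e3 M' => L.
  have [m [m0|m1]] := int_parity (x0 + x1 + x3).
    by left; exists x0, x1, x2, x3; split=> //; exists m.
  right; exists y0, y1, y2, y3; split=> //; apply: even_of => m' m1'.
  by rewrite m1 m1' in L; clear -L; lia.
- move=> _ _ [x0 [x1 [x2 [x3 [-> [m X0]]]]]] [y0 [y1 [y2 [y3 [-> [m' Y0]]]]]].
  rewrite FM; do 4 eexists; split; first reflexivity.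
  have [k3 K3] := @type2_prime_square c x0 x1 x2 x3 y0 y1 y2 y3 m m' X0 Y0.
  have [l' M'] := M x0 x1 x2 x3 y0 y1 y2 y3; rewrite X0 Y0 in M'.
  split; last by exists k3.
  exists (2 * m * m' + l' - k3); rewrite K3 in M'.
  by apply: (@addIr _ (2 * k3)); rewrite M'; ring.
- move=> _ _ [x0 [x1 [x2 [x3 [-> [[m X0] [n X1]]]]]]] [y0 [y1 [y2 [y3 [-> [[m' Y0] [n' Y1]]]]]]].
  have [[k0 K0] [k1 K1] [k2 K2] [k3 K3]] := @type2_square a b c x0 x1 x2 x3 y0 y1 y2 y3 _ _ _ _ X0 X1 Y0 Y1.
  by rewrite FM K0 K1 K2 K3 F2; exists (F k0 k1 k2 k3).
(* Up to a multiple of 2, [1 + r] is the square of [(s + t) / 2 - 1], an element of [P]. *)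
- have -> : F 1 1 0 0 = F (-1) 0 0 1 * F (-1) 0 0 1 + F (- ((2 * a + 1) * (b + c + 1))) (- a) 0 1 * 2%:R.
    by rewrite [F (- (_ * _)) _ _ _ * _]mulrC -F2 !FM FD; congr (F _ _ _ _); ring.
  apply: ideal_mul_add; last exact: PPM.
  by apply: ideal_mul_in; exists (-1), 0, 0, 1; split=> //; exists 0.
(* Here [(1 + r)^2 - 2 (1 + r) = be ga - 1], which is 2 modulo 4. *)
- rewrite -[LHS](Fint 2) [F 1 1 0 0 * (_ * _)]mulrCA !FM -!F2 !FD.
  by congr (F _ _ _ _); ring.
Qed.

End RamificationOfTypes.

(** * Shapes *)

Section RootArithmetic.
Variable R : realFieldType.
Implicit Types (E F : R) (a b : nat).

(** All pairs with product at most 4 that vanish together, as in the classification of root systems.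
    A reflection vector of square [F] with coordinates [m_i / 2] along orthogonal axes of squares
    [E_i] has integers [n_i] with [n_i F = m_i E_i], whence the [m_i n_i] sum to 4; [a] and [b] are
    their absolute values. *)
Let factors : seq (nat * nat) :=
  [:: (0, 0); (1, 1); (1, 2); (2, 1); (1, 3); (3, 1); (1, 4); (2, 2); (4, 1)]%N.

Lemma small_factors (a b p : nat) : (a == 0) = (b == 0) -> (a * b + p = 4)%N ->
  (a, b) \in factors.
Proof.
move=> ab0 E.
have [a0|a0] := posnP a; first by move: ab0; rewrite a0 eqxx => /esym/eqP ->.
have b0 : (0 < b)%N by rewrite lt0n -ab0 -lt0n.
have a4 : (a <= 4)%N by rewrite (leq_trans (leq_pmulr a b0)) // -E leq_addr.
have b4 : (b <= 4)%N by rewrite (leq_trans (leq_pmull b a0)) // -E leq_addr.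
by move: a b a4 b4 a0 b0 E {ab0} => [|[|[|[|[|a]]]]] // [|[|[|[|[|b]]]]].
Qed.

Lemma ratio_eq0 (E F : R) (a b : nat) : 0 < F -> 0 < E -> b%:R * F = a%:R * E -> (a == 0%N) = (b == 0%N).
Proof.
move=> F0 E0 /(congr1 (fun t => t == 0)).
by rewrite !mulf_eq0 !pnatr_eq0 (gt_eqF F0) (gt_eqF E0) !orbF.
Qed.

(** The parity conditions say that the vector lies in the body-centred lattice and pairs integrally
    with the centring vector. The finite search leaves nine cases, and in each of them the strict
    order of the [E_i] leaves an axis length or a contradiction. *)
Lemma root_oI (E1 E2 E3 F : R) a1 a2 a3 b1 b2 b3 : 0 < F -> 0 < E1 -> E1 < E2 -> E2 < E3 ->
  b1%:R * F = a1%:R * E1 -> b2%:R * F = a2%:R * E2 -> b3%:R * F = a3%:R * E3 ->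
  (a1 * b1 + a2 * b2 + a3 * b3 = 4)%N -> odd a1 = odd a2 -> odd a2 = odd a3 ->
  odd (b1 + b2 + b3) = false -> [\/ F = E1, F = E2 | F = E3].
Proof.
move=> F0 e1 e2 e3 H1 H2 H3 S p12 p23 pb.
have E20 := lt_trans e1 e2; have E30 := lt_trans E20 e3.
have m1 : (a1, b1) \in factors by apply: small_factors (ratio_eq0 F0 e1 H1) _; rewrite -S -addnA.
have m2 : (a2, b2) \in factors.
  by apply: small_factors (ratio_eq0 F0 E20 H2) _; rewrite -S [(a1 * b1 + _)%N]addnC -addnA.
have m3 : (a3, b3) \in factors by apply: small_factors (ratio_eq0 F0 E30 H3) _; rewrite -S addnC.
have /allP/(_ _ m1)/allP/(_ _ m2)/allP/(_ _ m3)/implyP : all (fun t1 => all (fun t2 => all (fun t3 =>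
  [&& t1.1 * t1.2 + t2.1 * t2.2 + t3.1 * t3.2 == 4, odd t1.1 == odd t2.1, odd t2.1 == odd t3.1
    & odd (t1.2 + t2.2 + t3.2) == false]%N ==> ((t1, t2, t3) \in
  [:: (0, 0, (0, 0), (2, 2)); (0, 0, (2, 1), (2, 1)); (0, 0, (2, 2), (0, 0)); (1, 1, (1, 1), (1, 2));
   (1, 1, (1, 2), (1, 1)); (1, 2, (1, 1), (1, 1)); (2, 1, (0, 0), (2, 1)); (2, 1, (2, 1), (0, 0));
   (2, 2, (0, 0), (0, 0))]%N)) factors) factors) factors by vm_compute.
rewrite /= S p12 p23 pb !eqxx => /(_ isT); rewrite !inE.
do 8 (case/predU1P => [[? ? ? ? ? ?]|]; first (subst;
  first [by apply: Or31; lra|by apply: Or32; lra|by apply: Or33; lra|by exfalso; lra])).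
by move=> /eqP[? ? ? ? ? ?]; subst; apply: Or31; lra.
Qed.

Lemma root_oC_axis (E1 E2 E3 F : R) a1 a2 a3 b1 b2 b3 : 0 < F -> 0 < E1 -> 0 < E2 -> 0 < E3 ->
  b1%:R * F = a1%:R * E1 -> b2%:R * F = a2%:R * E2 -> b3%:R * F = (2 * a3)%:R * E3 ->
  (a1 * b1 + a2 * b2 + 2 * (a3 * b3) = 4)%N -> odd a1 = odd a2 ->
  odd b1 = false -> odd b2 = false -> odd b3 = false -> (4 %| b1 + b2)%N ->
  [/\ a1 = 0%N, a2 = 0%N & F = E3] \/ E1 = 2 * F /\ E2 = 2 * F.
Proof.
move=> F0 e1 e2 e3 H1 H2 H3 S p12 pb1 pb2 pb3 d4.
have m1 : (a1, b1) \in factors by apply: small_factors (ratio_eq0 F0 e1 H1) _; rewrite -S -addnA.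
have m2 : (a2, b2) \in factors.
  by apply: small_factors (ratio_eq0 F0 e2 H2) _; rewrite -S [(a1 * b1 + _)%N]addnC -addnA.
have m3 : (a3, b3) \in factors.
  apply: (@small_factors _ _ (a1 * b1 + a2 * b2 + a3 * b3)%N); last by clear -S; lia.
  by rewrite -(ratio_eq0 F0 e3 H3) muln_eq0.
have /allP/(_ _ m1)/allP/(_ _ m2)/allP/(_ _ m3)/implyP : all (fun t1 => all (fun t2 => all (fun t3 =>
  [&& t1.1 * t1.2 + t2.1 * t2.2 + 2 * (t3.1 * t3.2) == 4, odd t1.1 == odd t2.1, odd t1.2 == false,
    odd t2.2 == false, odd t3.2 == false & 4 %| t1.2 + t2.2]%N ==> ((t1, t2, t3) \in
  [:: (0, 0, (0, 0), (1, 2)); (1, 2, (1, 2), (0, 0))]%N)) factors) factors) factors by vm_compute.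
rewrite /= S p12 pb1 pb2 pb3 d4 !eqxx => /(_ isT); rewrite !inE.
case/predU1P => [[? ? ? ? ? ?]|/eqP[? ? ? ? ? ?]]; subst.
  by left; split=> //; lra.
by right; split; lra.
Qed.

(** The last alternative is the centred square lattice, where half a diagonal is again a reflection
    vector. The excluded coefficients 2, 2 belong to a full diagonal, which is twice a lattice
    vector. *)
Lemma root_oC_plane (E1 E2 F : R) a1 a2 b1 b2 : 0 < F -> 0 < E1 -> 0 < E2 ->
  b1%:R * F = a1%:R * E1 -> b2%:R * F = a2%:R * E2 ->
  (a1 * b1 + a2 * b2 = 4)%N -> odd a1 = odd a2 -> odd (b1 + b2) = false ->
  ~ (a1 = 2%N /\ a2 = 2%N) ->
  [\/ F = E1, F = E2 | E1 = 2 * F /\ E2 = 2 * F].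
Proof.
move=> F0 e1 e2 H1 H2 S p12 pb n22.
have m1 : (a1, b1) \in factors by apply: small_factors (ratio_eq0 F0 e1 H1) _; rewrite -S.
have m2 : (a2, b2) \in factors.
  by apply: small_factors (ratio_eq0 F0 e2 H2) _; rewrite -S addnC.
have /allP/(_ _ m1)/allP/(_ _ m2)/implyP : all (fun t1 => all (fun t2 =>
  [&& t1.1 * t1.2 + t2.1 * t2.2 == 4, odd t1.1 == odd t2.1, odd (t1.2 + t2.2) == false
   & ~~ ((t1.1 == 2) && (t2.1 == 2))]%N ==> ((t1, t2) \in
  [:: (0, 0, (2, 2)); (1, 1, (1, 3)); (1, 1, (3, 1)); (1, 2, (1, 2)); (1, 3, (1, 1)); (3, 1, (1, 1));
      (2, 2, (0, 0))]%N)) factors) factors by vm_compute.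
have -> : (a1 == 2%N) && (a2 == 2%N) = false by apply/negP => /andP[/eqP ? /eqP ?]; apply: n22.
rewrite /= S p12 pb !eqxx => /(_ isT); rewrite !inE.
do 6 (case/predU1P => [[? ? ? ?]|]; first (subst;
  first [by apply: Or31; lra|by apply: Or32; lra|by apply: Or33; split; lra])).
by move=> /eqP[? ? ? ?]; subst; apply: Or31; lra.
Qed.

End RootArithmetic.

(** * The shape determines its coordinates *)

Section ShapeInjective.
Variable R : realType.
Implicit Types (x y c : R).

Definition dot3 (u v : 'rV[R]_3) : R := (u *m v^T) 0 0.

Local Notation j0 := (@Ordinal 3 0 isT).
Local Notation j1 := (@Ordinal 3 1 isT).
Local Notation j2 := (@Ordinal 3 2 isT).

Lemma sum_ord3 (V : nmodType) (F : 'I_3 -> V) : \sum_i F i = F j0 + F j1 + F j2.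
Proof.
rewrite !big_ord_recl big_ord0 addr0 !addrA.
by congr (F _ + F _ + F _); apply: val_inj.
Qed.

Lemma row3P (u v : 'rV[R]_3) : u 0 j0 = v 0 j0 -> u 0 j1 = v 0 j1 -> u 0 j2 = v 0 j2 -> u = v.
Proof.
move=> h0 h1 h2; apply/rowP => -[[|[|[|//]]] i].
- by rewrite (_ : Ordinal i = j0) //; apply: val_inj.
- by rewrite (_ : Ordinal i = j1) //; apply: val_inj.
- by rewrite (_ : Ordinal i = j2) //; apply: val_inj.
Qed.

Lemma vec3D a b c a' b' c' : vec3 a b c + vec3 a' b' c' = vec3 (a + a') (b + b') (c + c') :> 'rV[R]_3.
Proof. by apply: row3P; rewrite !mxE. Qed.

Lemma vec3Z k a b c : k *: vec3 a b c = vec3 (k * a) (k * b) (k * c) :> 'rV[R]_3.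
Proof. by apply: row3P; rewrite !mxE. Qed.

Lemma vec3Mz a b c (n : int) :
  vec3 a b c *~ n = vec3 (n%:~R * a) (n%:~R * b) (n%:~R * c) :> 'rV[R]_3.
Proof. by rewrite -scaler_int vec3Z. Qed.

Lemma dot3E a b c a' b' c' : dot3 (vec3 a b c) (vec3 a' b' c') = a * a' + b * b' + c * c'.
Proof. by rewrite /dot3 mxE sum_ord3 !mxE. Qed.

Definition lat_oI x y : set 'rV[R]_3 := [set v | inIntSpan
  [tuple vec3 x 0 0; vec3 0 y 0; vec3 0 0 1; vec3 (x / 2) (y / 2) (1 / 2)] v].
Definition lat_oC x y : set 'rV[R]_3 := [set v | inIntSpan
  [tuple vec3 x 0 0; vec3 0 y 0; vec3 0 0 1; vec3 (x / 2) (y / 2) 0] v].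

Lemma sum4 (V : nmodType) (F : 'I_4 -> V) : \sum_i F i =
  F (@Ordinal 4 0 isT) + F (@Ordinal 4 1 isT) + F (@Ordinal 4 2 isT) + F (@Ordinal 4 3 isT).
Proof.
rewrite !big_ord_recl big_ord0 addr0 !addrA.
by congr (F _ + F _ + F _ + F _); apply: val_inj.
Qed.

Lemma lat_oIP x y v : lat_oI x y v <-> exists m1 m2 m3 k l : int, [/\ m1 = m3 + 2 * k, m2 = m3 + 2 * l &
  v = vec3 (m1%:~R / 2 * x) (m2%:~R / 2 * y) (m3%:~R / 2)].
Proof.
split.
  move=> [a ->]; rewrite sum4 /= !vec3Mz !vec3D.
  set a0 := a _; set a1 := a _; set a2 := a _; set a3 := a _.
  exists (2 * a0 + a3), (2 * a1 + a3), (2 * a2 + a3), (a0 - a2), (a1 - a2); split; try ring.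
  by congr vec3; field.
move=> [m1 [m2 [m3 [k [l [-> -> ->]]]]]].
exists [ffun i : 'I_4 => [:: k; l; 0; m3]`_i].
rewrite sum4 !ffunE /= !vec3Mz !vec3D; congr vec3; by field.
Qed.

Lemma lat_oCP x y v : lat_oC x y v <-> exists m1 m2 m3 k : int, m1 = m2 + 2 * k /\
  v = vec3 (m1%:~R / 2 * x) (m2%:~R / 2 * y) m3%:~R.
Proof.
split.
  move=> [a ->]; rewrite sum4 /= !vec3Mz !vec3D.
  set a0 := a _; set a1 := a _; set a2 := a _; set a3 := a _.
  exists (2 * a0 + a3), (2 * a1 + a3), a2, (a0 - a1); split; first by ring.
  by congr vec3; field.
move=> [m1 [m2 [m3 [k [-> ->]]]]].
exists [ffun i : 'I_4 => [:: k; 0; m3; m2]`_i].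
rewrite sum4 !ffunE /= !vec3Mz !vec3D; congr vec3; by field.
Qed.

Definition similar (Q : 'M[R]_3) c (L L' : set 'rV[R]_3) :=
  [/\ Q *m Q^T = 1%:M, c != 0 & L' = [set c *: (v *m Q) | v in L]].

Lemma lattice_shape_similar (L L' : set 'rV[R]_3) : lattice_shape L = lattice_shape L' ->
  exists Q c, similar Q c L L'.
Proof.
move=> E; have : lattice_shape L' L'.
  exists 1%:M, 1; split; [by rewrite trmx1 mulmx1|exact: oner_neq0|].
  apply/seteqP; split=> v /=; first by move=> Lv; exists v => //; rewrite mulmx1 scale1r.
  by move=> [w Lw <-]; rewrite mulmx1 scale1r.
by rewrite -E => -[Q [c [QQ c0 LE]]]; exists Q, c.
Qed.

Lemma similar_sym Q c (L L' : set 'rV[R]_3) : similar Q c L L' -> similar Q^T c^-1 L' L.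
Proof.
move=> [QQ c0 ->]; split; [by rewrite trmxK (mulmx1C QQ)|by rewrite invr_eq0|].
have K v : c^-1 *: (c *: (v *m Q) *m Q^T) = v.
  by rewrite -scalemxAl scalerA mulVf // scale1r -mulmxA QQ mulmx1.
apply/seteqP; split=> v /=.
  by move=> Lv; exists (c *: (v *m Q)); [exists v|exact: K].
by move=> [_ [w Lw <-] <-]; rewrite K.
Qed.

Lemma similar_trans_shape Q c (L L' : set 'rV[R]_3) : similar Q c L L' ->
  lattice_shape L = lattice_shape L'.
Proof.
suff H Q1 c1 L1 L1' : similar Q1 c1 L1 L1' -> lattice_shape L1' `<=` lattice_shape L1.
  by move=> s; apply/seteqP; split; apply: H; [exact: similar_sym s|exact: s].
move=> [QQ c0 ->] L2 [Q2 [c2 [QQ2 c20 ->]]]; exists (Q1 *m Q2), (c2 * c1); split.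
- by rewrite trmx_mul mulmxA -[Q1 *m Q2 *m _]mulmxA QQ2 mulmx1.
- by rewrite mulf_neq0.
apply/seteqP; split=> v /=.
  by move=> [_ [w Lw <-] <-]; exists w => //; rewrite -scalemxAl scalerA mulmxA.
by move=> [w Lw <-]; exists (c1 *: (w *m Q1)); [exists w|rewrite -scalemxAl scalerA mulmxA].
Qed.

Lemma dot3_similar Q c (L L' : set 'rV[R]_3) u v : similar Q c L L' ->
  dot3 (c *: (u *m Q)) (c *: (v *m Q)) = c ^+ 2 * dot3 u v.
Proof.
move=> [QQ c0 _]; rewrite /dot3 linearZ /= -scalemxAl -scalemxAr scalerA mxE expr2.
by rewrite trmx_mul mulmxA -[u *m Q *m _]mulmxA QQ mulmx1.
Qed.

(* [f] is a root of [L]: the reflection in [f] has integral coefficients on [L]. *)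
Definition root (L : set 'rV[R]_3) (f : 'rV[R]_3) :=
  forall u, L u -> exists n : int, 2 * dot3 f u = n%:~R * dot3 f f.

Lemma root_similar Q c (L L' : set 'rV[R]_3) f : similar Q c L L' ->
  root L' (c *: (f *m Q)) -> root L f.
Proof.
move=> s rf u Lu; have [_ c0 LE] := s.
have [|n] := rf (c *: (u *m Q)); first by rewrite LE; exists u.
rewrite !(dot3_similar _ _ s) => E; exists n.
by apply: (@mulfI _ (c ^+ 2)); rewrite ?expf_neq0 // mulrCA E; ring.
Qed.

(** Corresponding coefficients have equal signs, which lets the search run over natural numbers. *)
Lemma abs_ratio (E F : R) (m n : int) : 0 < F -> 0 < E -> n%:~R * F = m%:~R * E ->
  `|n|%N%:R * F = `|m|%N%:R * E /\ m * n = (`|m| * `|n|)%N%:Z.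
Proof.
move=> F0 E0 H.
have mn0 : 0 <= m * n.
  rewrite -(ler0z R) intrM -(pmulr_lge0 _ F0).
  have -> : m%:~R * n%:~R * F = m%:~R * (n%:~R * F) by rewrite mulrA.
  by rewrite H mulrA mulr_ge0 ?(ltW E0) // -expr2 sqr_ge0.
split; last by rewrite PoszM !abszE -normrM ger0_norm.
by rewrite !natr_absz !intr_norm -{1}(gtr0_norm F0) -{1}(gtr0_norm E0) -!normrM H.
Qed.

Lemma odd_absz (m n k : int) : m = n + 2 * k -> odd `|m|%N = odd `|n|%N.
Proof. by lia. Qed.

Lemma sqrtr_inj_pos (a b : R) : 0 < a -> 0 < b -> a ^+ 2 = b ^+ 2 -> a = b.
Proof. by move=> a0 b0 /eqP; rewrite eqrXn2 ?ltW // => /eqP. Qed.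

(** Testing the reflection on the three axes and on the centring vector yields the integers and
    parities that [root_oI] requires. *)
Lemma oI_root x y f : 0 < x -> x < y -> y < 1 -> lat_oI x y f -> root (lat_oI x y) f ->
  0 < dot3 f f -> [\/ dot3 f f = x ^+ 2, dot3 f f = y ^+ 2 | dot3 f f = 1].
Proof.
move=> x0 xy y1 /lat_oIP[m1 [m2 [m3 [k [l [K L fE]]]]]]; rewrite /root.
have y0 := lt_trans x0 xy.
have := dot3E (m1%:~R / 2 * x) (m2%:~R / 2 * y) (m3%:~R / 2) (m1%:~R / 2 * x) (m2%:~R / 2 * y) (m3%:~R / 2).
rewrite -fE; move: (dot3 f f) => F FE rf F0; rewrite fE in rf.
have [|n1] := rf (vec3 x 0 0).
  by apply/lat_oIP; exists 2, 0, 0, 1, 0; split=> //; congr vec3; field.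
have [|n2] := rf (vec3 0 y 0).
  by apply/lat_oIP; exists 0, 2, 0, 0, 1; split=> //; congr vec3; field.
have [|n3] := rf (vec3 0 0 1).
  by apply/lat_oIP; exists 0, 0, 2, (-1), (-1); split=> //; congr vec3; field.
have [|n4] := rf (vec3 (x / 2) (y / 2) (1 / 2)).
  by apply/lat_oIP; exists 1, 1, 1, 0, 0; split=> //; congr vec3; field.
rewrite !dot3E {rf f fE} => N4 N3 N2 N1.
have {}N1 : n1%:~R * F = m1%:~R * x ^+ 2 by rewrite -N1; field.
have {}N2 : n2%:~R * F = m2%:~R * y ^+ 2 by rewrite -N2; field.
have {}N3 : n3%:~R * F = m3%:~R * 1 by rewrite -N3; field.
have n123 : n1 + n2 + n3 = 2 * n4.
  apply/eqP; rewrite -(eqr_int R); apply/eqP; apply: (@mulIf _ F); first by rewrite gt_eqF.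
  transitivity (n1%:~R * F + n2%:~R * F + n3%:~R * F); first by ring.
  rewrite intrM -mulrA -N4 N1 N2 N3; by field.
have S4 : m1 * n1 + m2 * n2 + m3 * n3 = 4.
  apply/eqP; rewrite -(eqr_int R); apply/eqP; apply: (@mulIf _ F); first by rewrite gt_eqF.
  transitivity (m1%:~R * (n1%:~R * F) + m2%:~R * (n2%:~R * F) + m3%:~R * (n3%:~R * F)); first by ring.
  rewrite N1 N2 N3 FE; by field.
have [A1 B1] := abs_ratio F0 (exprn_gt0 2 x0) N1.
have [A2 B2] := abs_ratio F0 (exprn_gt0 2 y0) N2.
have [A3 B3] := abs_ratio F0 ltr01 N3.
apply: (root_oI F0 _ _ _ A1 A2 A3).
- exact: exprn_gt0.
- by rewrite ltrXn2r ?ltW ?nnegrE.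
- by rewrite expr_lt1 ?ltW.
- by apply/eqP; rewrite -eqz_nat !PoszD -B1 -B2 -B3 S4.
- by rewrite (odd_absz K) (odd_absz L).
- exact: odd_absz L.
- by move: n123; clear; lia.
Qed.

Lemma oC_root x y f : 0 < x -> 0 < y -> lat_oC x y f -> root (lat_oC x y) f ->
  0 < dot3 f f -> ~ lat_oC x y (2^-1 *: f) -> f 0 j2 = 0 ->
  [\/ dot3 f f = x ^+ 2, dot3 f f = y ^+ 2 | x ^+ 2 = 2 * dot3 f f /\ y ^+ 2 = 2 * dot3 f f].
Proof.
move=> x0 y0 /lat_oCP[m1 [m2 [m3 [k [K fE]]]]] rf F0 nf f3.
have m30 : m3 = 0 by move: f3; rewrite fE mxE /= => /eqP; rewrite intr_eq0 => /eqP.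
rewrite m30 in fE.
have n22 : ~ (`|m1|%N = 2%N /\ `|m2|%N = 2%N).
  move=> [M1 M2]; apply: nf; apply/lat_oCP.
  have [m1' [m2' [k' [M1' M2' K']]]] : exists m1' m2' k', [/\ m1 = 2 * m1', m2 = 2 * m2' & m1' = m2' + 2 * k'].
    have : m1 = 2 \/ m1 = -2 by clear -M1; lia.
    have : m2 = 2 \/ m2 = -2 by clear -M2; lia.
    by case=> ->; case=> ->; [exists 1, 1, 0|exists (-1), 1, (-1)|exists 1, (-1), 1|exists (-1), (-1), 0].
  exists m1', m2', 0, k'; split=> //; rewrite fE vec3Z M1' M2'; congr vec3; by field.
move: rf F0; rewrite /root.
have := dot3E (m1%:~R / 2 * x) (m2%:~R / 2 * y) 0 (m1%:~R / 2 * x) (m2%:~R / 2 * y) 0.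
rewrite -[vec3 _ _ _]fE; move: (dot3 f f) => F FE rf F0; rewrite fE in rf.
have [|n1] := rf (vec3 x 0 0).
  by apply/lat_oCP; exists 2, 0, 0, 1; split=> //; congr vec3; field.
have [|n2] := rf (vec3 0 y 0).
  by apply/lat_oCP; exists 0, 2, 0, (-1); split=> //; congr vec3; field.
have [|n4] := rf (vec3 (x / 2) (y / 2) 0).
  by apply/lat_oCP; exists 1, 1, 0, 0; split=> //; congr vec3; field.
rewrite !dot3E {rf} => N4 N2 N1.
have {}N1 : n1%:~R * F = m1%:~R * x ^+ 2 by rewrite -N1; field.
have {}N2 : n2%:~R * F = m2%:~R * y ^+ 2 by rewrite -N2; field.
have n12 : n1 + n2 = 2 * n4.
  apply/eqP; rewrite -(eqr_int R); apply/eqP; apply: (@mulIf _ F); first by rewrite gt_eqF.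
  transitivity (n1%:~R * F + n2%:~R * F); first by ring.
  rewrite intrM -mulrA -N4 N1 N2; by field.
have S4 : m1 * n1 + m2 * n2 = 4.
  apply/eqP; rewrite -(eqr_int R); apply/eqP; apply: (@mulIf _ F); first by rewrite gt_eqF.
  transitivity (m1%:~R * (n1%:~R * F) + m2%:~R * (n2%:~R * F)); first by ring.
  rewrite N1 N2 FE; by field.
have [A1 B1] := abs_ratio F0 (exprn_gt0 2 x0) N1.
have [A2 B2] := abs_ratio F0 (exprn_gt0 2 y0) N2.
apply: (root_oC_plane F0 _ _ A1 A2) => //.
- exact: exprn_gt0.
- exact: exprn_gt0.
- by apply/eqP; rewrite -eqz_nat !PoszD -B1 -B2 S4.
- exact: odd_absz K.
- by move: n12; clear; lia.
Qed.

(** The condition on [f] says that it splits off as an orthogonal summand, as [(0, 0, 1)] does. The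
    only competitor is half a diagonal when [x = y]. *)
Lemma oC_axis_root x y f : 0 < x -> 0 < y -> lat_oC x y f ->
  (forall u, lat_oC x y u -> exists n : int, dot3 f u = n%:~R * dot3 f f) -> 0 < dot3 f f ->
  [/\ f 0 j0 = 0, f 0 j1 = 0 & dot3 f f = 1] \/ x ^+ 2 = 2 * dot3 f f /\ y ^+ 2 = 2 * dot3 f f.
Proof.
move=> x0 y0 /lat_oCP[m1 [m2 [m3 [k [K fE]]]]].
have := dot3E (m1%:~R / 2 * x) (m2%:~R / 2 * y) m3%:~R (m1%:~R / 2 * x) (m2%:~R / 2 * y) m3%:~R.
rewrite -fE; move: (dot3 f f) => F FE rf F0; rewrite fE in rf.
have [|n1] := rf (vec3 x 0 0).
  by apply/lat_oCP; exists 2, 0, 0, 1; split=> //; congr vec3; field.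
have [|n2] := rf (vec3 0 y 0).
  by apply/lat_oCP; exists 0, 2, 0, (-1); split=> //; congr vec3; field.
have [|n3] := rf (vec3 0 0 1).
  by apply/lat_oCP; exists 0, 0, 1, 0; split=> //; congr vec3; field.
have [|n4] := rf (vec3 (x / 2) (y / 2) 0).
  by apply/lat_oCP; exists 1, 1, 0, 0; split=> //; congr vec3; field.
rewrite !dot3E {rf} => N4 N3 N2 N1.
have {}N1 : (2 * n1)%:~R * F = m1%:~R * x ^+ 2 by rewrite intrM -mulrA -N1; field.
have {}N2 : (2 * n2)%:~R * F = m2%:~R * y ^+ 2 by rewrite intrM -mulrA -N2; field.
have {}N3 : (2 * n3)%:~R * F = (2 * m3)%:~R * 1 by rewrite !intrM -mulrA -N3; field.
have n12 : n1 + n2 = 2 * n4.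
  apply/eqP; rewrite -(eqr_int R); apply/eqP; apply: (@mulIf _ F); first by rewrite gt_eqF.
  transitivity (((2 * n1)%:~R * F + (2 * n2)%:~R * F) / 2); first by field.
  have -> : (2 * n4)%:~R * F = 2 * (n4%:~R * F) by ring.
  by rewrite -N4 N1 N2; field.
have S4 : m1 * (2 * n1) + m2 * (2 * n2) + (2 * m3) * (2 * n3) = 4.
  apply/eqP; rewrite -(eqr_int R); apply/eqP; apply: (@mulIf _ F); first by rewrite gt_eqF.
  transitivity (m1%:~R * ((2 * n1)%:~R * F) + m2%:~R * ((2 * n2)%:~R * F) + (2 * m3)%:~R * ((2 * n3)%:~R * F)); first by ring.
  rewrite N1 N2 N3 FE; by field.
have [A1 B1] := abs_ratio F0 (exprn_gt0 2 x0) N1.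
have [A2 B2] := abs_ratio F0 (exprn_gt0 2 y0) N2.
have [A3 B3] := abs_ratio F0 ltr01 N3.
rewrite B1 B2 B3 in S4.
rewrite !abszM in A1 A2 A3 S4.
have [||||||[z1 z2 FE1]|] := root_oC_axis F0 (exprn_gt0 2 x0) (exprn_gt0 2 y0) ltr01 A1 A2 A3.
- by move: S4; clear; lia.
- exact: odd_absz K.
- by rewrite oddM.
- by rewrite oddM.
- by rewrite oddM.
- by move: n12; clear; lia.
- left; split=> //; rewrite fE mxE /=.
    by move/eqP: z1; rewrite absz_eq0 => /eqP ->; rewrite !mul0r.
  by move/eqP: z2; rewrite absz_eq0 => /eqP ->; rewrite !mul0r.
- by right.
Qed.

Lemma oI_axis_root x y : [/\ root (lat_oI x y) (vec3 x 0 0), root (lat_oI x y) (vec3 0 y 0)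
  & root (lat_oI x y) (vec3 0 0 1)].
Proof.
by split=> u /lat_oIP[m1 [m2 [m3 [k [l [_ _ ->]]]]]]; rewrite !dot3E;
  [exists m1|exists m2|exists m3]; field.
Qed.

Lemma lat_oI_axis x y : [/\ lat_oI x y (vec3 x 0 0), lat_oI x y (vec3 0 y 0) & lat_oI x y (vec3 0 0 1)].
Proof.
split; apply/lat_oIP.
- by exists 2, 0, 0, 1, 0; split=> //; congr vec3; field.
- by exists 0, 2, 0, 0, 1; split=> //; congr vec3; field.
- by exists 0, 0, 2, (-1), (-1); split=> //; congr vec3; field.
Qed.

(** Axis vectors of one lattice pull back to reflection vectors of the other, so the squared lengths
    agree up to [c^2]. On both sides they are strictly ordered with largest member 1 before scaling,
    hence agree termwise. *)
Lemma sh_oI_inj (p q : R * R) : S_oI R p -> S_oI R q -> sh_oI p.1 p.2 = sh_oI q.1 q.2 -> p = q.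
Proof.
case: p q => [x y] [x' y'] [/= x0 xy y1] [/= x0' xy' y1'] /lattice_shape_similar[Q [c s]].
have [_ c0 LE] := s; have k0 : 0 < c ^+ 2 by rewrite exprn_even_gt0.
have [r1 r2 r3] := oI_axis_root x' y'; have [l1 l2 l3] := lat_oI_axis x' y'.
have ax e : lat_oI x' y' e -> root (lat_oI x' y') e -> 0 < dot3 e e ->
    [\/ dot3 e e = c ^+ 2 * x ^+ 2, dot3 e e = c ^+ 2 * y ^+ 2 | dot3 e e = c ^+ 2].
  rewrite [X in X -> _](_ : _ = [set c *: (v *m Q) | v in lat_oI x y] e); last by rewrite -LE.
  move=> [f Lf <-] /(root_similar s) rf; rewrite (dot3_similar _ _ s) pmulr_rgt0 // => F0.
  by have [->|->|->] := oI_root x0 xy y1 Lf rf F0; [apply: Or31|apply: Or32|apply: Or33; rewrite mulr1].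
have y0 := lt_trans x0 xy; have y0' := lt_trans x0' xy'.
have := ax _ l1 r1; have := ax _ l2 r2; have := ax _ l3 r3.
rewrite !dot3E !mul0r !addr0 !add0r -!expr2 expr1n => /(_ ltr01) A3 /(_ (exprn_gt0 2 y0')) A2 /(_ (exprn_gt0 2 x0')) A1.
have XY : c ^+ 2 * x ^+ 2 < c ^+ 2 * y ^+ 2 by rewrite ltr_pM2l // ltrXn2r ?ltW ?nnegrE.
have Y1 : c ^+ 2 * y ^+ 2 < c ^+ 2 by rewrite gtr_pMr // expr_lt1 ?ltW.
have XY' : x' ^+ 2 < y' ^+ 2 by rewrite ltrXn2r ?ltW ?nnegrE.
have Y1' : y' ^+ 2 < 1 by rewrite expr_lt1 ?ltW.
clear ax r1 r2 r3 l1 l2 l3 s LE.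
have k1 : c ^+ 2 = 1 by case: A1 A2 A3 => A1 [] A2 [] A3; lra.
rewrite k1 !mul1r in A1 A2 XY Y1.
have EX : x ^+ 2 = x' ^+ 2 by case: A1 A2 => A1 [] A2; lra.
have EY : y ^+ 2 = y' ^+ 2 by case: A1 A2 => A1 [] A2; lra.
by rewrite (sqrtr_inj_pos x0 x0' EX) (sqrtr_inj_pos y0 y0' EY).
Qed.

Definition basis_oC x y : 'M[R]_3 :=
  \matrix_(i < 3, j < 3) (nth [::] [:: [:: x; 0; 0]; [:: x / 2; y / 2; 0]; [:: 0; 0; 1]] i)`_j.

Lemma det_basis_oC x y : \det (basis_oC x y) = x * y / 2.
Proof.
rewrite det_trig; first by rewrite !big_ord_recl big_ord0 !mxE /=; ring.
by apply/is_trig_mxP => -[[|[|[|i]]] ilt] [[|[|[|j]]] jlt]; rewrite ?mxE //=.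
Qed.

Lemma basis_oCP x y v : lat_oC x y v <-> exists z : 'rV[int]_3, v = map_mx intr z *m basis_oC x y.
Proof.
split.
  move=> /lat_oCP[m1 [m2 [m3 [k [-> ->]]]]].
  exists (\row_(j < 3) [:: k; m2; m3]`_j).
  by apply: row3P; rewrite !mxE sum_ord3 !mxE /=; field.
move=> [z ->]; apply/lat_oCP; exists (2 * z 0 j0 + z 0 j1), (z 0 j1), (z 0 j2), (z 0 j0).
split; first by ring.
by apply: row3P; rewrite !mxE sum_ord3 !mxE /=; field.
Qed.

(** Reflection lengths alone do not tell the side of a centred square from half its diagonal; the
    covolume, which scales by [c^3], decides. *)
Lemma covolume_oC Q c x y x' y' : 0 < x' -> 0 < y' -> similar Q c (lat_oC x y) (lat_oC x' y') ->
  x' ^+ 2 * y' ^+ 2 = (c ^+ 2) ^+ 3 * (x ^+ 2 * y ^+ 2).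
Proof.
move=> x0' y0' [QQ c0 LE].
pose B := basis_oC x y; pose B' := basis_oC x' y'.
have rowB (a b : R) (i : 'I_3) : lat_oC a b (row i (basis_oC a b)).
  apply/basis_oCP; exists (delta_mx 0 i); rewrite rowE; congr (_ *m _).
  by apply/matrixP => u v; rewrite !mxE; case: (_ && _).
have ex1 (i : 'I_3) : exists z : 'rV[int]_3, row i B' = c *: (map_mx intr z *m B *m Q).
  have := rowB x' y' i; rewrite LE => -[v /basis_oCP[z ->] <-]; by exists z.
have ex2 (i : 'I_3) : exists z : 'rV[int]_3, c *: (row i B *m Q) = map_mx intr z *m B'.
  by apply/basis_oCP; rewrite LE; exists (row i B).
have [z Hz] := choice ex1; have [w Hw] := choice ex2.
pose A : 'M[int]_3 := \matrix_i z i; pose A' : 'M[int]_3 := \matrix_i w i.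
have rA (M : 'M[R]_3) i (Z : 'I_3 -> 'rV[int]_3) :
    row i (map_mx intr (\matrix_i Z i) *m M) = map_mx intr (Z i) *m M.
  by rewrite row_mul -map_row rowK.
have EA : B' = c *: (map_mx intr A *m B *m Q).
  by apply/row_matrixP => i; rewrite Hz linearZ /= row_mul rA.
have EA' : c *: (B *m Q) = map_mx intr A' *m B'.
  by apply/row_matrixP => i; rewrite linearZ /= row_mul Hw rA.
have dB' : \det B' != 0 by rewrite det_basis_oC !mulf_neq0 ?gt_eqF // invr_gt0.
have d1 : \det B' = c ^+ 3 * ((\det A)%:~R * \det B * \det Q).
  by rewrite {1}EA detZ !det_mulmx det_map_mx.
have d2 : c ^+ 3 * (\det B * \det Q) = (\det A')%:~R * \det B'.
  by rewrite -det_mulmx -detZ EA' det_mulmx det_map_mx.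
have dQ : \det Q * \det Q = 1 by rewrite -{2}det_tr -det_mulmx QQ det1.
(* The transition matrices are integral in both directions, so their determinants are 1 or -1. *)
have aa : \det A * \det A' = 1.
  apply/eqP; rewrite -(eqr_int R); apply/eqP; apply: (mulIf dB').
  by rewrite intrM -mulrA -d2 mul1r [RHS]d1; ring.
have a1 : \det A * \det A = 1.
  move: aa; move: (\det A) (\det A') => a b /(congr1 absz); rewrite abszM => /eqP.
  rewrite muln_eq1 => /andP[/eqP ha _].
  by have [->|->] : a = 1 \/ a = -1 by clear -ha; lia.
have a1R : (\det A)%:~R * (\det A)%:~R = 1 :> R by rewrite -intrM a1.
have E1 : \det B' * \det B' = (c ^+ 2) ^+ 3 * (\det B * \det B).
  transitivity ((c ^+ 2) ^+ 3 * ((\det A)%:~R * (\det A)%:~R) * (\det B * \det B) * (\det Q * \det Q)).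
    by rewrite {1 2}d1; ring.
  by rewrite a1R dQ !mulr1.
move: E1; rewrite /B /B' !det_basis_oC => E1.
transitivity (4 * (x' * y' / 2 * (x' * y' / 2))); first by field.
by rewrite E1; field.
Qed.

(** The third axis is intrinsic unless its pullback is half a diagonal of a square; the second
    alternative records that case. *)
Lemma oC_axes Q c x y x' y' : 0 < x -> 0 < y -> 0 < x' -> 0 < y' ->
  similar Q c (lat_oC x y) (lat_oC x' y') ->
  (c ^+ 2 = 1 /\ forall a, a = x' ^+ 2 \/ a = y' ^+ 2 ->
     [\/ a = x ^+ 2, a = y ^+ 2 | x ^+ 2 = 2 * a /\ y ^+ 2 = 2 * a])
  \/ c ^+ 2 * x ^+ 2 = 2 /\ c ^+ 2 * y ^+ 2 = 2.
Proof.
move=> x0 y0 x0' y0' s; have [_ c0 LE] := s.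
have k0 : 0 < c ^+ 2 by rewrite exprn_even_gt0.
have pull e : lat_oC x' y' e -> exists2 f, lat_oC x y f & e = c *: (f *m Q).
  by rewrite {1}LE => -[f Lf <-]; exists f.
have [|f3 L3 E3] := pull (vec3 0 0 1).
  by apply/lat_oCP; exists 0, 0, 1, 0; split=> //; congr vec3; field.
have D3 : c ^+ 2 * dot3 f3 f3 = 1.
  by rewrite -(dot3_similar _ _ s) -E3 dot3E; ring.
have F30 : 0 < dot3 f3 f3 by rewrite -(pmulr_rgt0 _ k0) D3.
have r3 u : lat_oC x y u -> exists n : int, dot3 f3 u = n%:~R * dot3 f3 f3.
  move=> Lu; have : lat_oC x' y' (c *: (u *m Q)) by rewrite LE; exists u.
  move=> /lat_oCP[m1 [m2 [m3 [k [_ uE]]]]]; exists m3.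
  apply: (@mulfI _ (c ^+ 2)); first by rewrite gt_eqF.
  by rewrite mulrCA D3 -(dot3_similar _ _ s) -E3 uE dot3E; ring.
have [[f30 f31 F3]|[X Y]] := oC_axis_root x0 y0 L3 r3 F30; last first.
  by right; rewrite X Y mulrCA D3 mulr1.
left; have k1 : c ^+ 2 = 1 by rewrite -D3 F3 mulr1.
split=> //.
have main e : lat_oC x' y' e -> root (lat_oC x' y') e -> 0 < dot3 e e ->
    ~ lat_oC x' y' (2^-1 *: e) -> dot3 e (vec3 0 0 1) = 0 ->
    [\/ dot3 e e = x ^+ 2, dot3 e e = y ^+ 2 | x ^+ 2 = 2 * dot3 e e /\ y ^+ 2 = 2 * dot3 e e].
  move=> /pull[f Lf ->] /(root_similar s) rf; rewrite (dot3_similar _ _ s) k1 mul1r => F0 nf.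
  rewrite {1}E3 (dot3_similar _ _ s) k1 mul1r => f3f.
  apply: oC_root => //.
    by move=> Lh; apply: nf; rewrite LE; exists (2^-1 *: f) => //; rewrite -scalemxAl scalerA mulrC -scalerA.
  move: F3 f3f; rewrite /dot3 !mxE !sum_ord3 !mxE f30 f31 !mulr0 !add0r => F3 f3f.
  have : f3 0 j2 != 0 by apply: contraTneq F30 => z; rewrite /dot3 mxE sum_ord3 !mxE f30 f31 z !mulr0 !addr0 ltxx.
  by move=> z; move/eqP: f3f; rewrite mulf_eq0 (negbTE z) orbF => /eqP.
have half (a b : R) : a != 0 \/ b != 0 -> a = 0 \/ b = 0 -> (a = 0 \/ a = x') -> (b = 0 \/ b = y') ->
    ~ lat_oC x' y' (2^-1 *: vec3 a b 0).
  move=> ab0 ab aE bE /lat_oCP[m1 [m2 [m3 [k [K]]]]]; rewrite vec3Z => E.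
  have := congr1 (fun v : 'rV[R]_3 => v 0 j0) E; have := congr1 (fun v : 'rV[R]_3 => v 0 j1) E.
  rewrite !mxE /= => Eb Ea.
  have cancel (m : int) (t : R) : t != 0 -> 2^-1 * t = m%:~R / 2 * t -> m = 1.
    move=> t0 H; apply/eqP; rewrite -(eqr_int R); apply/eqP; apply: (mulIf t0).
    transitivity (2 * (m%:~R / 2 * t)); first by field.
    by rewrite -H; field.
  have zero (m : int) (t : R) : t != 0 -> 2^-1 * 0 = m%:~R / 2 * t -> m = 0.
    move=> t0 H; apply/eqP; rewrite -(eqr_int R); apply/eqP; apply: (mulIf t0).
    transitivity (2 * (m%:~R / 2 * t)); first by field.
    by rewrite -H; field.
  have x'n : x' != 0 by rewrite gt_eqF.
  have y'n : y' != 0 by rewrite gt_eqF.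
  case: aE bE => aE [] bE; rewrite aE bE in Ea Eb ab ab0.
  - by case: ab0; rewrite eqxx.
  - have M1 := zero _ _ x'n Ea; have M2 := cancel _ _ y'n Eb; clear -M1 M2 K; lia.
  - have M1 := cancel _ _ x'n Ea; have M2 := zero _ _ y'n Eb; clear -M1 M2 K; lia.
  - by case: ab => z; rewrite z eqxx in x'n y'n.
move=> a [->|->].
- have := main (vec3 x' 0 0); rewrite !dot3E !mul0r !mulr0 !addr0 -!expr2; apply=> //.
  + by apply/lat_oCP; exists 2, 0, 0, 1; split=> //; congr vec3; field.
  + move=> u /lat_oCP[m1 [m2 [m3 [k [_ ->]]]]]; rewrite !dot3E; exists m1; by field.
  + exact: exprn_gt0.
  + by apply: half; [left; rewrite gt_eqF|right|right|left].
- have := main (vec3 0 y' 0); rewrite !dot3E !mul0r !mulr0 !addr0 !add0r -!expr2; apply=> //.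
  + by apply/lat_oCP; exists 0, 2, 0, (-1); split=> //; congr vec3; field.
  + move=> u /lat_oCP[m1 [m2 [m3 [k [_ ->]]]]]; rewrite !dot3E; exists m2; by field.
  + exact: exprn_gt0.
  + by apply: half; [right; rewrite gt_eqF|left|left|right].
Qed.

(** Equality of covolumes excludes that both sides are matched with half diagonals. *)
Lemma oC_arith (X Y X' Y' k : R) : 0 < X -> 0 < X' -> X <= Y -> X' <= Y' -> X' * Y' = X * Y ->
  (forall a, a = X' \/ a = Y' -> [\/ a = X, a = Y | X = 2 * a /\ Y = 2 * a]) -> X = X' /\ Y = Y'.
Proof.
move=> X0 X0' XY XY' V H.
have Y0 := lt_le_trans X0 XY; have Y0' := lt_le_trans X0' XY'.
have [E|E|[E1 E2]] := H X' (or_introl erefl).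
- by split=> //; move: V; rewrite E => /(mulfI (lt0r_neq0 X0)).
- have E' : Y' = X by apply: (mulfI (lt0r_neq0 X0')); rewrite V E mulrC.
  by split; lra.
- rewrite E1 E2 in V.
  have YE : Y' = 4 * X' by apply: (mulfI (lt0r_neq0 X0')); rewrite V; ring.
  by have [e|e|[e _]] := H Y' (or_intror erefl); lra.
Qed.

Lemma sh_oC_inj (p q : R * R) : S_oC R p -> S_oC R q -> sh_oC p.1 p.2 = sh_oC q.1 q.2 -> p = q.
Proof.
case: p q => [x y] [x' y'] [/= x0 xy] [/= x0' xy'] /lattice_shape_similar[Q [c s]].
have y0 := lt_le_trans x0 xy; have y0' := lt_le_trans x0' xy'.
have V := covolume_oC x0' y0' s; have [_ c0 _] := s.
have k0 : c ^+ 2 != 0 by rewrite expf_neq0.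
have sq a b : 0 < a -> a <= b -> a ^+ 2 <= b ^+ 2.
  by move=> a0 ab; rewrite lerXn2r ?nnegrE ?(ltW a0) // (le_trans (ltW a0)).
suff [EX EY] : x ^+ 2 = x' ^+ 2 /\ y ^+ 2 = y' ^+ 2.
  by rewrite (sqrtr_inj_pos x0 x0' EX) (sqrtr_inj_pos y0 y0' EY).
have [[k1 H]|[kX kY]] := oC_axes x0 y0 x0' y0' s.
  apply: oC_arith => //; rewrite ?sq ?exprn_gt0 //.
  by rewrite V k1 expr1n mul1r.
have [[k1 H]|[kX' kY']] := oC_axes x0' y0' x0 y0 (similar_sym s).
  have k1' : c ^+ 2 = 1 by rewrite -[c ^+ 2]invrK -exprVn k1 invr1.
  have [] := oC_arith (X := x' ^+ 2) (Y := y' ^+ 2) (X' := x ^+ 2) (Y' := y ^+ 2) 1; rewrite ?sq ?exprn_gt0 //.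
  by rewrite V k1' expr1n mul1r.
have EX : x' ^+ 2 = 2 * c ^+ 2 by rewrite -kX' exprVn mulrAC mulVf // mul1r.
have EY : y' ^+ 2 = 2 * c ^+ 2 by rewrite -kY' exprVn mulrAC mulVf // mul1r.
(* Both lattices are in the exceptional case, and the covolume identity forces [c^2 = 1]. *)
have E1 : c ^+ 2 * (2 * 2) = c ^+ 2 * c ^+ 2 * (2 * 2).
  have : c ^+ 2 * c ^+ 2 * (2 * 2) = c ^+ 2 * ((c ^+ 2 * x ^+ 2) * (c ^+ 2 * y ^+ 2)).
    transitivity (x' ^+ 2 * y' ^+ 2); first by rewrite EX EY; ring.
    by rewrite V; ring.
  by rewrite kX kY => ->.
have k1 : c ^+ 2 = 1.
  by apply: (mulfI k0); apply: (@mulIf _ (2 * 2)); rewrite ?mulf_neq0 // mulr1 E1.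
by move: kX kY; rewrite EX EY k1 !mul1r mulr1.
Qed.

End ShapeInjective.

(** * The Minkowski lattice in orthonormal coordinates *)

Section FieldShape.
Variable R : realType.
Local Notation C := R[i].
Local Notation cmx := (map_mx (real_complex R)).

Lemma cmx_inj m n : injective (map_mx (real_complex R) : 'M[R]_(m, n) -> 'M[C]_(m, n)).
Proof. by move=> A B /matrixP H; apply/matrixP => i j; have := H i j; rewrite !mxE => /complexI. Qed.

Lemma real_conj (x : R) : (x%:C)%C^* = x%:C%C.
Proof. by apply: CrealP; apply/complex_realP; exists x. Qed.

Lemma cmx_adjoint m n (A : 'M[R]_(m, n)) : ((cmx A) ^t*)%sesqui = cmx A^T.
Proof. by apply/matrixP => i j; rewrite !mxE real_conj. Qed.

Lemma unitary_cancel n m p (T : 'M[C]_(n, m)) (u v : 'M[C]_(p, n)) : T \is unitarymx ->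
  u *m T = v *m T -> u = v.
Proof.
move=> /unitarymxP TT /(congr1 (fun X => X *m (T ^t*)%sesqui)).
by rewrite -!mulmxA TT !mulmx1.
Qed.

(** As [L0] contains a multiple of every coordinate vector, each row of [T0] is a real combination
    of rows of [T]. The comparison matrix is thus real, and orthogonal because both systems of rows
    are orthonormal. *)
Lemma isometry_similar n m (T0 T : 'M[C]_(n, m)) (L0 L : set 'rV[R]_n) (k c : R) (d : 'I_n -> R) :
  T0 \is unitarymx -> T \is unitarymx -> k != 0 -> c != 0 -> (forall j, d j != 0) ->
  (forall j, L0 (d j *: delta_mx 0 j)) ->
  [set k%:C%C *: (cmx v *m T0) | v in L0] = [set c%:C%C *: (cmx v *m T) | v in L] ->
  exists Q : 'M[R]_n, Q *m Q^T = 1%:M /\ L = [set (k / c) *: (v *m Q) | v in L0].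
Proof.
move=> uT0 uT k0 c0 d0 L0d E.
have rc0 (x : R) : x != 0 -> x%:C%C != 0 by move=> x0; rewrite fmorph_eq0.
have [w Hw] : {w : 'I_n -> 'rV[R]_n & forall j, row j T0 = ((c / (k * d j))%:C%C *: (cmx (w j) *m T))}.
  apply: (@choice _ _ (fun j wj => row j T0 = ((c / (k * d j))%:C%C *: (cmx wj *m T)))) => j.
  have : [set k%:C%C *: (cmx v *m T0) | v in L0] (k%:C%C *: (cmx (d j *: delta_mx 0 j) *m T0)).
    by exists (d j *: delta_mx 0 j).
  rewrite E => -[wj _ wjE]; exists wj.
  have kd0 : (k * d j)%:C%C != 0 by apply: rc0; rewrite mulf_neq0.
  have e : (k * d j)%:C%C * (c / (k * d j))%:C%C = c%:C%C.
    by rewrite -rmorphM; congr (_%:C%C); field; rewrite k0 d0.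
  apply: (can_inj (scalerK kd0)); rewrite scalerA e wjE.
  rewrite rmorphM -scalerA; congr (_ *: _); rewrite map_mxZ -scalemxAl map_delta_mx rowE //.
pose Q : 'M[R]_n := \matrix_j ((c / (k * d j)) *: w j).
have QT : T0 = cmx Q *m T.
  apply/row_matrixP => j; rewrite Hw row_mul -map_row rowK map_mxZ -scalemxAl //.
exists Q; split.
  apply: cmx_inj; rewrite map_mxM -cmx_adjoint map_mx1.
  move: uT0 => /unitarymxP; rewrite {1 2}QT trmx_mul map_mxM mulmxA -[cmx Q *m T *m _]mulmxA.
  by move/unitarymxP: uT => ->; rewrite mulmx1.
have key v w' : k%:C%C *: (cmx v *m T0) = c%:C%C *: (cmx w' *m T) -> w' = (k / c) *: (v *m Q).
  rewrite QT mulmxA -map_mxM !scalemxAl -!map_mxZ => /(unitary_cancel uT)/cmx_inj H.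
  by rewrite -scalemxAl [k / c]mulrC -[RHS]scalerA H scalerA mulVf // scale1r.
apply/seteqP; split=> w' /=.
  move=> Lw; have : [set c%:C%C *: (cmx v *m T) | v in L] (c%:C%C *: (cmx w' *m T)) by exists w'.
  by rewrite -E => -[v Lv /key ->]; exists v.
move=> [v Lv <-]; have : [set k%:C%C *: (cmx v *m T0) | v in L0] (k%:C%C *: (cmx v *m T0)) by exists v.
by rewrite E => -[w'' Lw /esym/key <-].
Qed.

Section Embeddings.
Variables (K : splittingFieldType rat) (al be ga : int) (r s t : K).
Hypothesis bq : biquad al be ga r s t.
Hypothesis abg : [/\ al != 0, be != 0 & ga != 0].

(** An index below 4 codes in binary the signs given to the roots [r'] and [s']. *)
Let sg (b : bool) : C := (-1) ^+ b.
Let e1 (i : 'I_4) := sg (1 < i)%N.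
Let e2 (i : 'I_4) := sg (odd i).

Let r' : C := sqrtC (be * ga)%:~R.
Let s' : C := sqrtC (al * ga)%:~R.
(** Defined through [r'] and [s'], since [sqrtC] of a product need not be the product of the roots
    when factors are negative. *)
Let t' : C := (ga%:~R)^-1 * (r' * s').

Let gaC : (ga%:~R : C) != 0. Proof. by case: abg => _ _; rewrite intr_eq0. Qed.

Lemma sg2 b : sg b * sg b = 1.
Proof. by rewrite -expr2 sqrr_sign. Qed.

Lemma rel_embed i : quad_rel al be ga (e1 i * r') (e2 i * s') (e1 i * e2 i * t').
Proof.
have rr : r' * r' = (be * ga)%:~R by rewrite -expr2 sqrtCK.
have ss : s' * s' = (al * ga)%:~R by rewrite -expr2 sqrtCK.
have e1e : e1 i * e1 i = 1 by exact: sg2.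
have e2e : e2 i * e2 i = 1 by exact: sg2.
split; split.
- by rewrite mulrACA e1e mul1r.
- by rewrite mulrACA e2e mul1r.
- have -> : e1 i * e2 i * t' * (e1 i * e2 i * t') =
    (e1 i * e1 i) * (e2 i * e2 i) * (ga%:~R^-1 * ga%:~R^-1 * ((r' * r') * (s' * s'))) by rewrite /t'; ring.
  by rewrite e1e e2e rr ss !intrM; field.
- have -> : e2 i * s' * (e1 i * e2 i * t') = e1 i * (e2 i * e2 i) * (ga%:~R^-1 * (s' * s') * r') by rewrite /t'; ring.
  by rewrite e2e ss intrM; field.
- have -> : e1 i * r' * (e1 i * e2 i * t') = e2 i * (e1 i * e1 i) * (ga%:~R^-1 * (r' * r') * s') by rewrite /t'; ring.
  by rewrite e1e rr intrM; field.
- by rewrite /t'; field.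
Qed.

Lemma embed_exists : exists g : 'I_4 -> {rmorphism K -> C}, forall i,
  [/\ g i r = e1 i * r', g i s = e2 i * s' & g i t = e1 i * e2 i * t'].
Proof.
have H i : exists g : {rmorphism K -> C},
    [/\ g r = e1 i * r', g s = e2 i * s' & g t = e1 i * e2 i * t'].
  have [g gE] := biquad_morph (ratr : {rmorphism rat -> C}) bq (rel_embed i).
  exists g; have [rE sE tE] := linK_gens r s t.
  split; [rewrite {1}rE|rewrite {1}sE|rewrite {1}tE];
    by rewrite gE /lin4 !rmorph0 rmorph1 !mul0r !mul1r ?addr0 ?add0r.
have [g Hg] : {g : 'I_4 -> {rmorphism K -> C} & forall i, 
    [/\ g i r = e1 i * r', g i s = e2 i * s' & g i t = e1 i * e2 i * t']}.
  by apply: (@choice _ _ (fun i (h : {rmorphism K -> C}) =>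
    [/\ h r = e1 i * r', h s = e2 i * s' & h t = e1 i * e2 i * t'])).
by exists g.
Qed.

Lemma embed_linK (f : {rmorphism K -> C}) a b c d :
  f (linK r s t a b c d) = ratr a + ratr b * f r + ratr c * f s + ratr d * f t.
Proof.
have fq q : f q%:A = ratr q by exact: (fmorph_eq_rat (f \o GRing.in_alg K)).
by rewrite /linK /lin4 !rmorphD !rmorphM /= !fq.
Qed.

Lemma embed_ext (f h : {rmorphism K -> C}) : f r = h r -> f s = h s -> f =1 h.
Proof.
move=> fr fs x; have [a [b [c [d ->]]]] := biquad_span bq x.
rewrite !embed_linK fr fs; congr (_ + _ * _).
apply: (mulfI gaC); have [[_ _ _] [_ _ rs]] := biquad_rel bq.
have ft (k : {rmorphism K -> C}) : ga%:~R * k t = k r * k s by rewrite -rmorphM rs rmorphM rmorph_int.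
by rewrite !ft fr fs.
Qed.

Lemma embed_sqr (f : {rmorphism K -> C}) :
  (f r = r' \/ f r = - r') /\ (f s = s' \/ f s = - s').
Proof.
have [[rr ss _] _] := biquad_rel bq.
have sq (x : K) (n : int) : x * x = n%:~R -> f x = sqrtC n%:~R \/ f x = - sqrtC n%:~R.
  move=> xx; have /eqP : f x ^+ 2 = sqrtC n%:~R ^+ 2 by rewrite sqrtCK expr2 -rmorphM xx rmorph_int.
  by rewrite eqf_sqr => /orP[] /eqP ->; [left|right].
by split; apply: sq.
Qed.

Lemma root_neq0 : r' != 0 /\ s' != 0.
Proof.
case: abg => a0 b0 c0.
by split; rewrite sqrtC_eq0 intr_eq0 mulf_neq0.
Qed.

Lemma sign_index (b1 b2 : bool) : exists i, e1 i = sg b1 /\ e2 i = sg b2.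
Proof.
case: b1 b2 => -[].
- by exists (@Ordinal 4 3 isT).
- by exists (@Ordinal 4 2 isT).
- by exists (@Ordinal 4 1 isT).
- by exists (@Ordinal 4 0 isT).
Qed.

Lemma sg_inj : injective sg.
Proof.
move=> [] [] //; rewrite /sg expr0 expr1 => /eqP; rewrite ?[1 == _]eq_sym; 
  by rewrite eqNr oner_eq0.
Qed.

Lemma sign_index_inj i j : e1 i = e1 j -> e2 i = e2 j -> i = j.
Proof.
move=> /sg_inj h1 /sg_inj h2; apply: val_inj.
by move: i j h1 h2 => [[|[|[|[|i]]]] ilt] [[|[|[|[|j]]]] jlt].
Qed.

Lemma enum_embed (g : 'I_4 -> {rmorphism K -> C}) :
  (forall i, g i r = e1 i * r' /\ g i s = e2 i * s') -> enum_embeddings g.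
Proof.
move=> Hg; have [r0 s0] := root_neq0; split=> [i j|f].
  move=> E; apply: sign_index_inj.
    by apply: (mulIf r0); have [<- _] := Hg i; have [<- _] := Hg j.
  by apply: (mulIf s0); have [_ <-] := Hg i; have [_ <-] := Hg j.
have [hr hs] := embed_sqr f.
have [b1 B1] : exists b, f r = sg b * r'.
  by case: hr => ->; [exists false; rewrite mul1r|exists true; rewrite mulN1r].
have [b2 B2] : exists b, f s = sg b * s'.
  by case: hs => ->; [exists false; rewrite mul1r|exists true; rewrite mulN1r].
have [i [E1 E2]] := sign_index b1 b2; exists i.
have [gr gs] := Hg i; apply: embed_ext; [by rewrite gr E1 B1|by rewrite gs E2 B2].
Qed.

(* Sums over all embeddings do not depend on their enumeration. *)
Lemma sum_embed (f : 'I_4 -> {rmorphism K -> C}) (P : C -> C -> C) : enum_embeddings f ->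
  \sum_i P (f i r) (f i s) = \sum_i P (e1 i * r') (e2 i * s').
Proof.
have [g Hg] := embed_exists => -[finj fsur].
have /choice[p Hp] : forall i, exists j, f j =1 g i by move=> i; exact: fsur.
have [ginj _] : enum_embeddings g by apply: enum_embed => i; have [] := Hg i.
have pinj : injective p.
  by move=> i j E; apply: ginj => x; rewrite -Hp E Hp.
rewrite (reindex p); last by apply: onW_bij; exact: injF_bij.
by apply: eq_bigr => i _; rewrite !Hp; have [-> -> _] := Hg i.
Qed.

Let rho : R := Num.sqrt `|(be * ga)%:~R|.
Let sig : R := Num.sqrt `|(al * ga)%:~R|.
Let tau : R := Num.sqrt `|(al * be)%:~R|.

(** The factor 2 normalises: each of the four embeddings contributes 1/4 to the squared length of a
    row. *)
Definition frame (f : 'I_4 -> {rmorphism K -> C}) : 'M[C]_(3, 4) :=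
  \matrix_(i < 3, j < 4)
    [:: f j r / (2 * rho)%:C%C; f j s / (2 * sig)%:C%C; f j t / (2 * tau)%:C%C]`_i.

Lemma sqrt_norm (n : int) : sqrtC n%:~R * (sqrtC n%:~R)^* = ((Num.sqrt `|n%:~R : R|) ^+ 2)%:C%C.
Proof.
rewrite sqr_sqrtr ?normr_ge0 // -normCK -normrX sqrtCK.
by rewrite -!intr_norm rmorph_int.
Qed.

Lemma frame_pos : [/\ 0 < rho, 0 < sig & 0 < tau].
Proof.
by case: abg => a0 b0 c0; split; rewrite sqrtr_gt0 normr_gt0 intr_eq0 mulf_neq0.
Qed.

Lemma unit_frame (z : C) (x : R) : 0 < x -> z * z^* = (x ^+ 2)%:C%C ->
  z / (2 * x)%:C%C * (z / (2 * x)%:C%C)^* = 1 / 4.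
Proof.
move=> x0 zz; rewrite fmorph_div /= real_conj mulf_div zz -rmorphM -fmorph_div.
have -> : x ^+ 2 / (2 * x * (2 * x)) = 1 / 4 by field; rewrite gt_eqF.
by rewrite fmorph_div rmorph1 rmorph_nat.
Qed.

Lemma frame_unitary f : enum_embeddings f -> frame f \is unitarymx.
Proof.
move=> fE; have [rho0 sig0 tau0] := frame_pos.
pose a := r' / (2 * rho)%:C%C; pose b := s' / (2 * sig)%:C%C; pose c := t' / (2 * tau)%:C%C.
have aa : a * a^* = 1 / 4 by apply: unit_frame => //; exact: sqrt_norm.
have bb : b * b^* = 1 / 4 by apply: unit_frame => //; exact: sqrt_norm.
have cc : c * c^* = 1 / 4.
  apply: unit_frame => //.
  have -> : t'^* = ga%:~R^-1 * (r'^* * s'^*).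
    by rewrite /t' rmorphM fmorphV rmorph_int rmorphM.
  have -> : t' * (ga%:~R^-1 * (r'^* * s'^*)) =
    ga%:~R^-1 * ga%:~R^-1 * ((r' * r'^*) * (s' * s'^*)) by rewrite /t'; ring.
  rewrite !sqrt_norm !sqr_sqrtr ?normr_ge0 //.
  have -> : (ga%:~R : C) = (ga%:~R : R)%:C%C by rewrite rmorph_int.
  rewrite -!fmorphV -!rmorphM; congr (_%:C%C).
  have [_ _ g0] := abg; have gR : (ga%:~R : R) != 0 by rewrite intr_eq0.
  have -> : `|(be * ga)%:~R : R| * `|(al * ga)%:~R| = `|(al * be)%:~R| * (ga%:~R * ga%:~R).
    by rewrite -[ga%:~R * ga%:~R]ger0_norm -?expr2 ?sqr_ge0 // expr2 -!normrM !intrM; congr `|_|; ring.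
  by field.
(* [sum_embed] replaces an arbitrary enumeration by the explicit one, for which [t] has to be
   written through [r] and [s]. Orthogonality is then the cancellation of signs. *)
have ft i : f i t = ga%:~R^-1 * (f i r * f i s).
  have [[_ _ _] [_ _ rs]] := biquad_rel bq.
  by apply: (mulfI gaC); rewrite mulVKf // -rmorphM rs rmorphM rmorph_int.
pose G (k : nat) (x y : C) : C := [:: x / (2 * rho)%:C%C; y / (2 * sig)%:C%C; ga%:~R^-1 * (x * y) / (2 * tau)%:C%C]`_k.
pose H (k : nat) (i : 'I_4) : C := [:: e1 i * a; e2 i * b; e1 i * e2 i * c]`_k.
apply/unitarymxP/matrixP => i k; rewrite !mxE.
under eq_bigr => j _ do rewrite !mxE ft.
rewrite (sum_embed (fun x y => G i x y * (G k x y)^*) fE).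
have GH (l : 'I_3) j : G l (e1 j * r') (e2 j * s') = H l j.
  rewrite /G /H /a /b /c /t'.
  by case: l => [[|[|[|//]]] ?] /=; rewrite !mulrA // [ga%:~R^-1 * _ * _ * _ * _]mulrC; ring.
under eq_bigr => j _ do rewrite !GH.
rewrite sum_ord4 /H /e1 /e2 /sg /= !expr1 !expr0.
have cN (z : C) : (-1 * z)^* = - z^* by rewrite mulN1r rmorphN.
have c1 (z : C) : (1 * z)^* = z^* by rewrite mul1r.
clearbody a b c; clear GH G H ft fE.
move: i k => [[|[|[|//]]] ?] [[|[|[|//]]] ?] /=; rewrite ?(mulrN1, mulrNN, mul1r, mulr1, mulN1r, opprK) ?rmorphN ?mulrNN ?(mulrN, mulNr) ?aa ?bb ?cc; by field.
Qed.

Definition proj_lattice : set 'rV[R]_3 := [set v | exists a b c d : rat,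
  OK K (linK r s t a b c d) /\ v = vec3 (ratr b * rho) (ratr c * sig) (ratr d * tau)].

(** The element [4 x - tr x] has coordinates [0, 4 b, 4 c, 4 d], and the frame divides by [2 rho]
    and its analogues: together the factor 8. *)
Lemma minkowski_perp f : enum_embeddings f ->
  [set Defs.minkowski f a | a in OKperp 4 K] = [set (8 : R)%:C%C *: (cmx v *m frame f) | v in proj_lattice].
Proof.
move=> fE; have [rho0 sig0 tau0] := frame_pos.
have key a b c d : Defs.minkowski f (4%:R * linK r s t a b c d - galTrace 1 {:K} (linK r s t a b c d)) =
    (8 : R)%:C%C *: (cmx (vec3 (ratr b * rho) (ratr c * sig) (ratr d * tau)) *m frame f).
  have -> : 4%:R * linK r s t a b c d - galTrace 1 {:K} (linK r s t a b c d) =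
      linK r s t 0 (4 * b) (4 * c) (4 * d).
    rewrite (galTrace_linK _ _ _ _ bq) (alg_linK r s t) mulr_natl pmulrn mulrz_linK /linK lin4B.
    by congr lin4; ring.
  apply/rowP => j; rewrite !mxE embed_linK sum_ord3 !mxE /= rmorph0 add0r.
  have cr (q : rat) : (ratr q : C) = (ratr q : R)%:C%C.
    exact: (esym (fmorph_eq_rat (real_complex R \o (ratr : {rmorphism rat -> R})) q)).
  have n1 : (rho%:C%C : C) != 0 by rewrite fmorph_eq0 gt_eqF.
  have n2 : (sig%:C%C : C) != 0 by rewrite fmorph_eq0 gt_eqF.
  have n3 : (tau%:C%C : C) != 0 by rewrite fmorph_eq0 gt_eqF.
  have m8 : (8 : R)%:C%C = 8 :> C by rewrite rmorph_nat.
  have m2 (x : R) : (2 * x)%:C%C = 2 * x%:C%C :> C by rewrite rmorphM rmorph_nat.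
  rewrite m8 !m2 ![(ratr _ * _)%:C%C]rmorphM /= -!cr !(rmorphM ratr) !rmorph_nat.
  by field; rewrite n1 n2 n3.
apply/seteqP; split=> v /=.
  move=> [_ [x ox <-] <-]; have [a [b [c [d xE]]]] := biquad_span bq x.
  exists (vec3 (ratr b * rho) (ratr c * sig) (ratr d * tau)); last by rewrite xE; exact: (esym (key _ _ _ _)).
  by exists a, b, c, d; rewrite -xE.
move=> [_ [a [b [c [d [ox ->]]]]] <-].
exists (4%:R * linK r s t a b c d - galTrace 1 {:K} (linK r s t a b c d)); last exact: key.
by exists (linK r s t a b c d).
Qed.

Lemma OK_gens : [/\ OK K r, OK K s & OK K t].
Proof.
have [[rr ss tt] _] := biquad_rel bq.
have q (x : K) (n : int) : x * x = n%:~R -> OK K x.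
  move=> xx; apply: (@OK_quad _ 0 n%:~R); [exact: (OK_int K 0)|exact: OK_int|].
  by rewrite mul0r add0r.
by split; [exact: q rr|exact: q ss|exact: q tt].
Qed.

Lemma field_shape_proj : field_shape R 4 K = lattice_shape proj_lattice.
Proof.
have [rho0 sig0 tau0] := frame_pos; have [orr os ot] := OK_gens.
apply/seteqP; split=> L /=.
  move=> [f [T [c [fE uT c0 E]]]]; rewrite (minkowski_perp fE) in E.
  have n8 : (8 : R) != 0 by rewrite pnatr_eq0.
  have [||Q [QQ LE]] := isometry_similar (d := fun j => [:: rho; sig; tau]`_j) (frame_unitary fE) uT n8 c0 _ _ E.
  - by move=> [[|[|[|//]]] ?] /=; rewrite gt_eqF.
  - have [rE sE tE] := linK_gens r s t.
    move=> [[|[|[|//]]] ?] /=.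
    + exists 0, 1, 0, 0; rewrite -rE; split=> //.
      by apply: row3P; rewrite !mxE /= ?rmorph1 ?rmorph0 ?mul0r ?mul1r ?mulr1 ?mulr0.
    + exists 0, 0, 1, 0; rewrite -sE; split=> //.
      by apply: row3P; rewrite !mxE /= ?rmorph1 ?rmorph0 ?mul0r ?mul1r ?mulr1 ?mulr0.
    + exists 0, 0, 0, 1; rewrite -tE; split=> //.
      by apply: row3P; rewrite !mxE /= ?rmorph1 ?rmorph0 ?mul0r ?mul1r ?mulr1 ?mulr0.
  by exists Q, (8 / c); split=> //; rewrite mulf_neq0 ?invr_eq0.
move=> [Q [c [QQ c0 ->]]].
have [g Hg] := embed_exists.
have gE : enum_embeddings g by apply: enum_embed => i; have [] := Hg i.
(* The rotation [Q] is absorbed into the frame. *)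
exists g, (cmx Q^T *m frame g), (8 / c); split=> //.
- apply: mul_unitarymx; last exact: frame_unitary.
  by apply/unitarymxP; rewrite cmx_adjoint trmxK -map_mxM (mulmx1C QQ) map_mx1.
- by rewrite mulf_neq0 ?invr_eq0 // pnatr_eq0.
rewrite (minkowski_perp gE).
have key v : (8 / c)%:C%C *: (cmx (c *: (v *m Q)) *m (cmx Q^T *m frame g)) = (8 : R)%:C%C *: (cmx v *m frame g).
  rewrite map_mxZ -scalemxAl scalerA -rmorphM divfK // mulmxA -map_mxM -mulmxA QQ mulmx1 //.
apply/seteqP; split=> w /=.
  by move=> [v Lv <-]; exists (c *: (v *m Q)); [exists v|exact: key].
by move=> [_ [v Lv <-] <-]; exists v => //; exact: (esym (key _ v)).
Qed.

End Embeddings.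

Lemma sqrt_absz (a b : int) :
  Num.sqrt `|(a * b)%:~R : R| = Num.sqrt `|a|%N%:R * Num.sqrt `|b|%N%:R.
Proof. by rewrite -intr_norm -natr_absz abszM natrM sqrtrM. Qed.

Lemma sqrt_quot (a b : nat) : Num.sqrt (a%:R / b%:R : R) = Num.sqrt a%:R / Num.sqrt b%:R.
Proof. by rewrite sqrtrM // sqrtrV. Qed.

Lemma sqrt_absz_neq0 (a : int) : a != 0 -> Num.sqrt (`|a|%N%:R : R) != 0.
Proof. by move=> a0; rewrite gt_eqF // sqrtr_gt0 ltr0n absz_gt0. Qed.

Definition rot3 : 'M[R]_3 := \matrix_(i < 3, j < 3)
  (nth [::] [:: [:: 0; 0; 1]; [:: 1; 0; 0]; [:: 0; 1; 0]] i)`_j.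

Lemma rot3_orthogonal : rot3 *m rot3^T = 1%:M.
Proof.
apply/matrixP => i j; rewrite !mxE sum_ord3 !mxE.
by move: i j => [[|[|[|//]]] ?] [[|[|[|//]]] ?] /=; ring.
Qed.

Lemma vec3_rot3 a b c : vec3 a b c *m rot3 = vec3 b c a.
Proof. by apply: row3P; rewrite !mxE sum_ord3 !mxE /=; ring. Qed.

Lemma ratr_frac (n : nat) : ratr (1 / n%:R) = 1 / n%:R :> R.
Proof. by rewrite fmorph_div rmorph1 rmorph_nat. Qed.

Lemma ratr_intM (m : int) (p : rat) : ratr (m%:~R * p) = m%:~R * ratr p :> R.
Proof. by rewrite rmorphM rmorph_int. Qed.

Lemma ratr_comb (m k : int) (p q : rat) :
  ratr (m%:~R * p + k%:~R * q) = m%:~R * ratr p + k%:~R * ratr q :> R.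
Proof. by rewrite rmorphD /= !ratr_intM. Qed.

Section Shapes.
Variables (K : splittingFieldType rat) (al be ga : int) (r s t : K).
Hypothesis bq : biquad al be ga r s t.
Hypothesis abg : [/\ al != 0, be != 0 & ga != 0].

Let sA : R := Num.sqrt `|al|%N%:R.
Let sB : R := Num.sqrt `|be|%N%:R.
Let sG : R := Num.sqrt `|ga|%N%:R.

Let nz : [/\ sA != 0, sB != 0 & sG != 0].
Proof. by case: abg => *; split; exact: sqrt_absz_neq0. Qed.

Lemma proj_latticeE : proj_lattice al be ga r s t = [set v | exists a b c d : rat,
  OK K (linK r s t a b c d) /\ v = vec3 (ratr b * (sB * sG)) (ratr c * (sA * sG)) (ratr d * (sA * sB))].
Proof. by rewrite /proj_lattice !sqrt_absz. Qed.

(** The scale makes [t / 2] the unit axis; [sG / sA] and [sG / sB] are the ratios of the other two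
    axes to it. *)
Lemma field_shape_tame :
  ring_lattice r s t (1 / 2) (1 / 2) (1 / 2) (1 / 2) (1 / 4) (1 / 4) (1 / 4) (1 / 4) ->
  field_shape R 4 K = sh_oI (Num.sqrt (`|ga|%N%:R / `|al|%N%:R)) (Num.sqrt (`|ga|%N%:R / `|be|%N%:R)).
Proof.
move=> rl; rewrite (field_shape_proj bq abg) proj_latticeE !sqrt_quot -/sA -/sB -/sG.
have [a0 b0 g0] := nz.
apply: (@similar_trans_shape _ 1%:M (2 / (sA * sB)) _ (lat_oI (sG / sA) (sG / sB))).
split; [by rewrite trmx1 mulmx1|by rewrite !mulf_neq0 ?invr_eq0 ?mulf_neq0 // pnatr_eq0|].
apply/seteqP; split=> v /=.
  move=> /lat_oIP[m1 [m2 [m3 [k [l [-> -> ->]]]]]].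
  exists (vec3 (ratr (k%:~R * (1 / 2) + m3%:~R * (1 / 4)) * (sB * sG))
    (ratr (l%:~R * (1 / 2) + m3%:~R * (1 / 4)) * (sA * sG)) (ratr (m3%:~R * (1 / 4)) * (sA * sB))).
    do 4 eexists; split; last reflexivity; apply/rl; by exists 0, k, l, m3.
  rewrite mulmx1 vec3Z !ratr_comb !ratr_intM !ratr_frac.
  by congr vec3; field; rewrite ?a0 ?b0 ?g0.
move=> [_ [a [b [c [d [/rl[x0 [k [l [m3 [_ -> -> ->]]]]] ->]]]]] <-].
apply/lat_oIP; exists (m3 + 2 * k), (m3 + 2 * l), m3, k, l; split=> //.
rewrite mulmx1 vec3Z !ratr_comb !ratr_intM !ratr_frac.
by congr vec3; field; rewrite ?a0 ?b0 ?g0.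
Qed.

(** The axis of [r] splits off orthogonally; scaling makes it a unit vector and [rot3] moves it to
    the last place. It will be used with [n = 2] when [(1 + r) / 2] is integral and with [n = 1]
    otherwise. *)
Lemma field_shape_wild (n : nat) (p : rat) : (0 < n)%N ->
  ring_lattice r s t p (1 / n%:R) 0 1 0 0 (1 / 2) (1 / 2) ->
  field_shape R 4 K = sh_oC (n%:R * Num.sqrt (`|al|%N%:R / `|be|%N%:R)) (n%:R * Num.sqrt (`|al|%N%:R / `|ga|%N%:R)).
Proof.
move=> n0 rl; rewrite (field_shape_proj bq abg) proj_latticeE !sqrt_quot -/sA -/sB -/sG.
have [a0 b0 g0] := nz.
have nR : n%:R != 0 :> R by rewrite pnatr_eq0 -lt0n.
apply: (@similar_trans_shape _ rot3 (n%:R / (sB * sG)) _ (lat_oC (n%:R * (sA / sB)) (n%:R * (sA / sG)))).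
split; [exact: rot3_orthogonal|by rewrite mulf_neq0 ?invr_eq0 ?mulf_neq0|].
apply/seteqP; split=> v /=.
  move=> /lat_oCP[m1 [m2 [m3 [k [-> ->]]]]].
  exists (vec3 (ratr (m3%:~R * (1 / n%:R) + m2%:~R * 0) * (sB * sG))
    (ratr (k%:~R * 1 + m2%:~R * (1 / 2)) * (sA * sG)) (ratr (m2%:~R * (1 / 2)) * (sA * sB))).
    do 4 eexists; split; last reflexivity; apply/rl; by exists 0, m3, k, m2.
  rewrite vec3_rot3 vec3Z !ratr_comb !ratr_intM !ratr_frac ?(rmorph0 (@ratr R)) ?(rmorph1 (@ratr R)).
  by congr vec3; field; rewrite ?a0 ?b0 ?g0 ?nR.
move=> [_ [a [b [c [d [/rl[x0 [m3 [k [m2 [_ -> -> ->]]]]] ->]]]]] <-].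
apply/lat_oCP; exists (m2 + 2 * k), m2, m3, k; split=> //.
rewrite vec3_rot3 vec3Z !ratr_comb !ratr_intM !ratr_frac ?(rmorph0 (@ratr R)) ?(rmorph1 (@ratr R)).
by congr vec3; field; rewrite ?a0 ?b0 ?g0 ?nR.
Qed.

End Shapes.

End FieldShape.

(** * Normal forms of triples *)

Section Counting.

Lemma field_iso_sym K L : field_iso K L -> field_iso L K.
Proof.
move=> [f [g fK gK]].
have gz : zmod_morphism g by move=> x y; apply: (can_inj fK); rewrite rmorphB !gK.
have gm : monoid_morphism g.
  by split=> [|x y]; apply: (can_inj fK); rewrite ?rmorph1 ?rmorphM !gK.
pose gZ := GRing.isZmodMorphism.Build _ _ g gz.
pose gM := GRing.isMonoidMorphism.Build _ _ g gm.
pose h : {rmorphism L -> K} := HB.pack g gZ gM.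
by exists h; exists f.
Qed.

Lemma field_iso_trans K L M : field_iso K L -> field_iso L M -> field_iso K M.
Proof.
move=> [f bf] [g bg]; exists (g \o f); exact: bij_comp.
Qed.

(** The indices in [U] reach every field with [P]; those in [A] are realised by pairwise
    non-isomorphic fields. The upper bound also supplies finiteness, without which [count_upto_iso]
    takes its default value 0. *)
Lemma count_upto_iso_bounds (I : finType) (P : splittingFieldType rat -> Prop)
    (D : I -> splittingFieldType rat -> Prop) (A U : {pred I}) :
  (forall K, P K -> exists2 i, i \in U & D i K) ->
  (forall i K L, D i K -> D i L -> field_iso K L) ->
  (forall i, i \in A -> exists2 K, D i K & P K) ->
  (forall i j K L, i \in A -> j \in A -> D i K -> D j L -> field_iso K L -> i = j) ->
  (#|A| <= count_upto_iso P <= #|U|)%N.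
Proof.
move=> PU Diso AP Ainj.
pose indep n := exists F : 'I_n -> splittingFieldType rat,
  (forall i, P (F i)) /\ forall i j, field_iso (F i) (F j) -> i = j.
have upper n : indep n -> (n <= #|U|)%N.
  move=> [F [PF Finj]].
  have [u Hu] := choice (fun i => let: ex_intro2 j jU DjF := PU _ (PF i) in
    ex_intro (fun j => j \in U /\ D j (F i)) j (conj jU DjF)).
  have uinj : injective u.
    by move=> i j E; apply: Finj; apply: (Diso (u i)); [case: (Hu i)|rewrite E; case: (Hu j)].
  rewrite -[X in (X <= _)%N]card_ord -(card_codom uinj).
  apply: fintype.subset_leq_card; apply/fintype.subsetP => x.
  by move=> /codomP[i ->]; case: (Hu i).
have cn : is_count_upto_iso P (count_upto_iso P).
  (* A largest family of pairwise non-isomorphic fields is complete, since a field outside it could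
     be added. *)
  suff : exists n, is_count_upto_iso P n by exact: xgetPex.
  have ind0 : exists n, `[< indep n >].
    by exists 0%N; apply/asboolP; have F : 'I_0 -> splittingFieldType rat; [case|exists F; split=> -[]].
  have [|n /asboolP[F [PF Finj]] nmax] := ex_maxnP ind0 (m := #|U|).
    by move=> n /asboolP; exact: upper.
  exists n, F; split=> // K PK; apply: contrapT => noiso.
  suff /asboolP/nmax : indep n.+1 by rewrite ltnn.
  exists (fun i : 'I_n.+1 => if unlift ord_max i is Some j then F j else K); split.
    by move=> i; case: (unlift ord_max i).
  move=> i j; case: (unliftP ord_max i) => [i'|] ->; case: (unliftP ord_max j) => [j'|] -> //.
  - by move=> /Finj ->.
  - by move=> /field_iso_sym isoK; case: noiso; exists i'.
  - by move=> isoK; case: noiso; exists j'.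
move: (count_upto_iso P) cn => n [F [PF Finj cov]]; apply/andP; split; last first.
  by apply: upper; exists F.
pose rep (x : {i | i \in A}) := AP (val x) (valP x).
have [c Hc] := choice (fun x : {i | i \in A} => let: ex_intro2 K DK PK := AP (val x) (valP x) in
  let: ex_intro i iso := cov K PK in
  ex_intro (fun i => exists2 K, D (val x) K & field_iso K (F i)) i (ex_intro2 _ _ K DK iso)).
have cinj : injective c.
  move=> x y E; apply: val_inj.
  have [K DK iK] := Hc x; have [L DL iL] := Hc y; rewrite -E in iL.
  apply: (Ainj _ _ K L (valP x) (valP y) DK DL).
  by apply: field_iso_trans iK _; exact: field_iso_sym.
by rewrite -card_sig -[X in (_ <= X)%N]card_ord; exact: leq_card cinj.
Qed.

Lemma card_cnt (m B : nat) (Q : 'I_m -> nat -> nat -> nat -> bool) :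
  #|[pred x : 'I_m * ('I_B * ('I_B * 'I_B)) | Q x.1 x.2.1 x.2.2.1 x.2.2.2]| = (\sum_t cnt B (Q t))%N.
Proof.
rewrite -sum1_card big_mkcond /=.
rewrite (eq_bigr (fun x : 'I_m * ('I_B * ('I_B * 'I_B)) => (Q x.1 x.2.1 x.2.2.1 x.2.2.2 : nat))); last first.
  by move=> x _; rewrite inE; case: (Q _ _ _ _).
rewrite -(pair_bigA _ (fun t (y : 'I_B * ('I_B * 'I_B)) => (Q t y.1 y.2.1 y.2.2 : nat))) /=; apply: eq_bigr => t _.
rewrite -(pair_bigA _ (fun (i : 'I_B) (y : 'I_B * 'I_B) => (Q t i y.1 y.2 : nat))) /=; apply: eq_bigr => i _.
by rewrite -(pair_bigA _ (fun j k : 'I_B => (Q t i j k : nat))).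
Qed.

End Counting.

Section NormalForms.
Implicit Types (K : splittingFieldType rat) (al be ga : int).

Definition isQ K al be ga : Prop := exists r s t : K, biquad al be ga r s t.

Lemma isQ_perm K al be ga : isQ K al be ga -> isQ K be al ga /\ isQ K be ga al.
Proof.
by move=> [r [s [t /biquad_perm[b1 b2]]]]; split; do 3 eexists; [exact: b1|exact: b2].
Qed.

Lemma isQ_opp K al be ga : isQ K al be ga -> isQ K (- al) (- be) (- ga).
Proof. by move=> [r [s [t /biquad_opp b]]]; do 3 eexists; exact: b. Qed.

Lemma isQ_swap K al be ga : isQ K al be ga -> isQ K al ga be.
Proof. by move=> /isQ_perm[_ /isQ_perm[_ /isQ_perm[+ _]]]. Qed.

Lemma isQ_iso K L al be ga : isQ K al be ga -> isQ L al be ga -> field_iso K L.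
Proof. by move=> [r [s [t bK]]] [r' [s' [t' bL]]]; exact: biquad_iso bK bL. Qed.

Lemma isQ_neq1 K al be ga : isQ K al be ga -> [/\ be * ga != 1, al * ga != 1 & al * be != 1].
Proof.
move=> [r [s [t bq]]]; have [r1 s1 t1] := biquad_notin1 bq.
have [[rr ss tt] _] := biquad_rel bq.
have H (x : K) (n : int) : x \notin 1%VS -> x * x = n%:~R -> n != 1.
  move=> x1 xx; apply: contraNneq x1 => n1; move/eqP: xx.
  rewrite n1 -expr2 sqrf_eq1 => /orP[] /eqP ->; rewrite ?rpredN ?mem1v //.
by split; [exact: H r1 rr|exact: H s1 ss|exact: H t1 tt].
Qed.

(** The three products are the radicands of the quadratic subfields, and an isomorphism carries
    square roots to square roots. *)
Lemma isQ_products K L al be ga al' be' ga' : field_iso K L ->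
  sqfree `|(al * be * ga)%R|%N -> sqfree `|(al' * be' * ga')%R|%N ->
  isQ K al be ga -> isQ L al' be' ga' ->
  [/\ [\/ be * ga = be' * ga', be * ga = al' * ga' | be * ga = al' * be'],
      [\/ al * ga = be' * ga', al * ga = al' * ga' | al * ga = al' * be'] &
      [\/ al * be = be' * ga', al * be = al' * ga' | al * be = al' * be']].
Proof.
move=> [f _] sq sq' QK [r' [s' [t' bL]]]; have [n1 n2 n3] := isQ_neq1 QK.
have [r [s [t bK]]] := QK; have [[rr ss tt] _] := biquad_rel bK.
have [s1 s2 s3] : [/\ sqfree `|(be * ga)%R|%N, sqfree `|(al * ga)%R|%N & sqfree `|(al * be)%R|%N].
  split; rewrite abszM.
  - by apply: (@sqfreeMl _ `|al|%N); move: sq; rewrite !abszM -mulnA mulnC.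
  - by apply: (@sqfreeMl _ `|be|%N); move: sq; rewrite !abszM mulnAC.
  - by apply: (@sqfreeMl _ `|ga|%N); move: sq; rewrite !abszM.
have H (x : K) (n : int) : x * x = n%:~R -> f x * f x = n%:~R.
  by move=> xx; rewrite -rmorphM xx rmorph_int.
split.
- exact: (biquad_sqrt sq' bL s1 n1 (H _ _ rr)).
- exact: (biquad_sqrt sq' bL s2 n2 (H _ _ ss)).
- exact: (biquad_sqrt sq' bL s3 n3 (H _ _ tt)).
Qed.

End NormalForms.

(** * Recovering a triple from its pairwise products *)

Section SignedIntegers.

(** For odd [n], the choice of sign that gives residue 1 modulo 4. *)
Definition sint (n : nat) : int := if (n %% 4 == 1)%N then n%:Z else - n%:Z.

Lemma sint_abs n : `|sint n|%N = n.
Proof. by rewrite /sint; case: ifP => _; rewrite ?abszN. Qed.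

Lemma sint_mod4 n : odd n -> exists a, sint n = 4 * a + 1.
Proof.
move=> on; rewrite /sint; case: ifP => H; [exists (n %/ 4)%N%:Z|exists (- (n %/ 4)%N%:Z - 1)].
  by move: on H; lia.
by move: on H; lia.
Qed.

Lemma sint_of (b x : int) : b = 4 * x + 1 -> sint `|b|%N = b.
Proof. by move=> ->; rewrite /sint; case: ifP; lia. Qed.

Lemma sint3_of (b x : int) : b = 4 * x + 3 -> - sint `|b|%N = b.
Proof. by move=> ->; rewrite /sint; case: ifP; lia. Qed.

(** Residues modulo 4 single out the product [be ga]: it is the only odd one, or the only one
    congruent to 1. *)
Lemma wild_odd_product (a b c N M a' b' c' N' M' : int) :
  [\/ N = 3 /\ M = 1, N = 2 /\ M = 1 | N = 2 /\ M = 3] ->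
  [\/ N' = 3 /\ M' = 1, N' = 2 /\ M' = 1 | N' = 2 /\ M' = 3] ->
  [\/ (4 * b + 1) * (4 * c + M) = (4 * b' + 1) * (4 * c' + M'),
      (4 * b + 1) * (4 * c + M) = (4 * a' + N') * (4 * c' + M') |
      (4 * b + 1) * (4 * c + M) = (4 * a' + N') * (4 * b' + 1)] ->
  [\/ (4 * a + N) * (4 * c + M) = (4 * b' + 1) * (4 * c' + M'),
      (4 * a + N) * (4 * c + M) = (4 * a' + N') * (4 * c' + M') |
      (4 * a + N) * (4 * c + M) = (4 * a' + N') * (4 * b' + 1)] ->
  (4 * b + 1) * (4 * c + M) = (4 * b' + 1) * (4 * c' + M').
Proof.
by case=> -[-> ->]; case=> -[-> ->]; case=> // H1; case=> H2; exfalso; lia.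
Qed.

(** Once [be ga] is matched, the other two products agree in order or crosswise, and the order of
    the absolute values of [ga] and [be] excludes the second. *)
Lemma wild_products_inj (al be ga al' be' ga' a b c N M a' b' c' N' M' : int) :
  [\/ N = 3 /\ M = 1, N = 2 /\ M = 1 | N = 2 /\ M = 3] ->
  [\/ N' = 3 /\ M' = 1, N' = 2 /\ M' = 1 | N' = 2 /\ M' = 3] ->
  al = 4 * a + N -> be = 4 * b + 1 -> ga = 4 * c + M ->
  al' = 4 * a' + N' -> be' = 4 * b' + 1 -> ga' = 4 * c' + M' ->
  (`|ga| < `|be|)%N -> (`|ga'| < `|be'|)%N ->
  [\/ be * ga = be' * ga', be * ga = al' * ga' | be * ga = al' * be'] ->
  [\/ al * ga = be' * ga', al * ga = al' * ga' | al * ga = al' * be'] ->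
  [\/ al * be = be' * ga', al * be = al' * ga' | al * be = al' * be'] ->
  [/\ al = al', be = be' & ga = ga'].
Proof.
move=> NM NM' aE bE cE aE' bE' cE' gb gb' D1 D2 D3.
have E1 : be * ga = be' * ga'.
  by move: D1 D2; rewrite aE bE cE aE' bE' cE'; exact: wild_odd_product.
have a0 : al != 0 by rewrite aE; clear -NM; case: NM => -[-> _]; lia.
have a0' : al' != 0 by rewrite aE'; clear -NM'; case: NM' => -[-> _]; lia.
have g0 : ga != 0 by rewrite cE; clear -NM; case: NM => -[_ ->]; lia.
have g0' : ga' != 0 by rewrite cE'; clear -NM'; case: NM' => -[_ ->]; lia.
have b0 : be != 0 by rewrite bE; clear; lia.
have b0' : be' != 0 by rewrite bE'; clear; lia.
have ab : al <> be by rewrite aE bE; clear -NM; case: NM => -[-> _]; lia.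
have ag : al <> ga by rewrite aE cE; clear -NM; case: NM => -[-> ->]; lia.
have gbn : ga <> be by move=> E; rewrite E ltnn in gb.
have {}D2 : al * ga = al' * ga' \/ al * ga = al' * be'.
  case: D2 => [E|E|E]; [|by left|by right].
  by case: ab; apply: (mulIf g0); rewrite E E1.
have {}D3 : al * be = al' * ga' \/ al * be = al' * be'.
  case: D3 => [E|E|E]; [|by left|by right].
  by case: ag; apply: (mulIf b0); rewrite E -E1 mulrC.
case: D2 D3 => E2 [] E3.
- by case: gbn; apply: (mulfI a0); rewrite E2 E3.
- have E4 : ga * be' = be * ga'.
    apply: (mulfI a0); apply: (mulfI a0').
    transitivity ((al * ga) * (al' * be')); first by ring.
    by rewrite -E3 E2; ring.
  have E5 : be ^+ 2 = be' ^+ 2.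
    apply: (mulIf g0'); transitivity (be * (be * ga')); first by ring.
    rewrite -E4; transitivity ((be * ga) * be'); first by ring.
    by rewrite E1; ring.
  have bb : be = be'.
    move/eqP: E5; rewrite eqf_sqr => /orP[/eqP //|/eqP].
    by rewrite bE bE'; clear; lia.
  have gg : ga = ga' by apply: (mulfI b0); rewrite E1 bb.
  by split=> //; apply: (mulIf g0); rewrite E2 gg.
- have E4 : ga * ga' = be * be'.
    apply: (mulfI a0); apply: (mulfI a0').
    transitivity ((al * ga) * (al' * ga')); first by ring.
    by rewrite -E3 E2; ring.
  have := ltn_mul gb gb'; rewrite -!abszM E4 ltnn //.
- by case: gbn; apply: (mulfI a0); rewrite E2 E3.
Qed.

(** The strict order of the entries orders the products, so these agree termwise and determine the
    entries. *)
Lemma tame_products_inj (A B G A' B' G' : nat) : (0 < G)%N -> (0 < G')%N ->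
  (G < B)%N -> (B < A)%N -> (G' < B')%N -> (B' < A')%N ->
  [\/ B * G = B' * G', B * G = A' * G' | B * G = A' * B']%N ->
  [\/ A * G = B' * G', A * G = A' * G' | A * G = A' * B']%N ->
  [\/ A * B = B' * G', A * B = A' * G' | A * B = A' * B']%N ->
  [/\ A = A', B = B' & G = G'].
Proof.
move=> g0 g0' gb ba gb' ba' D1 D2 D3.
have lt1 : (B * G < A * G)%N by rewrite ltn_pmul2r.
have lt2 : (A * G < A * B)%N by rewrite ltn_pmul2l // (leq_trans g0) // ltnW // (ltn_trans gb).
have lt1' : (B' * G' < A' * G')%N by rewrite ltn_pmul2r.
have lt2' : (A' * G' < A' * B')%N by rewrite ltn_pmul2l // (leq_trans g0') // ltnW // (ltn_trans gb').
have [E1 E2 E3] : [/\ B * G = B' * G', A * G = A' * G' & A * B = A' * B']%N.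
  move: D1 D2 D3 lt1 lt2 lt1' lt2'.
  move: (B * G)%N (A * G)%N (A * B)%N (B' * G')%N (A' * G')%N (A' * B')%N => x y z x' y' z'.
  by clear; case=> ->; case=> ->; case=> -> *; split; lia.
have AA : (A ^ 2 = A' ^ 2)%N.
  have bg0 : (0 < B * G)%N by rewrite muln_gt0 g0 (leq_trans _ gb).
  apply/eqP; rewrite -(eqn_pmul2r bg0); apply/eqP.
  transitivity ((A * G) * (A * B))%N; first by lia.
  by rewrite E2 E3 E1; lia.
have AE : A = A' by apply/eqP; rewrite -(eqn_exp2r _ _ (isT : 0 < 2)%N) AA.
have A0 : (0 < A)%N by rewrite (leq_trans _ ba).
by split=> //; apply/eqP; rewrite -(eqn_pmul2l A0); [rewrite E3|rewrite E2]; rewrite AE.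
Qed.

End SignedIntegers.

Section Indices.
Implicit Types (K : splittingFieldType rat) (al be ga : int).

(** The five families. In family 0, [al] is 3 modulo 4; in 1 and 2, [al] is [2 i] or [- 2 i] with
    [ga] congruent to 1; in 3 and 4 likewise with [ga] congruent to 3. The parameter [be] is always
    1 modulo 4. *)
Definition wal (t : 'I_5) (i : nat) : int := [:: - sint i; 2 * i%:Z; - (2 * i%:Z); 2 * i%:Z; - (2 * i%:Z)]`_t.
Definition wga (t : 'I_5) (k : nat) : int := if (t < 3)%N then sint k else - sint k.

Definition wild_index (x : 'I_5 * (nat * (nat * nat))) K : Prop :=
  isQ K (wal x.1 x.2.1) (sint x.2.2.1) (wga x.1 x.2.2.2).

Definition wscale (t : 'I_5) : nat := if val t is 0 then 1 else 2.

Lemma wal_abs t i : `|wal t i|%N = (wscale t * i)%N.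
Proof.
case: t => [[|[|[|[|[|//]]]]] ?]; rewrite /wal /wscale /= ?abszN ?sint_abs ?abszM ?mul1n //.
Qed.

Lemma wga_abs t k : `|wga t k|%N = k.
Proof. by rewrite /wga; case: ifP; rewrite ?abszN sint_abs. Qed.

Lemma sqfree_double n : odd n -> sqfree n -> sqfree (2 * n).
Proof.
move=> on sn; have := @sqfree_mul_coprime 2 n 1; rewrite !muln1; apply=> //.
by rewrite coprime2n.
Qed.

Lemma sieve_odd i j k : sieve i j k -> [/\ odd i, odd j, odd k & sqfree (i * j * k)].
Proof. by rewrite /sieve !oddM -!andbA => /and4P[-> -> -> ->]. Qed.

Lemma wild_sqfree t i j k : sieve i j k -> sqfree `|(wal t i * sint j * wga t k)%R|%N.
Proof.
move=> sv; have [oi oj ok sq] := sieve_odd sv.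
rewrite !abszM wal_abs sint_abs wga_abs -!mulnA mulnA /wscale.
case: t => [[|t] ?] /=; rewrite ?mul1n -?mulnA 1?mulnA // mulnA.
by rewrite -!mulnA [(i * _)%N]mulnA; apply: sqfree_double; rewrite ?oddM ?oi ?oj ?ok.
Qed.

Lemma wild_mod t i j k : sieve i j k -> exists a b c N M, 
  [/\ [\/ N = 3 /\ M = 1, N = 2 /\ M = 1 | N = 2 /\ M = 3],
    wal t i = 4 * a + N, sint j = 4 * b + 1, wga t k = 4 * c + M &
    [/\ (t = 0 :> nat) -> N = 3 /\ M = 1, (0 < t < 3)%N -> N = 2 /\ M = 1 & (2 < t)%N -> N = 2 /\ M = 3]].
Proof.
move=> /sieve_odd[oi oj ok _]; have [a A] := sint_mod4 oi; have [b B] := sint_mod4 oj.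
have [c C] := sint_mod4 ok.
have oi2 : i%:Z = 2 * (i %/ 2)%N%:Z + 1 by move: oi; clear; lia.
case: t => [[|[|[|[|[|//]]]]] ?]; rewrite /wal /wga /= ?A B ?C.
- by exists (- a - 1), b, c, 3, 1; split=> //; [apply: Or31|ring].
- by exists (i %/ 2)%N%:Z, b, c, 2, 1; split=> //; [apply: Or32|rewrite oi2; ring].
- by exists (- (i %/ 2)%N%:Z - 1), b, c, 2, 1; split=> //; [apply: Or32|rewrite oi2; ring].
- by exists (i %/ 2)%N%:Z, b, (- c - 1), 2, 3; split=> //; [apply: Or33|rewrite oi2; ring|ring].
- by exists (- (i %/ 2)%N%:Z - 1), b, (- c - 1), 2, 3; split=> //; [apply: Or33|rewrite oi2; ring|ring].
Qed.

Lemma wild_index_inj t i j k t' i' j' k' K L : sieve i j k -> sieve i' j' k' ->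
  (k < j)%N -> (k' < j')%N -> wild_index (t, (i, (j, k))) K -> wild_index (t', (i', (j', k'))) L ->
  field_iso K L -> (t, (i, (j, k))) = (t', (i', (j', k'))).
Proof.
move=> sv sv' kj kj' QK QL iso.
have [D1 D2 D3] := isQ_products iso (wild_sqfree t sv) (wild_sqfree t' sv') QK QL.
have [a [b [c [N [M [NM aE bE cE [h1 h2 h3]]]]]]] := wild_mod t sv.
have [a' [b' [c' [N' [M' [NM' aE' bE' cE' [h1' h2' h3']]]]]]] := wild_mod t' sv'.
have [|| EA EB EC] := wild_products_inj NM NM' aE bE cE aE' bE' cE' _ _ D1 D2 D3.
- by rewrite wga_abs sint_abs.
- by rewrite wga_abs sint_abs.
have jj : j = j' by rewrite -(sint_abs j) EB sint_abs.
have kk : k = k' by rewrite -(wga_abs t k) EC wga_abs.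
have [_ _ _ /sqfreeP[p0 _]] := sieve_odd sv; have [_ _ _ /sqfreeP[p0' _]] := sieve_odd sv'.
have i0 : (0 < i)%N by move: p0; rewrite !muln_gt0 -andbA => /and3P[].
have i0' : (0 < i')%N by move: p0'; rewrite !muln_gt0 -andbA => /and3P[].
have NN : N = N' by move: EA; rewrite aE aE'; clear -NM NM'; case: NM => -[-> _]; case: NM' => -[-> _]; lia.
have MM : M = M' by move: EC; rewrite cE cE'; clear -NM NM'; case: NM => -[_ ->]; case: NM' => -[_ ->]; lia.
have [tt ii] : t = t' /\ i = i'.
{ move: EA h1 h2 h3 h1' h2' h3' i0 i0'; rewrite -NN -MM; clear.
  case: t t' => [[|[|[|[|[|//]]]]] tl] [[|[|[|[|[|//]]]]] tl']; rewrite /wal /=.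
  all: move=> E p1 p2 p3 q1 q2 q3 i0 i0'.
  all: first [have [e1 e2] := p1 erefl|have [e1 e2] := p2 isT|have [e1 e2] := p3 isT].
  all: first [have [e3 e4] := q1 erefl|have [e3 e4] := q2 isT|have [e3 e4] := q3 isT].
  all: first [by exfalso; clear -e1 e2 e3 e4; lia|by exfalso; clear -E i0 i0'; lia|split; first exact: val_inj].
  all: first [by clear -E; lia|by move/oppr_inj/(congr1 absz): E; rewrite !sint_abs].
}
by rewrite tt ii jj kk.
Qed.

Definition tame_index (x : nat * (nat * nat)) K : Prop :=
  isQ K (sint x.2.1) (sint x.2.2) (sint x.1).

Lemma tame_sqfree i j k : sieve i j k -> sqfree `|(sint j * sint k * sint i)%R|%N.
Proof.
by move=> /sieve_odd[_ _ _ sq]; rewrite !abszM !sint_abs mulnC mulnA.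
Qed.

Lemma tame_index_inj i j k i' j' k' K L : sieve i j k -> sieve i' j' k' ->
  (i < k)%N -> (k < j)%N -> (i' < k')%N -> (k' < j')%N ->
  tame_index (i, (j, k)) K -> tame_index (i', (j', k')) L ->
  field_iso K L -> (i, (j, k)) = (i', (j', k')).
Proof.
move=> sv sv' ik kj ik' kj' QK QL iso.
have [D1 D2 D3] := isQ_products iso (tame_sqfree sv) (tame_sqfree sv') QK QL.
have ab (x y z w : nat) : sint x * sint y = sint z * sint w -> (x * y = z * w)%N.
  by move=> /(congr1 absz); rewrite !abszM !sint_abs.
have [_ _ _ /sqfreeP[p0 _]] := sieve_odd sv; have [_ _ _ /sqfreeP[p0' _]] := sieve_odd sv'.
have i0 : (0 < i)%N by move: p0; rewrite !muln_gt0 -andbA => /and3P[].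
have i0' : (0 < i')%N by move: p0'; rewrite !muln_gt0 -andbA => /and3P[].
have [||| -> -> -> //] := @tame_products_inj j k i j' k' i' i0 i0' ik kj ik' kj'.
- by case: D1 => /ab; [apply: Or31|apply: Or32|apply: Or33].
- by case: D2 => /ab; [apply: Or31|apply: Or32|apply: Or33].
- by case: D3 => /ab; [apply: Or31|apply: Or32|apply: Or33].
Qed.

Lemma sqfree_square n m : sqfree (n * n * m) -> n = 1%N.
Proof.
move=> sq; have /sqfreeP[p0 _] := sq; have n0 : (0 < n)%N by move: p0; rewrite !muln_gt0 -andbA => /andP[].
by apply/eqP; rewrite -dvdn1; apply: (sqfree_dvd_sqr sq n0); rewrite muln1 expnS expn1 dvdn_mulr.
Qed.

Lemma not_sqfree_4 (m : nat) : ~ sqfree (4 * m).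
Proof. by move=> /(@sqfree_square 2). Qed.

Lemma int_mod4 (z : int) : exists a, [\/ z = 4 * a + 1, z = 4 * a + 3, z = 4 * a + 2 | z = 4 * a].
Proof.
exists (z %/ 4)%Z; have := divz_eq z 4; have := modz_ge0 z (isT : 4 != 0 :> int).
have := ltz_mod z (isT : 4 != 0 :> int) => lt ge E.
have : [\/ (z %% 4)%Z = 1, (z %% 4)%Z = 3, (z %% 4)%Z = 2 | (z %% 4)%Z = 0].
  move: ge lt; rewrite ger0_norm //; move: (z %% 4)%Z; clear; move=> m ge lt.
  have : m = 0 \/ m = 1 \/ m = 2 \/ m = 3 by lia.
  by case=> [->|[->|[->|->]]]; [apply: Or44|apply: Or41|apply: Or43|apply: Or42].
by case=> M; rewrite M in E; [apply: Or41|apply: Or42|apply: Or43|apply: Or44]; rewrite {1}E; clear; lia.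
Qed.

(** The order [k <= j] breaks the symmetry between [be] and [ga] and matches [x <= y]. *)
Definition normal_wild K : Prop := exists t i j k,
  [/\ sieve i j k, (k <= j)%N & wild_index (t, (i, (j, k))) K].
Definition normal_tame K : Prop := exists i j k,
  [/\ sieve i j k, (i < k)%N, (k < j)%N & tame_index (i, (j, k)) K].

(** Exchanging [be] with [ga] and changing all signs are both free: the first orders the two odd
    entries, the second makes the larger one 1 modulo 4. *)
Lemma normal_even K al be ga (a b c : int) N M : isQ K al be ga -> sqfree `|(al * be * ga)%R|%N ->
  al = 4 * a + 2 -> be = 4 * b + N -> ga = 4 * c + M -> N = 1 \/ N = 3 -> M = 1 \/ M = 3 ->
  normal_wild K.
Proof.
wlog gb : be ga b c N M / (`|ga| <= `|be|)%N.
  move=> H Q sq aE bE cE N13 M13; case: (leqP `|ga| `|be|) => [gb|/ltnW bg].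
    exact: (H be ga b c N M).
  apply: (H ga be c b M N) => //; first exact: isQ_swap.
  by rewrite mulrAC.
wlog N1 : al be ga a b c N M gb / N = 1.
  move=> H Q sq aE bE cE [N1|N3] M13.
    by apply: (H al be ga a b c N M) => //; left.
  apply: (H (- al) (- be) (- ga) (- a - 1) (- b - 1) (- c - 1) 1 (4 - M)) => //.
  - by rewrite !abszN.
  - exact: isQ_opp.
  - by have -> : - al * - be * - ga = - (al * be * ga) by [ring]; rewrite abszN.
  - by rewrite aE; ring.
  - by rewrite bE N3; ring.
  - by rewrite cE; ring.
  - by left.
  - by case: M13 => ->; [right|left].
move=> Q sq aE bE cE _ M13; rewrite N1 in bE.
pose i := `|(2 * a + 1)%R|%N; pose t : 'I_5 := if M == 1 then if 0 <= al then @Ordinal 5 1 isT else @Ordinal 5 2 isT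
   else if 0 <= al then @Ordinal 5 3 isT else @Ordinal 5 4 isT.
have a2 : al = 2 * (2 * a + 1) by rewrite aE; ring.
have sv : sieve i `|be|%N `|ga|%N.
  rewrite /sieve !oddM; apply/andP; split.
    by rewrite /i bE cE; clear -M13; case: M13 => ->; lia.
  apply: (@sqfreeMl _ 2); move: sq; rewrite a2 !abszM -/i.
  by rewrite (_ : `|2%R : int|%N * i * `|be| * `|ga| = i * `|be| * `|ga| * 2)%N //; clear; lia.
have tE : wal t i = al /\ wga t `|ga|%N = ga.
  rewrite /t /wal /wga; case: M13 => ME; rewrite ME in cE *; rewrite /= ?(sint_of cE) ?(sint3_of cE);
    case: ifP => al0; rewrite /= ?(sint_of cE) ?(sint3_of cE); split=> //; rewrite /i; clear -al0 a2; lia.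
exists t, i, `|be|%N, `|ga|%N; split=> //.
by rewrite /wild_index /=; case: tE => -> ->; rewrite (sint_of bE).
Qed.

Lemma normal_odd_wild K al be ga (a b c : int) : isQ K al be ga -> sqfree `|(al * be * ga)%R|%N ->
  al = 4 * a + 3 -> be = 4 * b + 1 -> ga = 4 * c + 1 -> normal_wild K.
Proof.
wlog gb : be ga b c / (`|ga| <= `|be|)%N.
  move=> H Q sq aE bE cE; case: (leqP `|ga| `|be|) => [gb|/ltnW bg].
    exact: (H be ga b c).
  by apply: (H ga be c b) => //; [exact: isQ_swap|rewrite mulrAC].
move=> Q sq aE bE cE; exists (@Ordinal 5 0 isT), `|al|%N, `|be|%N, `|ga|%N; split=> //.
  rewrite /sieve -!abszM sq andbT !abszM !oddM aE bE cE; clear; lia.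
by rewrite /wild_index /wal /wga /= (sint3_of aE) (sint_of bE) (sint_of cE).
Qed.

(** Equal absolute values and equal residues give [al = be], squarefreeness makes this 1 or -1, and
    [al be = 1] is excluded because [t] is irrational. *)
Lemma isQ_abs_neq K al be ga (a b : int) : isQ K al be ga -> sqfree `|(al * be * ga)%R|%N ->
  al = 4 * a + 1 -> be = 4 * b + 1 -> `|al|%N <> `|be|%N.
Proof.
move=> Q sq aE bE E; have [_ _ /eqP n3] := isQ_neq1 Q.
have e : al = be by rewrite -(sint_of aE) E (sint_of bE).
have A1 : `|be|%N = 1%N by move: sq; rewrite !abszM E; exact: sqfree_square.
apply: n3; rewrite e; have [->|->] : be = 1 \/ be = -1 by clear -A1; lia.
  by [].
by [].
Qed.

Lemma normal_odd_tame K al be ga (a b c : int) : isQ K al be ga -> sqfree `|(al * be * ga)%R|%N ->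
  al = 4 * a + 1 -> be = 4 * b + 1 -> ga = 4 * c + 1 -> normal_tame K.
Proof.
move=> Q sq aE bE cE; have [Q1 Q2] := isQ_perm Q.
have sorted x y z (u v w : int) : isQ K x y z -> sqfree `|(x * y * z)%R|%N -> x = 4 * u + 1 -> y = 4 * v + 1 ->
    z = 4 * w + 1 -> (`|z| < `|y|)%N -> (`|y| < `|x|)%N -> normal_tame K.
  move=> Qx sx xE yE zE zy yx; exists `|z|%N, `|x|%N, `|y|%N; split=> //.
    rewrite /sieve; apply/andP; split; first by rewrite !oddM xE yE zE; clear; lia.
    by move: sx; rewrite !abszM mulnC mulnA.
  by rewrite /tame_index /= (sint_of xE) (sint_of yE) (sint_of zE).
have nab := isQ_abs_neq Q sq aE bE.
have sq' : sqfree `|(al * ga * be)%R|%N by rewrite mulrAC.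
have nac := isQ_abs_neq (isQ_swap Q) sq' aE cE.
have sq2 : sqfree `|(be * ga * al)%R|%N by rewrite mulrC mulrA.
have nbc := isQ_abs_neq Q2 sq2 bE cE.
have Q3 : isQ K ga al be by have [_ + ] := isQ_perm Q2.
have sq1 : sqfree `|(be * al * ga)%R|%N by rewrite [be * al]mulrC.
have sq3 : sqfree `|(ga * al * be)%R|%N by rewrite -mulrA mulrC.
have sq4 : sqfree `|(ga * be * al)%R|%N by have -> : ga * be * al = al * be * ga by ring.
case: (ltngtP `|al| `|be|) => // ab; case: (ltngtP `|al| `|ga|) => // ac; case: (ltngtP `|be| `|ga|) => // bc.
- exact: (sorted ga be al c b a (isQ_swap Q3)).
- exact: (sorted be ga al b c a Q2).
- by have := ltn_trans bc (ltn_trans ac ab); rewrite ltnn.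
- exact: (sorted be al ga b a c Q1).
- exact: (sorted ga al be c a b Q3).
- by have := ltn_trans bc (ltn_trans ab ac); rewrite ltnn.
- exact: (sorted al ga be a c b (isQ_swap Q)).
- exact: (sorted al be ga a b c Q).
Qed.

(** Among three odd residues modulo 4 two agree, and a change of all signs makes the common residue
    1. *)
Lemma normal_odd K al be ga (a b c N M P : int) : isQ K al be ga -> sqfree `|(al * be * ga)%R|%N ->
  al = 4 * a + N -> be = 4 * b + M -> ga = 4 * c + P -> N = 1 \/ N = 3 -> M = 1 \/ M = 3 ->
  P = 1 \/ P = 3 -> normal_wild K \/ normal_tame K.
Proof.
move=> Q sq aE bE cE; have [Q1 Q2] := isQ_perm Q; have [_ Q3] := isQ_perm Q2.
have opp (x u : int) n m : x = 4 * u + n -> n + m = 4 -> - x = 4 * (- u - 1) + m.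
  by move=> -> e; have -> : m = 4 - n by [rewrite -e; ring]; ring.
have sqN : sqfree `|(- al * - be * - ga)%R|%N.
  by have -> : - al * - be * - ga = - (al * be * ga) by [ring]; rewrite abszN.
have s2 : sqfree `|(be * al * ga)%R|%N by rewrite [be * al]mulrC.
have s3 : sqfree `|(ga * al * be)%R|%N by rewrite -mulrA mulrC.
have s2N : sqfree `|(- be * - al * - ga)%R|%N by rewrite [- be * - al]mulrC.
have s3N : sqfree `|(- ga * - al * - be)%R|%N by rewrite -mulrA mulrC.
have Q1N := isQ_opp Q1; have Q3N := isQ_opp Q3; have QN := isQ_opp Q.
case=> NE [] ME [] PE; rewrite ?NE ?ME ?PE in aE bE cE.
- by right; exact: normal_odd_tame Q sq aE bE cE.
- by left; exact: normal_odd_wild Q3 s3 cE aE bE.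
- by left; exact: normal_odd_wild Q1 s2 bE aE cE.
- left; exact: normal_odd_wild QN sqN (opp _ _ _ 3 aE erefl) (opp _ _ _ 1 bE erefl) (opp _ _ _ 1 cE erefl).
- by left; exact: normal_odd_wild Q sq aE bE cE.
- left; exact: normal_odd_wild Q1N s2N (opp _ _ _ 3 bE erefl) (opp _ _ _ 1 aE erefl) (opp _ _ _ 1 cE erefl).
- left; exact: normal_odd_wild Q3N s3N (opp _ _ _ 3 cE erefl) (opp _ _ _ 1 aE erefl) (opp _ _ _ 1 bE erefl).
- right; exact: normal_odd_tame QN sqN (opp _ _ _ 1 aE erefl) (opp _ _ _ 1 bE erefl) (opp _ _ _ 1 cE erefl).
Qed.

(** A squarefree product is not divisible by 4, so at most one parameter is even; permutations bring
    it to the front. *)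
Theorem V4_normal K : V4_quartic K -> normal_wild K \/ normal_tame K.
Proof.
move=> /V4_biquad[al [be [ga [r [s [t [sq bq]]]]]]].
have Q : isQ K al be ga by exists r, s, t.
have [Q1 Q2] := isQ_perm Q; have [_ Q3] := isQ_perm Q2.
have s2 : sqfree `|(be * al * ga)%R|%N by rewrite [be * al]mulrC.
have s3 : sqfree `|(ga * al * be)%R|%N by rewrite -mulrA mulrC.
have n4 (x y : int) : `|(al * be * ga)%R|%N = `|(4 * x * y)%R|%N -> False.
  by move=> E; move: sq; rewrite E -mulrA abszM => /not_sqfree_4.
have cls (x y : int) : `|(al * be * ga)%R|%N = `|(x * y)%R|%N ->
    (exists a N, x = 4 * a + N /\ (N = 1 \/ N = 3)) \/ exists a, x = 4 * a + 2.
  move=> E; have [a [xE|xE|xE|xE]] := int_mod4 x.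
  - by left; exists a, 1; split=> //; left.
  - by left; exists a, 3; split=> //; right.
  - by right; exists a.
  - by case: (n4 a y); rewrite E xE.
have [[a [N [aE NN]]]|[a aE]] := cls al (be * ga) (congr1 absz (esym (mulrA _ _ _)));
have [[b [M [bE MM]]]|[b bE]] := cls be (al * ga) (congr1 absz (etrans (congr1 ( *%R^~ ga) (mulrC _ _)) (esym (mulrA _ _ _))));
have [[c [P [cE PP]]]|[c cE]] := cls ga (al * be) (congr1 absz (mulrC _ _)).
- exact: normal_odd Q sq aE bE cE NN MM PP.
- by left; exact: normal_even Q3 s3 cE aE bE NN MM.
- by left; exact: normal_even Q1 s2 bE aE cE NN PP.
- by case: (n4 ((2 * b + 1) * (2 * c + 1)) al); rewrite bE cE; congr absz; ring.
- by left; exact: normal_even Q sq aE bE cE MM PP.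
- by case: (n4 ((2 * a + 1) * (2 * c + 1)) be); rewrite aE cE; congr absz; ring.
- by case: (n4 ((2 * a + 1) * (2 * b + 1)) ga); rewrite aE bE; congr absz; ring.
- by case: (n4 ((2 * a + 1) * (2 * b + 1)) ga); rewrite aE bE; congr absz; ring.
Qed.

End Indices.

(** * Counting fields through their indices *)

Section IndexedFields.
Variable R : realType.
Implicit Types (K : splittingFieldType rat) (i j k : nat).

(** The square root of the discriminant divided by [ijk]: 4, 8, 8, 16, 16 for the five families. *)
Definition wconst (t : 'I_5) : nat := ((if (t < 3)%N then 4 else 8) * wscale t)%N.
(** The factor 2 or 1 is the [n] of [field_shape_wild]; the root accounts for [al] having absolute
    value [i] or [2 i]. *)
Definition wlam (t : 'I_5) : R := (if (t < 3)%N then 2 else 1) * Num.sqrt (wscale t)%:R.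

Lemma sqfree_neq0 al be ga : sqfree `|(al * be * ga)%R|%N -> [/\ al != 0, be != 0 & ga != 0].
Proof.
by move=> /sqfreeP[+ _]; rewrite !abszM !muln_gt0 !absz_gt0 -andbA => /and3P[].
Qed.

Lemma sieve_pos i j k : sieve i j k -> [/\ (0 < i)%N, (0 < j)%N & (0 < k)%N].
Proof. by move=> /sieve_odd[_ _ _ /sqfreeP[]]; rewrite !muln_gt0 -andbA => /and3P[]. Qed.

Lemma sqr_absz (n : int) : (n%:~R : rat) ^+ 2 = ((`|n|%N)%:R) ^+ 2.
Proof. by rewrite natr_absz intr_norm real_normK ?num_real. Qed.

Lemma wild_field K t i j k : sieve i j k -> wild_index (t, (i, (j, k))) K ->
  [/\ V4_quartic K, wildly_ramified K,
    forall d : int, is_discriminant K d <-> d = ((wconst t * (i * j * k)) ^ 2)%N%:Z &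
    field_shape R 4 K = sh_oC (shape_pt (wlam t) i j k).1 (shape_pt (wlam t) i j k).2].
Proof.
move=> sv [r [s [t0 bq]]]; have sq := wild_sqfree t sv.
have [a [b [c [N [M [NM aE bE cE [h1 h2 h3]]]]]]] := wild_mod t sv.
have abg := sqfree_neq0 sq.
have absE : `|(wal t i * sint j * wga t k)%R|%N = (wscale t * (i * j * k))%N.
  by rewrite !abszM wal_abs sint_abs wga_abs -!mulnA.
have shapeE (n : nat) x : x = j \/ x = k ->
    n%:R * Num.sqrt ((wscale t * i)%:R / x%:R) = n%:R * Num.sqrt (wscale t)%:R * Num.sqrt (i%:R / x%:R) :> R.
  by move=> _; rewrite natrM -mulrA sqrtrM // mulrA.
have ME3 : (t < 3)%N -> M = 1.
  move=> t3; have [t0'|t0'] := posnP (val t); first by case: (h1 t0').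
  by case: h2 => //; rewrite t3 t0'.
split; first exact: biquad_V4 bq.
- have [t3|t3] := ltnP t 3; last first.
    have [NE ME] := h3 t3; rewrite NE in aE; rewrite ME in cE.
    exact: type2_ramifies bq sq aE bE cE.
  have N23 : N = 2 \/ N = 3 by case: NM => -[-> _]; [right|left|left].
  have ME := ME3 t3.
  rewrite ME in cE; exact: type1_ramifies bq sq N23 aE bE cE.
- move=> d; have [t3|t3] := ltnP t 3; last first.
    have [NE ME] := h3 t3; rewrite NE in aE; rewrite ME in cE.
    have rl := ring_lattice_type2 bq sq aE bE cE.
    apply: (ring_lattice_disc _ bq rl); rewrite ?oner_neq0 //.
    by rewrite sqr_absz absE /wconst ltnNge t3 /= !(natrX, natrM, rmorphXn, natz) -[_%:~R]/(_%:R); rewrite natrX !natrM; field.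
  have N23 : N = 2 \/ N = 3 by case: NM => -[-> _]; [right|left|left].
  have ME := ME3 t3.
  rewrite ME in cE; have rl := ring_lattice_type1 bq sq N23 aE bE cE.
  apply: (ring_lattice_disc _ bq rl); rewrite ?oner_neq0 //.
  by rewrite sqr_absz absE /wconst t3 -[_%:~R]/(_%:R) natrX !natrM; field.
- have [t3|t3] := ltnP t 3; last first.
    have [NE ME] := h3 t3; rewrite NE in aE; rewrite ME in cE.
    have rl := ring_lattice_type2 bq sq aE bE cE.
    have rl' : ring_lattice r s t0 0 (1 / 1%:R) 0 1 0 0 (1 / 2) (1 / 2) by rewrite divr1.
    rewrite (field_shape_wild R bq abg (isT : 0 < 1)%N rl').
    rewrite wal_abs sint_abs wga_abs !shapeE; [|by right|by left].
    by rewrite /shape_pt /wlam ltnNge t3.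
  have N23 : N = 2 \/ N = 3 by case: NM => -[-> _]; [right|left|left].
  have ME := ME3 t3.
  rewrite ME in cE; have rl := ring_lattice_type1 bq sq N23 aE bE cE.
  rewrite (field_shape_wild R bq abg (isT : 0 < 2)%N rl).
  rewrite wal_abs sint_abs wga_abs !shapeE; [|by right|by left].
  by rewrite /shape_pt /wlam t3.
Qed.

Lemma tame_field K i j k : sieve i j k -> tame_index (i, (j, k)) K ->
  [/\ V4_quartic K, tamely_ramified K,
    forall d : int, is_discriminant K d <-> d = ((i * j * k) ^ 2)%N%:Z &
    field_shape R 4 K = sh_oI (shape_pt (1 : R) i j k).1 (shape_pt (1 : R) i j k).2].
Proof.
move=> sv [r [s [t0 bq]]]; have sq := tame_sqfree sv; have abg := sqfree_neq0 sq.
have [oi oj ok _] := sieve_odd sv.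
have [a aE] := sint_mod4 oj; have [b bE] := sint_mod4 ok; have [c cE] := sint_mod4 oi.
have rl := ring_lattice_tame bq sq aE bE cE.
split; first exact: biquad_V4 bq.
- exact: tame_not_ramifies bq sq aE bE cE.
- move=> d; apply: (ring_lattice_disc _ bq rl) => //.
  by rewrite sqr_absz !abszM !sint_abs -[_%:~R]/(_%:R) natrX !natrM; field.
- by rewrite (field_shape_tame R bq abg rl) !sint_abs /shape_pt !mul1r.
Qed.

Lemma sqrt_ratio_le i j k : (0 < i)%N -> (0 < j)%N -> (0 < k)%N ->
  (Num.sqrt (i%:R / j%:R) <= Num.sqrt (i%:R / k%:R) :> R) = (k <= j)%N.
Proof.
move=> i0 j0 k0; rewrite ler_psqrt ?nnegrE ?divr_ge0 // ler_pM2l ?ltr0n //.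
by rewrite lef_pV2 ?posrE ?ltr0n // ler_nat.
Qed.

Lemma sqrt_ratio_lt1 i k : (0 < k)%N -> (Num.sqrt (i%:R / k%:R) < 1 :> R) = (i < k)%N.
Proof.
move=> k0; rewrite ltNge -[X in ~~ (X <= _)]sqrtr1 ler_psqrt ?nnegrE ?divr_ge0 //.
by rewrite ler_pdivlMr ?ltr0n // mul1r ler_nat -ltnNge.
Qed.

Lemma disc_bound (X : R) (n : nat) : 0 <= X -> (((n ^ 2)%N%:Z)%:~R <= X) = (n%:R <= Num.sqrt X).
Proof.
move=> X0; rewrite -[_%:~R]/((n ^ 2)%N%:R) natrX -{1}(sqr_sqrtr X0).
by rewrite ler_pXn2r // nnegrE ?sqrtr_ge0.
Qed.

(** The solution [T] of [c T^3 = sqrt X], so that [ijk <= T^3] is the bound on the discriminant. *)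
Definition cone_radius (X : R) (c : nat) : R := (Num.sqrt X / c%:R) `^ 3^-1.

Lemma cone_radius3 X c : cone_radius X c ^+ 3 = Num.sqrt X / c%:R.
Proof.
have H : 0 <= Num.sqrt X / c%:R by rewrite divr_ge0.
by rewrite -powR_mulrn ?powR_ge0 // -powRrM mulVf // powRr1.
Qed.

(** Leaves out [j = k], which for a squarefree product means [j = k = 1]; there [be ga] may be 1,
    and then no quartic field belongs to the index. *)
Definition sieve_neq i j k := sieve i j k && (j != k).

Lemma wlam_gt0 t : 0 < wlam t.
Proof.
apply: mulr_gt0; first by case: ifP.
by rewrite sqrtr_gt0 ltr0n /wscale; case: (val t).
Qed.

Lemma wconst_gt0 t : (0 < wconst t)%N.
Proof. by rewrite /wconst /wscale; case: ifP; case: (val t). Qed.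

Lemma shape_pt_pos (lam : R) i j k : 0 < lam -> (0 < i)%N -> (0 < j)%N -> (0 < k)%N ->
  0 < (shape_pt lam i j k).1 /\ 0 < (shape_pt lam i j k).2.
Proof.
by move=> l0 i0 j0 k0; split; rewrite mulr_gt0 // sqrtr_gt0 divr_gt0 ?ltr0n.
Qed.

Lemma shape_pt_le (lam : R) i j k : 0 < lam -> (0 < i)%N -> (0 < j)%N -> (0 < k)%N ->
  ((shape_pt lam i j k).1 <= (shape_pt lam i j k).2) = (k <= j)%N.
Proof. by move=> l0 i0 j0 k0; rewrite ler_pM2l // sqrt_ratio_le. Qed.

Lemma cone_region_bound (lam : R) W S X c i j k : (0 < c)%N -> cone_region lam W S (cone_radius X c) i j k ->
  [&& i < (Num.truncn (Num.sqrt X)).+1, j < (Num.truncn (Num.sqrt X)).+1 & k < (Num.truncn (Num.sqrt X)).+1]%N.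
Proof.
move=> c0 /cone_region_lt /and3P[].
have le : (Num.truncn (cone_radius X c ^+ 3) <= Num.truncn (Num.sqrt X))%N.
  apply: le_truncn; rewrite cone_radius3 ler_pdivrMr ?ltr0n // ler_peMr ?sqrtr_ge0 //.
  by rewrite ler1n.
by move=> h1 h2 h3; apply/and3P; split; apply: leq_trans (le : _ < _.+1)%N.
Qed.

Lemma sqfree_biquad_exists al be ga : sqfree `|(al * be * ga)%R|%N ->
  be * ga != 1 -> al * ga != 1 -> al * be != 1 -> exists K, isQ K al be ga.
Proof.
by move=> sq h1 h2 h3; have [K [r [s [t bq]]]] := biquad_exists sq h1 h2 h3; exists K, r, s, t.
Qed.

(** For the upper bound, every field has an index with [k <= j]. For the lower bound, an index with
    [j <> k] is realised, and non-isomorphic fields belong to distinct indices. *)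
Lemma wild_count_bounds (W : set (R * R)) (X : R) : W `<=` S_oC R -> 0 < X ->
  (\sum_(t < 5) cone_count (wlam t) W sieve_neq (cone_radius X (wconst t)) <= N_wild X W
   <= \sum_(t < 5) cone_count (wlam t) W sieve (cone_radius X (wconst t)))%N.
Proof.
move=> WS X0; pose B := (Num.truncn (Num.sqrt X)).+1.
have bnd S t i j k := @cone_region_bound (wlam t) W S X (wconst t) i j k (wconst_gt0 t).
have cE S : (\sum_(t < 5) cone_count (wlam t) W S (cone_radius X (wconst t)))%N =
    #|[pred x : 'I_5 * ('I_B * ('I_B * 'I_B)) |
       cone_region (wlam x.1) W S (cone_radius X (wconst x.1)) x.2.1 x.2.2.1 x.2.2.2]|.
  rewrite (@card_cnt 5 B (fun t => cone_region (wlam t) W S (cone_radius X (wconst t)))).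
  by apply: eq_bigr => t _; apply/esym; exact: cone_countE (bnd S t).
have regE S t i j k : cone_region (wlam t) W S (cone_radius X (wconst t)) i j k ->
    [/\ S i j k, W (shape_pt (wlam t) i j k) & (wconst t * (i * j * k))%:R <= Num.sqrt X].
  rewrite /cone_region cone_radius3 => /andP[sv /and5P[_ _ _ /asboolP w]].
  rewrite ler_pdivlMr ?ltr0n ?wconst_gt0 // => H; split=> //.
  by rewrite natrM mulrC.
rewrite !cE; apply: (@count_upto_iso_bounds ('I_5 * ('I_B * ('I_B * 'I_B)))%type _ (fun x K => wild_index
  (x.1, (x.2.1 : nat, (x.2.2.1 : nat, x.2.2.2 : nat))) K)).
- move=> K [V4 wild [d dK dX] [p Wp shK]].
  have [[t [i [j [k [sv kj wi]]]]]|[i [j [k [sv _ _ ti]]]]] := V4_normal V4; last first.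
    by have [_ tame _ _] := tame_field sv ti.
  have [_ _ disc sh] := wild_field sv wi; have [i0 j0 k0] := sieve_pos sv.
  have pE : shape_pt (wlam t) i j k = p.
    apply: sh_oC_inj; [|exact: WS|by rewrite -sh].
    have [? _] := shape_pt_pos (wlam_gt0 t) i0 j0 k0.
    by split=> //; rewrite shape_pt_le // wlam_gt0.
  have reg : cone_region (wlam t) W sieve (cone_radius X (wconst t)) i j k.
    apply/and5P; split=> //; rewrite pE; apply/andP; split; first exact/asboolP.
    rewrite cone_radius3 ler_pdivlMr ?ltr0n ?wconst_gt0 // mulrC -natrM -disc_bound ?(ltW X0) //.
    by move/disc: dK => <-.
  have /and3P[iB jB kB] := bnd _ _ _ _ _ reg.
  by exists (t, (Ordinal iB, (Ordinal jB, Ordinal kB))).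
- by move=> x K L; exact: isQ_iso.
- move=> [t [i [j k]]] /= /regE /=[/andP[sv jk] Wp H].
  have [i0 j0 k0] := sieve_pos sv; have [_ le] := WS _ Wp.
  rewrite shape_pt_le ?wlam_gt0 // leq_eqVlt eq_sym (negbTE jk) /= in le.
  have [a [b [c [N [M [NM aE bE gE _]]]]]] := wild_mod t sv.
  have [||| K QK] := sqfree_biquad_exists (wild_sqfree t sv).
  (* Here [be ga = 1] would need [j = k = 1]; the other two products are not 1 modulo 4. *)
  + apply/negP => /eqP/(congr1 absz); rewrite abszM sint_abs wga_abs => /eqP.
    by rewrite muln_eq1 => /andP[/eqP j1 /eqP k1]; move: le; rewrite j1 k1.
  + by rewrite aE gE; clear -NM; apply/eqP; case: NM => -[-> ->]; lia.
  + by rewrite aE bE; clear -NM; apply/eqP; case: NM => -[-> _]; lia.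
  have [V4 wild disc sh] := wild_field sv QK.
  exists K => //; split=> //.
    by exists (((wconst t * (i * j * k)) ^ 2)%N%:Z); [exact/disc|rewrite disc_bound ?(ltW X0)].
  by exists (shape_pt (wlam t) i j k).
- move=> [t [i [j k]]] [t' [i' [j' k']]] K L /= /regE /=[/andP[sv jk] Wp _] /regE /=[/andP[sv' jk'] Wp' _] QK QL iso.
  have [i0 j0 k0] := sieve_pos sv; have [_ le] := WS _ Wp.
  rewrite shape_pt_le ?wlam_gt0 // leq_eqVlt eq_sym (negbTE jk) /= in le.
  have [i0' j0' k0'] := sieve_pos sv'; have [_ le'] := WS _ Wp'.
  rewrite shape_pt_le ?wlam_gt0 // leq_eqVlt eq_sym (negbTE jk') /= in le'.
  by have [-> /val_inj -> /val_inj -> /val_inj ->] := wild_index_inj sv sv' le le' QK QL iso.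
Qed.

(** The strict inequalities of [S_oI] separate the entries, so every index is realised and the count
    is exact. *)
Lemma tame_count (W : set (R * R)) (X : R) : W `<=` S_oI R -> 0 < X ->
  N_tame X W = cone_count 1 W sieve (cone_radius X 1).
Proof.
move=> WS X0; pose B := (Num.truncn (Num.sqrt X)).+1.
have bnd i j k := @cone_region_bound 1 W sieve X 1 i j k isT.
have cE : cone_count 1 W sieve (cone_radius X 1) =
    #|[pred x : 'I_1 * ('I_B * ('I_B * 'I_B)) |
       cone_region 1 W sieve (cone_radius X 1) x.2.1 x.2.2.1 x.2.2.2]|.
  rewrite (@card_cnt 1 B (fun=> cone_region 1 W sieve (cone_radius X 1))) big_ord1.
  by apply/esym; exact: cone_countE bnd.
have regE i j k : cone_region 1 W sieve (cone_radius X 1) i j k ->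
    [/\ sieve i j k, W (shape_pt 1 i j k) & (i * j * k)%:R <= Num.sqrt X].
  by rewrite /cone_region cone_radius3 divr1 => /andP[sv /and5P[_ _ _ /asboolP w H]].
have ineq i j k : sieve i j k -> W (shape_pt 1 i j k) -> (i < k)%N /\ (k < j)%N.
  move=> sv /WS[/= _]; have [i0 j0 k0] := sieve_pos sv; rewrite !mul1r.
  by rewrite ltNge sqrt_ratio_le // -ltnNge => kj; rewrite sqrt_ratio_lt1.
apply/eqP; rewrite eqn_leq andbC cE.
apply: (@count_upto_iso_bounds ('I_1 * ('I_B * ('I_B * 'I_B)))%type _ (fun x K => tame_index
  (x.2.1 : nat, (x.2.2.1 : nat, x.2.2.2 : nat)) K)).
- move=> K [V4 tame [d dK dX] [p Wp shK]].
  have [[t [i [j [k [sv kj wi]]]]]|[i [j [k [sv ik kj ti]]]]] := V4_normal V4.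
    by have [_ wild _ _] := wild_field sv wi.
  have [_ _ disc sh] := tame_field sv ti; have [i0 j0 k0] := sieve_pos sv.
  have pE : shape_pt 1 i j k = p.
    apply: sh_oI_inj; [|exact: WS|by rewrite -sh].
    have [? _] := shape_pt_pos (ltr01 : 0 < 1 :> R) i0 j0 k0; split=> //=; rewrite !mul1r.
      by rewrite ltNge sqrt_ratio_le // -ltnNge.
    by rewrite sqrt_ratio_lt1.
  have reg : cone_region 1 W sieve (cone_radius X 1) i j k.
    apply/and5P; split=> //; rewrite pE; apply/andP; split; first exact/asboolP.
    by rewrite cone_radius3 divr1 -disc_bound ?(ltW X0) //; move/disc: dK => <-.
  have /and3P[iB jB kB] := bnd _ _ _ reg.
  by exists (ord0, (Ordinal iB, (Ordinal jB, Ordinal kB))).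
- by move=> x K L; exact: isQ_iso.
- move=> [t [i [j k]]] /= /regE /=[sv Wp H]; have [ik kj] := ineq _ _ _ sv Wp.
  have neq (m n : nat) : (m < n)%N -> sint m * sint n != 1 /\ sint n * sint m != 1.
    move=> mn; rewrite [X in _ /\ X != 1]mulrC.
    suff : sint m * sint n != 1 by [].
    apply/negP => /eqP/(congr1 absz); rewrite abszM !sint_abs => /eqP.
    by rewrite muln_eq1 => /andP[/eqP m1 /eqP n1]; rewrite m1 n1 in mn.
  have [||| K QK] := sqfree_biquad_exists (tame_sqfree sv).
  + by have [] := neq _ _ ik.
  + by have [] := neq _ _ (ltn_trans ik kj).
  + by have [] := neq _ _ kj.
  have [V4 tame disc sh] := tame_field sv QK.
  exists K => //; split=> //.
    by exists (((i * j * k) ^ 2)%N%:Z); [exact/disc|rewrite disc_bound ?(ltW X0)].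
  by exists (shape_pt 1 i j k).
- move=> [t [i [j k]]] [t' [i' [j' k']]] K L /= /regE /=[sv Wp _] /regE /=[sv' Wp' _] QK QL iso.
  have [ik kj] := ineq _ _ _ sv Wp; have [ik' kj'] := ineq _ _ _ sv' Wp'.
  have [/val_inj -> /val_inj -> /val_inj ->] := tame_index_inj sv sv' ik kj ik' kj' QK QL iso.
  by rewrite (ord1 t) (ord1 t').
Qed.

End IndexedFields.

(** * The limits *)

Section Limits.
Variable R : realType.

(** In a squarefree product [j = k] forces [j = 1], a value that the box has left as soon as
    [1 <= l2 T]. *)
Lemma sieve_neq_box_density : has_box_density sieve_neq (1 / 8 * odd_euler_product R).
Proof.
move=> B l1 h1 l2 h2 l3 h3 l10 lh1 l20 lh2 l30 lh3 B1 B2 B3.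
have H := @sieve_box_density R B l1 h1 l2 h2 l3 h3 l10 lh1 l20 lh2 l30 lh3 B1 B2 B3.
apply: cvg_trans H; apply: near_eq_cvg; near=> T.
have T0 : 0 < T by near: T; exact: nbhs_pinfty_gt.
have lT : 1 <= l2 * T.
  by rewrite -ler_pdivrMl // mulr1; near: T; apply: nbhs_pinfty_ge; rewrite num_real.
congr (_%:R / _); apply: eq_cnt => i j k _ _ _.
rewrite /sieve_neq; case: (boolP (in_box _ _ _ _ _ _ _ _ _)) => //= /and3P[_ /andP[jl _] _].
case: (eqVneq j k) => [<-|]; rewrite ?andbT ?andbF //; apply/negP => sv.
have [_ _ _ sq] := sieve_odd sv.
have j1 : j = 1%N by apply: (@sqfree_square j i); rewrite mulnC mulnA.
by move: (le_lt_trans lT jl); rewrite j1 ltxx.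
Unshelve. all: by end_near. Qed.

Lemma odd_euler_ge0 : 0 <= 1 / 8 * odd_euler_product R.
Proof.
rewrite mulr_ge0 //; apply: (@cvgr_to_ge _ _ _ _ _ _ _ (@odd_euler_partial_cvg R)).
by near=> n; exact: odd_euler_partial_ge0.
Unshelve. all: by end_near. Qed.

Lemma cone_radius_cvg (c : nat) : (0 < c)%N -> (cone_radius X c : R) @[X --> +oo] --> +oo.
Proof.
move=> c0; apply/cvgryPge => A; near=> X.
have cR : 0 < c%:R :> R by rewrite ltr0n.
pose b := Num.max A 0.
have b0 : 0 <= b by rewrite le_max lexx orbT.
have X0 : (c%:R * b ^+ 3) ^+ 2 <= X by near: X; apply: nbhs_pinfty_ge; rewrite num_real.
apply: (@le_trans _ _ b); first by rewrite le_max lexx.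
rewrite -(@ler_pXn2r _ 3) ?nnegrE // ?powR_ge0 //.
rewrite cone_radius3 ler_pdivlMr // mulrC -(@ler_pXn2r _ 2) ?nnegrE ?sqrtr_ge0 ?mulr_ge0 ?exprn_ge0 //.
by rewrite sqr_sqrtr // (le_trans _ X0) // sqr_ge0.
Unshelve. all: by end_near. Qed.

(** * The boundary of a continuity set is Lebesgue null *)

Section Boundary.
Local Notation leb2 := (@lebesgue_measure R \x @lebesgue_measure R)%E.

(** Compares the suprema over simple functions that define the integrals, so that [boundary_in S W]
    can serve as a domain without a proof of its measurability. *)
Lemma le_integral_pointwise (D1 D2 : set (R * R)) (f1 f2 : R * R -> \bar R) :
  (forall p, 0 <= (f1 \_ D1) p)%E -> (forall p, (f1 \_ D1) p <= (f2 \_ D2) p)%E ->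
  (\int[leb2]_(p in D1) f1 p <= \int[leb2]_(p in D2) f2 p)%E.
Proof.
move=> f10 f12; rewrite integral_mkcond [leRHS]integral_mkcond.
rewrite !ge0_integralTE //; last by move=> p; exact: le_trans (f12 p).
apply: ge_ereal_sup => _ [h hle <-]; apply: ereal_sup_ubound; exists h => // p.
exact: le_trans (hle p) (f12 p).
Qed.

(** Each vertical section lies in a single point. *)
Lemma diagonal_null (D : set (R * R)) : measurable D -> (forall p, D p -> p.1 = p.2) -> leb2 D = 0%E.
Proof.
move=> mD Dd; rewrite /product_measure1 /=; apply: integral0_eq => x _ /=.
apply/eqP; rewrite -measure_le0 -(lebesgue_measure_set1 x).
apply: le_measure; rewrite ?inE //; first exact: measurable_xsection.
by move=> y /xsectionP /Dd /= <-.
Qed.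

(** The continuity hypothesis concerns the boundary relative to [S] and the measure [dx dy / (x y)].
    Off the diagonal, [S] is a neighbourhood of its points, so points of [D] lie in the relative
    boundary; the diagonal itself is null; and the density is at least [1 / M] on the compact
    [W]. *)
Lemma boundary_null (S W : set (R * R)) : W `<=` S -> S `<=` @quadrant R -> compact W ->
  mu_continuity_set S W ->
  (forall p, S p -> p.1 <> p.2 -> nbhs p S) ->
  forall D, measurable D -> D `<=` W `&` closure (~` W) -> leb2 D = 0%E.
Proof.
move=> WS Sq Wc [mW bd0] Sopen D mD DW.
pose dg := [set p : R * R | p.1 = p.2].
have mdg : measurable dg.
  have -> : dg = (fun p : R * R => p.1 - p.2) @^-1` [set 0].
    by apply/seteqP; split=> p /=; rewrite /dg /= => /eqP; rewrite ?subr_eq0 => /eqP H; apply/eqP; rewrite ?subr_eq0 ?H.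
  by rewrite -[_ @^-1` _]setTI; apply: measurable_funB.
have -> : D = (D `&` dg) `|` (D `\` dg) by rewrite setUIDK.
have mDd : measurable (D `&` dg) by exact: measurableI.
have mD' : measurable (D `\` dg) by exact: measurableD.
apply: null_set_setU => //; first by apply: diagonal_null => // p [].
apply/eqP; rewrite -measure_le0.
have D'b : D `\` dg `<=` boundary_in S W.
  move=> p [/DW[Wp cW] pd]; have Sp := WS _ Wp; split=> //; split; first exact: subset_closure.
  move=> U nU; have [q [nWq [Uq Sq']]] : (~` W) `&` (U `&` S) !=set0.
    by apply: cW; apply: filterI nU _; exact: Sopen.
  by exists q; split=> //; split.
have [M [M0 WM]] : exists M : R, 0 < M /\ forall p, W p -> p.1 * p.2 <= M.
  have : compact ((fun p : R * R => p.1 * p.2) @` W).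
    apply: continuous_compact => //; apply: continuous_in_subspaceT => p _.
    by apply: cvgM; [exact: cvg_fst|exact: cvg_snd].
  move/compact_bounded => [M [_ HM]].
  exists (`|M| + 1); split; first by rewrite ltr_wpDl.
  move=> p Wp; apply: le_trans (ler_norm _) _; apply: (HM (`|M| + 1)); last by exists p.
  by rewrite ltr_pwDr // ler_norm.
have : ((M^-1)%:E * leb2 (D `\` dg) <= 0)%E.
  have <- : (\int[leb2]_(p in D `\` dg) (M^-1)%:E = (M^-1)%:E * leb2 (D `\` dg))%E by exact: integral_cst.
  rewrite -bd0 /mu_shape; apply: le_integral_pointwise => p.
    by rewrite patchE; case: ifP => // _; rewrite lee_fin invr_ge0 ltW.
  rewrite !patchE; case: ifPn => [/set_mem D'p|_].
    have bp := D'b _ D'p; rewrite mem_set // lee_fin.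
    have [q1 q2] := Sq _ (proj1 bp); have [/DW[Wp _] _] := D'p.
    by rewrite lef_pV2 ?posrE ?mulr_gt0 // WM.
  case: ifPn => // /set_mem[/Sq[q1 q2] _]; by rewrite lee_fin invr_ge0 mulr_ge0 ?ltW.
by rewrite pmule_rle0 // lte_fin invr_gt0.
Qed.

End Boundary.

(** The midpoint of the two coordinates separates the factors of a product neighbourhood. *)
Lemma S_oC_interior (p : R * R) : S_oC R p -> p.1 <> p.2 -> nbhs p (S_oC R).
Proof.
move=> [p0 p12] /eqP ne; have lt : p.1 < p.2 by rewrite lt_neqAle ne.
have c1 : p.1 < (p.1 + p.2) / 2 by lra.
have c2 : (p.1 + p.2) / 2 < p.2 by lra.
exists (`]0, (p.1 + p.2) / 2[%classic, `](p.1 + p.2) / 2, +oo[%classic) => /=.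
  split; apply: open_nbhs_nbhs; split; rewrite /= ?in_itv /= ?p0 ?c1 ?c2 ?andbT //.
move=> [u v] /= []; rewrite !in_itv /= andbT => /andP[u0 u1] v1; split=> //=.
by apply/ltW/(lt_trans u1).
Qed.

Lemma S_oI_interior (p : R * R) : S_oI R p -> nbhs p (S_oI R).
Proof.
move=> [p0 lt p1].
have c1 : p.1 < (p.1 + p.2) / 2 by lra.
have c2 : (p.1 + p.2) / 2 < p.2 by lra.
exists (`]0, (p.1 + p.2) / 2[%classic, `](p.1 + p.2) / 2, 1[%classic) => /=.
  split; apply: open_nbhs_nbhs; split; rewrite /= ?in_itv /= ?p0 ?c1 ?c2 ?p1 //.
move=> [u v] /= []; rewrite !in_itv /= => /andP[u0 u1] /andP[v0 v1]; split=> //=.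
exact: lt_trans u1 v0.
Qed.

Lemma cone_count_sqrt_cvg (lam : R) (c : nat) (S : set (R * R)) (W : set (R * R)) P :
  0 < lam -> (0 < c)%N -> S `<=` @quadrant R -> W `<=` S -> compact W -> mu_continuity_set S W ->
  (forall p, S p -> p.1 <> p.2 -> nbhs p S) ->
  has_box_density P (1 / 8 * odd_euler_product R) ->
  (cone_count lam W P (cone_radius X c))%:R / Num.sqrt X @[X --> +oo] -->
  odd_euler_product R / 6 * fine (mu_shape W) / c%:R.
Proof.
move=> lam0 c0 Sq WS Wc cW Sopen HP; have [mW _] := cW.
have Wq : W `<=` @quadrant R by apply: subset_trans Sq.
have Wb := boundary_null WS Sq Wc cW Sopen.
have H := cone_count_cvg lam0 Wc Wq odd_euler_ge0 HP mW Wb.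
have H' := cvg_comp _ _ (cone_radius_cvg c0) H.
(* The sieve contributes 1/8 and the cone 4/3, together 1/6. *)
have -> : odd_euler_product R / 6 * fine (mu_shape W) / c%:R =
    1 / 8 * odd_euler_product R * (4 / 3 * fine (mu_shape W)) / c%:R by field; rewrite pnatr_eq0 -lt0n.
have H2 := cvgM H' (cvg_cst (c%:R : R)^-1).
apply: cvg_trans (H2 _ _); apply: near_eq_cvg; near=> X => /=.
have X0 : 0 < X by near: X; exact: nbhs_pinfty_gt.
rewrite cone_radius3; have sX : Num.sqrt X != 0 by rewrite gt_eqF // sqrtr_gt0.
have cR : c%:R != 0 :> R by rewrite pnatr_eq0 -lt0n.
have cancel (a s k : R) : s != 0 -> k != 0 -> a / (s / k) / k = a / s.
  by move=> s0 k0; rewrite invf_div mulrA mulrAC mulfK.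
exact: cancel sX cR.
Unshelve. all: by end_near. Qed.

Lemma S_oC_quadrant : S_oC R `<=` @quadrant R.
Proof. by move=> p [p0 p1]; split=> //; exact: lt_le_trans p1. Qed.

Lemma S_oI_quadrant : S_oI R `<=` @quadrant R.
Proof. by move=> p [p0 p1 _]; split=> //; exact: lt_trans p1. Qed.

Lemma cvg_EFin_mul (f : R -> R) (l C : R) (m : \bar R) : m \is a fin_num -> l = C * fine m ->
  f X @[X --> +oo] --> l -> (f X)%:E @[X --> +oo] --> (C%:E * m)%E.
Proof.
move=> mf -> fl; rewrite -(fineK mf) -EFinM.
by apply: cvg_EFin; [exact: nearW|exact: fl].
Qed.

End Limits.

Theorem theoremC (R : realType) :
  (forall W : set (R * R),
     W `<=` S_oC R -> compact W -> mu_continuity_set (S_oC R) W ->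
     ((N_wild X W)%:R / Num.sqrt X)%:E @[X --> +oo] -->
       ((C_wild R)%:E * mu_shape W)%E)
  /\
  (forall W : set (R * R),
     W `<=` S_oI R -> compact W -> mu_continuity_set (S_oI R) W ->
     ((N_tame X W)%:R / Num.sqrt X)%:E @[X --> +oo] -->
       ((C_tame R)%:E * mu_shape W)%E).
Proof.
split=> W WS Wc cW.
  have fin := mu_shape_fin (ltr01 : 0 < 1 :> R) Wc (subset_trans WS (@S_oC_quadrant R)) cW.1.
  have lim P : has_box_density P (1 / 8 * odd_euler_product R) ->
      (\sum_(t < 5) (cone_count (wlam R t) W P (cone_radius X (wconst t)))%:R / Num.sqrt X)
        @[X --> +oo] --> C_wild R * fine (mu_shape W).
    (* The weights [1 / wconst t] sum to 1/4 + 2/8 + 2/16 = 5/8, and 5/8 of 1/6 is 5/48. *)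
    move=> HP; have -> : C_wild R * fine (mu_shape W) =
        \sum_(t < 5) odd_euler_product R / 6 * fine (mu_shape W) / (wconst t)%:R.
      by rewrite !big_ord_recl big_ord0 /C_wild /wconst /wscale /=; field.
    apply: cvgr_sum => t _.
    exact: (cone_count_sqrt_cvg (wlam_gt0 R t) (wconst_gt0 t) (@S_oC_quadrant R) WS Wc cW
      (@S_oC_interior R) HP).
  apply: (cvg_EFin_mul fin erefl).
  (* The sieves with and without [j = k] have the same box density, so both bounds have one
     limit. *)
  apply: squeeze_cvgr (lim _ (@sieve_neq_box_density R)) (lim _ (@sieve_box_density R)).
  near=> X; have X0 : 0 < X by near: X; exact: nbhs_pinfty_gt.
  have /andP[lo up] := wild_count_bounds WS X0.
  by rewrite -!mulr_suml -!natr_sum !ler_pM2r ?invr_gt0 ?sqrtr_gt0 // !ler_nat lo up.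
have Sopen p : S_oI R p -> p.1 <> p.2 -> nbhs p (S_oI R) by move=> Sp _; exact: S_oI_interior.
have fin := mu_shape_fin (ltr01 : 0 < 1 :> R) Wc (subset_trans WS (@S_oI_quadrant R)) cW.1.
apply: (cvg_EFin_mul (l := odd_euler_product R / 6 * fine (mu_shape W) / 1%:R) fin).
  by rewrite /C_tame; field.
have H := cone_count_sqrt_cvg (ltr01 : 0 < 1 :> R) (isT : 0 < 1)%N (@S_oI_quadrant R) WS Wc cW
  Sopen (@sieve_box_density R).
apply: cvg_trans H; apply: near_eq_cvg; near=> X.
have X0 : 0 < X by near: X; exact: nbhs_pinfty_gt.
by rewrite (tame_count WS X0).
Unshelve. all: by end_near. Qed.
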